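(* Let $d\ge2$, $p\in(1,\infty)$, $s\in(0,1)$ and $0<r<R<\infty$. Then the function $t\mapsto\Lambda_{\mathcal{L}^s_p}\big(B_R(0)\setminus\overline{B}_r(te_1)\big)$ is strictly decreasing for $0\le t<R-r$. In particular, $$\Lambda_{\mathcal{L}^s_p}\big(B_R(0)\setminus\overline{B}_r(0)\big)=\max_{0\le t<R-r}\Lambda_{\mathcal{L}^s_p}\big(B_R(0)\setminus\overline{B}_r(te_1)\big).$$
   Context: $B_\rho(x)$ and $\overline{B}_\rho(x)$ are the open and closed balls in $\mathbb{R}^d$ of radius $\rho$ centered at $x$, and $e_1=(1,0,\dots,0)\in\mathbb{R}^d$. For an open set $\Omega\subset\mathbb{R}^d$, $$W^{1,p}_0(\Omega)=\{u\in L^p(\mathbb{R}^d): \|\nabla u\|_{L^p(\mathbb{R}^d)}<\infty,\ u=0\text{ in }\mathbb{R}^d\setminus\Omega\},$$ and $$[u]_{s,p}=\Big(\int_{\mathbb{R}^d}\int_{\mathbb{R}^d}\frac{|u(x)-u(y)|^p}{|x-y|^{d+sp}}\,dy\,dx\Big)^{1/p}.$$ For a bounded open set $\Omega$, $\Lambda_{\mathcal{L}^s_p}(\Omega)$ is the least Dirichlet eigenvalue of the mixed operator $\mathcal{L}^s_p=-\Delta_p+(-\Delta_p)^s$, given by $$\Lambda_{\mathcal{L}^s_p}(\Omega)=\inf\{\|\nabla u\|_{L^p(\Omega)}^p+[u]_{s,p}^p: u\in W^{1,p}_0(\Omega)\setminus\{0\},\ \|u\|_{L^p(\Omega)}=1\}.$$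 *)

(* Defs.v *)
From HB Require Import structures.
From mathcomp Require Import all_boot all_order all_algebra.
From mathcomp Require Import all_classical all_reals all_analysis.

Set Implicit Arguments.
Unset Strict Implicit.
Unset Printing Implicit Defensive.

Import Order.TTheory GRing.Theory Num.Theory.
Import numFieldNormedType.Exports.

Local Open Scope classical_set_scope.
Local Open Scope ring_scope.

(* The points of R^d are the row vectors 'rV[R]_d. They carry the library's
   (product) topology, but the library's norm and balls on 'rV[R]_d are those
   of the sup norm: the Euclidean ones are defined below. *)

(* 'rV[R]_n carries the sigma-algebra generated by the coordinates, as
   n.-tuple R does in the library; this is the Borel sigma-algebra. *)
Fact rV_display : measure_display. Proof. exact: default_measure_display. Qed.

Section measurable_rV.
Context {R : realType} {n : nat}.

Let coord : 'I_n -> 'rV[R]_n -> measurableTypeR R := fun i x => x ord0 i.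

Let rV_set0 : g_sigma_preimage coord set0.
Proof. exact: sigma_algebra0. Qed.

Let rV_setC A : g_sigma_preimage coord A -> g_sigma_preimage coord (~` A).
Proof. exact: sigma_algebraC. Qed.

Let rV_bigcup (F : _^nat) : (forall i, g_sigma_preimage coord (F i)) ->
  g_sigma_preimage coord (\bigcup_i (F i)).
Proof. exact: sigma_algebra_bigcup. Qed.

HB.instance Definition _ := @isMeasurable.Build rV_display
  'rV[R]_n (g_sigma_preimage coord) rV_set0 rV_setC rV_bigcup.

End measurable_rV.

Section measurable_rV_fun.
Context {R : realType}.

Lemma measurable_coord_rV n (i : 'I_n) :
  measurable_fun [set: 'rV[R]_n] (fun x => x ord0 i : measurableTypeR R).
Proof.
move=> _ Y mY; rewrite setTI; apply: sub_sigma_algebra => /=.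
rewrite -bigcup_seq/=; exists i => /=; first by rewrite mem_index_enum.
by exists Y => //; rewrite setTI.
Qed.

Lemma measurable_fun_rV d (T : measurableType d) n (f : T -> 'rV[R]_n) :
  (forall i, measurable_fun [set: T] (fun t => f t ord0 i : measurableTypeR R)) ->
  measurable_fun [set: T] f.
Proof.
move=> mf _ A mA; rewrite setTI.
suff /(_ A mA) : @measurable _ 'rV[R]_n `<=`
    [set B : set 'rV[R]_n | measurable (f @^-1` B)] by [].
apply: smallest_sub.
  split=> /=; first by rewrite preimage_set0.
  - by move=> B mB; rewrite setTD preimage_setC; exact: measurableC.
  - by move=> F mF; rewrite preimage_bigcup; exact: bigcupT_measurable.
rewrite -bigcup_seq => B [i _ [C mC <-]] /=.
by have := mf i measurableT C mC; rewrite !setTI.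
Qed.

Definition rV_cons n (xv : measurableTypeR R * 'rV[R]_n) : 'rV[R]_n.+1 :=
  row_mx xv.1%:M xv.2.

Definition rV_uncons n (x : 'rV[R]_n.+1) : measurableTypeR R * 'rV[R]_n :=
  (x ord0 ord0, \row_i x ord0 (lift ord0 i)).

Lemma rV_cons0 n (xv : measurableTypeR R * 'rV[R]_n) :
  rV_cons xv ord0 ord0 = xv.1.
Proof.
by rewrite mxE; case: splitP => // j _; rewrite mxE [j]ord1 eqxx mulr1n.
Qed.

Lemma rV_consS n (xv : measurableTypeR R * 'rV[R]_n) i :
  rV_cons xv ord0 (lift ord0 i) = xv.2 ord0 i.
Proof.
rewrite mxE; case: splitP => j /= => [|[/val_inj ->//]].
by rewrite [j]ord1.
Qed.

Lemma rV_consK n : cancel (@rV_cons n) (@rV_uncons n).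
Proof.
move=> [x v]; rewrite /rV_uncons rV_cons0; congr pair.
by apply/rowP => i; rewrite mxE rV_consS.
Qed.

Lemma measurable_rV_cons n :
  measurable_fun [set: (measurableTypeR R * 'rV[R]_n)%type] (@rV_cons n).
Proof.
apply: measurable_fun_rV => i; have [j ->|->] := unliftP ord0 i.
- under eq_fun do rewrite rV_consS.
  by apply: measurableT_comp (measurable_coord_rV j) _; exact: measurable_snd.
- under eq_fun do rewrite rV_cons0.
  exact: measurable_fst.
Qed.

Lemma measurable_rV_uncons n :
  measurable_fun [set: 'rV[R]_n.+1] (@rV_uncons n).
Proof.
apply/measurable_fun_pairP; split; first exact: measurable_coord_rV.
apply: measurable_fun_rV => i /=.
under eq_fun do rewrite mxE.
exact: measurable_coord_rV.
Qed.

End measurable_rV_fun.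

Section lebesgue_rV_step.
Context {R : realType} {n : nat}.
Variable m : {sigma_finite_measure set 'rV[R]_n -> \bar R}.

Definition lebesgue_rV_step : set 'rV[R]_n.+1 -> \bar R :=
  pushforward (@lebesgue_measure R \x m)%E (@rV_cons R n).

Let step0 : lebesgue_rV_step set0 = 0%E.
Proof. by rewrite /lebesgue_rV_step /pushforward preimage_set0 measure0. Qed.

Let step_ge0 A : (0 <= lebesgue_rV_step A)%E.
Proof. by rewrite /lebesgue_rV_step /pushforward; exact: measure_ge0. Qed.

Let step_semi_sigma_additive : semi_sigma_additive lebesgue_rV_step.
Proof.
move=> F mF tF mUF; rewrite /lebesgue_rV_step /pushforward preimage_bigcup.
apply: measure_semi_sigma_additive.
- by move=> i; rewrite -[X in measurable X]setTI; exact: measurable_rV_cons.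
- apply/trivIsetP => /= i j _ _ ij; rewrite -preimage_setI.
  by move/trivIsetP : tF => /(_ _ _ _ _ ij) ->//; rewrite preimage_set0.
- rewrite -preimage_bigcup -[X in measurable X]setTI.
  exact: measurable_rV_cons.
Qed.

HB.instance Definition _ := isMeasure.Build _ _ _ lebesgue_rV_step
  step0 step_ge0 step_semi_sigma_additive.

Let step_sigma_finite : sigma_finite setT lebesgue_rV_step.
Proof.
have /sigma_finiteP[F [TF ndF Foo]] := sigma_finiteT (@lebesgue_measure R).
have /sigma_finiteP[G [TG ndG Goo]] := sigma_finiteT m.
exists (fun k => @rV_uncons R n @^-1` (F k `*` G k)).
  rewrite -preimage_bigcup (_ : \bigcup_k (F k `*` G k) = setT) ?preimage_setT//.
  rewrite -setXTT TF TG; apply/seteqP; split=> [[x y] [k _ [/= Fx Gy]]|[x y]].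
    by split; exists k.
  move=> [/= [i _ Fx] [j _ Gy]]; exists (maxn i j) => //; split => /=.
    by move: x Fx; exact/subsetPset/ndF/leq_maxl.
  by move: y Gy; exact/subsetPset/ndG/leq_maxr.
move=> k; have [mF Fk] := Foo k; have [mG Gk] := Goo k; split.
  rewrite -[X in measurable X]setTI; apply: measurable_rV_uncons => //.
  exact: measurableX.
rewrite /lebesgue_rV_step /pushforward.
rewrite -comp_preimage (_ : _ \o _ = id); last exact/funext/rV_consK.
rewrite preimage_id.
by rewrite product_measure1E// lte_mul_pinfty// ge0_fin_numE.
Qed.

HB.instance Definition _ := Measure_isSigmaFinite.Build _ _ _ lebesgue_rV_step
  step_sigma_finite.

End lebesgue_rV_step.

Section lebesgue_rV.
Context {R : realType}.

(* Lebesgue measure on R^n, as the n-fold product of Lebesgue measure on R. *)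
Fixpoint lebesgue_rV (n : nat) : {sigma_finite_measure set 'rV[R]_n -> \bar R} :=
  match n with
  | 0 => @dirac _ 'rV[R]_0 0 R
  | n'.+1 => lebesgue_rV_step (lebesgue_rV n')
  end.

Lemma lebesgue_rV_box n (A : 'I_n -> set (measurableTypeR R)) :
  (forall i, measurable (A i)) ->
  lebesgue_rV n [set x | forall i, A i (x ord0 i)] =
  (\prod_(i < n) @lebesgue_measure R (A i))%E.
Proof.
elim: n A => [|n IHn] A mA /=.
  by rewrite big_ord0 diracE mem_set// => -[].
have mB : measurable
    [set x : 'rV[R]_n | forall i, A (lift ord0 i) (x ord0 i)].
  rewrite (_ : [set x | _] = \bigcap_(i in [set: 'I_n])
      (fun x : 'rV[R]_n => x ord0 i) @^-1` A (lift ord0 i)).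
    apply: fin_bigcap_measurable; first exact: finite_finset.
    move=> i _; rewrite -[X in measurable X]setTI.
    exact: measurable_coord_rV.
  by apply/seteqP; split=> x /= Ax i; [move=> _|]; exact: Ax.
rewrite big_ord_recl -IHn; last by move=> i; exact: mA.
rewrite -product_measure1E//; congr (product_measure1 _ _ _).
apply/seteqP; split=> -[x v] /=.
- move=> H; split; first by have := H ord0; rewrite rV_cons0.
  by move=> i; have := H (lift ord0 i); rewrite rV_consS.
- move=> [Ax Av] i; have [j ->|->] := unliftP ord0 i.
    by rewrite rV_consS; exact: Av.
  by rewrite rV_cons0.
Qed.

End lebesgue_rV.

Section euclidean.
Context {R : realType} {d : nat}.
Implicit Types x : 'rV[R]_d.

Definition enorm x : R := Num.sqrt (\sum_i x ord0 i ^+ 2).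

Definition eball x (rho : R) : set 'rV[R]_d := [set y | enorm (y - x) < rho].

Definition eclosed_ball x (rho : R) : set 'rV[R]_d :=
  [set y | enorm (y - x) <= rho].

(* The zero vector in the degenerate case d = 0. *)
Definition e1 : 'rV[R]_d := \row_i (i == 0 :> nat)%:R.

End euclidean.

Section sobolev.
Context {R : realType} {d : nat}.
Local Notation mu := (@lebesgue_rV R d).
Implicit Types (u phi : 'rV[R]_d -> R) (g : 'rV[R]_d -> 'rV[R]_d).
Implicit Types (p s : R) (Omega : set 'rV[R]_d).

Definition partial (i : 'I_d) phi : 'rV[R]_d -> R :=
  fun x => 'D_(delta_mx ord0 i) phi x.

Definition iter_partial (l : seq 'I_d) phi : 'rV[R]_d -> R :=
  foldr partial phi l.

Definition smooth phi : Prop := forall l : seq 'I_d,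
  continuous (iter_partial l phi) /\
  forall x i, derivable (iter_partial l phi) x (delta_mx ord0 i).

Definition test_function phi : Prop :=
  smooth phi /\ compact (closure [set x | phi x != 0]).

Definition locally_integrable_rV u : Prop :=
  forall K, compact K -> mu.-integrable K (EFin \o u).

Definition is_weak_gradient u g : Prop :=
  locally_integrable_rV u /\
  forall i, locally_integrable_rV (fun x => g x ord0 i) /\
    forall phi, test_function phi ->
      \int[mu]_x (u x * partial i phi x) = - \int[mu]_x (g x ord0 i * phi x).

(* A weak gradient is unique up to equality almost everywhere; this picks a
   representative, and is 0 if u has no weak gradient. *)
Definition weak_gradient u : 'rV[R]_d -> 'rV[R]_d :=
  xget (cst 0) [set g | is_weak_gradient u g].

Local Open Scope ereal_scope.

Definition grad_norm u : 'rV[R]_d -> \bar R :=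
  fun x => (enorm (weak_gradient u x))%:E.

(* Elements of L^p are represented by functions, so that "u = 0 outside Omega"
   is meant almost everywhere. *)
Definition W1p0 p Omega : set ('rV[R]_d -> R) := [set u |
  [/\ u \in Lfun mu p%:E,
      exists g, is_weak_gradient u g,
      'N[mu]_p%:E [grad_norm u] < +oo &
      {ae mu, forall x, ~ Omega x -> u x = 0%R}]].

(* The integrand is 0 on the diagonal x = y since 0^-1 = 0. *)
Definition gagliardo s p u : \bar R :=
  (\int[mu]_x \int[mu]_y
     (`|u x - u y| `^ p / enorm (x - y) `^ (d%:R + s * p))%:E) `^ p^-1.

(* The normalization excludes the zero function. *)
Definition Lambda s p Omega : \bar R := ereal_inf
  [set 'N[mu]_p%:E [(grad_norm u) \_ Omega] `^ p + gagliardo s p u `^ p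
  | u in [set u | W1p0 p Omega u /\
                  'N[mu]_p%:E [(EFin \o u) \_ Omega] = 1]].

End sobolev.

(* Main.v *)
(* Fix t1 < t2 and let sigma be the reflection in the hyperplane x_1 = (t1+t2)/2,
   which exchanges the two holes. Polarization (put the larger of u, u o sigma on
   the side of the origin and the smaller one on the other side) maps nonnegative
   functions vanishing outside shell t1 to functions vanishing outside shell t2,
   keeps the L^p norms of u and of its gradient, and lowers the Gagliardo
   seminorm by the double integral of an explicit nonnegative gap. So
   Lambda(shell t2) <= Lambda(shell t1).

   If equality held, a minimizing sequence u_k >= 0 for shell t1 would have a gap
   tending to 0. The Gagliardo seminorm alone gives a subsequence converging a.e.
   to some u <> 0 (average over small cells), and by Fatou the gap of u is 0:
   a.e. on the half-space, u >= u o sigma, or u <= u o sigma. Either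
   way u vanishes on a box B inside shell t1, since some points of shell t1 are
   reflected into the hole, and others out of the ball. No regularity or strong
   maximum principle is needed to conclude: comparing u_k with e phi, phi a bump
   carried by B, the energies of the maximum and of the minimum add up to at most
   E(u_k) + e^p E(phi), minus an explicit double integral which in the limit is at
   least c e with c > 0. Minimality bounds it by e^p E(phi): absurd as e -> 0,
   because p > 1. *)
From HB Require Import structures.
Require Import Defs.
From mathcomp Require Import all_boot all_order all_algebra.
From mathcomp Require Import all_classical all_reals all_analysis.
From mathcomp Require Import measurable_realfun.
From mathcomp Require Import ring lra.

Set Implicit Arguments.
Unset Strict Implicit.
Unset Printing Implicit Defensive.

Import Order.TTheory GRing.Theory Num.Theory.
Import numFieldNormedType.Exports.

Local Open Scope classical_set_scope.
Local Open Scope ring_scope.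

(** * Lebesgue measure on R^n *)

Section boxes.
Context {R : realType} {n : nat}.
Local Notation V := 'rV[R]_n.
Local Notation mu := (@lebesgue_rV R n).

(** All strictness comes from the nonlocal term. The gradient term enters only through identities:
    polarization keeps it, and the maximum and minimum of two functions together carry the gradient
    norms of both. So no semicontinuity of the gradient norm is used and the limit function is never
    given a gradient; in comparing energies only the nonnegative gaps go to the limit.

    The main labour is to show that polarization acts on weak gradients by the expected formula.
    Weak derivatives are defined by duality, which does not see pointwise operations; they are
    converted into L^1 convergence of difference quotients on cubes, where absolute values and
    reflections obey pointwise estimates. What remains is a cut along the mirror: polarization is
    min(u, u o sigma) + |1_H (u - u o sigma)| with H the half-space, and for w odd under sigma the
    gradient of 1_H w is 1_H grad w, since oddness cancels the boundary terms. *)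

Definition rbox (A : 'I_n -> set (measurableTypeR R)) : set V :=
  [set x | forall i, A i (x ord0 i)].

Definition mrbox : set (set V) :=
  [set B | exists2 A, (forall i, measurable (A i)) & B = rbox A].

Lemma measurable_rbox A : (forall i, measurable (A i)) -> measurable (rbox A).
Proof.
move=> mA; rewrite (_ : rbox A = \bigcap_(i in [set: 'I_n])
  (fun x : V => x ord0 i) @^-1` A i); last first.
  by apply/seteqP; split=> x /= Ax i; [move=> _|]; exact: Ax.
apply: fin_bigcap_measurable; first exact: finite_finset.
by move=> i _; rewrite -[X in measurable X]setTI; exact: measurable_coord_rV.
Qed.

Lemma measurable_rVE : @measurable _ V = <<s mrbox >>.
Proof.
apply/seteqP; split; last first.
  by apply: smallest_sub; [exact: sigma_algebra_measurable|move=> _ [A mA ->]; exact: measurable_rbox].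
apply: smallest_sub; first exact: smallest_sigma_algebra.
rewrite -bigcup_seq => B [i _ [C mC <-]] /=; apply: sub_sigma_algebra.
exists (fun j => if j == i then C else setT).
  by move=> j; case: ifP.
rewrite setTI; apply/seteqP; split => x /= => [Cx j|/(_ i)]; last by rewrite eqxx.
by case: eqP => // ->.
Qed.

Lemma mrboxI : setI_closed mrbox.
Proof.
move=> _ _ [A mA ->] [B mB ->]; exists (fun i => A i `&` B i).
  by move=> i; exact: measurableI.
apply/seteqP; split => x /= => [[Ax Bx] i|AB]; first by split.
by split => i; have [] := AB i.
Qed.

Definition cube (N : R) : set V := rbox (fun=> `[- N, N]%classic).

Lemma measurable_cube N : measurable (cube N).
Proof. exact: measurable_rbox. Qed.

Lemma cube_lty N : (mu (cube N) < +oo)%E.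
Proof.
rewrite lebesgue_rV_box//.
suff /andP[] : (0 <= \prod_(i < n) @lebesgue_measure R `[(- N)%R, N] < +oo)%E by [].
apply: (big_ind (fun x => 0 <= x < +oo)%E) => //.
- by rewrite lee01 ltry.
- by move=> x y /andP[x0 xoo] /andP[y0 yoo]; rewrite mule_ge0//= lte_mul_pinfty// ge0_fin_numE.
- move=> i _; rewrite measure_ge0/= lebesgue_measure_itv/= lte_fin.
  by case: ifPn => // _; rewrite ltry.
Qed.

Lemma bigcup_cube : \bigcup_k cube k%:R = setT.
Proof.
apply/seteqP; split => // x _.
exists (Num.truncn (\sum_i `|x ord0 i|)).+1 => // i /=; rewrite in_itv/= -ler_norml.
apply: (@le_trans _ _ (\sum_i `|x ord0 i|)); last exact/ltW/truncnS_gt.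
by rewrite (bigD1 i)//= lerDl sumr_ge0.
Qed.

(** Measurable boxes form a pi-system generating the sigma-algebra, and the cubes exhaust the space
    with finite measure. This reduces invariance of [mu] to one coordinate at a time. *)
Lemma lebesgue_rV_unique (m : {measure set V -> \bar R}) :
  (forall A, (forall i, measurable (A i)) -> m (rbox A) = mu (rbox A)) ->
  forall B, measurable B -> m B = mu B.
Proof.
move=> mE B mB; apply/esym.
apply: (measure_unique mrbox (fun k => cube k%:R)) => //.
- exact: measurable_rVE.
- exact: mrboxI.
- by move=> i; exists (fun=> `[- i%:R, i%:R]%classic).
- exact: bigcup_cube.
- by move=> _ [A mA ->]; rewrite mE.
- by move=> k; exact: cube_lty.
Qed.

End boxes.

(** * Open, closed and compact sets are measurable *)

Section open_measurable.
Context {R : realType} {n : nat}.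
Local Notation V := 'rV[R]_n.

Lemma rV_ballP (x y : V) (e : R) : 0 < e ->
  ball x e y <-> forall i, `|x ord0 i - y ord0 i| < e.
Proof.
move=> e0; split=> [[_ +] i|]; first by move=> /(_ ord0 i).
by move=> xy; split => // i j; rewrite [i]ord1; exact: xy.
Qed.

(** An open set is the union of the countably many balls with rational centre and radius 1/(k+1)
    that it contains. The generating family [G] is left free: it is used with all measurable boxes
    and with open boxes. *)
Lemma open_sigma (G : set (set V)) (U : set V) :
  (forall x (e : R), 0 < e -> <<s G >> (ball x e)) -> open U -> <<s G >> U.
Proof.
move=> ballG oU.
pose c (q : 'rV[rat]_n) : V := \row_i ratr (q ord0 i).
pose B (qk : 'rV[rat]_n * nat) : set V := ball (c qk.1) qk.2.+1%:R^-1.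
have mB qk : <<s G >> (B qk) by apply: ballG; rewrite invr_gt0.
rewrite (_ : U = \bigcup_qk (if `[< B qk `<=` U >] then B qk else set0)).
  apply: (@countable_bigcupT_measurable _ (g_sigma_algebraType G)) => [|qk].
    exact: countableP.
  by case: ifP => _; [exact: mB|exact: (@measurable0 _ (g_sigma_algebraType G))].
apply/seteqP; split => [x Ux|x [qk _]]; last by case: asboolP => // BU /BU.
have /nbhs_ballP[e /= e0 xeU] : nbhs x U by exact: open_nbhs_nbhs.
have [k ke] : exists k : nat, k.+1%:R^-1 < e / 2.
  exists (Num.truncn (e / 2)^-1); rewrite invf_plt ?posrE ?divr_gt0//.
  exact: truncnS_gt.
have qi i : exists q : rat, `|ratr q - x ord0 i| < k.+1%:R^-1.
  have [|q] := @rat_in_itvoo R (x ord0 i - k.+1%:R^-1) (x ord0 i).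
    by rewrite ltrBlDr ltrDl.
  rewrite in_itv/= => /andP[q1 q2]; exists q.
  by rewrite distrC ger0_norm ?subr_ge0 ?ltW// ltrBlDr addrC -ltrBlDr.
have {qi}[q qx] := choice qi.
have k0 : 0 < k.+1%:R^-1 :> R by rewrite invr_gt0.
exists (\row_i q i, k) => //; case: asboolP => [_|]; last first.
  case => y /(rV_ballP _ _ k0) qy; apply: xeU.
  apply/rV_ballP => // i; rewrite distrC -(subrKA (ratr (q i))).
  rewrite (le_lt_trans (ler_normD _ _))// (splitr e) ltrD//.
    by apply: lt_trans ke; move: (qy i); rewrite !mxE distrC.
  exact: lt_trans (qx i) ke.
by apply/rV_ballP => //= i; rewrite !mxE.
Qed.

Lemma open_measurable_rV (U : set V) : open U -> measurable U.
Proof.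
rewrite measurable_rVE; apply: open_sigma => x e e0; rewrite -measurable_rVE.
rewrite (_ : ball x e = rbox (fun i => ball (x ord0 i) e)).
  by apply: measurable_rbox => i; rewrite ball_itv; exact: measurable_itv.
by apply/seteqP; split => y /=; rewrite rV_ballP.
Qed.

Lemma closed_measurable_rV (U : set V) : closed U -> measurable U.
Proof. by move=> cU; rewrite -[U]setCK; apply: measurableC; apply: open_measurable_rV; exact: closed_openC. Qed.

Lemma compact_measurable_rV (U : set V) : compact U -> measurable U.
Proof. by move=> cU; apply: closed_measurable_rV; exact: (compact_closed (@norm_hausdorff _ _) cU). Qed.

Lemma continuous_measurable_rV (f : V -> R) : continuous f -> measurable_fun [set: V] f.
Proof.
move=> /continuousP cf; apply: (measurability _ (RGenOpens.measurableE R)) => //.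
move=> _ [_ [a [b ->] <-]]; rewrite setTI; apply: open_measurable_rV.
by apply: cf; exact: interval_open.
Qed.

Lemma compact_cube (K : set V) : compact K -> exists N : nat, K `<=` cube N%:R.
Proof.
move=> /compact_bounded[M [_ KM]]; exists (Num.truncn (M + 1)).+1 => x Kx i /=.
rewrite in_itv/= -ler_norml.
have := KM (M + 1); rewrite ltrDl => /(_ ltr01 x Kx).
move=> /le_trans /(_ (ltW (truncnS_gt _))); apply: le_trans.
rewrite [leRHS]/Num.norm/= mx_normrE.
by apply/bigmax_geP; right; exists (ord0, i).
Qed.

Lemma cube_compact (N : R) : compact (@cube R n N).
Proof. by apply: rV_compact => _; exact: segment_compact. Qed.

End open_measurable.

(** * Translations and reflections preserve Lebesgue measure *)

Section measure_preserving.
Context {R : realType} {n : nat}.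
Local Notation V := 'rV[R]_n.
Local Notation mu := (@lebesgue_rV R n).

Definition mpres (f : V -> V) : Prop := measurable_fun [set: V] f /\
  forall A, measurable A -> mu (f @^-1` A) = mu A.

Section mpres_lemmas.
Variables (f : V -> V) (mpf : mpres f).
Let mf := mpf.1.

Lemma ge0_integral_mpres (g : V -> \bar R) : measurable_fun [set: V] g ->
  (forall x, 0 <= g x)%E -> (\int[mu]_x g (f x) = \int[mu]_x g x)%E.
Proof.
move=> mg g0; transitivity (\int[pushforward mu f]_x g x)%E; last first.
  by apply: eq_measure_integral => A mA _; exact: mpf.2.
by rewrite ge0_integral_pushforward.
Qed.

Lemma integrable_mpres (g : V -> \bar R) : mu.-integrable [set: V] g ->
  mu.-integrable [set: V] (g \o f).
Proof.
move=> /integrableP[mg ig]; apply/integrableP; split.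
  exact: measurableT_comp mg mf.
have mag : measurable_fun [set: V] (fun x => `|g x|%E) by exact: measurableT_comp.
by rewrite (ge0_integral_mpres mag).
Qed.

Lemma integral_mpres (g : V -> \bar R) : mu.-integrable [set: V] g ->
  (\int[mu]_x g (f x) = \int[mu]_x g x)%E.
Proof.
move=> ig; transitivity (\int[pushforward mu f]_x g x)%E; last first.
  by apply: eq_measure_integral => A mA _; exact: mpf.2.
by rewrite integral_pushforward//; [exact: measurable_int ig|exact: integrable_mpres].
Qed.

Lemma Rintegral_mpres (g : V -> R) : mu.-integrable [set: V] (EFin \o g) ->
  (\int[mu]_x g (f x) = \int[mu]_x g x).
Proof. by move=> ig; rewrite /Rintegral (integral_mpres ig). Qed.

Lemma ae_mpres (P : V -> Prop) : {ae mu, forall x, P x} -> {ae mu, forall x, P (f x)}.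
Proof.
move=> [N [mN N0 PN]]; exists (f @^-1` N); split.
- by rewrite -[X in measurable X]setTI; exact: mf.
- by rewrite mpf.2.
- by move=> x /= Px; exact: PN.
Qed.

End mpres_lemmas.

(** A coordinatewise map pulls a box back to a box, so preservation in each coordinate gives it on
    boxes, hence everywhere by uniqueness. *)
Lemma mpres_coord (h : 'I_n -> R -> R) :
  (forall i, measurable_fun setT (h i)) ->
  (forall i (A : set (measurableTypeR R)), measurable A ->
    lebesgue_measure (h i @^-1` A) = lebesgue_measure A) ->
  mpres (fun x => \row_i h i (x ord0 i)).
Proof.
move=> mh hA; pose f (x : V) : V := \row_i h i (x ord0 i).
have mf : measurable_fun [set: V] f.
  apply: measurable_fun_rV => i; rewrite /f; under eq_fun do rewrite mxE.
  exact: measurableT_comp (mh i) (measurable_coord_rV i).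
split=> //.
move=> A mA; rewrite -[LHS]/(pushforward mu f A).
pose F : {mfun V >-> V} := HB.pack f (isMeasurableFun.Build _ _ _ _ f mf).
apply: (@lebesgue_rV_unique _ _ (pushforward mu F)) => // B mB.
rewrite /= /pushforward.
rewrite (_ : f @^-1` rbox B = rbox (fun i => h i @^-1` B i)).
  rewrite !lebesgue_rV_box//; last first.
    by move=> i; have := mh i measurableT (B i) (mB i); rewrite setTI.
  by apply: eq_bigr => i _; exact: hA.
by apply/seteqP; split => x /= Bx i; move: (Bx i); rewrite mxE.
Qed.

Lemma lebesgue_measure_shift (c : R) (A : set (measurableTypeR R)) : measurable A ->
  lebesgue_measure ((fun x => x + c) @^-1` A) = lebesgue_measure A.
Proof.
move=> mA; have ms : measurable_fun [set: measurableTypeR R] (fun x : measurableTypeR R => x + c : measurableTypeR R).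
  have : measurable_fun [set: R] (fun x : R => x + c) by exact: measurable_funD.
  exact.
pose F : {mfun (measurableTypeR R) >-> (measurableTypeR R)} := HB.pack (fun x : measurableTypeR R => x + c : measurableTypeR R) (isMeasurableFun.Build _ _ _ _ _ ms).
apply/esym.
apply: (@lebesgue_measure_unique _ (pushforward (@lebesgue_measure R) F)) => // _ [[a b] _ <-].
rewrite /= /pushforward (_ : _ @^-1` _ = `](a - c), (b - c)]%classic).
  by rewrite !lebesgue_measure_itv/= !lte_fin ltrD2r -!EFinB opprB addrA addrNK.
by apply/seteqP; split => x /=; rewrite !in_itv/= ltrBlDr lerBrDr.
Qed.

Lemma mpres_translate (v : V) : mpres (fun x => x + v).
Proof.
rewrite (_ : (+%R^~ v) = (fun x : V => \row_i (fun i t => t + v ord0 i) i (x ord0 i))).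
  apply: (mpres_coord (h := fun i t => t + v ord0 i)) => i; first exact: measurable_funD.
  by move=> A mA; exact: lebesgue_measure_shift.
by apply/funext => x; apply/rowP => i; rewrite !mxE.
Qed.

Lemma mpres_shift (v : V) : mpres (fun x => v + x).
Proof. by under eq_fun do rewrite addrC; exact: mpres_translate. Qed.

Definition refl (i : 'I_n) (a : R) (x : V) : V :=
  \row_j if j == i then a *+ 2 - x ord0 j else x ord0 j.

Lemma mpres_refl i a : mpres (refl i a).
Proof.
apply: (mpres_coord (h := fun j t => if j == i then a *+ 2 - t else t)) => j.
  by case: eqP => // _; exact: measurable_funB.
move=> A mA; case: eqP => // _.
have /= := lebesgue_measure_shift (a *+ 2) mA.
rewrite -lebesgue_measureN; last first.
  rewrite -[X in measurable X]setTI.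
  have : measurable_fun [set: R] (fun x : R => x + a *+ 2) by exact: measurable_funD.
  by move=> /(_ measurableT); exact.
move=> <-; congr (lebesgue_measure _); apply/seteqP; split => x /=.
  by rewrite addrC.
by rewrite addrC.
Qed.

Lemma reflK i a : involutive (refl i a).
Proof.
by move=> x; apply/rowP => j; rewrite !mxE; case: eqP => // _; rewrite subKr.
Qed.

End measure_preserving.

(** * Smooth bump functions *)

Section smooth1.
Context {R : realType}.
Implicit Types (f g : R -> R) (x : R).

Lemma is_derive_dirP {V : normedModType R} (f : V -> R) (x v : V) (l : R) :
  (fun h : R => h^-1 * (f (h *: v + x) - f x)) @ 0^' --> l -> is_derive x v f l.
Proof.
move=> fl; apply: DeriveDef; first by apply/cvg_ex; exists l.
exact: (cvg_lim (@Rhausdorff R) fl).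
Qed.

Lemma is_derive1P f x (l : R) :
  (fun h : R => h^-1 * (f (h + x) - f x)) @ 0^' --> l -> is_derive x 1 f l.
Proof.
move=> fl; apply: is_derive_dirP; apply: cvg_trans fl; apply: near_eq_cvg.
by near=> h; rewrite [h *: 1]mulr1.
Unshelve. all: by end_near. Qed.

Lemma is_derive_dirE {V : normedModType R} (f : V -> R) (x v : V) (l : R) :
  is_derive x v f l -> (fun h : R => h^-1 * (f (h *: v + x) - f x)) @ 0^' --> l.
Proof. by case=> /[swap] <-. Qed.

(** The functions x^(-m) exp(-1/x), extended by 0: up to scalars and sums the family is closed under
    differentiation, which is how [flat 0] is seen to be smooth. *)
Definition flat (m : nat) x : R :=
  if 0 < x then x^-1 ^+ m * expR (- x^-1) else 0.

(** From exp y >= y^(m+2) / (m+2)! at y = 1/x. The bound O(x^2) makes the difference quotient at 0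
    vanish in the limit. *)
Lemma flat_le (m : nat) x : 0 < x -> flat m x <= (m.+2)`!%:R * x ^+ 2.
Proof.
move=> x0; rewrite /flat x0; have y0 : 0 < x^-1 by rewrite invr_gt0.
have := @expR_ge1Dxn R x^-1 m.+1 (ltW y0).
move=> /(le_trans (ler_wpDl ler01 (lexx _))).
rewrite ler_pdivrMr ?ltr0n ?fact_gt0// => H.
rewrite expRN ler_pdivrMr ?expR_gt0//.
have -> : x^-1 ^+ m = x^-1 ^+ m.+2 * x ^+ 2.
  by rewrite -addn2 exprD -mulrA -exprMn mulVf ?gt_eqF// expr1n mulr1.
by rewrite [leRHS]mulrAC ler_pM2r ?exprn_gt0// mulrC.
Qed.

Lemma flat_ge0 m x : 0 <= flat m x.
Proof.
rewrite /flat; case: ifP => // x0.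
by rewrite mulr_ge0 ?expR_ge0// exprn_ge0// invr_ge0 ltW.
Qed.

Lemma is_derive_flat m x :
  is_derive x 1 (flat m) (flat m.+2 x - m%:R * flat m.+1 x).
Proof.
have [x0|x0|x0] := ltgtP x 0.
- rewrite {2 3}/flat ltNge (ltW x0)/= mulr0 subr0.
  apply: (@near_eq_is_derive _ _ _ (cst 0)).
  near=> y; rewrite /flat ifF//; apply/negbTE; rewrite -leNgt ltW//; near: y.
  exact: lt_nbhsl.
- apply: (@near_eq_is_derive _ _ _ ((fun x => x^-1) ^+ m * (expR \o - (fun x => x^-1)))).
  + near=> y; rewrite /flat ifT//; first by rewrite /GRing.mul/= exprfctE.
    by near: y; exact: lt_nbhsr.
  have xn0 : x != 0 by rewrite gt_eqF.
  have dV : is_derive x 1 (fun x : R => x^-1) (- x ^- 2 *: 1).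
    exact: (@is_deriveV _ id x 1 1 xn0 (is_derive_id _ _)).
  apply: is_derive_eq; rewrite /flat x0 exprfctE/=.
  rewrite /GRing.scale/= mulr1 -[x ^- 2]exprVn opprK.
  case: m => [|m]; first by rewrite !mul0r !mulr0 addr0 subr0 expr0 mul1r mulrC.
  by rewrite /= !exprS; ring.
- rewrite x0 /flat ltxx mulr0 subr0; apply: is_derive1P.
  rewrite -/(flat m); apply/cvgrPdist_le => e e0.
  near=> h; rewrite addr0 ltxx subr0 sub0r normrN normrM.
  have [h0|h0] := leP h 0; first by rewrite normr0 mulr0 ltW.
  have := flat_le m h0; rewrite /flat h0 => le_h.
  rewrite normfV (gtr0_norm h0) ger0_norm; last first.
    by rewrite mulr_ge0 ?expR_ge0// exprn_ge0// invr_ge0 ltW.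
  rewrite ler_pdivrMl// (le_trans le_h)//.
  rewrite expr2 mulrA mulrC ler_wpM2l ?(ltW h0)//.
  rewrite -ler_pdivlMl ?ltr0n ?fact_gt0//.
  rewrite -(ger0_norm (ltW h0)); near: h; apply: dnbhs0_le.
  by rewrite mulr_gt0// invr_gt0 ltr0n fact_gt0.
Unshelve. all: by end_near. Qed.

(** A syntactic class closed under differentiation, so that smoothness is proved by one induction.
    [sm_prim] admits primitives because a primitive of a bump is needed in [bump_antishift]. *)
Inductive sm : (R -> R) -> Prop :=
| sm_flat m : sm (flat m)
| sm_cst c : sm (fun=> c)
| sm_add f g : sm f -> sm g -> sm (fun x => f x + g x)
| sm_mul f g : sm f -> sm g -> sm (fun x => f x * g x)
| sm_aff f a b : sm f -> sm (fun x => f (a * x + b))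
| sm_prim f F : sm f -> (forall x, is_derive x 1 F (f x)) -> sm F.

Lemma sm_is_derive f : sm f ->
  exists2 g, sm g & forall x, is_derive x 1 f (g x).
Proof.
elim=> {f}.
- move=> m; exists (fun x => flat m.+2 x + (- m%:R) * flat m.+1 x).
    by apply: sm_add; [exact: sm_flat|apply: sm_mul; [exact: sm_cst|exact: sm_flat]].
  by move=> x; rewrite mulNr; exact: is_derive_flat.
- move=> c; exists (fun=> 0); first exact: sm_cst.
  by move=> x; exact: is_derive_cst.
- move=> f g sf [f' sf' df] sg [g' sg' dg]; exists (fun x => f' x + g' x).
    exact: sm_add.
  by move=> x; exact: is_deriveD.
- move=> f g sf [f' sf' df] sg [g' sg' dg].
  exists (fun x => f x * g' x + g x * f' x).
    by apply: sm_add; exact: sm_mul.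
  by move=> x; exact: is_deriveM.
- move=> f a b sf [f' sf' df]; exists (fun x => f' (a * x + b) * a).
    by apply: sm_mul; [exact: sm_aff|exact: sm_cst].
  move=> x; apply: (is_derive1_comp (g := fun x => a * x + b)) => //.
  have := @is_deriveD R R R (a \*: id) (cst b) x 1 _ _ (is_deriveZ _ (is_derive_id _ _)) (is_derive_cst _ _ _).
  by rewrite addr0 [a *: _]mulr1.
- by move=> f F sf _ dF; exists f.
Qed.

Lemma sm_derivable f x : sm f -> derivable f x 1.
Proof. by move=> /sm_is_derive[g _ df]; exact: ex_derive. Qed.

Lemma sm_continuous f : sm f -> continuous f.
Proof. by move=> sf x; apply/differentiable_continuous/derivable1_diffP/sm_derivable. Qed.

(** Supported in [a, b] with values in [0, 1]; [k] is a steepness, and as it grows the function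
    tends to the indicator of ]a, b[. *)
Definition bump1 (k a b : R) x : R := flat 0 (k * (x - a)) * flat 0 (k * (b - x)).

Lemma sm_bump1 k a b : sm (bump1 k a b).
Proof.
rewrite (_ : bump1 k a b = fun x => flat 0 (k * x + (- (k * a))) * flat 0 ((- k) * x + k * b)).
  by apply: sm_mul; apply: sm_aff; exact: sm_flat.
by apply/funext => x; rewrite /bump1; congr (flat 0 _ * flat 0 _); ring.
Qed.

Lemma flat0_le1 x : flat 0 x <= 1.
Proof.
rewrite /flat; case: ifP => // x0; rewrite expr0 mul1r -expR0 ler_expR.
by rewrite oppr_le0 invr_ge0 ltW.
Qed.

Lemma bump1_ge0 k a b x : 0 <= bump1 k a b x.
Proof. by rewrite mulr_ge0// flat_ge0. Qed.

Lemma bump1_le1 k a b x : bump1 k a b x <= 1.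
Proof. by rewrite /bump1 -[leRHS]mulr1 ler_pM// ?flat_ge0// flat0_le1. Qed.

Lemma bump1_eq0 (k a b x : R) : 0 <= k -> ~~ (a < x < b) -> bump1 k a b x = 0.
Proof.
move=> k0; rewrite negb_and -!leNgt /bump1 /flat => /orP[xa|bx].
  by rewrite ifF ?mul0r//; apply/negbTE; rewrite -leNgt mulr_ge0_le0// subr_le0.
by rewrite [X in _ * X]ifF ?mulr0//; apply/negbTE; rewrite -leNgt mulr_ge0_le0// subr_le0.
Qed.

Lemma bump1_gt0 (k a b x : R) : 0 < k -> a < x < b -> 0 < bump1 k a b x.
Proof.
move=> k0 /andP[ax xb]; have H y : 0 < y -> 0 < flat 0 (k * y) by move=> y0; rewrite /flat mulr_gt0// expr0 mul1r expR_gt0.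
by rewrite mulr_gt0//; apply: H; rewrite subr_gt0.
Qed.

Lemma bump1_cvg (a b x : R) :
  bump1 k.+1%:R a b x @[k --> \oo] --> (((a < x) && (x < b))%R%:R : R).
Proof.
have flat_cvg (y : R) : flat 0 (k.+1%:R * y) @[k --> \oo] --> ((0 < y)%R%:R : R).
  have [y0|y0] := leP y 0.
    apply: cvg_near_cst; near=> k; rewrite /flat ifF//.
    by apply/negbTE; rewrite -leNgt mulr_ge0_le0.
  rewrite (_ : (fun k => _) = (fun k : nat => expR (- (k.+1%:R^-1 * y^-1)))); last first.
    by apply/funext => k; rewrite /flat mulr_gt0// expr0 mul1r invfM.
  rewrite -[X in _ --> X]expR0; apply: continuous_cvg; first exact: continuous_expR.
  rewrite -[X in _ --> X]oppr0 -[X in _ --> - X](mul0r y^-1).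
  by apply: cvgN; apply: cvgMl; exact: cvg_harmonic.
rewrite (_ : ((a < x) && (x < b))%R%:R = (0 < x - a)%R%:R * (0 < b - x)%R%:R :> R); last first.
  by rewrite !subr_gt0 -natrM mulnb.
by apply: cvgM; exact: flat_cvg.
Unshelve. all: by end_near. Qed.

End smooth1.

(** * Smooth products of one-variable functions *)

Section product_functions.
Context {R : realType} {n : nat}.
Local Notation V := 'rV[R]_n.
Implicit Types (x : V) (eta : 'I_n -> R -> R) (phi : V -> R).

Definition unitv (i : 'I_n) : V := delta_mx ord0 i.

Definition pf eta x : R := \prod_i eta i (x ord0 i).

Lemma unitvE (h : R) i x j :
  (h *: unitv i + x) ord0 j = if j == i then h + x ord0 i else x ord0 j.
Proof.
rewrite !mxE eqxx/=; case: eqP => [->|_]; first by rewrite mulr1.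
by rewrite mulr0 add0r.
Qed.

Lemma pf_unitv eta (h : R) j x :
  pf eta (h *: unitv j + x) =
  eta j (h + x ord0 j) * \prod_(i | i != j) eta i (x ord0 i).
Proof.
rewrite /pf (bigD1 j)//= unitvE eqxx; congr (_ * _).
by apply: eq_bigr => i /negbTE ij; rewrite unitvE ij.
Qed.

Lemma pfD1 eta j x :
  pf eta x = eta j (x ord0 j) * \prod_(i | i != j) eta i (x ord0 i).
Proof. by rewrite /pf (bigD1 j). Qed.

Definition upd eta (j : 'I_n) (g : R -> R) : 'I_n -> R -> R :=
  fun i => if i == j then g else eta i.

Lemma pf_upd eta j (g : R -> R) x :
  pf (upd eta j g) x = g (x ord0 j) * \prod_(i | i != j) eta i (x ord0 i).
Proof.
rewrite (pfD1 _ j) /upd eqxx; congr (_ * _).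
by apply: eq_bigr => i /negbTE ->.
Qed.

Lemma is_derive_pf eta (j : 'I_n) (g : R -> R) x :
  (forall t : R, is_derive t 1 (eta j) (g t)) ->
  is_derive x (unitv j) (pf eta) (pf (upd eta j g) x).
Proof.
move=> dg; apply: is_derive_dirP; rewrite pf_upd.
rewrite (_ : (fun h => _) = (fun h => (h^-1 * (eta j (h *: 1 + x ord0 j) - eta j (x ord0 j))) *
    \prod_(i | i != j) eta i (x ord0 i))); last first.
  by apply/funext => h; rewrite pf_unitv [h *: 1]mulr1 -mulrA mulrBl -pfD1.
by apply: cvgMl; apply: is_derive_dirE.
Qed.

Lemma continuous_pf eta : (forall i, continuous (eta i)) -> continuous (pf eta).
Proof.
move=> ceta; rewrite /pf; elim: (index_enum _) => [|i s IH].
  under eq_fun do rewrite big_nil.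
  by move=> x; exact: cst_continuous.
under eq_fun do rewrite big_cons.
move=> x; apply: (@continuousM R V (fun y => eta i (y ord0 i)) (fun y => \prod_(j <- s) eta j (y ord0 j))); last exact: IH.
by apply: (@continuous_comp _ _ _ (fun y : V => y ord0 i) (eta i)); [exact: coord_continuous|exact: ceta].
Qed.

(** A partial derivative only replaces one factor by its derivative, so iterated partials of a
    product are again products of functions in [sm]. *)
Lemma iter_partial_pf (l : seq 'I_n) eta : (forall i, sm (eta i)) ->
  exists2 eta', (forall i, sm (eta' i)) & iter_partial l (pf eta) = pf eta'.
Proof.
move=> seta; elim: l => [|j l [eta' seta' IH]]; first by exists eta.
have [g sg dg] := sm_is_derive (seta' j).
exists (upd eta' j g); first by move=> i; rewrite /upd; case: ifP.
rewrite /= IH; apply/funext => x; have H := is_derive_pf x dg.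
by rewrite /partial derive_val.
Qed.

Lemma smooth_pf eta : (forall i, sm (eta i)) -> smooth (pf eta).
Proof.
move=> seta l; have [eta' seta' ->] := iter_partial_pf l seta; split.
  by apply: continuous_pf => i; apply: sm_continuous.
move=> x i; have [g sg dg] := sm_is_derive (seta' i).
by have H := is_derive_pf x dg; exact: ex_derive.
Qed.

Lemma closed_cube (N : R) : closed (@cube R n N).
Proof. by apply: compact_closed; [exact: norm_hausdorff|exact: cube_compact]. Qed.

Lemma compact_support_cube phi (N : R) : (forall x, phi x != 0 -> cube N x) ->
  compact (closure [set x | phi x != 0]).
Proof.
move=> supp; apply: (@subclosed_compact _ _ (cube N)); [exact: closed_closure|exact: cube_compact|].
by rewrite [X in _ `<=` X](iffLR (closure_id _) (@closed_cube N)); apply: closure_subset.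
Qed.

Lemma pf_neq0 eta x : pf eta x != 0 -> forall i, eta i (x ord0 i) != 0.
Proof. by move=> /prodf_neq0 H i; exact: H. Qed.

Lemma test_pf eta (N : R) : (forall i, sm (eta i)) ->
  (forall i t, eta i t != 0 -> `|t| <= N) -> test_function (pf eta).
Proof.
move=> seta supp; split; first exact: smooth_pf.
apply: (@compact_support_cube _ N) => x /pf_neq0 xN i /=.
by rewrite in_itv/= -ler_norml; exact: supp (xN i).
Qed.

End product_functions.

(** * Uniform bounds for test functions *)

Section test_functions.
Context {R : realType} {n : nat}.
Local Notation V := 'rV[R]_n.
Implicit Types (x : V) (phi : V -> R) (i : 'I_n).

Lemma continuous_cube_bounded phi (N : R) : continuous phi ->
  (forall x, ~ cube N x -> phi x = 0) -> exists2 C : R, 0 < C & forall x, `|phi x| <= C.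
Proof.
move=> cphi supp.
have : compact (phi @` cube N).
  by apply: continuous_compact; [exact: continuous_subspaceT|exact: cube_compact].
move=> /compact_bounded[M [_ BM]]; exists (Num.max 0 M + 1).
  by rewrite ltr_wpDl// le_max lexx.
move=> x; have [Nx|/supp ->] := pselect (cube N x); last first.
  by rewrite normr0 addr_ge0// le_max lexx.
by apply: BM; [rewrite ltr_pwDr// le_max lexx orbT|exists x].
Qed.

Lemma test_support phi : test_function phi ->
  exists N : nat, forall x, ~ cube N%:R x -> phi x = 0 /\ forall i, partial i phi x = 0.
Proof.
move=> [sphi /compact_cube[N KN]]; exists N => x xN.
have nx : ~ closure [set x | phi x != 0] x by move=> /KN.
have H : \near x, phi x = 0.
  have : open (~` closure [set x | phi x != 0]) by apply: closed_openC; exact: closed_closure.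
  move=> oc; have : nbhs x (~` closure [set x | phi x != 0]) by apply: open_nbhs_nbhs.
  apply: filterS => y ny.
  by apply: contrapT => /eqP y0; apply: ny; exact: subset_closure.
split; first exact: nbhs_singleton H.
move=> i; rewrite /partial (@near_eq_derive _ _ _ _ (cst 0))//.
by have d0 := is_derive_cst (0 : R) x (delta_mx ord0 i : V); rewrite derive_val.
Qed.

Lemma test_partial phi i x : test_function phi ->
  is_derive x (unitv i) phi (partial i phi x).
Proof. by move=> [/(_ [::])[_ /(_ x i) d] _]; exact: DeriveDef. Qed.

Lemma test_continuous phi : test_function phi -> continuous phi.
Proof. by move=> [/(_ [::])[]]. Qed.

Lemma test_partial_continuous phi i : test_function phi -> continuous (partial i phi).
Proof. by move=> [/(_ [:: i])[]]. Qed.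

Lemma test_bound phi : test_function phi -> exists N : nat, exists2 C : R, 0 < C & 
  [/\ forall x, ~ cube N%:R x -> phi x = 0, forall i x, ~ cube N%:R x -> partial i phi x = 0,
    forall x, `|phi x| <= C & forall i x, `|partial i phi x| <= C].
Proof.
move=> tphi; have [N H] := test_support tphi; exists N.
have H1 x : ~ cube N%:R x -> phi x = 0 by move=> /H[].
have H2 i x : ~ cube N%:R x -> partial i phi x = 0 by move=> /H[].
have [C0 C00 B0] := continuous_cube_bounded (test_continuous tphi) H1.
have : forall i, exists C : R, 0 < C /\ forall x, `|partial i phi x| <= C.
  by move=> i; have [C ? ?] := continuous_cube_bounded (@test_partial_continuous _ i tphi) (H2 i); exists C.
move=> /choice[C BC]; exists (C0 + \sum_i C i).
  by rewrite ltr_pwDl// sumr_ge0// => i _; have [/ltW] := BC i.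
have Ci i : 0 <= C i by have [/ltW] := BC i.
split => // [x|i x].
  by rewrite (le_trans (B0 x))// lerDl sumr_ge0.
rewrite (le_trans ((BC i).2 x))// (bigD1 i)//= addrCA lerDl addr_ge0 ?(ltW C00)//.
by rewrite sumr_ge0.
Qed.

Lemma test_lipschitz phi i (C : R) : test_function phi ->
  (forall x, `|partial i phi x| <= C) ->
  forall x (h : R), `|phi (h *: unitv i + x) - phi x| <= C * `|h|.
Proof.
move=> tphi BC.
have der (x : V) (t : R) : is_derive t 1 (fun t : R => phi (t *: unitv i + x)) (partial i phi (t *: unitv i + x)).
  apply: is_derive1P; have := is_derive_dirE (test_partial i (t *: unitv i + x) tphi).
  by under eq_fun do rewrite addrA -scalerDl.
have pos x h : 0 <= h -> `|phi (h *: unitv i + x) - phi x| <= C * `|h|.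
  move=> h0; have [|c _] := @MVT_segment R (fun t : R => phi (t *: unitv i + x)) _ 0 h h0 (fun t _ => der x t).
    apply: continuous_subspaceT => t; apply: differentiable_continuous.
    by apply/derivable1_diffP; case: (der x t).
  rewrite scale0r add0r subr0 => ->; rewrite normrM.
  by apply: ler_wpM2r.
move=> x h; have [h0|h0] := leP 0 h; first exact: pos.
have := pos (h *: unitv i + x) (- h); rewrite addrA -scalerDl addNr scale0r add0r.
by rewrite oppr_ge0 normrN distrC; apply; exact: ltW.
Qed.

Lemma test_quotient_cvg phi i x : test_function phi ->
  (fun h : R => h^-1 * (phi (h *: unitv i + x) - phi x)) @ 0^' --> partial i phi x.
Proof. by move=> tphi; exact: is_derive_dirE (test_partial i x tphi). Qed.

End test_functions.

(** * Functions determined by their integrals over open boxes *)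

Section open_boxes.
Context {R : realType} {n : nat}.
Local Notation V := 'rV[R]_n.
Local Notation mu := (@lebesgue_rV R n).

Definition obox (a b : V) : set V :=
  rbox (fun i => `]a ord0 i, b ord0 i[%classic).

Definition oboxes : set (set V) := [set B | exists a b, B = obox a b].

Lemma measurable_obox a b : measurable (obox a b).
Proof. by apply: measurable_rbox => i; exact: measurable_itv. Qed.

Lemma oboxI a b a' b' : obox a b `&` obox a' b' =
  obox (\row_i Num.max (a ord0 i) (a' ord0 i)) (\row_i Num.min (b ord0 i) (b' ord0 i)).
Proof.
apply/seteqP; split => x /= => [[H1 H2] i|H].
  by move: (H1 i) (H2 i); rewrite /= !in_itv/= !mxE gt_max lt_min => /andP[-> ->] /andP[-> ->].
by split=> i; move: (H i); rewrite /= !in_itv/= !mxE gt_max lt_min => /andP[/andP[? ?] /andP[? ?]]; apply/andP.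
Qed.

Lemma oboxesI : setI_closed oboxes.
Proof. by move=> _ _ [a [b ->]] [a' [b' ->]]; rewrite oboxI; eexists; eexists. Qed.

(** Bounded open boxes are the sets whose indicators are limits of bumps; being a generating
    pi-system, they support the Dynkin inductions below. *)
Lemma measurable_oboxesE : @measurable _ V = <<s oboxes >>.
Proof.
apply/seteqP; split; last first.
  by apply: smallest_sub; [exact: sigma_algebra_measurable|move=> _ [a [b ->]]; exact: measurable_obox].
rewrite measurable_rVE; apply: smallest_sub; first exact: smallest_sigma_algebra.
have oS (U : set V) : open U -> <<s oboxes >> U.
  apply: open_sigma => x e e0; apply: sub_sigma_algebra.
  exists (\row_i (x ord0 i - e)), (\row_i (x ord0 i + e)).
  apply/seteqP; split => y.
    by move=> /(rV_ballP _ _ e0) H i; rewrite /= in_itv/= !mxE -ltr_distlC.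
  by move=> H; apply/rV_ballP => // i; move: (H i); rewrite /= in_itv/= !mxE -ltr_distlC.
have coordS (i : 'I_n) (A : set (measurableTypeR R)) : measurable A ->
    <<s oboxes >> ((fun x : V => x ord0 i) @^-1` A).
  have : @measurable _ (measurableTypeR R) `<=` [set A | <<s oboxes >> ((fun x : V => x ord0 i) @^-1` A)].
    rewrite [X in X `<=` _](RGenOpens.measurableE R); apply: smallest_sub.
      split=> /=; first by rewrite preimage_set0; exact: (@measurable0 _ (g_sigma_algebraType oboxes)).
      - move=> B mB; rewrite setTD preimage_setC.
        exact: (@measurableC _ (g_sigma_algebraType oboxes)).
      - move=> F mF; rewrite preimage_bigcup.
        exact: (@bigcupT_measurable _ (g_sigma_algebraType oboxes)).
    move=> _ [a [b ->]] /=; apply: oS; apply: open_comp; last exact: interval_open.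
    by move=> x _; exact: coord_continuous.
  exact.
move=> _ [A mA ->]; rewrite (_ : rbox A = \bigcap_(i in [set: 'I_n])
  (fun x : V => x ord0 i) @^-1` A i); last first.
  by apply/seteqP; split=> x /= Ax i; [move=> _|]; exact: Ax.
apply: (@fin_bigcap_measurable _ (g_sigma_algebraType oboxes)); first exact: finite_finset.
by move=> i _; exact: coordS.
Qed.

Definition ocube (N : nat) : set V := obox (const_mx (- N%:R)) (const_mx N%:R).

Lemma ocubeP N x : ocube N x <-> forall i, `|x ord0 i| < N%:R.
Proof. by split=> H i; move: (H i); rewrite /= in_itv/= !mxE ltr_norml. Qed.

Lemma cubeP (N : R) (x : V) : cube N x <-> forall i, `|x ord0 i| <= N.
Proof. by split=> H i; move: (H i); rewrite /= in_itv/= ler_norml. Qed.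

Lemma measurable_ocube N : measurable (ocube N). Proof. exact: measurable_obox. Qed.

Lemma ocube_sub N : ocube N `<=` cube N%:R.
Proof. by move=> x /ocubeP H; apply/cubeP => i; exact: ltW. Qed.

Lemma cube_sub (M N : R) : M <= N -> @cube R n M `<=` cube N.
Proof. by move=> MN x /cubeP H; apply/cubeP => i; exact: le_trans MN. Qed.

Lemma cube_subo N : @cube R n N%:R `<=` ocube N.+1.
Proof. by move=> x /cubeP H; apply/ocubeP => i; rewrite (le_lt_trans (H i))// ltr_nat. Qed.

Lemma obox_cube a b : exists N : nat, obox a b `<=` cube N%:R.
Proof.
pose S := \sum_i (`|a ord0 i| + `|b ord0 i|).
exists (Num.truncn S).+1 => x /= H; apply/cubeP => i.
apply: (@le_trans _ _ S); last exact/ltW/truncnS_gt.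
rewrite /S (bigD1 i)//=; apply: ler_wpDr; first by apply: sumr_ge0 => j _; rewrite addr_ge0.
move: (H i); rewrite /= in_itv/= => /andP[ax xb].
have [x0|x0] := leP 0 (x ord0 i).
  by rewrite ger0_norm// (le_trans (ltW xb))// (le_trans (ler_norm _))// lerDr.
rewrite ltr0_norm// (@le_trans _ _ `|a ord0 i|) ?lerDl//.
by rewrite -normrN (le_trans _ (ler_norm _))// lerN2 ltW.
Qed.

Definition LI (f : V -> R) : Prop :=
  forall N : nat, mu.-integrable (cube N%:R) (EFin \o f).

Lemma measurable_ext_cube (f : V -> R) :
  (forall N : nat, measurable_fun (@cube R n N%:R) f) -> measurable_fun [set: V] f.
Proof.
move=> mf; rewrite -bigcup_cube; apply/measurable_fun_bigcup => // N.
exact: measurable_cube.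
Qed.

Lemma LI_measurable f : LI f -> measurable_fun [set: V] f.
Proof.
move=> If; apply: measurable_ext_cube => N.
by apply/measurable_EFinP; exact: measurable_int (If N).
Qed.

Lemma locally_integrable_rVE f : locally_integrable_rV f <-> LI f.
Proof.
split=> [lf N|If K cK]; first by apply: lf; exact: cube_compact.
have [N KN] := compact_cube cK.
by apply: integrableS (If N) => //; [exact: measurable_cube|exact: compact_measurable_rV].
Qed.

Lemma LI_obox f a b : LI f -> mu.-integrable (obox a b) (EFin \o f).
Proof.
move=> If; have [N abN] := obox_cube a b.
by apply: integrableS (If N) => //; [exact: measurable_cube|exact: measurable_obox].
Qed.

(** Dynkin induction inside each [ocube N], where [f] is integrable: its integral vanishes on every
    measurable part of the cube, hence [f] vanishes a.e. there. *)
Lemma ae0_boxes (f : V -> R) : LI f ->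
  (forall a b, \int[mu]_(x in obox a b) (f x)%:E = 0)%E ->
  {ae mu, forall x, f x = 0}.
Proof.
move=> If f0.
have PE N (E : set V) : measurable E -> (\int[mu]_(x in E `&` ocube N) (f x)%:E = 0)%E.
  have iE (F : set V) : measurable F -> mu.-integrable (F `&` ocube N) (EFin \o f).
    move=> mF; apply: (integrableS (measurable_ocube N)) (LI_obox _ _ If); last by [].
    by apply: measurableI => //; exact: measurable_ocube.
  rewrite measurable_oboxesE; apply: (dynkin_induction (G := oboxes)
    (P := fun E => (\int[mu]_(x in E `&` ocube N) (f x)%:E = 0)%E)).
  - exact: measurable_oboxesE.
  - exact: oboxesI.
  - by rewrite setTI f0.
  - by move=> _ [a [b ->]]; rewrite oboxI f0.
  - move=> S mS S0; have := f0 (const_mx (- N%:R)) (const_mx N%:R).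
    rewrite -/(ocube N) -[X in (\int[_]_(x in X) _)%E](setTI (ocube N)) -(setvU S) setIUl.
    rewrite integral_setU.
    + by rewrite S0 adde0.
    + by apply: measurableI; [exact: measurableC|exact: measurable_ocube].
    + by apply: measurableI => //; exact: measurable_ocube.
    + apply: measurable_funTS; apply/measurable_EFinP; exact: LI_measurable.
    + by apply/disj_set2P; rewrite setIACA setICl set0I.
  - move=> F mF tF F0; rewrite setI_bigcupl integral_bigcup.
    + by rewrite eseries0.
    + exact: trivIset_setIr.
    + by move=> k; apply: measurableI => //; exact: measurable_ocube.
    + by rewrite -setI_bigcupl; apply: iE; exact: bigcupT_measurable.
have ae0 N : {ae mu, forall x, ocube N x -> f x = 0}.
  have : ae_eq mu (ocube N) (EFin \o f) (cst 0%E).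
    apply: integral_ae_eq => //.
    - exact: measurable_ocube.
    - exact: LI_obox.
    move=> E EN mE; rewrite integral0 -(PE N _ mE); congr (\int[_]_(x in _) _)%E.
    by rewrite setIidl.
  by apply: filterS => x /= H xN; move: (H xN) => [].
have : {ae mu, forall x N, ocube N x -> f x = 0} by apply/ae_foralln.
apply: filterS => x H.
have : (\bigcup_k cube k%:R) x by rewrite bigcup_cube.
by move=> [k _ /cube_subo]; exact: H.
Qed.

End open_boxes.

(** * Bumps on boxes and the fundamental lemma of the calculus of variations *)

Section bumps.
Context {R : realType} {n : nat}.
Local Notation V := 'rV[R]_n.
Local Notation mu := (@lebesgue_rV R n).
Implicit Types (a b x : V).

Lemma cvg_prod_seq (I : Type) (s : seq I) (f : I -> nat -> R) (l : I -> R) :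
  (forall i, f i k @[k --> \oo] --> l i) ->
  \prod_(i <- s) f i k @[k --> \oo] --> \prod_(i <- s) l i.
Proof.
move=> fl; elim: s => [|i s IH].
  by rewrite big_nil; under eq_fun do rewrite big_nil; exact: cvg_cst.
by rewrite big_cons; under eq_fun do rewrite big_cons; exact: cvgM.
Qed.

Definition bump (k : nat) a b : V -> R :=
  pf (fun i => bump1 k.+1%:R (a ord0 i) (b ord0 i)).

Lemma bump_test k a b : test_function (bump k a b).
Proof.
apply: (@test_pf _ _ _ (\sum_i (`|a ord0 i| + `|b ord0 i|))) => [i|i t].
  exact: sm_bump1.
have [/andP[at_ tb] _|/bump1_eq0 ->] := boolP (a ord0 i < t < b ord0 i); rewrite ?eqxx//.
rewrite (bigD1 i)//=; apply: ler_wpDr; first by apply: sumr_ge0 => j _; rewrite addr_ge0.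
have [x0|x0] := leP 0 t.
  by rewrite ger0_norm// (le_trans (ltW tb))// (le_trans (ler_norm _))// lerDr.
rewrite ltr0_norm// (@le_trans _ _ `|a ord0 i|) ?lerDl//.
by rewrite -normrN (le_trans _ (ler_norm _))// lerN2 ltW.
Qed.

Lemma bump_ge0 k a b x : 0 <= bump k a b x.
Proof. by apply: prodr_ge0 => i _; exact: bump1_ge0. Qed.

Lemma bump_le1 k a b x : bump k a b x <= 1.
Proof.
have -> : 1 = \prod_(i < n) 1 :> R by rewrite big1.
by apply: ler_prod => i _; rewrite bump1_ge0 bump1_le1.
Qed.

Lemma bump_out k a b x : ~ obox a b x -> bump k a b x = 0.
Proof.
move=> /existsNP[i]; rewrite /= in_itv/= => /negP abx.
by rewrite /bump (pfD1 _ i) bump1_eq0// mul0r.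
Qed.

Lemma bump_gt0 k a b x : obox a b x -> 0 < bump k a b x.
Proof.
move=> abx; apply: prodr_gt0 => i _; apply: bump1_gt0 => //.
by have := abx i; rewrite /= in_itv.
Qed.

Lemma bump_cvg a b x : bump k a b x @[k --> \oo] --> (\1_(obox a b) x : R).
Proof.
have H := @cvg_prod_seq _ (index_enum 'I_n) _ _ (fun i => @bump1_cvg R (a ord0 i) (b ord0 i) (x ord0 i)).
suff -> : \1_(obox a b) x = \prod_i ((a ord0 i < x ord0 i) && (x ord0 i < b ord0 i))%R%:R :> R by [].
rewrite indicE; have [xab|xab] := pselect (obox a b x).
  rewrite mem_set// big1// => i _.
  by have := xab i; rewrite /= in_itv/= => ->.
rewrite memNset//; move/existsNP : xab => [i]; rewrite /= in_itv/= => /negP/negbTE abx.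
by rewrite (bigD1 i)//= abx mul0r.
Qed.

Lemma measurable_bump k a b : measurable_fun [set: V] (bump k a b).
Proof. by apply: continuous_measurable_rV; apply: test_continuous; exact: bump_test. Qed.

Lemma integral_bump_cvg (f : V -> R) a b : LI f ->
  (\int[mu]_x (f x * bump k a b x)%:E)%E @[k --> \oo] -->
  (\int[mu]_(x in obox a b) (f x)%:E)%E.
Proof.
move=> If; have mf := LI_measurable If.
have [|||||_ _] := @dominated_convergence _ V R mu setT measurableT
  (fun k x => (f x * bump k a b x)%:E) (fun x => (f x * \1_(obox a b) x)%:E)
  (fun x => (`|f x| * \1_(obox a b) x)%:E).
- by move=> k; apply/measurable_EFinP/measurable_funM => //; exact: measurable_bump.
- by apply/measurable_EFinP/measurable_funM => //; apply: measurable_indic; exact: measurable_obox.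
- apply: aeW => x _; apply: cvg_EFin; first exact: nearW.
  by apply: cvgM; [exact: cvg_cst|exact: bump_cvg].
- have -> : (fun x => (`|f x| * \1_(obox a b) x)%:E) = (fun x => `|f x|%:E) \_ (obox a b).
    by rewrite epatch_indic.
  apply/(integrable_mkcond _ (measurable_obox _ _)).1.
  exact/integrable_norm/LI_obox.
- apply: aeW => x k _; rewrite lee_fin normrM; apply: ler_wpM2l => //.
  rewrite ger0_norm ?bump_ge0// indicE.
  have [xab|xab] := pselect (obox a b x); first by rewrite mem_set// bump_le1.
  by rewrite bump_out.
by rewrite [X in _ -> _ --> X]integral_mkcond epatch_indic.
Qed.

(** Bumps tend to the indicator of their box under the dominating function |f| 1_box, so testing
    against bumps alone decides whether [f] vanishes a.e. *)
Lemma ae0_bump (f : V -> R) : LI f ->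
  (forall a b k, \int[mu]_x (f x * bump k a b x)%:E = 0)%E ->
  {ae mu, forall x, f x = 0}.
Proof.
move=> If f0; apply: ae0_boxes => // a b.
have := @integral_bump_cvg f a b If; under eq_fun do rewrite f0.
by move=> /cvg_lim <- //; rewrite lim_cst.
Qed.

End bumps.

Import HBSimple.

(** * Weak derivatives and difference quotients *)

Section translation_continuity.
Context {R : realType} {n : nat}.
Local Notation V := 'rV[R]_n.
Local Notation mu := (@lebesgue_rV R n).
Implicit Types (f g : V -> R) (i : 'I_n).

Definition L1 f : \bar R := (\int[mu]_x `|f x|%:E)%E.
Definition intg f : Prop := mu.-integrable [set: V] (EFin \o f).

Lemma L1_ge0 f : (0 <= L1 f)%E.
Proof. by apply: integral_ge0 => x _; rewrite lee_fin. Qed.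

Lemma intg_measurable f : intg f -> measurable_fun [set: V] f.
Proof. by move=> If; apply/measurable_EFinP; exact: measurable_int If. Qed.

Lemma intgP f : measurable_fun [set: V] f -> (L1 f < +oo)%E -> intg f.
Proof. by move=> mf f1; apply/integrableP; split => //; exact/measurable_EFinP. Qed.

Lemma intg_lty f : intg f -> (L1 f < +oo)%E.
Proof. by move=> /integrableP[]. Qed.

Lemma measurable_EFin_norm f : measurable_fun [set: V] f ->
  measurable_fun [set: V] (fun x => `|f x|%:E).
Proof. by move=> mf; apply/measurable_EFinP; exact: measurableT_comp. Qed.

Lemma cvge0_lt (u : nat -> \bar R) (e : R) : u @ \oo --> 0%E -> 0 < e ->
  exists k, (u k < e%:E)%E.
Proof.
move=> u0 e0; have : nbhs (0%E : \bar R) [set y | (y < e%:E)%E].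
  by apply: open_nbhs_nbhs; split; [exact: open_ereal_lt_ereal|rewrite /= lte_fin].
by move=> /u0[k _ /(_ k (leqnn k)) ?]; exists k.
Qed.

Lemma L1D f g : measurable_fun [set: V] f -> measurable_fun [set: V] g ->
  (L1 (f \+ g)%R <= L1 f + L1 g)%E.
Proof.
move=> mf mg; have mf1 := measurable_EFin_norm mf; have mg1 := measurable_EFin_norm mg.
rewrite /L1 -ge0_integralD//.
apply: ge0_le_integral => //.
- by apply: measurable_EFin_norm; exact: measurable_funD.
- exact: emeasurable_funD.
- by move=> x _; rewrite -EFinD lee_fin ler_normD.
Qed.

Lemma le_L1_norm f g : measurable_fun [set: V] f -> measurable_fun [set: V] g ->
  (forall x, `|f x| <= `|g x|) -> (L1 f <= L1 g)%E.
Proof.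
move=> mf mg fg; apply: ge0_le_integral => //.
- exact: measurable_EFin_norm.
- exact: measurable_EFin_norm.
- by move=> x _; rewrite lee_fin.
Qed.

Lemma le_L1 f g : measurable_fun [set: V] f -> measurable_fun [set: V] g ->
  (forall x, `|f x| <= g x) -> (L1 f <= L1 g)%E.
Proof.
by move=> mf mg fg; apply: le_L1_norm => // x; rewrite (le_trans (fg x))// ler_norm.
Qed.

Lemma L1N f : L1 (\- f)%R = L1 f.
Proof. by rewrite /L1; under eq_integral do rewrite normrN. Qed.

Lemma L1Z (c : R) f : measurable_fun [set: V] f -> L1 (fun x => c * f x) = (`|c|%:E * L1 f)%E.
Proof.
move=> mf; rewrite /L1 -ge0_integralZl//; last exact: measurable_EFin_norm.
by apply: eq_integral => x _; rewrite -EFinM -normrM.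
Qed.

Definition shf (i : 'I_n) (t : R) f : V -> R := fun x => f (t *: unitv i + x).

Lemma measurable_shf i t f : measurable_fun [set: V] f -> measurable_fun [set: V] (shf i t f).
Proof. by move=> mf; apply: measurableT_comp mf _; have [] := mpres_shift (t *: unitv i : V). Qed.

Lemma L1_shf i t f : measurable_fun [set: V] f -> L1 (shf i t f) = L1 f.
Proof.
move=> mf; apply: (ge0_integral_mpres (mpres_shift (t *: unitv i)) (g := fun x => `|f x|%:E)).
  by apply/measurable_EFinP; apply: measurableT_comp.
by move=> x; rewrite lee_fin.
Qed.

(** Continuity at 0, in L^1, of the translation of [f] along the i-th axis. *)
Definition TC i f : Prop := intg f /\ forall e : R, 0 < e -> exists2 D : R, 0 < D &
  forall t, `|t| < D -> (L1 (fun x => shf i t f x - f x)%R <= e%:E)%E.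

(** The usual three-epsilon argument: translation is an L^1 isometry, so the property is closed
    under L^1 limits. *)
Lemma TC_approx i f : intg f ->
  (forall e : R, 0 < e -> exists2 g, TC i g & (L1 (fun x => f x - g x)%R <= e%:E)%E) ->
  TC i f.
Proof.
move=> If H; split => // e e0; have e3 : 0 < e / 3 by rewrite divr_gt0.
have [g [Ig TCg] fg] := H _ e3; have [D D0 HD] := TCg _ e3.
have mf := intg_measurable If; have mg := intg_measurable Ig.
exists D => // t tD.
rewrite (_ : (fun x => shf i t f x - f x) = (shf i t (f \- g)%R \+ ((fun x => shf i t g x - g x) \+ (\- (f \- g)))%R)%R); last first.
  by apply/funext => x /=; rewrite /shf/=; ring.
have mfg : measurable_fun [set: V] (f \- g)%R by exact: measurable_funB.
have msg : measurable_fun [set: V] (fun x => shf i t g x - g x).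
  by apply: measurable_funB => //; exact: measurable_shf.
have mN : measurable_fun [set: V] (\- (f \- g))%R by exact: measurable_funN.
apply: (le_trans (L1D _ _)); [exact: measurable_shf|exact: measurable_funD|].
rewrite L1_shf//; apply: (@le_trans _ _ ((e/3)%:E + ((e/3)%:E + (e/3)%:E))%E); last first.
  by rewrite -!EFinD lee_fin; lra.
apply: leeD => //; apply: (le_trans (L1D _ _)) => //.
by apply: leeD; [exact: HD|rewrite L1N].
Qed.

Lemma TC_cst0 i : TC i (fun=> 0).
Proof.
split; first exact: integrable0.
move=> e e0; exists 1 => // t _; rewrite /L1 /shf.
under eq_integral do rewrite subrr normr0.
by rewrite integral0 lee_fin ltW.
Qed.

Lemma TC_add i f g : TC i f -> TC i g -> TC i (fun x => f x + g x).
Proof.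
move=> [If TCf] [Ig TCg]; split.
  by have := integrableD measurableT If Ig; apply: eq_integrable.
have mf := intg_measurable If; have mg := intg_measurable Ig.
move=> e e0; have e2 : 0 < e / 2 by rewrite divr_gt0.
have [D D0 HD] := TCf _ e2; have [D' D0' HD'] := TCg _ e2.
exists (Num.min D D'); first by rewrite lt_min D0.
move=> t; rewrite lt_min => /andP[tD tD'].
rewrite (_ : (fun x => _) = ((fun x => shf i t f x - f x) \+ (fun x => shf i t g x - g x))%R); last first.
  by apply/funext => x /=; rewrite /shf/=; ring.
apply: (le_trans (L1D _ _)).
- by apply: measurable_funB => //; exact: measurable_shf.
- by apply: measurable_funB => //; exact: measurable_shf.
apply: (@le_trans _ _ ((e/2)%:E + (e/2)%:E)%E); last by rewrite -EFinD lee_fin; lra.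
by apply: leeD; [exact: HD|exact: HD'].
Qed.

Lemma TC_scale i (c : R) f : TC i f -> TC i (fun x => c * f x).
Proof.
move=> [If TCf]; split.
  by have := integrableZl measurableT c If; apply: eq_integrable.
have mf := intg_measurable If.
move=> e e0; have ce : 0 < e / (`|c| + 1) by rewrite divr_gt0// ltr_wpDl.
have [D D0 HD] := TCf _ ce; exists D => // t tD.
rewrite (_ : (fun x => _) = (fun x => c * (shf i t f x - f x))); last first.
  by apply/funext => x /=; rewrite /shf/=; ring.
rewrite L1Z; last by apply: measurable_funB => //; exact: measurable_shf.
apply: (@le_trans _ _ (`|c|%:E * (e / (`|c| + 1))%:E)%E).
  by apply: lee_wpmul2l; [rewrite lee_fin|exact: HD].
rewrite -EFinM lee_fin mulrA ler_pdivrMr ?ltr_wpDl// mulrC ler_pM2l//.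
by rewrite lerDl.
Qed.

Lemma TC_test i phi : test_function phi -> TC i phi.
Proof.
move=> tphi; have [N [C C0 [p0 dp0 pC dpC]]] := test_bound tphi.
have mphi : measurable_fun [set: V] phi by apply: continuous_measurable_rV; exact: test_continuous.
have cubeE (M : R) : L1 (\1_(cube M)) = mu (cube M).
  rewrite /L1; under eq_integral => x _ do rewrite ger0_norm//.
  by rewrite integral_indic ?setIT//; exact: measurable_cube.
have fincube (M : R) : mu (cube M) \is a fin_num by rewrite ge0_fin_numE// cube_lty.
split.
  apply: intgP => //; apply: (@le_lt_trans _ _ (L1 (fun x => C * \1_(cube N%:R) x))).
    apply: le_L1 => //.
      by apply: measurable_funM => //; by apply: measurable_indic; exact: measurable_cube.
    move=> x; rewrite indicE; have [Nx|Nx] := pselect (cube N%:R x).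
      by rewrite mem_set// mulr1.
    by rewrite memNset// mulr0 p0// normr0.
  rewrite L1Z; last by apply: measurable_indic; exact: measurable_cube.
  by rewrite cubeE lte_mul_pinfty ?cube_lty// ?lee_fin.
move=> e e0; pose M := fine (mu (cube (N%:R + 1))).
(* For |t| < 1 the difference lives in [cube (N + 1)], of measure [M], and is at most C |t| there;
   adding 1 to [M] makes the denominator visibly positive. *)
exists (Num.min 1 (e / (C * (M + 1)))).
  by rewrite lt_min ltr01 divr_gt0// mulr_gt0// ltr_wpDl// fine_ge0.
move=> t; rewrite lt_min => /andP[t1 tD].
apply: (@le_trans _ _ (L1 (fun x => (C * `|t|) * \1_(cube (N%:R + 1)) x))).
  apply: le_L1 => //.
  - by apply: measurable_funB => //; exact: measurable_shf.
  - by apply: measurable_funM => //; by apply: measurable_indic; exact: measurable_cube.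
  move=> x; rewrite indicE; have [Nx|Nx] := pselect (cube (N%:R + 1) x).
    by rewrite mem_set// mulr1; apply: (@test_lipschitz _ _ phi).
  rewrite memNset// mulr0 /shf !p0 ?subrr ?normr0//.
    by move=> H; apply: Nx; apply: cube_sub H; rewrite lerDl.
  move=> /cubeP H; apply: Nx; apply/cubeP => j; move: (H j); rewrite unitvE.
  case: eqP => [->|_]; last by move=> /le_trans; apply; rewrite lerDl.
  move=> h; rewrite -[X in `|X|](addKr t) (le_trans (ler_normD _ _))//.
  by rewrite normrN addrC lerD// ltW.
rewrite L1Z; last by apply: measurable_indic; exact: measurable_cube.
rewrite cubeE -(fineK (fincube _)) -EFinM lee_fin normrM normr_id gtr0_norm//.
have M0 : 0 <= M by exact: fine_ge0.
move: tD; rewrite ltr_pdivlMr ?mulr_gt0 ?ltr_wpDl// => /ltW; apply: le_trans.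
rewrite -/M mulrAC mulrC ler_wpM2l//.
by rewrite ler_pM2l// lerDl.
Qed.

Lemma intg_indic_sub (E : set V) (N : nat) : measurable E -> E `<=` cube N%:R ->
  intg (\1_E).
Proof.
move=> mE EN; apply: intgP; first exact: measurable_indic.
rewrite /L1; under eq_integral => x _ do rewrite ger0_norm//.
rewrite integral_indic// setIT.
apply: le_lt_trans (cube_lty N%:R); apply: le_measure => //; rewrite inE//.
exact: measurable_cube.
Qed.

Lemma TC_obox i (a b : V) : TC i (\1_(obox a b)).
Proof.
have [N abN] := obox_cube a b.
apply: TC_approx; first exact: (intg_indic_sub (measurable_obox _ _) abN).
move=> e e0.
have [|||||_ H _] := @dominated_convergence _ V R mu setT measurableT
  (fun k x => (bump k a b x)%:E) (fun x => (\1_(obox a b) x)%:E)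
  (fun x => (\1_(obox a b) x)%:E).
- by move=> k; apply/measurable_EFinP; exact: measurable_bump.
- by apply/measurable_EFinP; apply: measurable_indic; exact: measurable_obox.
- apply: aeW => x _; apply: cvg_EFin; first exact: nearW.
  exact: bump_cvg.
- exact: (intg_indic_sub (measurable_obox _ _) abN).
- apply: aeW => x k _; rewrite lee_fin ger0_norm ?bump_ge0// indicE.
  have [xab|xab] := pselect (obox a b x); first by rewrite mem_set// bump_le1.
  by rewrite bump_out.
have [k Hk] := cvge0_lt H e0; exists (bump k a b); first by apply: TC_test; exact: bump_test.
by apply/ltW; apply: le_lt_trans Hk; rewrite /L1; under eq_integral do rewrite distrC.
Qed.

(** Dynkin induction from open boxes, where bumps give L^1 approximation. Complements come from
    linearity, disjoint unions from dominated convergence of the partial sums. *)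
Lemma TC_indic i (E : set V) (N : nat) : measurable E -> TC i (\1_(E `&` ocube N)).
Proof.
move=> mE; have : <<s @oboxes R n >> E by rewrite -measurable_oboxesE.
apply: (dynkin_induction (G := oboxes) (P := fun E => TC i (\1_(E `&` ocube N)))).
- exact: measurable_oboxesE.
- exact: oboxesI.
- by rewrite setTI; exact: TC_obox.
- by move=> _ [a [b ->]]; rewrite oboxI; exact: TC_obox.
- move=> S mS TS; rewrite (_ : \1_(~` S `&` ocube N) =
    (fun x => \1_(ocube N) x + (-1) * \1_(S `&` ocube N) x)).
    by apply: TC_add; [exact: TC_obox|exact: TC_scale].
  apply/funext => x; rewrite !indicE !in_setI in_setC.
  by case: (x \in S); case: (x \in ocube N); rewrite /= ?mulr0 ?mulr1 ?addr0 ?subrr.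
move=> F mF tF TF; have mFN k : measurable (F k `&` ocube N).
  by apply: measurableI => //; exact: measurable_ocube.
have mUN : measurable (\bigcup_k F k `&` ocube N).
  by apply: measurableI; [exact: bigcupT_measurable|exact: measurable_ocube].
have subN (A : set V) : A `&` ocube N `<=` cube N%:R by move=> x [_ /ocube_sub].
apply: TC_approx; first exact: (intg_indic_sub mUN (subN _)).
move=> e e0; pose g (k : nat) x : R := \sum_(j < k) \1_(F j `&` ocube N) x.
have TCg k : TC i (g k).
  rewrite /g; elim: k => [|k IH].
    by rewrite (_ : (fun x => _) = (fun=> 0)); [exact: TC_cst0|apply/funext => x; rewrite big_ord0].
  rewrite (_ : (fun x => _) = (fun x => \sum_(j < k) \1_(F j `&` ocube N) x + \1_(F k `&` ocube N) x)).
    exact: TC_add.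
  by apply/funext => x; rewrite big_ord_recr.
have gE k x : g k x = \1_(\bigcup_(j < k) (F j `&` ocube N)) x.
  rewrite /g indicE; have [[j /= jk Fjx]|Fx] := pselect ((\bigcup_(j < k) (F j `&` ocube N)) x).
    rewrite mem_set; last by exists j.
    rewrite (bigD1 (Ordinal jk))//= indicE mem_set// big1 ?addr0// => m mj.
    rewrite indicE memNset// => Fmx; move/trivIsetP : tF => /(_ j m I I).
    have jm : j != m by apply: contra mj => /eqP jm; apply/eqP/val_inj.
    move=> /(_ jm) FF; have : (F j `&` F m) x by split; [case: Fjx|case: Fmx].
    by rewrite FF.
  rewrite memNset// big1// => m _; rewrite indicE memNset// => Fmx.
  by apply: Fx; exists m => //=.
have mg k : measurable_fun [set: V] (g k) by apply: intg_measurable; exact: (TCg k).1.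
have [|||||_ H _] := @dominated_convergence _ V R mu setT measurableT
  (fun k x => (g k x)%:E) (fun x => (\1_(\bigcup_k F k `&` ocube N) x)%:E)
  (fun x => (\1_(\bigcup_k F k `&` ocube N) x)%:E).
- by move=> k; apply/measurable_EFinP.
- by apply/measurable_EFinP; apply: measurable_indic.
- apply: aeW => x _; apply: cvg_EFin; first exact: nearW.
  apply: cvg_near_cst; have [[[j _ Fjx] Nx]|Fx] := pselect ((\bigcup_k F k `&` ocube N) x).
    exists j.+1 => // k /= jk; rewrite gE !indicE !mem_set//; first by split => //; exists j.
    by exists j.
  apply: nearW => k; rewrite /= gE !indicE !memNset// => -[j _ [Fjx Nx]].
  by apply: Fx; split => //; exists j.
- exact: (intg_indic_sub mUN (subN _)).
- apply: aeW => x k _; rewrite lee_fin gE !indicE ger0_norm// ler_nat.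
  have [[j _ [Fjx Nx]]|Fx] := pselect ((\bigcup_(j < k) (F j `&` ocube N)) x); last first.
    by rewrite memNset.
  by rewrite [X in (_ <= nat_of_bool X)%N]mem_set ?leq_b1//; split => //; exists j.
have [k Hk] := cvge0_lt H e0; exists (g k); first exact: TCg.
by apply/ltW; apply: le_lt_trans Hk; rewrite /L1; under eq_integral do rewrite distrC.
Qed.

(** Simple functions are dense in L^1; cutting to [ocube N] comes first because [TC_indic] only
    treats bounded sets. *)
Lemma TC_intg i f : intg f -> TC i f.
Proof.
have base g (N : nat) : intg g -> TC i (fun x => g x * \1_(ocube N) x).
  move=> Ig; have mN := @measurable_ocube R n N.
  have IgN : intg (fun x => g x * \1_(ocube N) x).
    have := (integrable_mkcond (EFin \o g) mN).1 (integrableS measurableT mN (@subsetT _ _) Ig).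
    by apply: eq_integrable => // x _; rewrite epatch_indic.
  apply: TC_approx => // e e0.
  have [h [Ih _ H]] := approximation_sfun_integrable measurableT Ig.
  have [k Hk] := cvge0_lt H e0.
  exists (fun x => h k x * \1_(ocube N) x).
    rewrite (_ : (fun x => _) = (fun x => \sum_(r <- finmap.enum_fset (fset_set (range (h k)))) r * \1_(h k @^-1` [set r] `&` ocube N) x)).
      elim: (finmap.enum_fset _) => [|r s IH].
        by rewrite (_ : (fun x => _) = (fun=> 0)); [exact: TC_cst0|apply/funext => x; rewrite big_nil].
      rewrite (_ : (fun x => _) = (fun x => r * \1_(h k @^-1` [set r] `&` ocube N) x + \sum_(j <- s) j * \1_(h k @^-1` [set j] `&` ocube N) x)).
        by apply: TC_add => //; apply: TC_scale; exact: TC_indic.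
      by apply/funext => x; rewrite big_cons.
    apply/funext => x; rewrite [in LHS]fimfunE fsbig_finite//= mulr_suml.
    by apply: eq_bigr => r _; rewrite indicI mulrA.
  apply/ltW; apply: le_lt_trans Hk.
  apply: (@le_L1_norm (fun x => g x * \1_(ocube N) x - h k x * \1_(ocube N) x) (fun x => g x - h k x)).
  - have mi : measurable_fun [set: V] (\1_(ocube N) : V -> R) by exact: measurable_indic.
    by apply: measurable_funB; apply: measurable_funM => //; exact: intg_measurable.
  - by apply: measurable_funB => //; exact: intg_measurable.
  - move=> x; rewrite -mulrBl normrM indicE; case: (x \in _); rewrite ?normr1 ?mulr1//.
    by rewrite normr0 mulr0.
move=> If; apply: TC_approx => // e e0; have mf := intg_measurable If.
have [|||||_ H _] := @dominated_convergence _ V R mu setT measurableT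
  (fun k x => (f x * \1_(ocube k) x)%:E) (EFin \o f) (fun x => `|f x|%:E).
- move=> k; apply/measurable_EFinP; apply: measurable_funM => //.
  by apply: measurable_indic; exact: measurable_ocube.
- exact/measurable_EFinP.
- apply: aeW => x _; apply: cvg_EFin; first exact: nearW.
  apply: cvg_near_cst; have : (\bigcup_k cube k%:R) x by rewrite bigcup_cube.
  move=> [k _ /cube_subo kx]; exists k.+1 => // m /= km.
  rewrite indicE mem_set ?mulr1//; move/ocubeP : kx => kx; apply/ocubeP => j.
  by rewrite (lt_le_trans (kx j))// ler_nat.
- exact: integrable_norm.
- apply: aeW => x k _; rewrite lee_fin normrM indicE; case: (x \in _).
    by rewrite normr1 mulr1.
  by rewrite normr0 mulr0.
have [k Hk] := cvge0_lt H e0; exists (fun x => f x * \1_(ocube k) x); first exact: base.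
by apply/ltW; apply: le_lt_trans Hk; rewrite /L1; under eq_integral do rewrite distrC.
Qed.

End translation_continuity.

(** * Averages over short segments parallel to an axis *)

Section segment_averages.
Context {R : realType} {n : nat}.
Local Notation V := 'rV[R]_n.
Local Notation RR := (measurableTypeR R).
Local Notation mu := (@lebesgue_rV R n).
Local Notation leb := (@lebesgue_measure R).
Implicit Types (f g u : V -> R) (i : 'I_n) (h : R).

Lemma measurable_fun_shift2 i :
  measurable_fun [set: (V * RR)%type] (fun z : V * RR => z.2 *: unitv i + z.1 : V).
Proof.
apply: measurable_fun_rV => j.
rewrite (_ : (fun t => _) = fun z : V * RR => if j == i then z.2 + z.1 ord0 i else z.1 ord0 j).
  have mc k : measurable_fun [set: (V * RR)%type] (fun z : V * RR => z.1 ord0 k : R).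
    by apply: measurableT_comp (measurable_coord_rV k) _; exact: measurable_fst.
  case: eqP => _; last exact: mc.
  have m2 : measurable_fun [set: (V * RR)%type] (fun z : V * RR => z.2 : R) by exact: measurable_snd.
  by have := measurable_funD m2 (mc i).
by apply/funext => z; rewrite unitvE.
Qed.

Definition seg h (G : V * RR -> R) : V * RR -> \bar R :=
  fun z => (G z * \1_(`[0, h]%classic) z.2)%:E.

Lemma measurable_seg h (G : V * RR -> R) : measurable_fun [set: (V * RR)%type] G ->
  measurable_fun [set: (V * RR)%type] (seg h G).
Proof.
move=> mG; apply/measurable_EFinP; apply: measurable_funM => //.
have mI : measurable_fun [set: RR] (\1_(`[0, h]%classic) : RR -> R) by apply: measurable_indic; exact: measurable_itv.
by apply: measurableT_comp mI _; exact: measurable_snd.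
Qed.

Lemma integral_seg_cst h (c : R) : 0 <= h ->
  (\int[leb]_t (c * \1_(`[0, h]%classic) t)%:E = (h * c)%:E)%E.
Proof.
move=> h0; rewrite (_ : (fun t => _) = (cst c%:E) \_ `[0, h]%classic); last by rewrite epatch_indic.
rewrite -integral_mkcond integral_cst; last exact: measurable_itv.
transitivity (c%:E * lebesgue_measure `[0%R, h]%classic)%E => //.
by rewrite lebesgue_measure_itv/= lte_fin; case: ltgtP h0 => // [_ _|<- _];
  rewrite ?sube0 -EFinM mulrC// mulr0.
Qed.

Lemma integral_seg_le h (G : V * RR -> R) (B : R) : 0 <= h ->
  measurable_fun [set: (V * RR)%type] G ->
  (forall t, 0 <= t <= h -> (L1 (fun x => G (x, t)) <= B%:E)%E) ->
  (\int[leb]_t \int[mu]_x `|seg h G (x, t)| <= (h * B)%:E)%E.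
Proof.
move=> h0 mG GB; have mseg := measurable_seg h mG.
have mI : measurable_fun [set: RR] (\1_(`[0, h]%classic) : RR -> R) by apply: measurable_indic; exact: measurable_itv.
apply: (@le_trans _ _ (\int[leb]_t (`|B| * \1_(`[0, h]%classic) t)%:E)%E).
  apply: ge0_le_integral => //.
  - by move=> t _; apply: integral_ge0 => x _.
  - apply: (measurable_fun_fubini_tonelli_G (abse \o seg h G)).
      exact: measurableT_comp.
    by move=> z; exact: abse_ge0.
  - by apply/measurable_EFinP; apply: measurable_funM.
  move=> t _; rewrite /seg indicE; have [th|th] := boolP (t \in _); last first.
    under eq_integral do rewrite mulr0 abse0.
    by rewrite integral0 lee_fin mulr0.
  under eq_integral do rewrite mulr1.
  rewrite mulr1; apply: (le_trans (GB t _)); last by rewrite lee_fin ler_norm.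
  by move: th; rewrite inE/= in_itv.
rewrite integral_seg_cst// lee_fin; have [->|hn0] := eqVneq h 0; first by rewrite !mul0r.
have : (0 <= B%:E)%E by apply: le_trans (GB 0 _); [exact: L1_ge0|rewrite lexx].
by rewrite lee_fin => B0; rewrite ger0_norm.
Qed.

Lemma integrable_seg h (G : V * RR -> R) (B : R) : 0 <= h ->
  measurable_fun [set: (V * RR)%type] G ->
  (forall t, 0 <= t <= h -> (L1 (fun x => G (x, t)) <= B%:E)%E) ->
  (mu \x leb)%E.-integrable setT (seg h G).
Proof.
move=> h0 mG GB; apply/integrable21ltyP; first exact: measurable_seg.
by apply: le_lt_trans (integral_seg_le h0 mG GB) _; rewrite ltry.
Qed.

(** The integral of G(x, t) over t in [0, h]. It is known to be finite only for almost every x, by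
    Fubini ([segintE]); [fine] makes it a real function everywhere. *)
Definition segint h (G : V * RR -> R) (x : V) : R :=
  fine (\int[leb]_t seg h G (x, t))%E.

Section fubini_segment.
Variables (h B : R) (h0 : 0 <= h) (G : V * RR -> R).
Variable mG : measurable_fun [set: (V * RR)%type] G.
Variable GB : forall t, 0 <= t <= h -> (L1 (fun x => G (x, t)) <= B%:E)%E.

Lemma segintE : {ae mu, forall x, (segint h G x)%:E = \int[leb]_t seg h G (x, t)}%E.
Proof.
have /integrable_fubini_F/(integrable_ae measurableT) := integrable_seg h0 mG GB.
by apply: filterS => x /= /(_ I) Hx; rewrite /segint fineK.
Qed.

Lemma measurable_segint : measurable_fun [set: V] (segint h G).
Proof.
have /integrable_fubini_F/measurable_int := integrable_seg h0 mG GB.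
move=> H; apply/measurableT_comp => //.
Qed.

Lemma intg_segint : intg (segint h G).
Proof.
have /integrable_fubini_F iF := integrable_seg h0 mG GB.
have mE := measurable_int _ iF.
have aeE : ae_eq mu setT (fubini_F leb (seg h G)) (EFin \o segint h G).
  by apply: filterS segintE => x H _; rewrite /fubini_F -H.
apply/integrableP; split; first by apply/measurable_EFinP; exact: measurable_segint.
suff -> : (\int[mu]_x `|(EFin \o segint h G) x| = \int[mu]_x `|fubini_F leb (seg h G) x|)%E.
  by case/integrableP : iF.
apply: ae_eq_integral => //.
- by apply: measurableT_comp => //; apply/measurable_EFinP; exact: measurable_segint.
- exact: measurableT_comp.
- by apply: filterS aeE => x /= H /H ->.
Qed.

Lemma integral_segint :
  (\int[mu]_x (segint h G x)%:E = \int[leb]_t \int[mu]_x seg h G (x, t))%E.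
Proof.
have iG := integrable_seg h0 mG GB; have /integrable_fubini_F iF := iG.
rewrite -(Fubini iG); apply: ae_eq_integral => //.
- by apply/measurable_EFinP; exact: measurable_segint.
- exact: measurable_int iF.
- by apply: filterS segintE => x /= H _.
Qed.

Lemma L1_segint : (L1 (segint h G) <= (h * B)%:E)%E.
Proof.
have mseg := measurable_seg h mG.
apply: le_trans (integral_seg_le h0 mG GB).
rewrite -(fubini_tonelli (abse \o seg h G)); last 2 first.
- exact: measurableT_comp.
- by move=> z; exact: abse_ge0.
apply: ae_ge0_le_integral => //.
- by apply: measurable_EFin_norm; exact: measurable_segint.
- by move=> x _; apply: integral_ge0 => t _; exact: abse_ge0.
- apply: (measurable_fun_fubini_tonelli_F (abse \o seg h G)).
    exact: measurableT_comp.
  by move=> z; exact: abse_ge0.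
- apply: filterS segintE => x H _; rewrite -[leLHS]/(`|(segint h G x)%:E|)%E H.
  apply: le_abse_integral => //; apply: measurableT_comp mseg _.
  exact: pair1_measurable.
Qed.

End fubini_segment.

Definition shift2 i g : V * RR -> R := fun z => g (z.2 *: unitv i + z.1).

Lemma measurable_shift2 i g : measurable_fun [set: V] g ->
  measurable_fun [set: (V * RR)%type] (shift2 i g).
Proof. by move=> mg; apply: measurableT_comp mg _; exact: measurable_fun_shift2. Qed.

Lemma cube_shift i (N M t : R) (x : V) : cube N x -> `|t| <= M -> cube (N + M) (t *: unitv i + x).
Proof.
move=> /cubeP Nx tM; apply/cubeP => j; rewrite unitvE; case: eqP => _.
  by rewrite (le_trans (ler_normD _ _))// addrC lerD.
by rewrite (le_trans (Nx j))// lerDl (le_trans _ tM).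
Qed.

(** The average minus [g] is itself an average over t in [0, h] of the translation error of [g],
    which [TC_intg] makes small in L^1 uniformly in t; Tonelli exchanges norm and average. *)
Lemma segint_shift_approx i g : intg g -> forall e : R, 0 < e ->
  exists2 D : R, 0 < D & forall h, 0 < h < D ->
    (L1 (fun x => (segint h (shift2 i g) x / h - g x)%R) <= e%:E)%E.
Proof.
move=> Ig e e0; have [_ /(_ e e0)[D D0 HD]] := TC_intg i Ig.
have mg := intg_measurable Ig.
exists D => // h /andP[h0 hD]; have h0' := ltW h0.
pose G (z : V * RR) := shift2 i g z - g z.1.
have mg1 : measurable_fun [set: (V * RR)%type] (fun z : V * RR => g z.1).
  by apply: measurableT_comp mg _; exact: measurable_fst.
have mG : measurable_fun [set: (V * RR)%type] G.
  by apply: measurable_funB => //; exact: measurable_shift2.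
have GB t : 0 <= t <= h -> (L1 (fun x => G (x, t)) <= e%:E)%E.
  by move=> /andP[t0 th]; apply: HD; rewrite ger0_norm// (le_lt_trans th).
have Bg t : 0 <= t <= h -> (L1 (fun x => shift2 i g (x, t)) <= (fine (L1 g))%:E)%E.
  move=> _; rewrite fineK; last by rewrite ge0_fin_numE ?L1_ge0//; exact: intg_lty.
  by rewrite -(L1_shf i t mg).
have Bg1 t : 0 <= t <= h -> (L1 (fun x => g (x, t).1) <= (fine (L1 g))%:E)%E.
  by move=> _; rewrite fineK//; rewrite ge0_fin_numE ?L1_ge0//; exact: intg_lty.
have iS := integrable_seg h0' (measurable_shift2 i mg) Bg.
have ig1 := integrable_seg h0' mg1 Bg1.
have aeE : {ae mu, forall x, segint h G x = segint h (shift2 i g) x - h * g x}.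
  have := ae_integrable1 iS; have := ae_integrable1 ig1.
  have := segintE h0' (measurable_shift2 i mg) Bg.
  apply: filterS3 => x HS Ix IgS; rewrite /segint.
  rewrite (_ : (\int[leb]_t seg h G (x, t)) = \int[leb]_t (seg h (shift2 i g) (x,t) - seg h (fun z => g z.1) (x,t)))%E; last first.
    by apply: eq_integral => t _; rewrite /seg/= /G/= -EFinB mulrBl.
  rewrite integralB//=.
  have -> : (\int[leb]_t seg h (fun z => g z.1) (x, t) = (h * g x)%:E)%E.
    exact: (integral_seg_cst (g x) h0').
  by rewrite -HS.
have := L1_segint h0' mG GB.
rewrite (_ : L1 (segint h G) = (h%:E * L1 (fun x => segint h (shift2 i g) x / h - g x)%R)%E).
  by rewrite EFinM lee_pmul2l// ?lte_fin// fin_numE.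
have mSg := measurable_segint h0' (measurable_shift2 i mg) Bg.
have mq : measurable_fun [set: V] (fun x => segint h (shift2 i g) x / h - g x).
  by apply: measurable_funB => //; apply: measurable_funM.
rewrite -[X in (X%:E * _)%E](gtr0_norm h0) -L1Z//.
apply: ae_eq_integral => //.
- by apply: measurable_EFin_norm; exact: measurable_segint mG GB.
- by apply: measurable_EFin_norm; apply: measurable_funM.
- apply: filterS aeE => x -> _ /=; congr (`|_|%:E).
  by rewrite mulrBr mulrCA divff ?mulr1// gt_eqF.
Qed.

End segment_averages.

(** * Primitives of one-variable bumps *)

Section bump_primitive.
Context {R : realType}.
Local Notation leb := (@lebesgue_measure R).
Implicit Types (k a b t h : R).

Lemma bump1_integrable k a b (A : set R) : 0 <= k -> measurable A ->
  leb.-integrable A (EFin \o bump1 k a b).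
Proof.
move=> k0 mA; have cb : continuous (bump1 k a b) by apply: sm_continuous; exact: sm_bump1.
have mb : measurable_fun [set: R] (bump1 k a b) by exact: continuous_measurable_fun.
apply: (integrableS measurableT) => //.
apply: (@le_integrable _ _ _ leb _ measurableT _ (EFin \o \1_(`[a, b]%classic))).
- exact/measurable_EFinP.
- move=> t _; rewrite /= lee_fin indicE.
  have [tab|tab] := boolP (a < t < b); last by rewrite bump1_eq0// normr0.
  rewrite mem_set ?normr1; last by rewrite /= in_itv/=; case/andP: tab => /ltW -> /ltW ->.
  by rewrite ger0_norm ?bump1_ge0// bump1_le1.
- exact: integrable_indic_itv.
Qed.

Lemma bump1_prim k a b : 0 <= k -> exists N : R -> R, [/\ sm N,
  forall x : R, is_derive x 1 N (bump1 k a b x),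
  forall t, t <= a -> N t = N a & forall t, b <= t -> N t = N b].
Proof.
move=> k0.
pose N (x : R) := (\int[leb]_(t in [set` Interval -oo%O (BRight x)]) bump1 k a b t)%R.
have cb : continuous (bump1 k a b) by apply: sm_continuous; exact: sm_bump1.
have dN (x : R) : is_derive x 1 N (bump1 k a b x).
  have [] := @continuous_FTC1 R (bump1 k a b) -oo%O x (x + 1).
  - by rewrite ltrDl.
  - exact: bump1_integrable.
  - by rewrite lt0x.
  - exact: cb.
  by move=> dN N'; apply: DeriveDef; [exact: dN|rewrite -derive1E].
have cN : continuous N.
  by move=> x; apply/differentiable_continuous/derivable1_diffP; case: (dN x).
exists N; split => // [|t ta|t bt].
- by apply: sm_prim dN; exact: sm_bump1.
- have [|c cta H] := @MVT_segment R N _ t a ta (fun x _ => dN x).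
    exact: continuous_subspaceT.
  apply/esym/eqP; rewrite -subr_eq0 H bump1_eq0 ?mul0r//.
  by move: cta; rewrite in_itv/= negb_and -!leNgt => /andP[_ ->].
- have [|c cta H] := @MVT_segment R N _ b t bt (fun x _ => dN x).
    exact: continuous_subspaceT.
  apply/eqP; rewrite -subr_eq0 H bump1_eq0 ?mul0r//.
  by move: cta; rewrite in_itv/= negb_and -!leNgt => /andP[-> _]; rewrite orbT.
Qed.

Lemma sm_FTC (f N : R -> R) (x h : R) : sm f -> (forall x : R, is_derive x 1 N (f x)) ->
  0 < h -> (\int[leb]_(t in `[0%R, h]) (f (x - t)%R)%:E = (N x - N (x - h)%R)%R%:E)%E.
Proof.
move=> sf dN h0.
have dF (t : R) : is_derive t 1 (fun t => - N (x - t)) (f (x - t)).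
  have dx : is_derive t 1 (fun t : R => x - t) (- 1).
    have := @is_deriveB R R R (cst x) id t 1 _ _ (is_derive_cst _ _ _) (is_derive_id _ _).
    by rewrite sub0r.
  have := is_deriveN (is_derive1_comp (f := N) (g := fun t => x - t) (dN (x - t)) dx).
  by rewrite mulrN mulr1 opprK.
have cF : continuous (fun t => - N (x - t)).
  by move=> t; apply/differentiable_continuous/derivable1_diffP; case: (dF t).
rewrite (@continuous_FTC2 _ _ (fun t => - N (x - t)))//.
- by rewrite -EFinB subr0 opprK addrC.
- apply: continuous_subspaceT => t.
  apply: (@continuous_comp _ _ _ (fun t => x - t) f); last exact: sm_continuous.
  by apply: cvgB; [exact: cvg_cst|exact: cvg_id].
- split.
  + by move=> t _; case: (dF t).
  + by apply: cvg_at_right_filter; exact: cF.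
  + by apply: cvg_at_left_filter; exact: cF.
- by move=> t _; rewrite derive1E; have := dF t => dFt; rewrite derive_val.
Qed.

End bump_primitive.

(** * Weak derivatives and difference quotients in L^1 on cubes *)

Section weak_derivative.
Context {R : realType} {n : nat}.
Local Notation V := 'rV[R]_n.
Local Notation RR := (measurableTypeR R).
Local Notation mu := (@lebesgue_rV R n).
Local Notation leb := (@lebesgue_measure R).
Implicit Types (f g u : V -> R) (i : 'I_n) (h : R).

Definition wderiv i u g : Prop := forall phi, test_function phi ->
  (\int[mu]_x (u x * partial i phi x) = - \int[mu]_x (g x * phi x))%R.

(* It is enough to test against products of one-variable functions. *)
Definition pderiv i u g : Prop := forall eta, (forall j, sm (eta j)) ->
  test_function (pf eta) ->
  (\int[mu]_x (u x * partial i (pf eta) x) = - \int[mu]_x (g x * pf eta x))%R.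

Lemma wderiv_pderiv i u g : wderiv i u g -> pderiv i u g.
Proof. by move=> ug eta _; exact: ug. Qed.

Lemma bump_antishift k (a b : V) i h : 0 < h -> exists eta, [/\ forall j, sm (eta j),
  test_function (pf eta), forall x, partial i (pf eta) x = bump k a b x - bump k a b (- h *: unitv i + x) &
  forall x, (pf eta x)%:E = (\int[leb]_t seg h (fun z => bump k a b (- z.2 *: unitv i + z.1)) (x, t))%E].
Proof.
move=> h0; pose eta j := bump1 k.+1%:R (a ord0 j) (b ord0 j).
have [N [sN dN Na Nb]] := @bump1_prim R k.+1%:R (a ord0 i) (b ord0 i) (ler0n _ _).
(* Written with [1 * t + (- h)] so as to match the constructor [sm_aff]. *)
pose Psi (t : R) := N t + (-1) * N (1 * t + (- h)).
have sPsi : sm Psi by apply: sm_add => //; apply: sm_mul; [exact: sm_cst|exact: sm_aff].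
have dPsi (t : R) : is_derive t 1 Psi (eta i t - eta i (t - h)).
  have dx : is_derive t 1 (fun t : R => t - h) 1.
    have := @is_deriveB R R R id (cst h) t 1 _ _ (is_derive_id _ _) (is_derive_cst _ _ _).
    by rewrite subr0.
  have := is_deriveB (dN t) (is_derive1_comp (f := N) (g := fun t => t - h) (dN (t - h)) dx).
  rewrite mulr1; rewrite (_ : N - _ = Psi)//.
  by apply/funext => s; rewrite /Psi mulN1r mul1r.
have sPf j : sm (upd eta i Psi j) by rewrite /upd; case: ifP => // _; exact: sm_bump1.
have PsiE t : Psi t = N t - N (t - h) by rewrite /Psi mulN1r mul1r.
exists (upd eta i Psi); split => //.
- apply: (@test_pf _ _ _ (\sum_j (`|a ord0 j| + `|b ord0 j|) + h)) => // j t.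
  have le_S (x : R) : a ord0 j < x -> x < b ord0 j + h -> `|x| <= \sum_j (`|a ord0 j| + `|b ord0 j|) + h.
    move=> ax xb; rewrite (bigD1 j)//=.
    have S0 : 0 <= \sum_(m < n | m != j) (`|a ord0 m| + `|b ord0 m|).
      by apply: sumr_ge0 => m _; rewrite addr_ge0.
    have := ler_norm (b ord0 j); have := ler_norm (- a ord0 j); rewrite normrN => ? ?.
    have := normr_ge0 (b ord0 j); have := normr_ge0 (a ord0 j) => ? ?.
    by rewrite ler_norml; lra.
  rewrite /upd; case: (j =P i) => [ji|_].
    rewrite PsiE ji in le_S * => Pt; apply: le_S.
      by rewrite ltNge; apply: contra_neqN Pt => ta; rewrite !Na ?subrr//; lra.
    by rewrite ltNge; apply: contra_neqN Pt => tb; rewrite !Nb ?subrr//; lra.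
  have [/andP[at_ tb] _|/bump1_eq0] := boolP (a ord0 j < t < b ord0 j).
    by apply: le_S => //; lra.
  by rewrite /eta => ->; rewrite ?eqxx.
- move=> x; have H := is_derive_pf x (j := i) (eta := upd eta i Psi) (g := fun t => eta i t - eta i (t - h)).
  have {}H : is_derive x (unitv i) (pf (upd eta i Psi)) (pf (upd (upd eta i Psi) i (fun t => eta i t - eta i (t - h))) x).
    by apply: H => t; rewrite /upd eqxx.
  rewrite /partial derive_val pf_upd.
  rewrite (_ : \prod_(j | j != i) _ = \prod_(j | j != i) eta j (x ord0 j)); last first.
    by apply: eq_bigr => j /negbTE ji; rewrite /upd ji.
  by rewrite mulrBl /bump -/eta pf_unitv (pfD1 eta i x) (addrC (- h)).
- move=> x; rewrite pf_upd PsiE /seg/=.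
  under eq_integral => t _ do rewrite /bump -/eta pf_unitv (addrC (- t)) mulrAC EFinM muleC.
  rewrite (_ : (fun t => _) = (fun t => (\prod_(j | j != i) eta j (x ord0 j))%:E * ((fun t => (eta i (x ord0 i - t)%R)%:E) \_ (`[0%R, h]%classic)) t))%E; last first.
    by apply/funext => t; rewrite epatch_indic/= -EFinM.
  rewrite integralZl//.
    have FT := sm_FTC (x ord0 i) (sm_bump1 _ _ _) dN h0.
    rewrite [X in _ = (_ * X)%E](_ : _ = (N (x ord0 i) - N (x ord0 i - h))%:E).
      by rewrite -EFinM mulrC.
    by rewrite -integral_mkcond; exact: FT.
  apply: (integrable_mkcond _ _).1; first exact: measurable_itv.
  apply: continuous_compact_integrable; first exact: segment_compact.
  apply: continuous_subspaceT => t.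
  apply: (@continuous_comp _ _ _ (fun t => x ord0 i - t) (eta i)).
    by apply: cvgB; [exact: cvg_cst|exact: cvg_id].
  by apply: sm_continuous; exact: sm_bump1.
Qed.

Lemma segint_scale h (B : R) (c : V -> R) (G : V * RR -> R) : 0 <= h ->
  measurable_fun [set: (V * RR)%type] G ->
  (forall t, 0 <= t <= h -> (L1 (fun x => G (x, t)) <= B%:E)%E) ->
  {ae mu, forall x, segint h (fun z => c z.1 * G z) x = c x * segint h G x}.
Proof.
move=> h0 mG GB; have iG := integrable_seg h0 mG GB.
have := segintE h0 mG GB; have := ae_integrable1 iG.
apply: filterS2 => x iGx GE; rewrite {1}/segint.
rewrite (_ : (\int[leb]_t seg h (fun z => c z.1 * G z)%R (x, t) = (c x)%:E * \int[leb]_t seg h G (x, t))%E).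
  by rewrite -GE.
by rewrite -integralZl//; apply: eq_integral => t _; rewrite /seg/= -EFinM mulrA.
Qed.

Definition trunc g (N : nat) : V -> R := fun x => g x * \1_(cube N%:R) x.

Lemma intg_trunc g N : LI g -> intg (trunc g N).
Proof.
move=> Ig; have := (integrable_mkcond (EFin \o g) (@measurable_cube R n N%:R)).1 (Ig N).
by apply: eq_integrable => // x _; rewrite epatch_indic.
Qed.

Lemma truncE g (N : nat) x : cube N%:R x -> trunc g N x = g x.
Proof. by move=> Nx; rewrite /trunc indicE mem_set ?mulr1. Qed.

Lemma LI_intg f : intg f -> LI f.
Proof. by move=> If N; apply: integrableS If => //; exact: measurable_cube. Qed.

Lemma LI_local f : (forall N, exists2 g, intg g & forall x, cube N%:R x -> f x = g x) -> LI f.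
Proof.
move=> H N; have [g Ig fg] := H N; apply: eq_integrable (LI_intg Ig N) => //.
  exact: measurable_cube.
by move=> x; rewrite inE => /fg /= ->.
Qed.

Lemma LI_add f g : LI f -> LI g -> LI (fun x => f x + g x).
Proof.
by move=> If Ig N; have := integrableD (measurable_cube N%:R) (If N) (Ig N); apply: eq_integrable => //; exact: measurable_cube.
Qed.

Lemma LI_scale (c : R) f : LI f -> LI (fun x => c * f x).
Proof.
by move=> If N; have := integrableZl (measurable_cube N%:R) c (If N); apply: eq_integrable => //; exact: measurable_cube.
Qed.

Lemma LI_sub f g : LI f -> LI g -> LI (fun x => f x - g x).
Proof.
move=> If Ig; rewrite (_ : (fun x => _) = (fun x => f x + (-1) * g x)).
  by apply: LI_add => //; exact: LI_scale.
by apply/funext => x; rewrite mulN1r.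
Qed.

Lemma intg_shf i t f : intg f -> intg (shf i t f).
Proof. by move=> If; have := integrable_mpres (mpres_shift (t *: unitv i)) If; exact. Qed.

Lemma LI_shf i t f : `|t| <= 1 -> LI f -> LI (shf i t f).
Proof.
move=> t1 If; apply: LI_local => N; exists (shf i t (trunc f N.+1)).
  by apply: intg_shf; exact: intg_trunc.
by move=> x Nx; rewrite /shf truncE// -natr1; exact: cube_shift.
Qed.

Lemma test_intg_mul f (phi : V -> R) (N : nat) : LI f -> continuous phi ->
  (forall x, ~ cube N%:R x -> phi x = 0) -> intg (fun x => f x * phi x).
Proof.
move=> If cphi supp; have [C C0 HC] := continuous_cube_bounded cphi supp.
have mphi := continuous_measurable_rV cphi; have mf := LI_measurable If.
apply: intgP; first exact: measurable_funM.
apply: (@le_lt_trans _ _ (L1 (fun x => C * trunc f N x))).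
  apply: le_L1_norm; first exact: measurable_funM.
    by apply: measurable_funM => //; apply: intg_measurable; exact: intg_trunc.
  move=> x; have [Nx|Nx] := pselect (cube N%:R x); last by rewrite supp// mulr0 normr0.
  by rewrite truncE// !normrM (gtr0_norm C0) mulrC; apply: ler_wpM2r.
rewrite L1Z; last by apply: intg_measurable; exact: intg_trunc.
by rewrite lte_mul_pinfty// ?lee_fin// intg_lty//; exact: intg_trunc.
Qed.

(** The fundamental theorem of calculus along lines, for almost every starting point. Both sides are
    tested against a bump [phi]: the shift of [u] is moved to [phi], the result is the derivative of
    the function from [bump_antishift], and Fubini moves the shifts from [phi] to [g]. *)
Lemma pderiv_segint i u g h : LI u -> LI g -> pderiv i u g -> 0 < h -> h <= 1 ->
  {ae mu, forall x, u (h *: unitv i + x) - u x = segint h (shift2 i g) x}.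
Proof.
move=> Iu Ig ug h0 h1; have h0' := ltW h0.
have mg := LI_measurable Ig.
have seg_trunc N x : cube N%:R x -> segint h (shift2 i g) x = segint h (shift2 i (trunc g N.+1)) x.
  move=> Nx; congr fine; apply: eq_integral => t _; rewrite /seg/= indicE.
  have [th|] := boolP (t \in _); last by rewrite !mulr0.
  congr ((_ * _)%:E); rewrite /shift2/= truncE// -natr1; apply: cube_shift => //.
  by move: th; rewrite inE/= in_itv/= => /andP[t0 th]; rewrite ger0_norm// (le_trans th).
have boundG f : intg f -> forall t, 0 <= t <= h -> (L1 (fun x => shift2 i f (x, t)) <= (fine (L1 f))%:E)%E.
  move=> If t _; rewrite fineK; last by rewrite ge0_fin_numE ?L1_ge0//; exact: intg_lty.
  by rewrite -(L1_shf i t (intg_measurable If)).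
have Iseg : LI (segint h (shift2 i g)).
  apply: LI_local => N; exists (segint h (shift2 i (trunc g N.+1))); last exact: seg_trunc.
  have It := intg_trunc N.+1 Ig.
  apply: intg_segint => //; first by apply: measurable_shift2; exact: intg_measurable.
  exact: boundG.
have Ish : LI (shf i h u) by apply: LI_shf => //; rewrite gtr0_norm.
suff : {ae mu, forall x, shf i h u x - u x - segint h (shift2 i g) x = 0}.
  by apply: filterS => x /eqP; rewrite subr_eq0 => /eqP.
apply: ae0_bump; first by apply: LI_sub => //; exact: LI_sub.
move=> a b k; have [eta [seta tpsi dpsi psiE]] := bump_antishift k a b i h0.
pose psi := pf eta.
set phi := bump k a b.
have tphi : test_function phi by exact: bump_test.
have [N [C C0 [p0 dp0 pC dpC]]] := test_bound tphi.
have cphi := test_continuous tphi.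
have mphi := continuous_measurable_rV cphi.
have I1 : intg (fun x => shf i h u x * phi x) by exact: test_intg_mul Ish cphi p0.
have I2 : intg (fun x => u x * phi x) by exact: test_intg_mul Iu cphi p0.
have I3 : intg (fun x => segint h (shift2 i g) x * phi x) by exact: test_intg_mul Iseg cphi p0.
have I1' : intg (fun x => u x * phi (- h *: unitv i + x)).
  have := intg_shf i (- h) I1; rewrite /shf/=.
  apply: eq_integrable => // x _ /=; congr ((u _ * _)%:E).
  by rewrite addrA -scalerDl subrr scale0r add0r.
have E1 : (\int[mu]_x (u x * phi (- h *: unitv i + x))%:E = \int[mu]_x (shf i h u x * phi x)%:E)%E.
  have := integral_mpres (mpres_shift (- h *: unitv i : V)) (g := fun x => (shf i h u x * phi x)%:E) I1.
  move=> <-; apply: eq_integral => x _; congr ((u _ * _)%:E).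
  by rewrite addrA -scalerDl subrr scale0r add0r.
(* Since [phi] lives in [cube N] and h <= 1, only the values of [g] on [cube N.+1] occur; the
   truncation is integrable, as Fubini requires. *)
pose gN := trunc g N.+1.
have IgN : intg gN by exact: intg_trunc.
have mgN := intg_measurable IgN.
pose K (z : V * RR) := phi z.1 * shift2 i gN z.
pose J (z : V * RR) := gN z.1 * phi (- z.2 *: unitv i + z.1).
have m1 f : measurable_fun [set: V] f -> measurable_fun [set: (V * RR)%type] (fun z : V * RR => f z.1).
  by move=> mf; apply: measurableT_comp mf _; exact: measurable_fst.
have mK : measurable_fun [set: (V * RR)%type] K.
  by apply: measurable_funM; [exact: m1|exact: measurable_shift2].
have mphi2 : measurable_fun [set: (V * RR)%type] (fun z : V * RR => phi (- z.2 *: unitv i + z.1)).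
  have ms : measurable_fun [set: (V * RR)%type] (fun z : V * RR => (z.1, - z.2 : RR)).
    apply: measurable_fun_pair; first exact: measurable_fst.
    have m2 : measurable_fun [set: (V * RR)%type] (fun z : V * RR => z.2 : R) by exact: measurable_snd.
    by have := measurable_funN m2.
  exact: measurableT_comp (measurable_shift2 i mphi) ms.
have mJ : measurable_fun [set: (V * RR)%type] J by apply: measurable_funM => //; exact: m1.
have finL1 f : intg f -> L1 f \is a fin_num by move=> If; rewrite ge0_fin_numE ?L1_ge0//; exact: intg_lty.
have KB t : 0 <= t <= h -> (L1 (fun x => K (x, t)) <= (C * fine (L1 gN))%:E)%E.
  move=> th; rewrite EFinM fineK ?finL1// -(L1_shf i t mgN) -[X in (X%:E * _)%E](gtr0_norm C0) -L1Z; last exact: measurable_shf.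
  apply: le_L1_norm.
  - by apply: measurable_funM => //; exact: measurable_shf.
  - by apply: measurable_funM => //; exact: measurable_shf.
  - by move=> x; rewrite !normrM (gtr0_norm C0); apply: ler_wpM2r.
have JB t : 0 <= t <= h -> (L1 (fun x => J (x, t)) <= (C * fine (L1 gN))%:E)%E.
  move=> th; rewrite EFinM fineK ?finL1// -[X in (X%:E * _)%E](gtr0_norm C0) -L1Z//.
  apply: le_L1_norm.
  - apply: measurable_funM => //; have := measurable_shf i (- t) mphi; exact.
  - exact: measurable_funM.
  - by move=> x; rewrite !normrM (gtr0_norm C0) mulrC; apply: ler_wpM2r.
(* For each fixed t, the translation by t along the i-th axis carries [J] to [K]. *)
have JK : (\int[mu]_x (segint h J x)%:E = \int[mu]_x (segint h K x)%:E)%E.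
  rewrite (integral_segint h0' mJ JB) (integral_segint h0' mK KB).
  apply: eq_integral => t _; rewrite /seg/= indicE.
  have [th|_] := boolP (t \in _); last by under eq_integral do rewrite mulr0; under [RHS]eq_integral do rewrite mulr0.
  under eq_integral do rewrite mulr1; under [RHS]eq_integral do rewrite mulr1.
  have th' : 0 <= t <= h by move: th; rewrite inE/= in_itv.
  have iJt : intg (fun x => J (x, t)).
    apply: intgP; last by apply: le_lt_trans (JB t th') _; rewrite ltry.
    by apply: measurable_funM => //; have := measurable_shf i (- t) mphi; exact.
  have := integral_mpres (mpres_shift (t *: unitv i : V)) iJt => <-.
  apply: eq_integral => x _; rewrite /J /K /shift2/= mulrC; congr ((_ * _)%:E).
  by rewrite addrA -scalerDl addNr scale0r add0r.
have EK : (\int[mu]_x (segint h (shift2 i g) x * phi x)%:E = \int[mu]_x (segint h K x)%:E)%E.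
  have mSK : measurable_fun [set: V] (segint h K) := measurable_segint h0' mK KB.
  apply: ae_eq_integral; [exact: measurableT|exact: measurable_int I3|exact/measurable_EFinP|].
  have := segint_scale phi h0' (measurable_shift2 i mgN) (boundG _ IgN).
  apply: filterS => x -> _; congr EFin; rewrite mulrC.
  have [Nx|Nx] := pselect (cube N%:R x); last by rewrite (p0 x Nx) !mul0r.
  by rewrite (seg_trunc N).
have phiB t : 0 <= t <= h -> (L1 (fun x => phi (- (x, t).2 *: unitv i + (x, t).1)%R) <= (fine (L1 phi))%:E)%E.
  move=> _; rewrite fineK; first by rewrite -(L1_shf i (- t) mphi).
  by apply: finL1; exact: (TC_test i tphi).1.
have EJ : (\int[mu]_x (g x * psi x)%:E = \int[mu]_x (segint h J x)%:E)%E.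
  have cpsi := test_continuous tpsi; have mpsi := continuous_measurable_rV cpsi.
  have mSJ : measurable_fun [set: V] (segint h J) := measurable_segint h0' mJ JB.
  have mgp : measurable_fun [set: V] (fun x => g x * psi x) by exact: measurable_funM.
  apply: ae_eq_integral; [exact: measurableT|exact/measurable_EFinP|exact/measurable_EFinP|].
  have := segint_scale gN h0' mphi2 phiB.
  apply: filterS => x JE _; rewrite JE; congr EFin.
  have psx : psi x = segint h (fun z => phi (- z.2 *: unitv i + z.1)) x by rewrite /segint -psiE.
  rewrite psx; have [Nx|Nx] := pselect (cube N.+1%:R x); first by rewrite /gN truncE.
  suff -> : segint h (fun z => phi (- z.2 *: unitv i + z.1)) x = 0 by rewrite !mulr0.
  clear E1 JK EK; rewrite /segint (_ : (\int[_]_t _ = 0)%E)//; apply: integral0_eq => t _.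
  rewrite /seg/= indicE; have [th|_] := boolP (t \in _); last by rewrite mulr0.
  rewrite p0 ?mul0r// => H; apply: Nx; rewrite -natr1.
  rewrite -[x](addKr (- t *: unitv i)) -scaleNr opprK; apply: cube_shift => //.
  by move: th; rewrite inE/= in_itv/= => /andP[t0 th]; rewrite ger0_norm// (le_trans th).
have := ug _ seta tpsi; rewrite -/psi.
rewrite /Rintegral EJ JK -EK.
under eq_integral do rewrite dpsi mulrBr EFinB.
rewrite (integralB measurableT I2 I1') E1.
have e1 : (\int[mu]_x (shf i h u x * phi x)%:E)%E \is a fin_num by exact: integrable_fin_num I1.
have e2 : (\int[mu]_x (u x * phi x)%:E)%E \is a fin_num by exact: integrable_fin_num I2.
have e3 : (\int[mu]_x (segint h (shift2 i g) x * phi x)%:E)%E \is a fin_num by exact: integrable_fin_num I3.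
rewrite fineB// => H.
under eq_integral do rewrite mulrBl mulrBl !EFinB.
have I12 := integrableB measurableT I1 I2.
rewrite (integralB measurableT I12 I3) (integralB measurableT I1 I2).
pose A := fine (\int[mu]_x (shf i h u x * phi x)%:E)%E.
pose B := fine (\int[mu]_x (u x * phi x)%:E)%E.
pose S := fine (\int[mu]_x (segint h (shift2 i g) x * phi x)%:E)%E.
have H' : B - A = - S := H.
rewrite -(fineK e1) -(fineK e2) -(fineK e3) -!EFinB.
by change ((A - B - S)%:E = 0%E); congr EFin; lra.
Qed.

(* Equivalent to wderiv, but visibly stable under u |-> |u|, reflection, and gluing
   along a hyperplane. *)
Definition diffq i u g : Prop := forall (N : nat) (e : R), 0 < e ->
  exists2 D : R, 0 < D & forall h, h != 0 -> `|h| < D ->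
    (\int[mu]_(x in cube N%:R) `|(shf i h u x - u x) / h - g x|%R%:E <= e%:E)%E.

Lemma integral_cube_le f g (N : nat) : measurable_fun [set: V] f -> measurable_fun [set: V] g ->
  {ae mu, forall x, cube N%:R x -> f x = g x} ->
  (\int[mu]_(x in cube N%:R) `|f x|%:E <= L1 g)%E.
Proof.
move=> mf mg fg; have mN := @measurable_cube R n N%:R.
rewrite (_ : (\int[mu]_(x in cube N%:R) `|f x|%:E = \int[mu]_(x in cube N%:R) `|g x|%:E)%E).
  by apply: ge0_subset_integral => //; exact: measurable_EFin_norm.
apply: ae_eq_integral => //.
- by apply: measurable_funTS; exact: measurable_EFin_norm.
- by apply: measurable_funTS; exact: measurable_EFin_norm.
- by apply: filterS fg => x H /H ->.
Qed.

(** By [pderiv_segint] a quotient with positive step is an average of [g] over a segment, which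
    tends to [g] in L^1. Negative steps are then reduced to positive ones. *)
Lemma pderiv_diffq i u g : LI u -> LI g -> pderiv i u g -> diffq i u g.
Proof.
move=> Iu Ig ug.
have mu_ := LI_measurable Iu; have mg := LI_measurable Ig.
have pos (N : nat) (e : R) : 0 < e -> exists2 D : R, 0 < D & forall h, 0 < h -> h < D ->
    (\int[mu]_(x in cube N%:R) `|(shf i h u x - u x) / h - g x|%R%:E <= e%:E)%E.
  move=> e0; have IgN := intg_trunc N.+1 Ig; have mgN := intg_measurable IgN.
  have [D D0 HD] := segint_shift_approx i IgN e0.
  exists (Num.min D 1) => [|h h0]; first by rewrite lt_min D0/=.
  rewrite lt_min => /andP[hD h1].
  have := HD h; rewrite h0 hD => /(_ isT); apply: le_trans.
  have bG t : 0 <= t <= h -> (L1 (fun x => shift2 i (trunc g N.+1) (x, t)) <= (fine (L1 (trunc g N.+1)))%:E)%E.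
    move=> _; rewrite fineK; last by rewrite ge0_fin_numE ?L1_ge0//; exact: intg_lty.
    by rewrite -(L1_shf i t mgN).
  apply: integral_cube_le.
  - apply: measurable_funB => //; apply: measurable_funM => //.
    by apply: measurable_funB => //; exact: measurable_shf.
  - have mS : measurable_fun [set: V] (segint h (shift2 i (trunc g N.+1))) :=
      measurable_segint (ltW h0) (measurable_shift2 i mgN) bG.
    by apply: measurable_funB => //; apply: measurable_funM.
  have := pderiv_segint Iu Ig ug h0 (ltW h1).
  apply: filterS => x; rewrite /shf => -> Nx.
  rewrite truncE; last by apply: cube_sub Nx; rewrite ler_nat.
  congr (_ / h - _); congr fine; apply: eq_integral => t _; rewrite /seg/= indicE.
  have [th|] := boolP (t \in _); last by rewrite !mulr0.
  congr ((_ * _)%:E); rewrite /shift2/= truncE// -natr1; apply: cube_shift => //.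
  by move: th; rewrite inE/= in_itv/= => /andP[t0 th]; rewrite ger0_norm// (le_trans th)// ltW.
(* A quotient with step -k is the one with step k read at a translated point. This costs half of [e]
   for the positive step and half for translating [g], and enlarges the cube by one. *)
move=> N e e0; have e2 : 0 < e / 2 by rewrite divr_gt0.
have [D D0 HD] := pos N.+1 _ e2.
have IgN := intg_trunc N.+2 Ig; have mgN := intg_measurable IgN.
have [_ /(_ _ e2)[D' D'0 HD']] := TC_intg i IgN.
have [D1 D10 HD1] := pos N _ e0.
exists (Num.min D1 (Num.min 1 (Num.min D D'))); first by rewrite !lt_min ltr01 D0 D'0 D10.
move=> h hn0; rewrite !lt_min => /and4P[hD1 h1 hD hD'].
have [h0|h0] := ltP 0 h; first by apply: HD1 => //; rewrite -(gtr0_norm h0).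
have k0 : 0 < - h by rewrite oppr_gt0 lt_neqAle hn0.
set k := - h in k0; have hk : h = - k by rewrite opprK.
have kh : `|h| = k by rewrite hk normrN gtr0_norm.
pose q x := (shf i k u x - u x) / k.
have mq : measurable_fun [set: V] q.
  by apply: measurable_funM => //; apply: measurable_funB => //; exact: measurable_shf.
have qE x : (shf i h u x - u x) / h = q (h *: unitv i + x).
  rewrite /q /shf hk addrA -scalerDl subrr scale0r add0r invrN mulrN -mulNr opprB.
  by [].
pose F x := (trunc q N.+1 x - trunc g N.+1 x) + (trunc g N.+1 x - shf i k (trunc g N.+2) x) * \1_(cube N.+1%:R) x.
have mF1 : measurable_fun [set: V] (fun x => trunc q N.+1 x - trunc g N.+1 x).
  by apply: measurable_funB; apply: measurable_funM => //; apply: measurable_indic; exact: measurable_cube.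
have mF2 : measurable_fun [set: V] (fun x => (trunc g N.+1 x - shf i k (trunc g N.+2) x) * \1_(cube N.+1%:R) x).
  apply: measurable_funM; last by apply: measurable_indic; exact: measurable_cube.
  apply: measurable_funB; last exact: measurable_shf.
  by apply: measurable_funM => //; apply: measurable_indic; exact: measurable_cube.
have mF : measurable_fun [set: V] F by exact: measurable_funD.
apply: (@le_trans _ _ (L1 (shf i h F))).
  apply: integral_cube_le.
  - apply: measurable_funB => //; apply: measurable_funM => //.
    by apply: measurable_funB => //; exact: measurable_shf.
  - exact: measurable_shf.
  apply: aeW => x Nx; rewrite qE /shf /F.
  have Nhx : cube N.+1%:R (h *: unitv i + x) by rewrite -natr1; apply: cube_shift => //; rewrite ltW.
  rewrite !truncE//.
  rewrite /shf addrA -scalerDl [k + h](_ : _ = 0) ?scale0r ?add0r; last by rewrite hk subrr.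
  rewrite truncE; last by apply: cube_sub Nx; rewrite ler_nat -addn2 leq_addr.
  by rewrite indicE mem_set// mulr1 addrA subrK.
rewrite L1_shf//; apply: (@le_trans _ _ ((e/2)%:E + (e/2)%:E)%E); last by rewrite -EFinD lee_fin; lra.
apply: (le_trans (L1D mF1 mF2)); apply: leeD.
  have := HD k k0; rewrite -kh => /(_ hD); apply: le_trans.
  rewrite [leRHS]integral_mkcond epatch_indic.
  apply: ge0_le_integral => //.
  - exact: measurable_EFin_norm.
  - apply: emeasurable_funM.
      apply: measurable_EFin_norm; apply: measurable_funB => //; apply: measurable_funM => //.
      by apply: measurable_funB => //; exact: measurable_shf.
    by apply/measurable_EFinP; apply: measurable_indic; exact: measurable_cube.
  - move=> x _; rewrite /= -EFinM lee_fin /trunc -mulrBl normrM indicE kh.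
    by case: (x \in _); rewrite ?normr1// normr0.
have := HD' k; rewrite -{1}kh normr_id => /(_ hD'); apply: le_trans.
apply: le_L1_norm => //.
  by apply: measurable_funB => //; exact: measurable_shf.
move=> x; rewrite indicE; have [Nx|Nx] := pselect (cube N.+1%:R x).
  rewrite mem_set// mulr1 distrC truncE// truncE//.
  by apply: cube_sub Nx; rewrite ler_nat.
by rewrite memNset// mulr0 normr0.
Qed.

End weak_derivative.

(** * Passing between weak derivatives and difference quotients *)

Section weak_calculus.
Context {R : realType} {n : nat}.
Local Notation V := 'rV[R]_n.
Local Notation mu := (@lebesgue_rV R n).
Implicit Types (f g u v w phi : V -> R) (i : 'I_n) (h : R).

Lemma dominated_mul (w : V -> R) (psi : nat -> V -> R) (l : V -> R) (C : R) (N : nat) :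
  LI w -> (forall k, measurable_fun [set: V] (psi k)) -> measurable_fun [set: V] l ->
  (forall k x, `|psi k x| <= C * \1_(cube N%:R) x) ->
  {ae mu, forall x, psi k x @[k --> \oo] --> l x} ->
  (\int[mu]_x (w x * psi k x)%:E)%E @[k --> \oo] --> (\int[mu]_x (w x * l x)%:E)%E.
Proof.
move=> Iw mpsi ml bnd cv; have mw := LI_measurable Iw.
have [|||||_ _] := @dominated_convergence _ V R mu setT measurableT
  (fun k x => (w x * psi k x)%:E) (fun x => (w x * l x)%:E) (fun x => (C * `|trunc w N x|)%:E).
- by move=> k; apply/measurable_EFinP/measurable_funM.
- by apply/measurable_EFinP/measurable_funM.
- apply: filterS cv => x cv _; apply: cvg_EFin; first exact: nearW.
  by apply: cvgM; [exact: cvg_cst|exact: cv].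
- have := integrableZl measurableT C (integrable_norm (intg_trunc N Iw)).
  by apply: eq_integrable => // x _; rewrite /= EFinM.
- apply: aeW => x k _; rewrite lee_fin normrM /trunc normrM (ger0_norm (_ : 0 <= \1_(cube N%:R) x))//.
  by rewrite mulrCA; apply: ler_wpM2l.
by [].
Qed.

Definition qtest i phi h : V -> R := fun x => (phi x - phi (- h *: unitv i + x)) / h.

Lemma qtest_bound i phi : test_function phi -> exists N : nat, exists2 C, 0 < C &
  forall h, `|h| <= 1 -> forall x, `|qtest i phi h x| <= C * \1_(cube N%:R) x.
Proof.
move=> tphi; have [N [C C0 [p0 dp0 pC dpC]]] := test_bound tphi.
exists N.+1, C => // h h1 x; have [->|hn0] := eqVneq h 0.
  by rewrite /qtest invr0 mulr0 normr0 mulr_ge0// ltW.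
rewrite indicE; have [Nx|Nx] := pselect (cube N.+1%:R x).
  rewrite mem_set// mulr1 /qtest normrM normfV ler_pdivrMr ?normr_gt0//.
  by rewrite distrC -(normrN h); apply: test_lipschitz.
rewrite memNset// mulr0 /qtest !p0 ?subrr ?mul0r ?normr0//.
  move=> H; apply: Nx; rewrite -natr1 -[x](addKr (- h *: unitv i)) -scaleNr opprK.
  exact: cube_shift.
by move=> H; apply: Nx; apply: cube_sub H; rewrite ler_nat.
Qed.

Lemma measurable_qtest i phi h : test_function phi -> measurable_fun [set: V] (qtest i phi h).
Proof.
move=> tphi; have mphi := continuous_measurable_rV (test_continuous tphi).
apply: measurable_funM => //; apply: measurable_funB => //.
by have := measurable_shf i (- h) mphi.
Qed.

Lemma qtest_cvg i phi (h : nat -> R) x : test_function phi ->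
  h @ \oo --> 0 -> (forall k, h k != 0) -> qtest i phi (h k) x @[k --> \oo] --> partial i phi x.
Proof.
move=> tphi h0 hn0.
have hN : (- h k) @[k --> \oo] --> (0 : R) by rewrite -oppr0; exact: cvgN.
have hd : (fun k => - h k) @ \oo --> (0 : R)^'.
  move=> A [e /= e0 HA]; have /cvgrPdist_lt/(_ e e0) := hN.
  by apply: filterS => k /= He; apply: HA => //; rewrite oppr_eq0.
have := @cvg_comp _ _ _ (fun k => - h k) (fun h : R => h^-1 * (phi (h *: unitv i + x) - phi x)) _ _ _ hd (@test_quotient_cvg _ _ phi i x tphi).
apply: cvg_trans; apply: near_eq_cvg; apply: nearW => k /=.
by rewrite /qtest invrN mulNr -mulrN opprB mulrC.
Qed.

(** Discrete integration by parts: [qtest] is the adjoint quotient, which falls on the smooth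
    factor. *)
Lemma integral_dq i w phi h : LI w -> test_function phi -> `|h| <= 1 ->
  (\int[mu]_x ((shf i h w x - w x) / h * phi x)%:E =
   - \int[mu]_x (w x * qtest i phi h x)%:E)%E.
Proof.
move=> Iw tphi h1; have cphi := test_continuous tphi.
have [N [C C0 [p0 _ _ _]]] := test_bound tphi.
have Ish : LI (shf i h w) by exact: LI_shf.
have I1 : intg (fun x => shf i h w x * phi x) by exact: (test_intg_mul Ish cphi p0).
have I2 : intg (fun x => w x * phi x) by exact: (test_intg_mul Iw cphi p0).
have shK (x : V) : h *: unitv i + (- h *: unitv i + x) = x.
  by rewrite addrA -scalerDl subrr scale0r add0r.
have I1' : intg (fun x => w x * phi (- h *: unitv i + x)).
  have := intg_shf i (- h) I1; rewrite /shf/=.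
  by apply: eq_integrable => // x _ /=; rewrite shK.
have E1 : (\int[mu]_x (w x * phi (- h *: unitv i + x))%:E = \int[mu]_x (shf i h w x * phi x)%:E)%E.
  have := integral_mpres (mpres_shift (- h *: unitv i : V)) (g := fun x => (shf i h w x * phi x)%:E) I1.
  by move=> <-; apply: eq_integral => x _; rewrite /shf shK.
rewrite (_ : (fun x => _) = (fun x => (h^-1)%:E * ((shf i h w x * phi x)%:E - (w x * phi x)%:E))%E); last first.
  by apply/funext => x; rewrite -EFinB -EFinM; congr EFin; ring.
rewrite (_ : (fun x => (w x * qtest i phi h x)%:E) = (fun x => (h^-1)%:E * ((w x * phi x)%:E - (w x * phi (- h *: unitv i + x))%:E))%E); last first.
  by apply/funext => x; rewrite -EFinB -EFinM; congr EFin; rewrite /qtest; ring.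
have I3 := integrableB measurableT I1 I2; have I4 := integrableB measurableT I2 I1'.
rewrite (integralZl measurableT I3) (integralZl measurableT I4).
rewrite (integralB measurableT I1 I2) (integralB measurableT I2 I1').
rewrite -muleN; congr (_ * _)%E.
have f1 := integrable_fin_num measurableT I1; have f2 := integrable_fin_num measurableT I2.
have f3 := integrable_fin_num measurableT I1'.
have -> : (\int[mu]_x (EFin \o (fun x => (w x * phi (- h *: unitv i + x))%R)) x = \int[mu]_x (EFin \o (fun x => (shf i h w x * phi x)%R)) x)%E by exact: E1.
rewrite -(fineK f1) -(fineK f2) -!EFinB -EFinN; congr EFin; ring.
Qed.

(* A sequence of steps of sign (-1)^b: centered differences are needed for |u|. *)
Definition hseq (b : bool) (k : nat) : R := (-1) ^+ b * k.+1%:R^-1.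

Lemma hseq_neq0 b k : hseq b k != 0.
Proof. by rewrite /hseq mulf_neq0 ?signr_eq0// invr_eq0. Qed.

Lemma hseq_norm b k : `|hseq b k| = k.+1%:R^-1.
Proof. by rewrite /hseq normrM normr_sign mul1r ger0_norm. Qed.

Lemma hseq_le1 b k : `|hseq b k| <= 1.
Proof. by rewrite hseq_norm invf_le1// ler1n. Qed.

Lemma hseq_cvg b : hseq b @ \oo --> 0.
Proof.
rewrite -(mulr0 ((-1) ^+ b)); apply: cvgM; first exact: cvg_cst.
exact: cvg_harmonic.
Qed.

Lemma dq_test i w phi b : LI w -> test_function phi ->
  (\int[mu]_x ((shf i (hseq b k) w x - w x) / hseq b k * phi x)%:E)%E @[k --> \oo] -->
  (- \int[mu]_x (w x * partial i phi x)%:E)%E.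
Proof.
move=> Iw tphi; have [N [C C0 bnd]] := qtest_bound i tphi.
under eq_fun do rewrite integral_dq ?hseq_le1//.
apply: cvgeN; apply: (@dominated_mul _ _ _ C N) => //.
- by move=> k; exact: measurable_qtest.
- by apply: continuous_measurable_rV; exact: test_partial_continuous.
- by move=> k x; apply: bnd; exact: hseq_le1.
- by apply: aeW => x; apply: qtest_cvg => //; [exact: hseq_cvg|exact: hseq_neq0].
Qed.

Lemma partial_intg i w phi : LI w -> test_function phi -> intg (fun x => w x * partial i phi x).
Proof.
move=> Iw tphi; have [N [C C0 [_ dp0 _ _]]] := test_bound tphi.
exact: (test_intg_mul Iw (test_partial_continuous tphi) (dp0 i)).
Qed.

Lemma test_intg w phi : LI w -> test_function phi -> intg (fun x => w x * phi x).
Proof.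
move=> Iw tphi; have [N [C C0 [p0 _ _ _]]] := test_bound tphi.
exact: (test_intg_mul Iw (test_continuous tphi) p0).
Qed.

Lemma wderivE i u g : LI u -> LI g -> wderiv i u g <-> forall phi, test_function phi ->
  ((- (\int[mu]_x (u x * partial i phi x)%:E)) = \int[mu]_x (g x * phi x)%:E)%E.
Proof.
move=> Iu Ig; split=> H phi tphi; have := H _ tphi;
  have e1 := integrable_fin_num measurableT (partial_intg i Iu tphi);
  have e2 := integrable_fin_num measurableT (test_intg Ig tphi).
- rewrite /Rintegral -(fineK e1) -(fineK e2)/= => ->.
  by rewrite opprK.
- rewrite /Rintegral -(fineK e1) -(fineK e2) -EFinN => -[<-]/=.
  by rewrite opprK.
Qed.

Lemma ecvg_unique (f : nat -> \bar R) (a b : \bar R) : f @ \oo --> a -> f @ \oo --> b -> a = b.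
Proof. by move=> fa fb; rewrite -(cvg_lim (@ereal_hausdorff R) fa) -(cvg_lim (@ereal_hausdorff R) fb). Qed.

(** Tested difference quotients always converge, to the distributional derivative ([dq_test]). It is
    therefore enough to identify their limit along one sequence of steps. *)
Lemma dq_cvg_wderiv i u g (b : bool) : LI u -> LI g ->
  (forall phi, test_function phi ->
  (\int[mu]_x ((shf i (hseq b k) u x - u x) / hseq b k * phi x)%:E)%E @[k --> \oo] -->
  (\int[mu]_x (g x * phi x)%:E)%E) -> wderiv i u g.
Proof.
move=> Iu Ig H; apply/wderivE => // phi tphi.
exact: (ecvg_unique (dq_test (i := i) b Iu tphi) (H _ tphi)).
Qed.

Lemma ecvg0 (u : nat -> \bar R) : (forall k, 0 <= u k)%E ->
  (forall e : R, 0 < e -> \forall k \near \oo, (u k <= e%:E)%E) -> u @ \oo --> 0%E.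
Proof.
move=> u0 H A /= [e /= e0 He]; have e2 : 0 < e / 2 by rewrite divr_gt0.
apply: filterS (H _ e2) => k; have := u0 k; case uk : (u k) => [r||]//.
rewrite !lee_fin => r0 re; rewrite /= uk; apply: He; rewrite /= sub0r normrN ger0_norm//.
by rewrite (le_lt_trans re)// ltr_pdivrMr// ltr_pMr// ltr1n.
Qed.

Lemma diffq_seq i u g b (N : nat) : diffq i u g ->
  (\int[mu]_(x in cube N%:R) `|(shf i (hseq b k) u x - u x) / hseq b k - g x|%R%:E)%E @[k --> \oo] --> 0%E.
Proof.
move=> H; apply: ecvg0 => [k|e e0]; first by apply: integral_ge0 => x _; rewrite lee_fin.
have [D D0 HD] := H N e e0; have /cvgrPdist_lt/(_ _ D0) := @cvg_harmonic R.
have hk k : 0 <= @harmonic R k by rewrite /harmonic invr_ge0.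
apply: filterS => k; rewrite sub0r normrN ger0_norm// => kD; apply: HD; first exact: hseq_neq0.
by rewrite hseq_norm.
Qed.

Lemma eq_L1 (f g : V -> R) : f =1 g -> L1 f = L1 g.
Proof. by move=> /funext ->. Qed.

Lemma int_perturb (F G : nat -> V -> R) (L : \bar R) : (forall k, intg (F k)) ->
  (forall k, intg (G k)) -> L \is a fin_num ->
  (\int[mu]_x (G k x)%:E)%E @[k --> \oo] --> L ->
  L1 (fun x => F k x - G k x)%R @[k --> \oo] --> 0%E ->
  (\int[mu]_x (F k x)%:E)%E @[k --> \oo] --> L.
Proof.
move=> IF IG Lfin GL FG.
have IFG k : intg (fun x => F k x - G k x).
  by have := integrableB measurableT (IF k) (IG k); exact: eq_integrable.
rewrite -[L]add0e.
rewrite (_ : (fun k => _) = (fun k => \int[mu]_x (F k x - G k x)%R%:E + \int[mu]_x (G k x)%:E)%E); last first.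
  apply/funext => k; rewrite -(integralD measurableT (IFG k) (IG k)).
  by apply: eq_integral => x _; rewrite /= -EFinD subrK.
apply: cvgeD; [by rewrite fin_num_adde_defl| |exact: GL].
apply/cvg_abse0P; apply: (squeeze_cvge _ (cvg_cst _) FG).
apply: nearW => k; rewrite abse_ge0/=.
exact: (le_abse_integral _ _ (measurable_int _ (IFG k))).
Qed.

Lemma measurable_dq i u h : measurable_fun [set: V] u ->
  measurable_fun [set: V] (fun x => (shf i h u x - u x) / h).
Proof.
move=> mu_; apply: measurable_funM => //; apply: measurable_funB => //.
exact: measurable_shf.
Qed.

Lemma LI_dq i u h : `|h| <= 1 -> LI u -> LI (fun x => (shf i h u x - u x) / h).
Proof.
move=> h1 Iu; rewrite (_ : (fun x => _) = (fun x => h^-1 * (shf i h u x - u x))).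
  by apply: LI_scale; apply: LI_sub => //; exact: LI_shf.
by apply/funext => x; rewrite mulrC.
Qed.

Lemma L1_mul_le (f c : V -> R) (C : R) (N : nat) : measurable_fun [set: V] f ->
  measurable_fun [set: V] c -> (forall x, `|c x| <= C * \1_(cube N%:R) x) -> 0 <= C ->
  (L1 (fun x => f x * c x)%R <= C%:E * \int[mu]_(x in cube N%:R) `|f x|%:E)%E.
Proof.
move=> mf mc bnd C0; have mN := @measurable_cube R n N%:R.
have m1 : measurable_fun [set: V] (\1_(cube N%:R) : V -> R) by exact: measurable_indic.
rewrite [X in (_ * X)%E]integral_mkcond epatch_indic -ge0_integralZl//; last first.
- by move=> x _; rewrite mule_ge0// lee_fin.
- by apply: emeasurable_funM; [exact: measurable_EFin_norm|exact/measurable_EFinP].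
apply: ge0_le_integral => //.
- by apply: measurable_EFin_norm; exact: measurable_funM.
- apply: emeasurable_funM => //; apply: emeasurable_funM; [exact: measurable_EFin_norm|exact/measurable_EFinP].
- move=> x _; rewrite /= -!EFinM lee_fin normrM mulrCA; exact: ler_wpM2l.
Qed.

Lemma diffq_int i u g (c : V -> R) (b : bool) (C : R) (N : nat) : LI u -> LI g -> diffq i u g ->
  measurable_fun [set: V] c -> (forall x, `|c x| <= C * \1_(cube N%:R) x) -> 0 <= C ->
  (\int[mu]_x ((shf i (hseq b k) u x - u x) / hseq b k * c x)%:E)%E @[k --> \oo] -->
  (\int[mu]_x (g x * c x)%:E)%E.
Proof.
move=> Iu Ig ug mc bnd C0.
have mu_ := LI_measurable Iu; have mg := LI_measurable Ig.
have Imul f : LI f -> intg (fun x => f x * c x).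
  move=> If; have mf := LI_measurable If; apply: intgP; first exact: measurable_funM.
  apply: (le_lt_trans (L1_mul_le mf mc bnd C0)); apply: lte_mul_pinfty; rewrite ?lee_fin//.
  by have /integrableP[] := If N.
apply: (@int_perturb _ (fun k x => g x * c x)).
- by move=> k; apply: Imul; apply: LI_dq => //; exact: hseq_le1.
- by move=> k; exact: Imul.
- exact: integrable_fin_num (Imul _ Ig).
- exact: cvg_cst.
have H := diffq_seq b N ug.
apply: (@squeeze_cvge _ _ _ _ (cst 0%E) _ (fun k => C%:E * \int[mu]_(x in cube N%:R) `|(shf i (hseq b k) u x - u x) / hseq b k - g x|%R%:E)%E).
- apply: nearW => k; rewrite L1_ge0/=.
  under [L1 _]eq_L1 do rewrite -mulrBl.
  apply: L1_mul_le => //; apply: measurable_funB => //; exact: measurable_dq.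
- exact: cvg_cst.
- by rewrite -(mule0 C%:E); apply: cvgeZl.
Qed.

Lemma test_bound_indic phi : test_function phi -> exists N : nat, exists2 C, 0 < C &
  forall x, `|phi x| <= C * \1_(cube N%:R) x.
Proof.
move=> tphi; have [N [C C0 [p0 _ pC _]]] := test_bound tphi; exists N, C => // x.
rewrite indicE; have [Nx|Nx] := pselect (cube N%:R x); first by rewrite mem_set// mulr1.
by rewrite memNset// mulr0 p0// normr0.
Qed.

Lemma diffq_wderiv i u g : LI u -> LI g -> diffq i u g -> wderiv i u g.
Proof.
move=> Iu Ig ug; apply: (@dq_cvg_wderiv _ _ _ false) => // phi tphi.
have [N [C C0 bnd]] := test_bound_indic tphi.
apply: (@diffq_int _ _ _ _ _ C N) => //; last exact: ltW.
by apply: continuous_measurable_rV; exact: test_continuous.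
Qed.

Lemma wderiv_diffq i u g : LI u -> LI g -> wderiv i u g -> diffq i u g.
Proof. by move=> Iu Ig /wderiv_pderiv; exact: pderiv_diffq. Qed.

Lemma wderiv_unique i u g g' : LI u -> LI g -> LI g' -> wderiv i u g -> wderiv i u g' ->
  {ae mu, forall x, g x = g' x}.
Proof.
move=> Iu Ig Ig' ug ug'.
suff : {ae mu, forall x, g x - g' x = 0}.
  by apply: filterS => x /eqP; rewrite subr_eq0 => /eqP.
apply: ae0_bump => [|a b k]; first exact: LI_sub.
have tb := bump_test k a b.
have I1 := test_intg Ig tb; have I2 := test_intg Ig' tb.
under eq_integral do rewrite mulrBl EFinB.
rewrite (integralB measurableT I1 I2).
have := (wderivE i Iu Ig).1 ug _ tb; have := (wderivE i Iu Ig').1 ug' _ tb => -> ->.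
by rewrite subee//; exact: integrable_fin_num I1.
Qed.

Lemma wderiv_ae i u u' g g' : LI u -> LI g -> LI u' -> LI g' ->
  {ae mu, forall x, u x = u' x} -> {ae mu, forall x, g x = g' x} ->
  wderiv i u g -> wderiv i u' g'.
Proof.
move=> Iu Ig Iu' Ig' uu' gg' /(wderivE i Iu Ig) H; apply/wderivE => // phi tphi.
have := H _ tphi.
have -> : (\int[mu]_x (u x * partial i phi x)%:E = \int[mu]_x (u' x * partial i phi x)%:E)%E.
  apply: ae_eq_integral => //; [exact: measurable_int (partial_intg i Iu tphi)|exact: measurable_int (partial_intg i Iu' tphi)|].
  by apply: filterS uu' => x -> _.
have -> // : (\int[mu]_x (g x * phi x)%:E = \int[mu]_x (g' x * phi x)%:E)%E.
apply: ae_eq_integral => //; [exact: measurable_int (test_intg Ig tphi)|exact: measurable_int (test_intg Ig' tphi)|].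
by apply: filterS gg' => x -> _.
Qed.

Lemma wderiv_lin i u v g g' (a b : R) : LI u -> LI v -> LI g -> LI g' ->
  wderiv i u g -> wderiv i v g' ->
  wderiv i (fun x => a * u x + b * v x) (fun x => a * g x + b * g' x).
Proof.
move=> Iu Iv Ig Ig' /(wderivE i Iu Ig) H /(wderivE i Iv Ig') H'.
have lin f f' c : intg (fun x => f x * c x) -> intg (fun x => f' x * c x) ->
    (\int[mu]_x ((a * f x + b * f' x) * c x)%:E =
     a%:E * (\int[mu]_x (f x * c x)%:E) + b%:E * (\int[mu]_x (f' x * c x)%:E))%E.
  move=> I1 I2; rewrite -(integralZl measurableT I1) -(integralZl measurableT I2) -integralD//.
  - by apply: eq_integral => x _; rewrite -!EFinM -EFinD mulrDl !mulrA.
  - exact: integrableZl.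
  - exact: integrableZl.
apply/wderivE; [by apply: LI_add; exact: LI_scale|by apply: LI_add; exact: LI_scale|].
move=> phi tphi; have p1 := partial_intg i Iu tphi; have p2 := partial_intg i Iv tphi.
rewrite (lin _ _ _ p1 p2) (lin _ _ _ (test_intg Ig tphi) (test_intg Ig' tphi)).
rewrite -(H _ tphi) -(H' _ tphi).
have f1 : (\int[mu]_x (u x * partial i phi x)%:E)%E \is a fin_num := integrable_fin_num measurableT p1.
have f2 : (\int[mu]_x (v x * partial i phi x)%:E)%E \is a fin_num := integrable_fin_num measurableT p2.
by rewrite -(fineK f1) -(fineK f2) -!EFinM -EFinD; congr EFin; ring.
Qed.

End weak_calculus.

(** * Absolute values and vanishing sets *)

Section weak_derivatives.
Context {R : realType} {n : nat}.
Local Notation V := 'rV[R]_n.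
Local Notation mu := (@lebesgue_rV R n).
Implicit Types (f g u v w phi : V -> R) (i : 'I_n) (h : R).

Lemma RintE f : intg f -> (\int[mu]_x (f x)%:E)%E = (\int[mu]_x f x)%:E.
Proof. by move=> If; rewrite /Rintegral fineK//; exact: (integrable_fin_num measurableT If). Qed.

Lemma Rint_lin (a b : R) f g : intg f -> intg g ->
  \int[mu]_x (a * f x + b * g x) = a * (\int[mu]_x f x) + b * (\int[mu]_x g x).
Proof.
move=> If Ig.
have I1 : intg (fun x => a * f x) by have := integrableZl measurableT a If; exact: eq_integrable.
have I2 : intg (fun x => b * g x) by have := integrableZl measurableT b Ig; exact: eq_integrable.
by rewrite (RintegralD measurableT I1 I2) (RintegralZl _ measurableT If) (RintegralZl _ measurableT Ig).
Qed.

Lemma dq_testR i w phi b : LI w -> test_function phi ->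
  \int[mu]_x ((shf i (hseq b k) w x - w x) / hseq b k * phi x) @[k --> \oo] -->
  - \int[mu]_x (w x * partial i phi x).
Proof.
move=> Iw tphi; have := dq_test (i := i) b Iw tphi.
by rewrite (RintE (partial_intg i Iw tphi)) -EFinN => /fine_cvg.
Qed.

Lemma dominated_mulR (w : V -> R) (psi : nat -> V -> R) (l : V -> R) (C : R) (N : nat) :
  LI w -> (forall k, measurable_fun [set: V] (psi k)) -> measurable_fun [set: V] l ->
  (forall k x, `|psi k x| <= C * \1_(cube N%:R) x) ->
  (forall x, psi k x @[k --> \oo] --> l x) -> intg (fun x => w x * l x) ->
  \int[mu]_x (w x * psi k x) @[k --> \oo] --> \int[mu]_x (w x * l x).
Proof.
move=> Iw mpsi ml bnd cv Il; have := dominated_mul Iw mpsi ml bnd (aeW _ cv).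
by rewrite (RintE Il) => /fine_cvg.
Qed.

Lemma dominated_intgR (F : nat -> V -> R) f (G : V -> R) :
  (forall k, measurable_fun [set: V] (F k)) -> measurable_fun [set: V] f -> intg G ->
  (forall x, F k x @[k --> \oo] --> f x) -> (forall k x, `|F k x| <= G x) ->
  \int[mu]_x F k x @[k --> \oo] --> \int[mu]_x f x.
Proof.
move=> mF mf IG cv dom.
have [|||||If _] := @dominated_convergence _ V R mu setT measurableT
  (fun k x => (F k x)%:E) (fun x => (f x)%:E) (fun x => (G x)%:E).
- by move=> k; apply/measurable_EFinP.
- exact/measurable_EFinP.
- by apply: aeW => x _; apply: cvg_EFin; [exact: nearW|exact: cv].
- exact: IG.
- by apply: aeW => x k _; rewrite lee_fin.
by rewrite (RintE If) => /fine_cvg.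
Qed.

Lemma LI_mulb (c : V -> R) f : LI f -> measurable_fun [set: V] c -> (forall x, `|c x| <= 1) ->
  LI (fun x => c x * f x).
Proof.
move=> If mc c1 N; have mf := LI_measurable If; have mN := @measurable_cube R n N%:R.
apply: le_integrable (If N) => //.
  by apply/measurable_EFinP; apply: (measurable_funS measurableT) => //; exact: measurable_funM.
by move=> x _; rewrite /= lee_fin normrM ler_piMl.
Qed.

Lemma LI_mul_intg f (c : V -> R) (C : R) (N : nat) : LI f -> measurable_fun [set: V] c ->
  (forall x, `|c x| <= C * \1_(cube N%:R) x) -> 0 <= C -> intg (fun x => f x * c x).
Proof.
move=> If mc bnd C0; have mf := LI_measurable If; apply: intgP; first exact: measurable_funM.
apply: (le_lt_trans (L1_mul_le mf mc bnd C0)); apply: lte_mul_pinfty; rewrite ?lee_fin//.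
by have /integrableP[] := If N.
Qed.

Lemma diffq_intR i u g (c : V -> R) (b : bool) (C : R) (N : nat) : LI u -> LI g -> diffq i u g ->
  measurable_fun [set: V] c -> (forall x, `|c x| <= C * \1_(cube N%:R) x) -> 0 <= C ->
  \int[mu]_x ((shf i (hseq b k) u x - u x) / hseq b k * c x) @[k --> \oo] -->
  \int[mu]_x (g x * c x).
Proof.
move=> Iu Ig ug mc bnd C0; have := @diffq_int _ _ i u g c b C N Iu Ig ug mc bnd C0.
by rewrite (RintE (LI_mul_intg Ig mc bnd C0)) => /fine_cvg.
Qed.

Lemma int_perturbR (F G : nat -> V -> R) (L : R) : (forall k, intg (F k)) ->
  (forall k, intg (G k)) -> \int[mu]_x G k x @[k --> \oo] --> L ->
  L1 (fun x => F k x - G k x)%R @[k --> \oo] --> 0%E ->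
  \int[mu]_x F k x @[k --> \oo] --> L.
Proof.
move=> IF IG GL FG.
have : (\int[mu]_x (G k x)%:E)%E @[k --> \oo] --> L%:E.
  under eq_fun do rewrite (RintE (IG _)).
  by apply: cvg_EFin => //; exact: nearW.
by move=> GL'; have := int_perturb IF IG (isT : L%:E \is a fin_num) GL' FG => /fine_cvg.
Qed.

Lemma dq_cvg_wderivR i u g (b : bool) : LI u -> (forall phi, test_function phi ->
  \int[mu]_x ((shf i (hseq b k) u x - u x) / hseq b k * phi x) @[k --> \oo] -->
  \int[mu]_x (g x * phi x)) -> wderiv i u g.
Proof.
move=> Iu H phi tphi; have H1 := dq_testR (i := i) b Iu tphi; have H2 := H _ tphi.
have : - (\int[mu]_x (u x * partial i phi x)) = \int[mu]_x (g x * phi x).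
  by rewrite -(cvg_lim (@Rhausdorff R) H1) -(cvg_lim (@Rhausdorff R) H2).
by move=> <-; rewrite opprK.
Qed.

Lemma LI_norm f : LI f -> LI (fun x => `|f x|).
Proof.
by move=> If N; have := integrable_norm (If N); apply: eq_integrable => //; exact: measurable_cube.
Qed.

Lemma L1_norm f : L1 (fun x => `|f x|) = L1 f.
Proof. by apply: eq_integral => x _; rewrite normr_id. Qed.

(** Here [up] and [um] stand for the values of a function at steps h and -h. The two quotients of
    |u| add up to a centered difference from which |u| cancels; the rest is that |.| is
    1-Lipschitz. *)
Lemma abs_dq (u up um g h : R) : 0 < h ->
  `|h^-1 * (`|u + h * g| - `|u + (- h) * g|) - ((`|up| - `|u|) / h + (`|um| - `|u|) / (- h))| <=
  `|(up - u) / h - g| + `|(um - u) / (- h) - g|.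
Proof.
move=> h0; have hn0 := lt0r_neq0 h0; have hi : 0 < h^-1 by rewrite invr_gt0.
have -> : (up - u) / h - g = h^-1 * (up - (u + h * g)) by field.
have -> : (um - u) / (- h) - g = - (h^-1 * (um - (u + (- h) * g))) by field.
rewrite normrN !(normrM h^-1) (gtr0_norm hi) -mulrDr.
have -> : h^-1 * (`|u + h * g| - `|u + - h * g|) - ((`|up| - `|u|) / h + (`|um| - `|u|) / (- h)) =
    h^-1 * ((`|um| - `|u + - h * g|) - (`|up| - `|u + h * g|)) by field.
rewrite (normrM h^-1) (gtr0_norm hi); apply: ler_wpM2l; first exact: ltW.
apply: (le_trans (ler_normB _ _)).
by rewrite addrC; apply: lerD; exact: ler_dist_dist.
Qed.

Lemma abs_sg (u t : R) : `|t| <= `|u| -> `|u + t| = Num.sg u * (u + t).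
Proof.
have [u0|u0|->] := ltgtP u 0.
- rewrite ltr0_sg// (ltr0_norm u0) ler_norml => /andP[_ H]; rewrite ler0_norm ?mulN1r//; lra.
- rewrite gtr0_sg// (gtr0_norm u0) ler_norml => /andP[H _]; rewrite ger0_norm ?mul1r//; lra.
- by rewrite normr0 normr_le0 => /eqP ->; rewrite addr0 normr0 mulr0.
Qed.

(** At u = 0 the centered difference is exactly 0, in agreement with sg 0 = 0; a one-sided one would
    give |g| instead. *)
Lemma abs_cvg (u g : R) :
  (hseq false k)^-1 * (`|u + hseq false k * g| - `|u + (- hseq false k) * g|) @[k --> \oo] -->
  2 * (Num.sg u * g).
Proof.
apply: cvg_near_cst.
have [->|u0] := eqVneq u 0.
  by apply: nearW => k; rewrite !add0r mulNr normrN subrr mulr0 sgr0 mul0r mulr0.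
have hg : hseq false k * g @[k --> \oo] --> (0 : R).
  by rewrite -(mul0r g); apply: cvgM; [exact: hseq_cvg|exact: cvg_cst].
have u0' : 0 < `|u| by rewrite normr_gt0.
have /cvgrPdist_lt/(_ _ u0') := hg; apply: filterS => k; rewrite sub0r normrN => /ltW hk.
have hn0 := @hseq_neq0 R false k.
rewrite (abs_sg hk) mulNr abs_sg ?normrN//.
by field.
Qed.

Lemma abs_le (u g h : R) : h != 0 -> `|h^-1 * (`|u + h * g| - `|u + (- h) * g|)| <= 2 * `|g|.
Proof.
move=> h0; rewrite normrM (le_trans (ler_wpM2l _ (ler_dist_dist _ _)))//.
have -> : u + h * g - (u + - h * g) = h * (2 * g) by ring.
rewrite normrM normfV mulrA mulVf ?normr_eq0// mul1r normrM.
by rewrite (ger0_norm (ler0n _ _)).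
Qed.

Lemma measurable_sg u : measurable_fun [set: V] u -> measurable_fun [set: V] (fun x => Num.sg (u x)).
Proof.
move=> mu_; rewrite (_ : (fun x => _) = (fun x => \1_(u @^-1` `]0, +oo[%classic) x - \1_(u @^-1` `]-oo, 0[%classic) x)).
  apply: measurable_funB; apply: measurable_indic; rewrite -[X in measurable X]setTI; exact: mu_.
apply/funext => x; rewrite !indicE.
have [u0|u0|u0] := ltgtP (u x) 0.
- by rewrite ltr0_sg// memNset ?mem_set ?sub0r//= in_itv/= ?andbT//; apply/negP; rewrite -leNgt ltW.
- by rewrite gtr0_sg// mem_set ?memNset ?subr0//= in_itv/= ?andbT//; apply/negP; rewrite -leNgt ltW.
- by rewrite u0 sgr0 !memNset ?subrr//= in_itv/= ?andbT u0 ltxx.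
Qed.

Lemma normr_sg_le1 (x : R) : `|Num.sg x| <= 1.
Proof. by rewrite normr_sg; case: (x != 0). Qed.

(** Tested, the forward and backward quotients of |u| together tend to twice the distributional
    derivative. By [abs_dq] they may be replaced by the centered difference of |u + h g|, which
    tends to 2 sg(u) g and is dominated by 2 |g|. *)
Lemma wderiv_abs i u g : LI u -> LI g -> wderiv i u g ->
  wderiv i (fun x => `|u x|) (fun x => Num.sg (u x) * g x).
Proof.
move=> Iu Ig ug phi tphi; have Iw := LI_norm Iu.
have mu_ := LI_measurable Iu; have mg := LI_measurable Ig.
have msg := measurable_sg mu_; have dug := wderiv_diffq Iu Ig ug.
have mphi := continuous_measurable_rV (test_continuous tphi).
have [N [C C0 bnd]] := test_bound_indic tphi; have C0' := ltW C0.
have Is : LI (fun x => Num.sg (u x) * g x) by apply: LI_mulb => // x; exact: normr_sg_le1.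
pose E k x := (hseq false k)^-1 * (`|u x + hseq false k * g x| - `|u x + (- hseq false k) * g x|).
pose D (b : bool) w k x : R := (shf i (hseq b k) w x - w x) / hseq b k.
have IE k : LI (E k).
  by apply: LI_scale; apply: LI_sub; apply: LI_norm; apply: LI_add => //; exact: LI_scale.
have ID b w k : LI w -> LI (D b w k) by move=> ?; apply: LI_dq => //; exact: hseq_le1.
have hN k : hseq true k = - hseq false k :> R by rewrite /hseq/= expr1 expr0 mul1r mulN1r.
have HD : \int[mu]_x ((D false (fun x => `|u x|) k x + D true (fun x => `|u x|) k x) * phi x) @[k --> \oo] -->
    - (\int[mu]_x (`|u x| * partial i phi x)) - (\int[mu]_x (`|u x| * partial i phi x)).
  rewrite (_ : (fun k => _) = (fun k => (\int[mu]_x (D false (fun x => `|u x|) k x * phi x)) + \int[mu]_x (D true (fun x => `|u x|) k x * phi x))).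
    by apply: cvgD; exact: dq_testR.
  apply/funext => k; rewrite -RintegralD//; try by apply: test_intg => //; exact: ID.
  by apply: eq_Rintegral => x _; rewrite mulrDl.
have HE : \int[mu]_x (E k x * phi x) @[k --> \oo] -->
    - (\int[mu]_x (`|u x| * partial i phi x)) - (\int[mu]_x (`|u x| * partial i phi x)).
  apply: int_perturbR HD _ => [k|k|].
  - exact: test_intg.
  - by apply: test_intg => //; apply: LI_add; exact: ID.
  have mA b k : measurable_fun [set: V] (fun x => D b u k x - g x).
    by apply: LI_measurable; apply: LI_sub => //; exact: ID.
  have D0 b := diffq_seq b N dug.
  apply: (@squeeze_cvge _ _ _ _ (cst 0%E) _ (fun k => (C%:E * \int[mu]_(x in cube N%:R) `|D false u k x - g x|%R%:E + C%:E * \int[mu]_(x in cube N%:R) `|D true u k x - g x|%R%:E)%E)).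
  - apply: nearW => k; rewrite L1_ge0/=.
    apply: (@le_trans _ _ (L1 ((fun x => `|(D false u k x - g x) * phi x|) \+ (fun x => `|(D true u k x - g x) * phi x|))%R)).
      apply: le_L1.
      + apply: intg_measurable; have := integrableB measurableT (test_intg (IE k) tphi) (test_intg (LI_add (ID false _ k Iw) (ID true _ k Iw)) tphi).
        exact: eq_integrable.
      + by apply: measurable_funD; apply: measurableT_comp => //; exact: measurable_funM.
      move=> x /=; rewrite -mulrBl !normrM -mulrDl ler_wpM2r// /D hN; apply: abs_dq.
      by rewrite /hseq expr0 mul1r.
    apply: (le_trans (L1D _ _)); try by apply: measurableT_comp => //; exact: measurable_funM.
    by rewrite !L1_norm; apply: leeD; exact: L1_mul_le.
  - exact: cvg_cst.
  - have -> : (0 = C%:E * 0 + C%:E * 0 :> \bar R)%E by rewrite !mule0 adde0.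
    apply: cvgeD; first by rewrite mule0.
      by apply: cvgeZl => //; exact: D0.
    by apply: cvgeZl => //; exact: D0.
have Il : intg (fun x => 2 * (Num.sg (u x) * g x * phi x)).
  by have := integrableZl measurableT 2 (test_intg Is tphi); exact: eq_integrable.
have HE' : \int[mu]_x (E k x * phi x) @[k --> \oo] --> \int[mu]_x (2 * (Num.sg (u x) * g x * phi x)).
  apply: (@dominated_intgR _ _ (fun x => (2 * C) * `|trunc g N x|)) => //.
  - by move=> k; apply: measurable_funM => //; exact: LI_measurable.
  - exact: intg_measurable.
  - have := integrableZl measurableT (2 * C) (integrable_norm (intg_trunc N Ig)).
    exact: eq_integrable.
  - move=> x; rewrite mulrA; apply: cvgM; [exact: abs_cvg|exact: cvg_cst].
  - move=> k x; have hn := @hseq_neq0 R false k.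
    have -> : `|trunc g N x| = `|g x| * \1_(cube N%:R) x by rewrite /trunc normrM (@ger0_norm _ (\1_(cube N%:R) x)).
    rewrite (_ : 2 * C * _ = (2 * `|g x|) * (C * \1_(cube N%:R) x)); last by ring.
    by rewrite (normrM (E k x)); apply: ler_pM => //; exact: abs_le.
have E1 : - (\int[mu]_x (`|u x| * partial i phi x)) - (\int[mu]_x (`|u x| * partial i phi x)) = \int[mu]_x (2 * (Num.sg (u x) * g x * phi x)).
  by rewrite -(cvg_lim (@Rhausdorff R) HE) -(cvg_lim (@Rhausdorff R) HE').
rewrite (RintegralZl _ measurableT (test_intg Is tphi)) in E1.
lra.
Qed.

(** The positive part of [u] equals its own absolute value. By uniqueness its derivative (g + sg(u)
    g) / 2 vanishes a.e. where the positive part does; on u = 0 this derivative is g / 2. *)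
Lemma wderiv_zero i u g : LI u -> LI g -> wderiv i u g ->
  {ae mu, forall x, u x = 0 -> g x = 0}.
Proof.
move=> Iu Ig ug; have mu_ := LI_measurable Iu; have msg := measurable_sg mu_.
pose up x := 2^-1 * u x + 2^-1 * `|u x|; pose gp x := 2^-1 * g x + 2^-1 * (Num.sg (u x) * g x).
have Is : LI (fun x => Num.sg (u x) * g x) by apply: LI_mulb => // x; exact: normr_sg_le1.
have Iup : LI up by apply: LI_add; apply: LI_scale => //; exact: LI_norm.
have Igp : LI gp by apply: LI_add; exact: LI_scale.
have upgp : wderiv i up gp by apply: wderiv_lin => //; [exact: LI_norm|exact: wderiv_abs].
have up_abs : (fun x => `|up x|) = up.
  apply/funext => x; rewrite ger0_norm// /up -mulrDr mulr_ge0//.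
  by have := ler_norm (- u x); rewrite normrN; lra.
have := wderiv_abs Iup Igp upgp; rewrite up_abs => upgp'.
have Is' : LI (fun x => Num.sg (up x) * gp x).
  by apply: LI_mulb => //; [apply: measurable_sg; exact: LI_measurable|move=> x; exact: normr_sg_le1].
have := wderiv_unique Iup Igp Is' upgp upgp'.
apply: filterS => x + u0; have -> : up x = 0 by rewrite /up u0 normr0 !mulr0 addr0.
rewrite sgr0 mul0r /gp u0 sgr0 mul0r mulr0 addr0 => /eqP.
by rewrite mulf_eq0 invr_eq0 pnatr_eq0/= => /eqP.
Qed.

End weak_derivatives.

(** * Reflection of weak derivatives and gluing along a hyperplane *)

Section reflection_gluing.
Context {R : realType} {n : nat}.
Local Notation V := 'rV[R]_n.
Local Notation mu := (@lebesgue_rV R n).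
Implicit Types (f g u v w phi : V -> R) (i j : 'I_n) (a h : R).

Lemma integral_cube_mpres (sig : V -> V) (N M : nat) f : mpres sig ->
  (forall x, cube N%:R x -> cube M%:R (sig x)) -> measurable_fun [set: V] f ->
  (\int[mu]_(x in cube N%:R) `|f (sig x)|%:E <= \int[mu]_(x in cube M%:R) `|f x|%:E)%E.
Proof.
move=> msig NM mf; have mN := @measurable_cube R n N%:R; have mM := @measurable_cube R n M%:R.
have mF : measurable_fun [set: V] (fun x => `|f x|%:E * (\1_(cube M%:R) x)%:E)%E.
  apply: emeasurable_funM; first exact: measurable_EFin_norm.
  by apply/measurable_EFinP.
rewrite [leRHS]integral_mkcond epatch_indic -(ge0_integral_mpres msig mF); last first.
  by move=> x; rewrite -EFinM lee_fin mulr_ge0.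
rewrite integral_mkcond epatch_indic; apply: ge0_le_integral => //.
- by move=> x _; rewrite -EFinM lee_fin mulr_ge0.
- apply: emeasurable_funM; last by apply/measurable_EFinP.
  by apply: measurable_EFin_norm; apply: measurableT_comp mf _; exact: msig.1.
- by apply: measurableT_comp mF _; exact: msig.1.
- move=> x _; rewrite -!EFinM lee_fin ler_wpM2l// !indicE.
  have [Nx|Nx] := pselect (cube N%:R x); last by rewrite memNset.
  by rewrite !mem_set//; exact: NM.
Qed.

Lemma cube_refl j a (N : nat) : exists M : nat, forall x : V, cube N%:R x -> cube M%:R (refl j a x).
Proof.
exists (N + (Num.truncn `|a *+ 2|).+1)%N => x /cubeP Nx; apply/cubeP => i; rewrite mxE natrD.
have h0 : `|a *+ 2| <= (Num.truncn `|a *+ 2|).+1%:R by exact/ltW/truncnS_gt.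
case: eqP => _; last by rewrite (le_trans (Nx i))// lerDl.
by rewrite (le_trans (ler_normB _ _))// addrC lerD.
Qed.

Lemma eq_row (x y : V) : (forall k, x ord0 k = y ord0 k) -> x = y.
Proof. by move=> H; apply/rowP => k; exact: H. Qed.

Lemma reflE j a (x : V) k :
  refl j a x ord0 k = if k == j then a *+ 2 - x ord0 k else x ord0 k.
Proof. by rewrite mxE. Qed.

Lemma refl_unitv i j a h (x : V) :
  refl j a (h *: unitv i + x) = ((if i == j then -1 else 1) * h) *: unitv i + refl j a x.
Proof.
apply: eq_row => k; rewrite !(unitvE, reflE).
have [->|ki] := eqVneq k i; last by case: eqP.
by case: eqP => _; ring.
Qed.

Lemma LI_refl j a f : LI f -> LI (f \o refl j a).
Proof.
move=> If; apply: LI_local => N; have [M NM] := cube_refl j a N.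
exists (trunc f M \o refl j a).
  by have := integrable_mpres (mpres_refl j a) (intg_trunc M If); exact.
by move=> x /NM Mx /=; rewrite truncE.
Qed.

(** For i = j the reflection turns a step h into -h, which is why [diffq] controls steps of both
    signs. *)
Lemma wderiv_refl i j a u g : LI u -> LI g -> wderiv i u g ->
  wderiv i (u \o refl j a) (fun x => (if i == j then -1 else 1) * g (refl j a x)).
Proof.
move=> Iu Ig ug; have mu_ := LI_measurable Iu; have mg := LI_measurable Ig.
set s : R := if i == j then -1 else 1.
have ss : s * s = 1 by rewrite /s; case: ifP => _; rewrite ?mulrNN mulr1.
have s0 : s != 0 by apply/eqP => s0; move: ss; rewrite s0 mulr0 => /esym/eqP; rewrite oner_eq0.
have s1 : `|s| = 1 by rewrite /s; case: ifP => _; rewrite ?normrN normr1.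
apply: diffq_wderiv; [exact: LI_refl|by apply: LI_scale; exact: (LI_refl j a Ig)|].
move=> N e e0; have [M NM] := cube_refl j a N.
have [D D0 HD] := wderiv_diffq Iu Ig ug M e0.
exists D => // h h0 hD; have c0 : s * h != 0 by rewrite mulf_neq0.
apply: (le_trans _ (HD (s * h) c0 _)); last by rewrite normrM s1 mul1r.
pose F y := (shf i (s * h) u y - u y) / (s * h) - g y.
have mF : measurable_fun [set: V] F by apply: measurable_funB => //; exact: measurable_dq.
apply: (le_trans _ (integral_cube_mpres (mpres_refl j a) NM mF)).
rewrite le_eqVlt; apply/orP; left; apply/eqP; apply: eq_integral => x _; congr EFin.
rewrite /F /shf/= refl_unitv -/s -[RHS]mul1r -s1 -normrM; congr `|_|.
have hs : (s * h)^-1 = s * h^-1.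
  by apply: (mulfI c0); rewrite divff// mulrACA ss mul1r divff.
by rewrite hs mulrBr mulrCA [s * (s * _)]mulrA ss mul1r.
Qed.

Lemma measurable_indb (P : V -> bool) : measurable [set x | P x] ->
  measurable_fun [set: V] (fun x => (P x)%:R : R).
Proof.
move=> mP; rewrite (_ : (fun x => _) = \1_[set x | P x]); first exact: measurable_indic.
by apply/funext => x; rewrite indicE (_ : (x \in _) = P x)//; apply/idP/idP; rewrite inE.
Qed.

Lemma measurable_half i a : measurable [set x : V | x ord0 i < a].
Proof.
have := @measurable_coord_rV R n i measurableT _ (measurable_itv `]-oo, a[).
by rewrite setTI; congr measurable; apply/seteqP; split => x /=; rewrite in_itv.
Qed.

Lemma measurable_slab i a b : measurable [set x : V | a < x ord0 i < b].
Proof.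
have := @measurable_coord_rV R n i measurableT _ (measurable_itv `]a, b[).
by rewrite setTI; congr measurable; apply/seteqP; split => x /=; rewrite in_itv.
Qed.

Lemma norm_indb_le1 (b : bool) : `|b%:R : R| <= 1.
Proof. by case: b; rewrite ?normr1 ?normr0. Qed.

Lemma hseq_gt0 k : 0 < hseq false k :> R.
Proof. by rewrite /hseq expr0 mul1r invr_gt0. Qed.

Section glue.
Variables (i0 : 'I_n) (a : R) (w : V -> R) (g : 'I_n -> V -> R).
Hypotheses (Iw : LI w) (Ig : forall j, LI (g j)) (wg : forall j, wderiv j w (g j)).
Hypothesis anti : forall x, w (refl i0 a x) = - w x.

Let H (x : V) : R := (x ord0 i0 < a)%R%:R.
Let S k (x : V) : R := (a - hseq false k < x ord0 i0 < a)%R%:R.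

Let mH : measurable_fun [set: V] H.
Proof. by apply: measurable_indb; exact: measurable_half. Qed.

Let mS k : measurable_fun [set: V] (S k).
Proof. by apply: measurable_indb; exact: measurable_slab. Qed.

Let w0 (x : V) : x ord0 i0 = a -> w x = 0.
Proof.
move=> xa; have : refl i0 a x = x.
  by apply: eq_row => k; rewrite mxE; case: eqP => // ->; rewrite xa mulr2n addrK.
by move=> E; have := anti x; rewrite E => Ew; lra.
Qed.

Let S_cvg x : S k x @[k --> \oo] --> (0 : R).
Proof.
apply: cvg_near_cst; have [xa|xa] := ltP (x ord0 i0) a; last first.
  by apply: nearW => k; rewrite /S [x ord0 i0 < a]ltNge xa /= andbF.
have d0 : 0 < a - x ord0 i0 by rewrite subr_gt0.
have /cvgrPdist_lt/(_ _ d0) := @hseq_cvg R false; apply: filterS => k.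
rewrite sub0r normrN gtr0_norm ?hseq_gt0// => hk; rewrite /S (_ : _ < x ord0 i0 = false)//.
by apply/negbTE; rewrite -leNgt; lra.
Qed.

(** Reflection in the middle hyperplane of the slab of [S k]: it preserves the slab and moves its
    points by at most the step. Oddness turns a shift of [w] into this reflection. *)
Let tau k (x : V) : V := refl i0 (a - hseq false k / 2) x.

Let tau_shift k (x : V) : w (hseq false k *: unitv i0 + x) = - w (tau k x).
Proof.
have := anti (hseq false k *: unitv i0 + x); rewrite refl_unitv eqxx mulN1r => E.
rewrite -[LHS]opprK -E; congr (- w _); apply: eq_row => j.
by rewrite unitvE !reflE eqxx; case: eqP => [->|//]; field.
Qed.

Let S_tau k x : S k (tau k x) = S k x.
Proof.
rewrite /S /tau reflE eqxx; congr (nat_of_bool _)%:R; apply/idP/idP => /andP[H1 H2]; apply/andP; split; lra.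
Qed.

Let tau_near k x : tau k x = (2 * a - hseq false k - 2 * x ord0 i0) *: unitv i0 + x.
Proof.
by apply: eq_row => j; rewrite unitvE !reflE; case: eqP => // ->; field.
Qed.

(** A discrete Leibniz rule: the jump of [H] contributes a term supported in the slab of width equal
    to the step. *)
Let step k (x : V) : H (hseq false k *: unitv i0 + x) * w (hseq false k *: unitv i0 + x) - H x * w x =
  H x * (w (hseq false k *: unitv i0 + x) - w x) - S k x * w (hseq false k *: unitv i0 + x).
Proof.
have h0 := hseq_gt0 k; rewrite /H /S unitvE eqxx; set c := hseq false k in h0 *.
have [xa|xa] := ltP (x ord0 i0) a; last first.
  by rewrite andbF (_ : c + _ < a = false) ?mul0r ?subrr//; apply/negbTE; rewrite -leNgt; lra.
have [xac|xac|xac] := ltgtP (a - c) (x ord0 i0); rewrite ?andbT ?andbF.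
- rewrite (_ : c + _ < a = false); first by rewrite /= ?mulr1n ?mulr0n; ring.
  by apply/negbTE; rewrite -leNgt; lra.
- rewrite (_ : c + _ < a = true); first by rewrite /= ?mulr1n ?mulr0n; ring.
  by apply/idP; lra.
(* On the boundary of the slab the shifted point lies on the mirror, where an odd function
   vanishes. *)
- rewrite (w0 (x := c *: unitv i0 + x)); first by rewrite /= ?mulr1n ?mulr0n; ring.
  by rewrite unitvE eqxx -xac; ring.
Qed.

Let step_tan j k (x : V) : j != i0 -> H (hseq false k *: unitv j + x) = H x.
Proof. by move=> ji; rewrite /H unitvE eq_sym (negbTE ji). Qed.

(** The slab term is of size 1 / step, so it has to be cancelled. Writing A and B for the integrals
    over the slab of the shifted [w] and of [w] against [phi], split A as half of A - B plus half of
    A + B. After division by the step, the first is a difference quotient of [w] on a shrinking set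
    ([T2]); by oddness the second is [w] times a quotient of [phi] along [tau], bounded on a
    shrinking set ([T3]). *)
Lemma wderiv_glue j : wderiv j (fun x => H x * w x) (fun x => H x * g j x).
Proof.
have mw := LI_measurable Iw; have mg i := LI_measurable (Ig i).
have dwg i := wderiv_diffq Iw (Ig i) (wg i).
have IH f : LI f -> LI (fun x => H x * f x).
  by move=> If; apply: LI_mulb => // x; exact: norm_indb_le1.
apply: (@dq_cvg_wderivR _ _ _ _ _ false); first exact: IH.
move=> phi tphi; have mphi := continuous_measurable_rV (test_continuous tphi).
have [N [C C0 [p0 dp0 pC dpC]]] := test_bound tphi; have C0' := ltW C0.
have bnd x : `|phi x| <= C * \1_(cube N%:R) x.
  rewrite indicE; have [Nx|Nx] := pselect (cube N%:R x); first by rewrite mem_set// mulr1.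
  by rewrite memNset// mulr0 p0// normr0.
have bndb (b : V -> bool) x : `|(b x)%:R * phi x| <= C * \1_(cube N%:R) x.
  by rewrite normrM (le_trans _ (bnd x))// ler_piMl// norm_indb_le1.
have bH x : `|H x * phi x| <= C * \1_(cube N%:R) x by exact: (bndb (fun x => x ord0 i0 < a)).
have bS k x : `|S k x * phi x| <= C * \1_(cube N%:R) x.
  exact: (bndb (fun x => a - hseq false k < x ord0 i0 < a)).
have T1 : \int[mu]_x ((shf j (hseq false k) w x - w x) / hseq false k * (H x * phi x)) @[k --> \oo] -->
    \int[mu]_x (g j x * (H x * phi x)).
  apply: (@diffq_intR _ _ _ _ _ _ _ C N) => //; first exact: measurable_funM.
have lim : \int[mu]_x (H x * g j x * phi x) = \int[mu]_x (g j x * (H x * phi x)).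
  by apply: eq_Rintegral => x _; ring.
rewrite lim; have [jE|ji] := eqVneq j i0; last first.
  apply: cvg_trans T1; apply: near_eq_cvg; apply: nearW => k.
  by apply: eq_Rintegral => x _; rewrite /shf step_tan//; ring.
subst j.
have IdqM k (c : V -> R) : measurable_fun [set: V] c -> (forall x, `|c x| <= C * \1_(cube N%:R) x) ->
    intg (fun x => (shf i0 (hseq false k) w x - w x) / hseq false k * c x).
  by move=> mc cb; apply: (LI_mul_intg (N := N) (C := C)) => //; apply: LI_dq => //; exact: hseq_le1.
have mSp k : measurable_fun [set: V] (fun x => S k x * phi x) by exact: measurable_funM.
have mHp : measurable_fun [set: V] (fun x => H x * phi x) by exact: measurable_funM.
have T2 : \int[mu]_x ((shf i0 (hseq false k) w x - w x) / hseq false k * (S k x * phi x)) @[k --> \oo] --> (0 : R).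
  apply: (@int_perturbR _ _ _ (fun k x => g i0 x * (S k x * phi x))) => [k|k||].
  - by apply: IdqM => // x; exact: bS.
  - by apply: (LI_mul_intg (N := N) (C := C)) => // x; exact: bS.
  - have := @dominated_mulR _ _ (g i0) (fun k x => S k x * phi x) (cst 0) C N (Ig i0) mSp (measurable_cst _).
    rewrite (_ : \int[mu]_x (g i0 x * cst 0 x) = 0); last first.
      by under eq_Rintegral do rewrite mulr0; rewrite Rintegral_cst// mul0r.
    apply.
    + by move=> k x; exact: bS.
    + by move=> x; rewrite -(mul0r (phi x)); apply: cvgM; [exact: S_cvg|exact: cvg_cst].
    + by under eq_fun do rewrite mulr0; exact: integrable0.
  - apply: (@squeeze_cvge _ _ _ _ (cst 0%E) _ (fun k => C%:E * \int[mu]_(x in cube N%:R) `|(shf i0 (hseq false k) w x - w x) / hseq false k - g i0 x|%R%:E)%E).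
    + apply: nearW => k; rewrite L1_ge0/=; under [L1 _]eq_L1 do rewrite -mulrBl.
      apply: (L1_mul_le _ (mSp k) (bS k) C0').
      by apply: measurable_funB => //; exact: measurable_dq.
    + exact: cvg_cst.
    + by rewrite -(mule0 C%:E); apply: cvgeZl => //; exact: (diffq_seq false N (dwg i0)).
pose psi k x := S k x * ((phi x - phi (tau k x)) / hseq false k).
have mtau k : measurable_fun [set: V] (tau k) by have [] := mpres_refl i0 (a - hseq false k / 2).
have mpsi k : measurable_fun [set: V] (psi k).
  apply: measurable_funM => //; apply: measurable_funM => //; apply: measurable_funB => //.
  exact: measurableT_comp.
have bpsi k x : `|psi k x| <= C * \1_(cube N.+1%:R) x.
  rewrite /psi /S; have [/andP[S1 S2]|_] := boolP (a - hseq false k < x ord0 i0 < a); last by rewrite mul0r normr0 mulr_ge0.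
  rewrite mul1r; have h0 := @hseq_gt0 k.
  have d1 : `|2 * a - hseq false k - 2 * x ord0 i0| <= hseq false k by rewrite ler_norml; apply/andP; split; lra.
  have h1 := @hseq_le1 R false k.
  rewrite (gtr0_norm h0) in h1.
  rewrite indicE; have [Nx|Nx] := pselect (cube N.+1%:R x).
    rewrite mem_set// mulr1 normrM normfV (gtr0_norm h0) ler_pdivrMr// distrC tau_near.
    by apply: (le_trans (test_lipschitz tphi (dpC i0) _ _)); rewrite ler_wpM2l.
  rewrite memNset// mulr0 !p0 ?subrr ?mul0r ?normr0// => Hc; apply: Nx.
    rewrite -natr1 -[x](addKr ((2 * a - hseq false k - 2 * x ord0 i0) *: unitv i0)) -tau_near -scaleNr.
    by apply: cube_shift => //; rewrite normrN; exact: le_trans d1 h1.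
  by apply: cube_sub Hc; rewrite ler_nat.
have T3 : \int[mu]_x (w x * psi k x) @[k --> \oo] --> (0 : R).
  have := @dominated_mulR _ _ w psi (cst 0) C N.+1 Iw mpsi (measurable_cst _) bpsi.
  rewrite (_ : \int[mu]_x (w x * cst 0 x) = 0); last first.
    (* The limit is 0, since the psi k vanish eventually at each point: the slab leaves every
       point. *)
    by under eq_Rintegral do rewrite mulr0; rewrite Rintegral_cst// mul0r.
  apply.
  - move=> x; apply: cvg_near_cst; have := @S_cvg x => /cvgrPdist_lt/(_ 1 ltr01).
    apply: filterS => k; rewrite /psi sub0r normrN /S; case: (_ < _ < _) => /=; last by rewrite mul0r.
    by rewrite normr1 ltxx.
  - by under eq_fun do rewrite mulr0; exact: integrable0.
have Iws k : intg (fun x => w x * (S k x * phi x)).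
  by apply: (LI_mul_intg (N := N) (C := C)) => // x; exact: bS.
have Ishs k : intg (fun x => shf i0 (hseq false k) w x * (S k x * phi x)).
  by apply: (LI_mul_intg _ (mSp k) (bS k) C0'); apply: LI_shf => //; exact: hseq_le1.
have Iwst k : intg (fun x => w x * (S k x * phi (tau k x))).
  have := integrable_mpres (mpres_refl i0 (a - hseq false k / 2)) (integrableN (Ishs k)).
  apply: eq_integrable => // x _ /=; congr EFin; rewrite /shf.
  by rewrite -/(tau k x) tau_shift S_tau /tau reflK; ring.
have E3 k : \int[mu]_x (w x * (S k x * phi (tau k x))) = - (\int[mu]_x (shf i0 (hseq false k) w x * (S k x * phi x))).
  rewrite -(Rintegral_mpres (mpres_refl i0 (a - hseq false k / 2)) (Iwst k)).
  have -> : - (\int[mu]_x (shf i0 (hseq false k) w x * (S k x * phi x))) = \int[mu]_x (-1 * (shf i0 (hseq false k) w x * (S k x * phi x))).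
    by rewrite (RintegralZl _ measurableT (Ishs k)) mulN1r.
  apply: eq_Rintegral => x _.
  by rewrite -/(tau k x) S_tau [tau k (tau k x)]reflK /shf tau_shift; ring.
have T4 k : \int[mu]_x ((shf i0 (hseq false k) (fun x => H x * w x) x - H x * w x) / hseq false k * phi x) =
    \int[mu]_x ((shf i0 (hseq false k) w x - w x) / hseq false k * (H x * phi x))
    - 2^-1 * (\int[mu]_x ((shf i0 (hseq false k) w x - w x) / hseq false k * (S k x * phi x)))
    - 2^-1 * (\int[mu]_x (w x * psi k x)).
  have hn0 := @hseq_neq0 R false k; set c := hseq false k in hn0 *.
  have J1 : intg (fun x => (shf i0 c w x - w x) / c * (H x * phi x)) by apply: IdqM.
  have -> : \int[mu]_x (w x * psi k x) = c^-1 * (\int[mu]_x (w x * (S k x * phi x))) - c^-1 * (\int[mu]_x (w x * (S k x * phi (tau k x)))).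
    rewrite -mulNr -(Rint_lin _ _ (Iws k) (Iwst k)); apply: eq_Rintegral => x _.
    by rewrite /psi -/c; ring.
  rewrite E3 -/c.
  have -> : \int[mu]_x ((shf i0 c w x - w x) / c * (S k x * phi x)) = c^-1 * (\int[mu]_x (shf i0 c w x * (S k x * phi x))) - c^-1 * (\int[mu]_x (w x * (S k x * phi x))).
    by rewrite -mulNr -(Rint_lin _ _ (Ishs k) (Iws k)); apply: eq_Rintegral => x _; ring.
  transitivity (1 * (\int[mu]_x ((shf i0 c w x - w x) / c * (H x * phi x))) + (- c^-1) * (\int[mu]_x (shf i0 c w x * (S k x * phi x)))).
    rewrite -(Rint_lin _ _ J1 (Ishs k)); apply: eq_Rintegral => x _.
    by rewrite /shf step -/c; ring.
  by field.
rewrite (funext T4) -[X in _ --> X]subr0 -[X in _ --> X - _]subr0.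
rewrite -[X in _ --> _ - X - _](mulr0 2^-1) -[X in _ --> _ - _ - X](mulr0 2^-1).
by apply: cvgB; [apply: cvgB => //|]; apply: cvgM => //; exact: cvg_cst.
Qed.

End glue.

End reflection_gluing.

(** * Weak gradients and polarization *)

Section gradients.
Context {R : realType} {n : nat}.
Local Notation V := 'rV[R]_n.
Local Notation mu := (@lebesgue_rV R n).
Implicit Types (u v w phi : V -> R) (g h : V -> V) (i j : 'I_n) (a : R).

Definition isgrad u g : Prop := LI u /\ forall i, LI (fun x => g x ord0 i) /\
  wderiv i u (fun x => g x ord0 i).

Lemma isgradE u g : is_weak_gradient u g <-> isgrad u g.
Proof.
split=> -[/locally_integrable_rVE Iu H]; split => // i; have [/locally_integrable_rVE Ig ug] := H i;
  split => //.
Qed.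

Lemma ae_ord (P : 'I_n -> V -> Prop) : (forall i, {ae mu, forall x, P i x}) ->
  {ae mu, forall x, forall i, P i x}.
Proof.
move=> H; have : {ae mu, forall x, forall i, i \in index_enum 'I_n -> P i x}.
  elim: (index_enum 'I_n) => [|i r IH]; first exact: aeW.
  have := H i; apply: filterS2 IH => x IH Pi j; rewrite in_cons => /orP[/eqP->//|]; exact: IH.
by apply: filterS => x H' i; apply: H'; rewrite mem_index_enum.
Qed.

Lemma ae_grad g h : (forall i, {ae mu, forall x, g x ord0 i = h x ord0 i}) ->
  {ae mu, forall x, g x = h x}.
Proof. by move=> /ae_ord; apply: filterS => x H; exact: eq_row. Qed.

Lemma isgrad_unique u g h : isgrad u g -> isgrad u h -> {ae mu, forall x, g x = h x}.
Proof.
move=> [Iu ug] [_ uh]; apply: ae_grad => i; have [Ig Dg] := ug i; have [Ih Dh] := uh i.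
exact: wderiv_unique Iu Ig Ih Dg Dh.
Qed.

Lemma isgrad_ae u u' g h : isgrad u g -> LI u' -> (forall i, LI (fun x => h x ord0 i)) ->
  {ae mu, forall x, u x = u' x} -> {ae mu, forall x, g x = h x} -> isgrad u' h.
Proof.
move=> [Iu ug] Iu' Ih uu' gh; split => // i; have [Ig Dg] := ug i; split => //.
apply: (wderiv_ae Iu Ig Iu' (Ih i) uu' _ Dg).
by apply: filterS gh => x ->.
Qed.

Lemma isgrad_zero u g : isgrad u g -> {ae mu, forall x, u x = 0 -> g x = 0}.
Proof.
move=> [Iu ug]; have : {ae mu, forall x, forall i, u x = 0 -> g x ord0 i = 0}.
  by apply: ae_ord => i; have [Ig Dg] := ug i; exact: wderiv_zero Iu Ig Dg.
by apply: filterS => x H u0; apply: eq_row => i; rewrite H// mxE.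
Qed.

Lemma isgrad_lin (a b : R) u v g h : isgrad u g -> isgrad v h ->
  isgrad (fun x => a * u x + b * v x) (fun x => a *: g x + b *: h x).
Proof.
move=> [Iu ug] [Iv vh]; split; first by apply: LI_add; exact: LI_scale.
move=> i; have [Ig Dg] := ug i; have [Ih Dh] := vh i.
have -> : (fun x => (a *: g x + b *: h x) ord0 i) = (fun x => a * g x ord0 i + b * h x ord0 i).
  by apply/funext => x; rewrite !mxE.
by split; [apply: LI_add; exact: LI_scale|exact: wderiv_lin].
Qed.

Lemma isgrad_scale (c : R) u g : isgrad u g -> isgrad (fun x => c * u x) (fun x => c *: g x).
Proof.
move=> ug; have := isgrad_lin c 0 ug ug.
by congr isgrad; apply/funext => x; rewrite ?mul0r ?scale0r addr0.
Qed.

Lemma isgrad_abs u g : isgrad u g ->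
  isgrad (fun x => `|u x|) (fun x => Num.sg (u x) *: g x).
Proof.
move=> [Iu ug]; split; first exact: LI_norm.
move=> i; have [Ig Dg] := ug i.
have -> : (fun x => (Num.sg (u x) *: g x) ord0 i) = (fun x => Num.sg (u x) * g x ord0 i).
  by apply/funext => x; rewrite mxE.
split; last exact: wderiv_abs.
apply: LI_mulb => //; last by move=> x; exact: normr_sg_le1.
by apply: measurable_sg; exact: LI_measurable.
Qed.

Definition pick T (b : V -> bool) (f f' : V -> T) (x : V) : T := if b x then f x else f' x.

Lemma LI_pick (b : V -> bool) f f' : measurable [set x | b x] -> LI f -> LI f' -> LI (pick b f f').
Proof.
move=> mb If If'.
have -> : pick b f f' = (fun x => (b x)%:R * f x + (~~ b x)%:R * f' x).
  by apply/funext => x; rewrite /pick; case: (b x); rewrite /= !(mul1r, mul0r, addr0, add0r).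
apply: LI_add; apply: LI_mulb => //; try by move=> x; exact: norm_indb_le1.
  exact: measurable_indb.
apply: measurable_indb; rewrite (_ : [set x | _] = ~` [set x | b x]); first exact: measurableC.
by apply/seteqP; split => x /= /negP.
Qed.

Lemma LI_pick_row (b : V -> bool) g h i : measurable [set x | b x] ->
  LI (fun x => g x ord0 i) -> LI (fun x => h x ord0 i) -> LI (fun x => pick b g h x ord0 i).
Proof.
move=> mb Ig Ih; have := LI_pick mb Ig Ih; congr LI; apply/funext => x.
by rewrite /pick; case: (b x).
Qed.

Lemma measurable_leb u v : measurable_fun [set: V] u -> measurable_fun [set: V] v ->
  measurable [set x | v x <= u x].
Proof.
move=> mu_ mv; have mB : measurable_fun [set: V] (fun x => u x - v x) by exact: measurable_funB.
have := mB measurableT _ (measurable_itv `[0, +oo[); rewrite setTI; congr measurable.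
by apply/seteqP; split => x /=; rewrite in_itv/= andbT subr_ge0.
Qed.

Lemma isgrad_diff_zero u v g h : isgrad u g -> isgrad v h ->
  {ae mu, forall x, u x = v x -> g x = h x}.
Proof.
move=> ug vh; have := isgrad_zero (isgrad_lin 1 (-1) ug vh).
apply: filterS => x H uv; have : 1 *: g x + -1 *: h x = 0 by apply: H; rewrite uv; ring.
by rewrite scale1r scaleN1r => /eqP; rewrite subr_eq0 => /eqP.
Qed.

(** From max(u, v) = (u + v + |u - v|) / 2. Where u = v the formula for |u - v| gives the mean of
    the two gradients, which agree a.e. there. *)
Lemma isgrad_max u v g h : isgrad u g -> isgrad v h ->
  isgrad (pick (fun x => v x <= u x) u v) (pick (fun x => v x <= u x) g h).
Proof.
move=> ug vh; have mb : measurable [set x | v x <= u x].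
  by apply: measurable_leb; apply: LI_measurable; [case: ug|case: vh].
have H := isgrad_lin 2^-1 2^-1 (isgrad_lin 1 1 ug vh) (isgrad_abs (isgrad_lin 1 (-1) ug vh)).
apply: (isgrad_ae H).
- by apply: LI_pick => //; [case: ug|case: vh].
- by move=> i; apply: LI_pick_row => //; [case: ug => _ /(_ i)[]|case: vh => _ /(_ i)[]].
- apply: aeW => x; rewrite /pick; case: leP => uv.
    by rewrite ger0_norm; [field|lra].
  by rewrite ltr0_norm; [field|lra].
- apply: filterS (isgrad_diff_zero ug vh) => x E; rewrite /pick; have [uv|uv|uv] := ltgtP (u x) (v x).
  + rewrite ltr0_sg; last by lra.
    by apply: eq_row => i; rewrite !mxE; field.
  + rewrite gtr0_sg; last by lra.
    by apply: eq_row => i; rewrite !mxE; field.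
  + by rewrite E//; apply: eq_row => i; rewrite !mxE; field.
Qed.

Lemma isgrad_min u v g h : isgrad u g -> isgrad v h ->
  isgrad (pick (fun x => v x <= u x) v u) (pick (fun x => v x <= u x) h g).
Proof.
move=> ug vh; have := isgrad_lin 1 (-1) (isgrad_lin 1 1 ug vh) (isgrad_max ug vh).
congr isgrad; apply/funext => x; rewrite /pick; case: ifP => _; try (by ring);
  by apply: eq_row => i; rewrite !mxE; ring.
Qed.

Definition rowrefl j (x : V) : V := \row_i ((if i == j then -1 else 1) * x ord0 i).

Lemma enorm_rowrefl j (x : V) : enorm (rowrefl j x) = enorm x.
Proof.
congr Num.sqrt; apply: eq_bigr => i _; rewrite mxE exprMn.
by case: ifP => _; rewrite ?sqrrN expr1n mul1r.
Qed.

Lemma isgrad_refl j a u g : isgrad u g -> isgrad (u \o refl j a) (fun x => rowrefl j (g (refl j a x))).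
Proof.
move=> [Iu ug]; split; first exact: LI_refl.
move=> i; have [Ig Dg] := ug i.
have -> : (fun x => rowrefl j (g (refl j a x)) ord0 i) = (fun x => (if i == j then -1 else 1) * g (refl j a x) ord0 i).
  by apply/funext => x; rewrite mxE.
split; last exact: (wderiv_refl j a Iu Ig Dg).
by apply: LI_scale; exact: (LI_refl j a Ig).
Qed.

(** True where [u] keeps its value: on the side below [a] when it is the larger one, on the other
    side when it is strictly smaller. In case of a tie both choices give the same value. *)
Definition polb j a u (x : V) : bool := (x ord0 j < a) == (u (refl j a x) <= u x).

Definition polar j a u : V -> R := pick (polb j a u) u (u \o refl j a).

Definition polar_grad j a u g : V -> V :=
  pick (polb j a u) g (fun x => rowrefl j (g (refl j a x))).

Lemma measurable_polb j a u : measurable_fun [set: V] u -> measurable [set x | polb j a u x].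
Proof.
move=> mu_; have m1 := @measurable_half R n j a.
have m2 : measurable [set x | u (refl j a x) <= u x].
  by apply: (measurable_leb mu_); apply: measurableT_comp mu_ _; have [] := mpres_refl j a.
rewrite (_ : [set x | _] = ([set x : V | x ord0 j < a] `&` [set x | u (refl j a x) <= u x]) `|`
   (~` [set x : V | x ord0 j < a] `&` ~` [set x | u (refl j a x) <= u x])).
  by apply: measurableU; apply: measurableI => //; exact: measurableC.
apply/seteqP; split => x; rewrite /polb /=; case: (_ < _); case: (_ <= _) => /=; intuition.
Qed.

(** Add to the minimum of [u] and its reflection the absolute value of their difference cut to the
    half-space: this restores the maximum on one side and keeps the minimum on the other. The
    difference is odd, so [wderiv_glue] applies to the cut. *)
Lemma isgrad_polar j a u g : isgrad u g -> isgrad (polar j a u) (polar_grad j a u g).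
Proof.
move=> ug; have vh := isgrad_refl j a ug.
have mb := measurable_polb j a (LI_measurable ug.1).
have ug0 := isgrad_diff_zero ug vh.
pose w x := 1 * u x + (-1) * (u \o refl j a) x.
pose gw x := 1 *: g x + (-1) *: rowrefl j (g (refl j a x)).
have wgw : isgrad w gw by exact: isgrad_lin.
have anti x : w (refl j a x) = - w x by rewrite /w /= reflK; ring.
have Hw : isgrad (fun x => (x ord0 j < a)%R%:R * w x) (fun x => (x ord0 j < a)%R%:R *: gw x).
  have [Iw Dw] := wgw; have mH : measurable_fun [set: V] (fun x => (x ord0 j < a)%R%:R : R).
    by apply: measurable_indb; exact: measurable_half.
  split; first by apply: LI_mulb => // x; exact: norm_indb_le1.
  move=> i; have [Igi Dgi] := Dw i.
  have -> : (fun x : V => ((x ord0 j < a)%R%:R *: gw x) ord0 i) = (fun x : V => (x ord0 j < a)%R%:R * gw x ord0 i).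
    by apply/funext => x; rewrite mxE.
  split; first by apply: LI_mulb => // x; exact: norm_indb_le1.
  exact: (wderiv_glue Iw (fun i => (Dw i).1) (fun i => (Dw i).2) anti i).
have H := isgrad_lin 1 1 (isgrad_min ug vh) (isgrad_abs Hw).
apply: (isgrad_ae H).
- by apply: LI_pick => //; [case: ug|case: vh].
- by move=> i; apply: LI_pick_row => //; [case: ug => _ /(_ i)[]|case: vh => _ /(_ i)[]].
- apply: aeW => x; rewrite /polar /pick /polb /w /=; case: (_ < a); case: leP => uv /=;
    rewrite ?mulr1n ?mul1r ?mulr0n ?mul0r ?normr0 ?addr0//.
    by rewrite ger0_norm; [ring|lra].
  by rewrite ltr0_norm; [ring|lra].
- apply: filterS ug0 => x E; rewrite /polar_grad /pick /polb /w /gw /=; case: (_ < a);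
    rewrite /= ?mulr1n ?mul1r ?mulr0n ?mul0r ?sgr0 ?scale0r ?scale1r ?addr0; last by case: leP.
  rewrite !mulN1r scaleN1r; have [uv|uv|uv] := ltgtP (u x) (u (refl j a x)) => /=.
  + rewrite ltr0_sg; last by lra.
    by rewrite scaleN1r opprB addrC subrK.
  + rewrite gtr0_sg; last by lra.
    by rewrite scale1r addrC subrK.
  + by rewrite E//= !subrr scaler0 addr0.
Qed.

(** On each orbit of the reflection the choice keeps the two values or exchanges them, so Q(x) +
    Q(sigma x) = G(x) + G(sigma x); integrating doubles both sides. At ties one value may be taken
    twice, whence the last hypothesis. *)
Lemma pick_integral (G : V -> R) j a u g : isgrad u g -> measurable_fun [set: V] G ->
  (forall x, 0 <= G x) -> {ae mu, forall x, u x = u (refl j a x) -> G x = G (refl j a x)} ->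
  (\int[mu]_x (pick (polb j a u) G (G \o refl j a) x)%:E = \int[mu]_x (G x)%:E)%E.
Proof.
move=> ug mG G0 uG; have mb := measurable_polb j a (LI_measurable ug.1).
set Q := pick _ _ _.
have msig := (mpres_refl (R := R) j a).1.
have mGs : measurable_fun [set: V] (G \o refl j a) by exact: measurableT_comp.
have mQ : measurable_fun [set: V] Q.
  have mib := measurable_indb mb.
  rewrite (_ : Q = (fun x => (polb j a u x)%:R * G x + (1 - (polb j a u x)%:R) * (G \o refl j a) x)).
    by apply: measurable_funD; apply: measurable_funM => //; exact: measurable_funB.
  by apply/funext => x; rewrite /Q /pick; case: (polb _ _ _ _) => /=; ring.
have Q0 x : 0 <= Q x by rewrite /Q /pick /=; case: ifP.
have mE (f : V -> R) : measurable_fun [set: V] f -> measurable_fun [set: V] (fun x => (f x)%:E) by move=> ?; exact/measurable_EFinP.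
have dbl (f : V -> R) : measurable_fun [set: V] f -> (forall x, 0 <= f x) ->
    (\int[mu]_x (f x + f (refl j a x))%:E = \int[mu]_x (f x)%:E + \int[mu]_x (f x)%:E)%E.
  move=> mf f0; under eq_integral do rewrite EFinD.
  have mfs : measurable_fun [set: V] (f \o refl j a) by exact: measurableT_comp.
  rewrite ge0_integralD//; [|by move=> x _; rewrite lee_fin|exact: mE|by move=> x _; rewrite lee_fin|exact: (mE _ mfs)].
  by congr (_ + _)%E; apply: (ge0_integral_mpres (mpres_refl j a) (mE _ mf)) => x; rewrite lee_fin.
have E : (\int[mu]_x (Q x)%:E + \int[mu]_x (Q x)%:E = \int[mu]_x (G x)%:E + \int[mu]_x (G x)%:E)%E.
  rewrite -!dbl//; apply: ae_eq_integral => //.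
  - by apply/measurable_EFinP; apply: measurable_funD => //; exact: (measurableT_comp mQ).
  - by apply/measurable_EFinP; apply: measurable_funD.
  apply: filterS uG => x H _; congr EFin; rewrite /Q /pick /polb /= !reflK !reflE eqxx.
  have [uv|uv|uv] := ltgtP (u x) (u (refl j a x)); last by rewrite H//; case: ifP; case: ifP.
    have [xa|xa|xa] := ltgtP (x ord0 j) a; rewrite /=.
    + by rewrite ltNge (_ : _ <= _ = true) /= ?[G (refl _ _ _) + _]addrC//; apply/idP; lra.
    + by rewrite (_ : _ < a = true) //=; apply/idP; lra.
    + have -> : refl j a x = x by apply: eq_row => k; rewrite reflE; case: eqP => // ->; rewrite xa mulr2n addrK.
      by case: ifP.
  have [xa|xa|xa] := ltgtP (x ord0 j) a; rewrite /=.
  + by rewrite ltNge (_ : _ <= _ = true)//=; apply/idP; lra.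
  + by rewrite (_ : _ < a = true) //= addrC//; apply/idP; lra.
  + have -> : refl j a x = x by apply: eq_row => k; rewrite reflE; case: eqP => // ->; rewrite xa mulr2n addrK.
    by case: ifP.
have q0 : (0 <= \int[mu]_x (Q x)%:E)%E by apply: integral_ge0 => x _; rewrite lee_fin.
have g0 : (0 <= \int[mu]_x (G x)%:E)%E by apply: integral_ge0 => x _; rewrite lee_fin.
move: E q0 g0; case: (integral _ _ (fun x => (Q x)%:E)) => [q||]//; case: (integral _ _ _) => [r||]//.
by rewrite -!EFinD => -[E] _ _; congr EFin; lra.
Qed.

End gradients.

(** * The Gagliardo seminorm under polarization *)

Section power_inequalities.
Context {R : realType}.
Variable p : R.
Hypothesis p1 : 1 < p.

Let p0 : 0 < p. Proof. exact: lt_trans p1. Qed.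

(** Strict Bernoulli inequality. With L = ln y, the strict bound exp z > 1 + z is used at z = (p -
    1) L and at z = -L. *)
Lemma bernoulli_lt (y : R) : 0 <= y -> y != 1 -> p * y - (p - 1) < y `^ p.
Proof.
rewrite le_eqVlt => /predU1P[<- _|y0 y1].
  by rewrite powR0 ?gt_eqF// mulr0 sub0r oppr_lt0 subr_gt0.
set L := ln y; have yE : y = expR L by rewrite /L lnK.
have L0 : L != 0 by apply: contra y1; rewrite /L ln_eq0.
have pL0 : (p - 1) * L != 0 by rewrite mulf_neq0// subr_eq0 gt_eqF.
have -> : y `^ p = expR (L * p) by rewrite expRM -yE.
have H1 : y * (1 + (p - 1) * L) < expR (L * p).
  have -> : L * p = L + (p - 1) * L by ring.
  by rewrite expRD -yE ltr_pM2l// expR_gt1Dx.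
have H2 : y * (1 - L) < 1.
  have := @expR_gt1Dx _ (- L); rewrite oppr_eq0 => /(_ L0); rewrite expRN -yE => H.
  by rewrite -ltr_pdivlMl// mulr1.
have : (p - 1) * (y * (1 - L)) < p - 1 by rewrite gtr_pMr// subr_gt0.
by lra.
Qed.

Lemma tangent_lt (m : R) : exists k, forall t, t != m -> `|m| `^ p + k * (t - m) < `|t| `^ p.
Proof.
have pos : forall m : R, 0 < m -> exists k, forall t, t != m -> `|m| `^ p + k * (t - m) < `|t| `^ p.
  move=> {}m m0; exists (p * m `^ p / m) => t tm; have mn0 := lt0r_neq0 m0.
  rewrite (gtr0_norm m0); have mp := powR_gt0 p m0.
  have -> : m `^ p + p * m `^ p / m * (t - m) = m `^ p * (p * (t / m) - (p - 1)) by field.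
  have [t0|t0] := leP 0 t.
    have -> : `|t| `^ p = m `^ p * (t / m) `^ p.
      by rewrite -powRM ?divr_ge0 ?(ltW m0)// ger0_norm// mulrCA divff// mulr1.
    rewrite ltr_pM2l//; apply: bernoulli_lt; first by rewrite divr_ge0// ltW.
    by apply: contra tm => /eqP E; rewrite -[t](divfK mn0) E mul1r.
  apply: lt_le_trans (powR_ge0 _ _); rewrite pmulr_rlt0//.
  have : t / m < 0 by rewrite pmulr_llt0// invr_gt0.
  by move: p1 p0; nra.
have [m0|m0|->] := ltgtP m 0.
- have := pos (- m); rewrite oppr_gt0 => /(_ m0)[k Hk]; exists (- k) => t tm.
  have := Hk (- t); rewrite eqr_opp => /(_ tm); rewrite !normrN.
  by congr (_ < _); congr (_ + _); ring.
- exact: pos.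
- by exists 0 => t t0; rewrite normr0 powR0 ?gt_eqF// mul0r addr0 powR_gt0// normr_gt0.
Qed.

(** Use the supporting lines of |.|^p at a - b and at a' - b', each at the two crossed differences.
    Weighting the four strict inequalities by a - a' and b - b' makes the slopes cancel. *)
Lemma two_point_lt (a a' b b' : R) : a' < a -> b' < b ->
  `|a - b| `^ p + `|a' - b'| `^ p < `|a - b'| `^ p + `|a' - b| `^ p.
Proof.
move=> a'a b'b; have [k1 H1] := tangent_lt (a - b); have [k2 H2] := tangent_lt (a' - b').
have h1 := H1 (a - b'); have h2 := H1 (a' - b); have h3 := H2 (a - b'); have h4 := H2 (a' - b).
have {}h1 : `|a - b| `^ p + k1 * (b - b') < `|a - b'| `^ p.
  by move: h1; rewrite (_ : a - b' - (a - b) = b - b'); [apply; apply/eqP; lra|ring].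
have {}h2 : `|a - b| `^ p + k1 * (a' - a) < `|a' - b| `^ p.
  by move: h2; rewrite (_ : a' - b - (a - b) = a' - a); [apply; apply/eqP; lra|ring].
have {}h3 : `|a' - b'| `^ p + k2 * (a - a') < `|a - b'| `^ p.
  by move: h3; rewrite (_ : a - b' - (a' - b') = a - a'); [apply; apply/eqP; lra|ring].
have {}h4 : `|a' - b'| `^ p + k2 * (b' - b) < `|a' - b| `^ p.
  by move: h4; rewrite (_ : a' - b - (a' - b') = b' - b); [apply; apply/eqP; lra|ring].
move: h1 h2 h3 h4; set F1 := `|a - b| `^ p; set F2 := `|a' - b'| `^ p.
set X := `|a - b'| `^ p; set Y := `|a' - b| `^ p.
have da : 0 < a - a' by rewrite subr_gt0.
have db : 0 < b - b' by rewrite subr_gt0.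
move=> h1 h2 h3 h4; rewrite -subr_gt0 -(pmulr_rgt0 _ (addr_gt0 da db)).
have e1 : 0 < (a - a') * (X - F1 - k1 * (b - b')) by rewrite mulr_gt0//; lra.
have e2 : 0 < (b - b') * (Y - F1 - k1 * (a' - a)) by rewrite mulr_gt0//; lra.
have e3 : 0 < (b - b') * (X - F2 - k2 * (a - a')) by rewrite mulr_gt0//; lra.
have e4 : 0 < (a - a') * (Y - F2 - k2 * (b' - b)) by rewrite mulr_gt0//; lra.
have -> : (a - a' + (b - b')) * (X + Y - (F1 + F2)) = (a - a') * (X - F1 - k1 * (b - b')) +
  (b - b') * (Y - F1 - k1 * (a' - a)) + (b - b') * (X - F2 - k2 * (a - a')) + (a - a') * (Y - F2 - k2 * (b' - b)) by ring.
lra.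
Qed.

Lemma two_point_le (a a' b b' : R) : a' <= a -> b' <= b ->
  `|a - b| `^ p + `|a' - b'| `^ p <= `|a - b'| `^ p + `|a' - b| `^ p.
Proof.
rewrite le_eqVlt => /predU1P[->|a'a]; first by rewrite addrC.
rewrite le_eqVlt => /predU1P[->//|b'b].
exact/ltW/two_point_lt.
Qed.

(* The value of [K0 (f(a-b) + f(a'-b')) + K1 (f(a'-b) + f(a-b'))], with f = |.|^p,
   minus its value once both pairs have been sorted. *)
Definition quad (K0 K1 a a' b b' : R) : R :=
  K0 * (`|a - b| `^ p + `|a' - b'| `^ p - (`|Num.max a a' - Num.max b b'| `^ p + `|Num.min a a' - Num.min b b'| `^ p)) +
  K1 * (`|a' - b| `^ p + `|a - b'| `^ p - (`|Num.max a a' - Num.min b b'| `^ p + `|Num.min a a' - Num.max b b'| `^ p)).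

(** If both pairs are ordered alike, sorting changes nothing. If not, it exchanges the two groups of
    terms, and the change is (K0 - K1) times the two-point deficit. *)
Lemma quad_ge0 (K0 K1 a a' b b' : R) : K1 <= K0 -> 0 <= quad K0 K1 a a' b b'.
Proof.
move=> KK; rewrite /quad; have [aa|aa] := leP a a'; have [bb|bb] := leP b b'.
- by rewrite [leRHS](_ : _ = 0)//; ring.
- rewrite [leRHS](_ : _ = (K0 - K1) * ((`|a - b| `^ p + `|a' - b'| `^ p) - (`|a' - b| `^ p + `|a - b'| `^ p))); last by ring.
  by rewrite mulr_ge0 ?subr_ge0//; have := two_point_le aa (ltW bb); lra.
- rewrite [leRHS](_ : _ = (K0 - K1) * ((`|a - b| `^ p + `|a' - b'| `^ p) - (`|a' - b| `^ p + `|a - b'| `^ p))); last by ring.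
  by rewrite mulr_ge0 ?subr_ge0//; have := two_point_le (ltW aa) bb; lra.
- by rewrite [leRHS](_ : _ = 0)//; ring.
Qed.

Lemma quad_eq0 (K0 K1 a a' b b' : R) : K1 < K0 -> quad K0 K1 a a' b b' = 0 ->
  0 <= (a - a') * (b - b').
Proof.
move=> KK; rewrite /quad; have [aa|aa] := leP a a'; have [bb|bb] := leP b b' => H.
- by rewrite mulr_le0// subr_le0.
- move: aa; rewrite le_eqVlt => /predU1P[->|aa]; first by rewrite subrr mul0r.
  have KK0 : K0 - K1 != 0 by rewrite subr_eq0 gt_eqF.
  have : (K0 - K1) * ((`|a - b| `^ p + `|a' - b'| `^ p) - (`|a' - b| `^ p + `|a - b'| `^ p)) = 0.
    by rewrite -H; ring.
  by move=> /eqP; rewrite mulf_eq0 (negbTE KK0)/= => /eqP; have := two_point_lt aa bb; lra.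
- move: bb; rewrite le_eqVlt => /predU1P[->|bb]; first by rewrite subrr mulr0.
  have KK0 : K0 - K1 != 0 by rewrite subr_eq0 gt_eqF.
  have : (K0 - K1) * ((`|a - b| `^ p + `|a' - b'| `^ p) - (`|a' - b| `^ p + `|a - b'| `^ p)) = 0.
    by rewrite -H; ring.
  by move=> /eqP; rewrite mulf_eq0 (negbTE KK0)/= => /eqP; have := two_point_lt aa bb; lra.
- by rewrite mulr_ge0// subr_ge0 ltW.
Qed.

Lemma continuous_pow_norm : continuous (fun t : R => `|t| `^ p).
Proof.
move=> x; have [->|x0] := eqVneq x 0.
  rewrite /continuous_at /= normr0 powR0 ?gt_eqF//; apply/cvgrPdist_le => e e0.
  have h0 : 0 < Num.min 1 e by rewrite lt_min ltr01.
  exists (Num.min 1 e) => //= t; rewrite /ball_/= sub0r normrN lt_min => /andP[t1 te].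
  rewrite sub0r normrN ger0_norm ?powR_ge0//; have [->|t0] := eqVneq t 0.
    by rewrite normr0 powR0 ?gt_eqF// ltW.
  apply: (le_trans _ (ltW te)); apply: ge1r_powR; last exact: ltW.
  by rewrite normr_gt0 t0 ltW.
have ax : 0 < `|x| by rewrite normr_gt0.
have cln : {for x, continuous (fun t : R => expR (p * ln `|t|))}.
  apply: (@continuous_comp _ _ _ (fun t : R => p * ln `|t|) expR); last exact: continuous_expR.
  apply: (@cvgM _ _ _ _ (cst p) (fun t : R => ln `|t|)); first exact: cvg_cst.
  apply: (@cvg_comp _ _ _ (fun t : R => `|t|) (@ln R) _ (nbhs `|x|)); first exact: norm_continuous.
  exact: continuous_ln.
have E (t : R) : t != 0 -> expR (p * ln `|t|) = `|t| `^ p by move=> t0; rewrite /powR normr_eq0 (negbTE t0).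
rewrite /continuous_at /= -E//; apply: cvg_trans cln; apply: near_eq_cvg.
exists `|x| => //= t; rewrite /ball/= => xt; rewrite E//.
by apply: contraTneq xt => ->; rewrite subr0 ltxx.
Qed.

Lemma pow_norm_cvg (u : nat -> R) (l : R) : u @ \oo --> l ->
  `|u k| `^ p @[k --> \oo] --> `|l| `^ p.
Proof. by move=> ul; apply: (@cvg_comp _ _ _ u (fun t : R => `|t| `^ p) _ _ _ ul); exact: continuous_pow_norm. Qed.

Lemma maxr_cvg (u v : nat -> R) (l m : R) : u @ \oo --> l -> v @ \oo --> m ->
  Num.max (u k) (v k) @[k --> \oo] --> Num.max l m.
Proof.
move=> ul vm; have E (x y : R) : Num.max x y = 2^-1 * (x + y + `|x - y|).
  by have [xy|xy] := leP x y; [rewrite ler0_norm ?subr_le0//|rewrite gtr0_norm ?subr_gt0//]; field.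
rewrite E; under eq_fun do rewrite E; apply: cvgM; first exact: cvg_cst.
by apply: cvgD; [exact: cvgD|apply: cvg_norm; exact: cvgB].
Qed.

Lemma minr_cvg (u v : nat -> R) (l m : R) : u @ \oo --> l -> v @ \oo --> m ->
  Num.min (u k) (v k) @[k --> \oo] --> Num.min l m.
Proof.
move=> ul vm; have E (x y : R) : Num.min x y = x + y - Num.max x y by have [xy|xy] := leP x y; ring.
rewrite E; under eq_fun do rewrite E; apply: cvgB; [exact: cvgD|exact: maxr_cvg].
Qed.

Lemma quad_cvg (K0 K1 : R) (a a' b b' : nat -> R) (la la' lb lb' : R) : a @ \oo --> la ->
  a' @ \oo --> la' -> b @ \oo --> lb -> b' @ \oo --> lb' ->
  quad K0 K1 (a k) (a' k) (b k) (b' k) @[k --> \oo] --> quad K0 K1 la la' lb lb'.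
Proof.
move=> ha ha' hb hb'; have hM := maxr_cvg ha ha'; have hm := minr_cvg ha ha'.
have hN := maxr_cvg hb hb'; have hn := minr_cvg hb hb'.
by apply: cvgD; apply: cvgM; try exact: cvg_cst; apply: cvgB; apply: cvgD; apply: pow_norm_cvg; exact: cvgB.
Qed.

(** Since (v - t)^p <= (v - t) v^(p-1), the difference v^p - (v - t)^p is at least t v^(p-1). The
    bound is linear in t: this is the order e that beats e^p. *)
Lemma pow_gap (t c v : R) : 0 <= t -> t <= c -> c <= v ->
  t * c `^ (p - 1) <= `|v| `^ p + `|t| `^ p - `|t - v| `^ p.
Proof.
move=> t0 tc cv; have c0 := le_trans t0 tc; have v0 := le_trans c0 cv; have tv := le_trans tc cv.
have q0 : 0 <= p - 1 by rewrite subr_ge0 ltW.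
rewrite (ger0_norm v0) distrC (ger0_norm (_ : 0 <= v - t)) ?subr_ge0//.
rewrite -(mulr_powRB1 v0 p0) -(mulr_powRB1 (_ : 0 <= v - t) p0) ?subr_ge0//.
have h1 : (v - t) * (v - t) `^ (p - 1) <= (v - t) * v `^ (p - 1).
  by rewrite ler_wpM2l ?subr_ge0//; apply: ge0_ler_powR; rewrite ?nnegrE ?subr_ge0//; lra.
have h2 : t * c `^ (p - 1) <= t * v `^ (p - 1).
  by rewrite ler_wpM2l//; apply: ge0_ler_powR; rewrite ?nnegrE.
have h3 := powR_ge0 `|t| p.
lra.
Qed.

Lemma powD_le (a b : R) : `|a + b| `^ p <= 2 `^ p * (`|a| `^ p + `|b| `^ p).
Proof.
have p0' := ltW p0.
have H : `|a + b| <= 2 * Num.max `|a| `|b|.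
  apply: (le_trans (ler_normD _ _)); rewrite mulr2n mulrDl !mul1r.
  by apply: lerD; rewrite le_max lexx ?orbT.
have M0 : 0 <= Num.max `|a| `|b| by rewrite le_max normr_ge0.
apply: (@le_trans _ _ ((2 * Num.max `|a| `|b|) `^ p)).
  by apply: ge0_ler_powR; rewrite ?nnegrE// mulr_ge0.
rewrite powRM// ler_wpM2l ?powR_ge0//; have [ab|ab] := leP `|a| `|b|.
  by rewrite lerDr powR_ge0.
by rewrite lerDl powR_ge0.
Qed.

End power_inequalities.

(** * Double integrals, null sets of products and Fatou *)

Section double_integrals.
Context {R : realType} {n : nat}.
Local Notation V := 'rV[R]_n.
Local Notation VV := (V * V)%type.
Local Notation mu := (@lebesgue_rV R n).
Implicit Types (F G : VV -> R).

Definition DI F : \bar R := (\int[mu \x mu]_z (F z)%:E)%E.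

Lemma DI_ge0 F : (forall z, 0 <= F z) -> (0 <= DI F)%E.
Proof. by move=> F0; apply: integral_ge0 => z _; rewrite lee_fin. Qed.

Lemma DI_iter F : measurable_fun [set: VV] F -> (forall z, 0 <= F z) ->
  DI F = (\int[mu]_x \int[mu]_y (F (x, y))%:E)%E.
Proof.
move=> mF F0; have mF' : measurable_fun [set: VV] (fun z => (F z)%:E) by exact/measurable_EFinP.
by rewrite /DI fubini_tonelli1// => z; rewrite lee_fin.
Qed.

Lemma DI_le F G : measurable_fun [set: VV] F -> measurable_fun [set: VV] G ->
  (forall z, 0 <= F z) -> (forall z, F z <= G z) -> (DI F <= DI G)%E.
Proof.
move=> mF mG F0 FG; apply: ge0_le_integral => //.
- by move=> z _; rewrite lee_fin.
- exact/measurable_EFinP.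
- exact/measurable_EFinP.
- by move=> z _; rewrite lee_fin.
Qed.

Lemma DI_D F G : measurable_fun [set: VV] F -> measurable_fun [set: VV] G ->
  (forall z, 0 <= F z) -> (forall z, 0 <= G z) -> DI (fun z => F z + G z) = (DI F + DI G)%E.
Proof.
move=> mF mG F0 G0; rewrite /DI; under eq_integral do rewrite EFinD.
rewrite ge0_integralD//.
- by move=> z _; rewrite lee_fin.
- exact/measurable_EFinP.
- by move=> z _; rewrite lee_fin.
- exact/measurable_EFinP.
Qed.

Lemma DI_Z (c : R) F : measurable_fun [set: VV] F -> (forall z, 0 <= F z) -> 0 <= c ->
  DI (fun z => c * F z) = (c%:E * DI F)%E.
Proof.
move=> mF F0 c0; rewrite /DI; under eq_integral do rewrite EFinM.
rewrite ge0_integralZl//.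
- exact/measurable_EFinP.
- by move=> z _; rewrite lee_fin.
Qed.

Lemma measurable_map2 (s1 s2 : V -> V) : measurable_fun [set: V] s1 -> measurable_fun [set: V] s2 ->
  measurable_fun [set: VV] (fun z => (s1 z.1, s2 z.2)).
Proof.
move=> m1 m2; apply/measurable_fun_pairP; split.
  by apply: (measurableT_comp m1); exact: measurable_fst.
by apply: (measurableT_comp m2); exact: measurable_snd.
Qed.

Lemma DI_map F (s1 s2 : V -> V) : mpres s1 -> mpres s2 -> measurable_fun [set: VV] F ->
  (forall z, 0 <= F z) -> DI (fun z => F (s1 z.1, s2 z.2)) = DI F.
Proof.
move=> ms1 ms2 mF F0; have mF' : measurable_fun [set: VV] (fun z => (F z)%:E) by exact/measurable_EFinP.
have F0' z : (0 <= (F z)%:E)%E by rewrite lee_fin.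
rewrite !DI_iter//; last first.
  by apply: (measurableT_comp mF); apply: measurable_map2; [exact: ms1.1|exact: ms2.1].
transitivity (\int[mu]_x \int[mu]_y (F (s1 x, y))%:E)%E.
  apply: eq_integral => x _; have mF2 : measurable_fun [set: V] (fun y => (F (s1 x, y))%:E).
    by apply: (measurableT_comp mF'); exact: measurable_pair1.
  by apply: (ge0_integral_mpres ms2 mF2).
have mFF : measurable_fun [set: V] (fun x => \int[mu]_y (F (x, y))%:E)%E.
  exact: (measurable_fun_fubini_tonelli_F (m2 := mu) _ mF' F0').
by apply: (ge0_integral_mpres ms1 mFF) => x; apply: integral_ge0 => y _.
Qed.

Lemma DI_eq0 F : measurable_fun [set: VV] F -> (forall z, 0 <= F z) -> DI F = 0%E ->
  {ae (mu \x mu)%E, forall z, F z = 0}.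
Proof.
move=> mF F0 DF; have mF' : measurable_fun [set: VV] (fun z => (F z)%:E) by exact/measurable_EFinP.
have /(ae_eq_integral_abs (mu \x mu)%E measurableT mF') : (\int[mu \x mu]_z `|(F z)%:E| = 0)%E.
  by rewrite -DF; apply: eq_integral => z _; rewrite gee0_abs// lee_fin.
by apply: filterS => z /(_ Logic.I)[].
Qed.

Lemma ae_fst (P : V -> Prop) : {ae mu, forall x, P x} -> {ae (mu \x mu)%E, forall z : VV, P z.1}.
Proof.
move=> [N [mN N0 PN]]; exists (N `*` [set: V]); split; first exact: measurableX.
- rewrite product_measure1E//; transitivity (0 * mu [set: V])%E; last exact: mul0e.
  by congr (_ * _)%E; exact: N0.
- by move=> z /= Pz; split => //; exact: PN.
Qed.

Lemma ae_snd (P : V -> Prop) : {ae mu, forall x, P x} -> {ae (mu \x mu)%E, forall z : VV, P z.2}.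
Proof.
move=> [N [mN N0 PN]]; exists ([set: V] `*` N); split; first exact: measurableX.
- rewrite product_measure1E//; transitivity (mu [set: V] * 0)%E; last exact: mule0.
  by congr (_ * _)%E; exact: N0.
- by move=> z /= Pz; split => //; exact: PN.
Qed.

(** Fatou for real functions, with an eventual bound up to every e > 0 in place of a lower limit. *)
Lemma fatou_le d (T : measurableType d) (m : {measure set T -> \bar R}) (f : nat -> T -> R) (g : T -> R) (C : \bar R) :
  (forall k, measurable_fun [set: T] (f k)) -> measurable_fun [set: T] g -> (forall k x, 0 <= f k x) ->
  {ae m, forall x, f k x @[k --> \oo] --> g x} ->
  (forall e : R, 0 < e -> \forall k \near \oo, (\int[m]_x (f k x)%:E <= C + e%:E)%E) ->
  (\int[m]_x (g x)%:E <= C)%E.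
Proof.
move=> mf mg f0 fg fC.
have mf' k : measurable_fun [set: T] (fun x => (f k x)%:E) by exact/measurable_EFinP.
have -> : (\int[m]_x (g x)%:E = \int[m]_x limn_einf (fun k => (f k x)%:E))%E.
  apply: ae_eq_integral => //.
  - exact/measurable_EFinP.
  - rewrite /limn_einf; apply: measurableT_comp => //; apply: measurable_fun_limn_esup => k.
    by apply: measurableT_comp => //; exact: mf'.
  apply: filterS fg => x fgx _.
  have H : (f k x)%:E @[k --> \oo] --> (g x)%:E by apply: cvg_EFin; [exact: nearW|exact: fgx].
  by apply/esym; rewrite (cvg_limn_einf_sup H).1.
apply: (le_trans (fatou m measurableT mf' _)); first by move=> k x _; rewrite lee_fin.
apply/lee_addgt0Pr => e e0; have [N _ HN] := fC _ e0.
rewrite limn_einf_lim; apply: lime_le; first exact: is_cvg_einfs.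
exists N => // k /= Nk; apply: (le_trans _ (HN k Nk)); apply: ereal_inf_lbound.
by exists k => //=.
Qed.

End double_integrals.

(** * The kernel, folding by the reflection, and the gaps *)

Section kernel.
Context {R : realType} {n : nat}.
Local Notation V := 'rV[R]_n.
Local Notation VV := (V * V)%type.
Local Notation mu := (@lebesgue_rV R n).

Lemma measurable_enorm : measurable_fun [set: V] (@enorm R n).
Proof.
apply: (measurableT_comp (f := @Num.sqrt R)).
  by apply: continuous_measurable_fun => x; exact: sqrt_continuous.
apply: measurable_sum => i; apply: measurable_funX; exact: measurable_coord_rV.
Qed.

Lemma measurable_subVV : measurable_fun [set: VV] (fun z : VV => z.1 - z.2).
Proof.
apply: measurable_fun_rV => i; under eq_fun do rewrite !mxE.
apply: measurable_funB.
  by apply: (measurableT_comp (measurable_coord_rV i)); exact: measurable_fst.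
by apply: (measurableT_comp (measurable_coord_rV i)); exact: measurable_snd.
Qed.

Lemma enorm_ge0 (x : V) : 0 <= enorm x. Proof. exact: sqrtr_ge0. Qed.

Lemma enorm_sqr (x : V) : enorm x ^+ 2 = \sum_i x ord0 i ^+ 2.
Proof. by rewrite sqr_sqrtr// sumr_ge0// => i _; exact: sqr_ge0. Qed.

Lemma coord_le_enorm (x : V) i : `|x ord0 i| <= enorm x.
Proof.
rewrite -ler_sqr ?nnegrE ?enorm_ge0// enorm_sqr real_normK ?num_real// (bigD1 i)//= lerDl.
by rewrite sumr_ge0// => j _; exact: sqr_ge0.
Qed.

Lemma enorm_eq0 (x : V) : enorm x = 0 -> x = 0.
Proof.
move=> x0; apply: eq_row => i; have := coord_le_enorm x i.
by rewrite x0 normr_le0 mxE => /eqP.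
Qed.

Lemma enormZ (c : R) (x : V) : enorm (c *: x) = `|c| * enorm x.
Proof.
rewrite /enorm -sqrtr_sqr -sqrtrM ?sqr_ge0// mulr_sumr; congr Num.sqrt.
by apply: eq_bigr => i _; rewrite mxE exprMn.
Qed.

Variables (s p : R).

Definition ker (z : VV) : R := (enorm (z.1 - z.2) `^ (n%:R + s * p))^-1.

Lemma ker_ge0 z : 0 <= ker z.
Proof. by rewrite invr_ge0 powR_ge0. Qed.

Lemma measurable_ker : measurable_fun [set: VV] ker.
Proof.
rewrite (_ : ker = (fun z => enorm (z.1 - z.2) `^ (- (n%:R + s * p)))); last first.
  by apply/funext => z; rewrite powRN.
apply: (measurableT_comp (measurable_powR _)).
exact: (measurableT_comp measurable_enorm measurable_subVV).
Qed.

Lemma enorm_subC (x y : V) : enorm (x - y) = enorm (y - x).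
Proof. by rewrite -opprB -scaleN1r enormZ normrN normr1 mul1r. Qed.

Lemma enorm_refl2 j a (x y : V) : enorm (refl j a x - refl j a y) = enorm (x - y).
Proof.
congr Num.sqrt; apply: eq_bigr => i _; rewrite !mxE; case: eqP => // _.
by rewrite -sqrrN; congr (_ ^+ 2); ring.
Qed.

Lemma enorm_refl1 j a (x y : V) : enorm (refl j a x - y) = enorm (x - refl j a y).
Proof. by rewrite -(enorm_refl2 j a) reflK. Qed.

(** The squares of the two distances differ by exactly 4 (a - x_j)(a - y_j). *)
Lemma enorm_refl_lt j a (x y : V) : x ord0 j < a -> y ord0 j < a ->
  enorm (x - y) < enorm (refl j a x - y).
Proof.
move=> xa ya; rewrite -ltr_sqr ?nnegrE ?enorm_ge0// !enorm_sqr.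
rewrite (bigD1 j)//= [ltRHS](bigD1 j)//= !mxE eqxx.
rewrite (eq_bigr (fun i => (refl j a x - y) ord0 i ^+ 2)) ?ltrD2r; last first.
  by move=> i ij; rewrite !mxE (negbTE ij).
rewrite -subr_gt0 [ltRHS](_ : _ = 4 * ((a - x ord0 j) * (a - y ord0 j))); last by ring.
by rewrite mulr_gt0// mulr_gt0// subr_gt0.
Qed.

Lemma enorm_refl_le j a (x y : V) : x ord0 j <= a -> y ord0 j <= a ->
  enorm (x - y) <= enorm (refl j a x - y).
Proof.
move=> xa ya; rewrite -ler_sqr ?nnegrE ?enorm_ge0// !enorm_sqr.
rewrite (bigD1 j)//= [leRHS](bigD1 j)//= !mxE eqxx.
rewrite (eq_bigr (fun i => (refl j a x - y) ord0 i ^+ 2)) ?lerD2r; last first.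
  by move=> i ij; rewrite !mxE (negbTE ij).
rewrite -subr_ge0 [leRHS](_ : _ = 4 * ((a - x ord0 j) * (a - y ord0 j))); last by ring.
by rewrite mulr_ge0// mulr_ge0// subr_ge0.
Qed.

Hypotheses (p1 : 1 < p) (s0 : 0 < s).

Lemma kexp_gt0 : 0 < n%:R + s * p.
Proof. by rewrite ltr_wpDl// mulr_gt0// (lt_trans _ p1). Qed.

(** Points on one side of the mirror are closer to each other than to reflected ones. The diagonal
    must be excluded: [ker] is 0 there, because 0^-1 = 0. *)
Lemma ker_refl_le j a (x y : V) : x != y -> x ord0 j <= a -> y ord0 j <= a ->
  ker (refl j a x, y) <= ker (x, y).
Proof.
move=> xy xa ya; have k0 := kexp_gt0.
have e0 : 0 < enorm (x - y).
  by rewrite lt_neqAle enorm_ge0 andbT eq_sym; apply: contra xy => /eqP/enorm_eq0/eqP; rewrite subr_eq0.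
have e1 := enorm_refl_le xa ya.
rewrite /ker/= lef_pV2 ?posrE ?powR_gt0//; last exact: lt_le_trans e1.
by apply: ge0_ler_powR; rewrite ?nnegrE ?enorm_ge0// ltW.
Qed.

Lemma ker_refl_lt j a (x y : V) : x != y -> x ord0 j < a -> y ord0 j < a ->
  ker (refl j a x, y) < ker (x, y).
Proof.
move=> xy xa ya; have k0 := kexp_gt0.
have e0 : 0 < enorm (x - y).
  by rewrite lt_neqAle enorm_ge0 andbT eq_sym; apply: contra xy => /eqP/enorm_eq0/eqP; rewrite subr_eq0.
have e1 := enorm_refl_lt xa ya.
rewrite /ker/= ltf_pV2 ?posrE ?powR_gt0//; last exact: lt_trans e1.
by apply: gt0_ltr_powR; rewrite ?nnegrE ?enorm_ge0.
Qed.

Implicit Types u v : V -> R.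

Definition gag u (z : VV) : R := `|u z.1 - u z.2| `^ p * ker z.

Lemma gag_ge0 u z : 0 <= gag u z.
Proof. by rewrite mulr_ge0 ?powR_ge0 ?ker_ge0. Qed.

Lemma measurable_pow_norm d (T : measurableType d) (f : T -> R) : measurable_fun [set: T] f ->
  measurable_fun [set: T] (fun x => `|f x| `^ p).
Proof.
by move=> mf; apply: (measurableT_comp (measurable_powR _)); exact: measurableT_comp.
Qed.

Lemma measurable_dif u : measurable_fun [set: V] u -> measurable_fun [set: VV] (fun z : VV => u z.1 - u z.2).
Proof.
move=> mu_; apply: measurable_funB; apply: (measurableT_comp mu_); [exact: measurable_fst|exact: measurable_snd].
Qed.

Lemma measurable_gag u : measurable_fun [set: V] u -> measurable_fun [set: VV] (gag u).
Proof.
move=> mu_; apply: measurable_funM; last exact: measurable_ker.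
by apply: measurable_pow_norm; exact: measurable_dif.
Qed.

Lemma gagliardoE u : measurable_fun [set: V] u -> (gagliardo s p u `^ p)%E = DI (gag u).
Proof.
move=> mu_; have p0 : p != 0 by rewrite gt_eqF// (lt_trans _ p1).
rewrite DI_iter; [|exact: measurable_gag|exact: gag_ge0].
rewrite /gagliardo -poweRrM mulVf// poweRe1//.
by apply: integral_ge0 => x _; apply: integral_ge0 => y _; rewrite lee_fin divr_ge0 ?powR_ge0.
Qed.

Lemma measurable_quad d (T : measurableType d) (K0 K1 f f' g g' : T -> R) :
  measurable_fun [set: T] K0 -> measurable_fun [set: T] K1 -> measurable_fun [set: T] f ->
  measurable_fun [set: T] f' -> measurable_fun [set: T] g -> measurable_fun [set: T] g' ->
  measurable_fun [set: T] (fun z => quad p (K0 z) (K1 z) (f z) (f' z) (g z) (g' z)).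
Proof.
move=> m0 m1 mf mf' mg mg'; have mM := measurable_maxr mf mf'; have mm := measurable_minr mf mf'.
have mN := measurable_maxr mg mg'; have mn := measurable_minr mg mg'.
have mP (h k : T -> R) : measurable_fun [set: T] h -> measurable_fun [set: T] k ->
    measurable_fun [set: T] (fun x => `|h x - k x| `^ p).
  by move=> mh mk; apply: measurable_pow_norm; exact: measurable_funB.
have mPB (h k h' k' h2 k2 h3 k3 : T -> R) : measurable_fun [set: T] h -> measurable_fun [set: T] k ->
    measurable_fun [set: T] h' -> measurable_fun [set: T] k' -> measurable_fun [set: T] h2 ->
    measurable_fun [set: T] k2 -> measurable_fun [set: T] h3 -> measurable_fun [set: T] k3 ->
    measurable_fun [set: T] (fun x => `|h x - k x| `^ p + `|h' x - k' x| `^ p - (`|h2 x - k2 x| `^ p + `|h3 x - k3 x| `^ p)).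
  by move=> *; apply: measurable_funB; apply: measurable_funD; exact: mP.
exact: (measurable_funD (measurable_funM m0 (mPB _ _ _ _ _ _ _ _ mf mg mf' mg' mM mN mm mn))
  (measurable_funM m1 (mPB _ _ _ _ _ _ _ _ mf' mg mf mg' mM mn mm mN))).
Qed.

Lemma quad_same (K0 K1 b b' : R) : quad p K0 K1 b b' b b' = 0.
Proof. by rewrite /quad; have [bb|bb] := leP b b'; ring. Qed.

Section folding.
Variables (j : 'I_n) (a : R).
Local Notation sig := (refl j a).

Let id_mpres : mpres (@id V).
Proof. by split => //; exact: measurable_id. Qed.

(* Sums over the four images of z, so that polarization acts pointwise on fold. *)
Definition fold4 (G : VV -> R) (z : VV) : R :=
  G z + G (sig z.1, z.2) + G (z.1, sig z.2) + G (sig z.1, sig z.2).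

Lemma fold4C1 G x y : fold4 G (sig x, y) = fold4 G (x, y).
Proof. by rewrite /fold4 /= reflK; ring. Qed.

Lemma fold4C2 G x y : fold4 G (x, sig y) = fold4 G (x, y).
Proof. by rewrite /fold4 /= reflK; ring. Qed.

Lemma fold4_ge0 G z : (forall z, 0 <= G z) -> 0 <= fold4 G z.
Proof. by move=> G0; rewrite /fold4 !addr_ge0. Qed.

Lemma measurable_fold4 (G : VV -> R) : measurable_fun [set: VV] G ->
  [/\ measurable_fun [set: VV] (fun z => G (sig z.1, z.2)),
    measurable_fun [set: VV] (fun z => G (z.1, sig z.2)),
    measurable_fun [set: VV] (fun z => G (sig z.1, sig z.2)) & measurable_fun [set: VV] (fold4 G)].
Proof.
move=> mG; have ms : measurable_fun [set: V] sig by have [] := mpres_refl j a.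
have mi : measurable_fun [set: V] (@id V) by exact: measurable_id.
have m1 : measurable_fun [set: VV] (fun z => G (sig z.1, z.2)).
  by apply: (measurableT_comp mG); exact: (measurable_map2 ms mi).
have m2 : measurable_fun [set: VV] (fun z => G (z.1, sig z.2)).
  by apply: (measurableT_comp mG); exact: (measurable_map2 mi ms).
have m3 : measurable_fun [set: VV] (fun z => G (sig z.1, sig z.2)).
  by apply: (measurableT_comp mG); exact: (measurable_map2 ms ms).
split => //; exact: (measurable_funD (measurable_funD (measurable_funD mG m1) m2) m3).
Qed.

Lemma DI_fold4 (G : VV -> R) : measurable_fun [set: VV] G -> (forall z, 0 <= G z) ->
  DI (fold4 G) = (4%:E * DI G)%E.
Proof.
move=> mG G0; have ms := mpres_refl (R := R) j a; have [m1 m2 m3 _] := measurable_fold4 mG.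
have m01 := measurable_funD mG m1; have m02 := measurable_funD m01 m2.
rewrite /fold4 (DI_D m02 m3) ?(DI_D m01 m2) ?(DI_D mG m1)//; try by move=> z; rewrite ?addr_ge0.
rewrite (DI_map ms id_mpres mG G0) (DI_map id_mpres ms mG G0) (DI_map ms ms mG G0).
have D0 := DI_ge0 G0; move: D0; case: (DI G) => [r||]//=; last by rewrite mulry gtr0_sg// mul1e.
by rewrite lee_fin => r0; rewrite -EFinM -!EFinD; congr EFin; ring.
Qed.

Definition fold u : VV -> R := fold4 (gag u).

Lemma fold_ge0 u z : 0 <= fold u z.
Proof. by apply: fold4_ge0; exact: gag_ge0. Qed.

Lemma measurable_fold u : measurable_fun [set: V] u -> measurable_fun [set: VV] (fold u).
Proof. by move=> mu_; have [] := measurable_fold4 (measurable_gag mu_). Qed.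

Lemma DI_fold u : measurable_fun [set: V] u -> DI (fold u) = (4%:E * DI (gag u))%E.
Proof. by move=> mu_; apply: DI_fold4; [exact: measurable_gag|exact: gag_ge0]. Qed.

Lemma foldE u x y : fold u (x, y) =
  ker (x, y) * (`|u x - u y| `^ p + `|u (sig x) - u (sig y)| `^ p) +
  ker (sig x, y) * (`|u (sig x) - u y| `^ p + `|u x - u (sig y)| `^ p).
Proof.
have k1 : ker (x, sig y) = ker (sig x, y) by rewrite /ker/= enorm_refl1.
have k2 : ker (sig x, sig y) = ker (x, y) by rewrite /ker/= enorm_refl2.
rewrite /fold /fold4 /gag /= k1 k2.
by move: (ker _) (ker _) (powR _ _) (powR _ _) (powR _ _) (powR _ _) => *; ring.
Qed.

Lemma polar_max u (x : V) : x ord0 j <= a -> polar j a u x = Num.max (u x) (u (sig x)).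
Proof.
rewrite /polar /pick /polb le_eqVlt => /predU1P[xa|->]; last by case: leP.
have -> : sig x = x by apply: eq_row => k; rewrite reflE; case: eqP => // ->; rewrite xa mulr2n addrK.
by rewrite maxxx /= /refl; case: ifP => //= _; congr u; apply: eq_row => k; rewrite reflE; case: eqP => // ->; rewrite xa mulr2n addrK.
Qed.

Lemma polar_min u (x : V) : x ord0 j <= a -> polar j a u (sig x) = Num.min (u x) (u (sig x)).
Proof.
rewrite /polar /pick /polb /= reflK reflE eqxx le_eqVlt => /predU1P[xa|xa].
  have -> : sig x = x by apply: eq_row => k; rewrite reflE; case: eqP => // ->; rewrite xa mulr2n addrK.
  by rewrite minxx; case: ifP.
by rewrite (_ : _ < a = false) /=; [case: ltgtP => // ->; case: ifP|apply/negbTE; rewrite -leNgt; lra].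
Qed.

Definition gap u (z : VV) : R := quad p (ker z) (ker (sig z.1, z.2)) (u z.1) (u (sig z.1)) (u z.2) (u (sig z.2)).

(** On the side of the maximum, polarization sorts the pairs of values at x and at y. The fold
    groups the terms by the direct kernel and the crossed one, which are the [K0] and [K1] of
    [quad]. *)
Lemma fold_polar u (x y : V) : x ord0 j <= a -> y ord0 j <= a ->
  fold u (x, y) = fold (polar j a u) (x, y) + gap u (x, y).
Proof.
by move=> xa ya; rewrite !foldE /gap /quad /= !(polar_max _ xa, polar_max _ ya, polar_min _ xa, polar_min _ ya); ring.
Qed.

Lemma gap_ge0 u (x y : V) : x ord0 j <= a -> y ord0 j <= a -> 0 <= gap u (x, y).
Proof.
(* On the diagonal the kernels are not ordered as required, but there [quad] vanishes
   identically. *)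
move=> xa ya; have [->|xy] := eqVneq x y; last by apply: quad_ge0 => //; exact: ker_refl_le.
by rewrite /gap /= quad_same.
Qed.

(** The fold is invariant under reflecting either variable, so both points can be brought to the
    side where [fold_polar] holds. *)
Lemma fold_polar_le u z : fold (polar j a u) z <= fold u z.
Proof.
have low (x y : V) : x ord0 j <= a -> y ord0 j <= a -> fold (polar j a u) (x, y) <= fold u (x, y).
  by move=> xa ya; rewrite (fold_polar u xa ya) lerDl gap_ge0.
have refl_le (x : V) : a < x ord0 j -> sig x ord0 j <= a by move=> xa; rewrite reflE eqxx; lra.
case: z => x y; have [xa|xa] := leP (x ord0 j) a; have [ya|ya] := leP (y ord0 j) a.
- exact: low.
- by rewrite -[leLHS]fold4C2 -[leRHS]fold4C2; apply: low => //; exact: refl_le.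
- by rewrite -[leLHS]fold4C1 -[leRHS]fold4C1; apply: low => //; exact: refl_le.
- by rewrite -[leLHS]fold4C1 -[leRHS]fold4C1 -[leLHS]fold4C2 -[leRHS]fold4C2; apply: low; exact: refl_le.
Qed.

Definition half2 (z : VV) : bool := (z.1 ord0 j < a) && (z.2 ord0 j < a).

(** The gap restricted to one of the four products of half-spaces. This part already forces the sign
    information needed when it vanishes. *)
Definition hgap u (z : VV) : R := (half2 z)%:R * gap u z.

Lemma hgap_ge0 u z : 0 <= hgap u z.
Proof.
rewrite /hgap /half2; case: z => x y /=; have [xa|] := ltP (x ord0 j) a; last by rewrite mul0r.
have [ya|] := ltP (y ord0 j) a; last by rewrite mul0r.
by rewrite mul1r gap_ge0// ltW.
Qed.

Lemma hgap_le u z : fold (polar j a u) z + hgap u z <= fold u z.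
Proof.
rewrite /hgap /half2; case: z => x y /=; have [xa|] := ltP (x ord0 j) a; last by rewrite mul0r addr0 fold_polar_le.
have [ya|] := ltP (y ord0 j) a; last by rewrite mul0r addr0 fold_polar_le.
by rewrite mul1r (fold_polar u (ltW xa) (ltW ya)).
Qed.

Lemma measurable_hgap u : measurable_fun [set: V] u -> measurable_fun [set: VV] (hgap u).
Proof.
move=> mu_; have ms : measurable_fun [set: V] sig by have [] := mpres_refl j a.
have mus : measurable_fun [set: V] (u \o sig) by exact: measurableT_comp.
have m1 : measurable_fun [set: VV] (fun z : VV => u z.1) by apply: (measurableT_comp mu_); exact: measurable_fst.
have m2 : measurable_fun [set: VV] (fun z : VV => u z.2) by apply: (measurableT_comp mu_); exact: measurable_snd.
have m1s : measurable_fun [set: VV] (fun z : VV => u (sig z.1)) by apply: (measurableT_comp mus); exact: measurable_fst.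
have m2s : measurable_fun [set: VV] (fun z : VV => u (sig z.2)) by apply: (measurableT_comp mus); exact: measurable_snd.
have mi : measurable_fun [set: V] (@id V) by exact: measurable_id.
have mk := measurable_ker; have mks : measurable_fun [set: VV] (fun z => ker (sig z.1, z.2)).
  by apply: (measurableT_comp mk); exact: (measurable_map2 ms mi).
have mh : measurable_fun [set: V] (fun x : V => (x ord0 j < a)%R%:R : R).
  by apply: measurable_indb; exact: measurable_half.
apply: measurable_funM.
  rewrite (_ : (fun z => _) = (fun z : VV => (z.1 ord0 j < a)%R%:R * (z.2 ord0 j < a)%R%:R)).
    apply: measurable_funM; apply: (measurableT_comp mh); [exact: measurable_fst|exact: measurable_snd].
  by apply/funext => z; rewrite /half2; case: (_ < _); case: (_ < _); rewrite /= ?(mul0r,mul1r).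
exact: (measurable_quad mk mks m1 m1s m2 m2s).
Qed.

Lemma DI_polar u : measurable_fun [set: V] u -> measurable_fun [set: V] (polar j a u) ->
  (4%:E * DI (gag (polar j a u)) + DI (hgap u) <= 4%:E * DI (gag u))%E.
Proof.
move=> mu_ mP; have mh := measurable_hgap mu_; have mfP := measurable_fold mP.
rewrite -(DI_fold mP) -(DI_fold mu_) -(DI_D mfP mh (fold_ge0 _) (hgap_ge0 _)).
apply: DI_le.
- exact: measurable_funD.
- exact: measurable_fold.
- by move=> z; rewrite addr_ge0 ?fold_ge0 ?hgap_ge0.
- exact: hgap_le.
Qed.

Lemma hgap_eq0 u (x y : V) : x != y -> x ord0 j < a -> y ord0 j < a -> hgap u (x, y) = 0 ->
  0 <= (u x - u (sig x)) * (u y - u (sig y)).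
Proof.
move=> xy xa ya; rewrite /hgap /half2 /= xa ya mul1r; apply: quad_eq0 => //.
exact: ker_refl_lt.
Qed.

End folding.

(* Replacing (u, v) by (max, min) is a polarization without cross terms. *)
Definition mgap u v (z : VV) : R := quad p (ker z) 0 (u z.1) (v z.1) (u z.2) (v z.2).

Lemma mgap_ge0 u v z : 0 <= mgap u v z.
Proof. by apply: quad_ge0 => //; exact: ker_ge0. Qed.

Lemma measurable_fstf u : measurable_fun [set: V] u -> measurable_fun [set: VV] (fun z : VV => u z.1).
Proof. by move=> mu_; apply: (measurableT_comp mu_); exact: measurable_fst. Qed.

Lemma measurable_sndf u : measurable_fun [set: V] u -> measurable_fun [set: VV] (fun z : VV => u z.2).
Proof. by move=> mu_; apply: (measurableT_comp mu_); exact: measurable_snd. Qed.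

Lemma measurable_mgap u v : measurable_fun [set: V] u -> measurable_fun [set: V] v ->
  measurable_fun [set: VV] (mgap u v).
Proof.
move=> mu_ mv; exact: (measurable_quad measurable_ker (measurable_cst _) (measurable_fstf mu_)
  (measurable_fstf mv) (measurable_sndf mu_) (measurable_sndf mv)).
Qed.

Lemma gag_maxmin u v z :
  gag (pick (fun x => v x <= u x) u v) z + gag (pick (fun x => v x <= u x) v u) z + mgap u v z =
  gag u z + gag v z.
Proof.
have M x : pick (fun x => v x <= u x) u v x = Num.max (u x) (v x) by rewrite /pick; case: leP.
have m x : pick (fun x => v x <= u x) v u x = Num.min (u x) (v x) by rewrite /pick; case: leP.
rewrite /gag !M !m /mgap /quad mul0r addr0.
by move: (ker _) (powR _ _) (powR _ _) (powR _ _) (powR _ _) => *; ring.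
Qed.

Lemma measurable_pick (b : V -> bool) u v : measurable [set x | b x] -> measurable_fun [set: V] u ->
  measurable_fun [set: V] v -> measurable_fun [set: V] (pick b u v).
Proof.
move=> mb mu_ mv; have mib := measurable_indb mb.
rewrite (_ : pick b u v = (fun x => (b x)%:R * u x + (1 - (b x)%:R) * v x)).
  by apply: measurable_funD; apply: measurable_funM => //; exact: measurable_funB.
by apply/funext => x; rewrite /pick; case: (b x) => /=; ring.
Qed.

Lemma DI_maxmin u v : measurable_fun [set: V] u -> measurable_fun [set: V] v ->
  (DI (gag (pick (fun x => v x <= u x)%R u v)) + DI (gag (pick (fun x => v x <= u x)%R v u)) + DI (mgap u v) =
  DI (gag u) + DI (gag v))%E.
Proof.
move=> mu_ mv; have mb := measurable_leb mu_ mv.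
have m1 := measurable_gag (measurable_pick mb mu_ mv).
have m2 := measurable_gag (measurable_pick mb mv mu_).
have m12 := measurable_funD m1 m2; have m3 := measurable_mgap mu_ mv.
rewrite -(DI_D m1 m2 (gag_ge0 _) (gag_ge0 _)) -(DI_D m12 m3 _ (mgap_ge0 _ _)); last first.
  by move=> z; rewrite addr_ge0 ?gag_ge0.
rewrite -(DI_D (measurable_gag mu_) (measurable_gag mv) (gag_ge0 _) (gag_ge0 _)); congr DI.
by apply/funext => z; rewrite gag_maxmin.
Qed.

Lemma gag_abs_le u z : gag (fun x => `|u x|) z <= gag u z.
Proof.
rewrite /gag ler_wpM2r ?ker_ge0//; apply: ge0_ler_powR; rewrite ?nnegrE ?ler_dist_dist//.
by rewrite ltW// (lt_trans _ p1).
Qed.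

Lemma gag_scale (c : R) u z : gag (fun x => c * u x) z = `|c| `^ p * gag u z.
Proof. by rewrite /gag -mulrBr normrM powRM// mulrA. Qed.

End kernel.

(** * Energies of admissible functions *)

Section admissible.
Context {R : realType} {n : nat}.
Local Notation V := 'rV[R]_n.
Local Notation VV := (V * V)%type.
Local Notation mu := (@lebesgue_rV R n).
Variables (s p : R).
Hypotheses (p1 : 1 < p) (s0 : 0 < s).
Implicit Types (u v : V -> R) (g h : V -> V) (Omega : set V).

Let p0 : 0 < p. Proof. exact: lt_trans p1. Qed.

Lemma int_D (f f' : V -> R) : measurable_fun [set: V] f -> measurable_fun [set: V] f' ->
  (forall x, 0 <= f x) -> (forall x, 0 <= f' x) ->
  (\int[mu]_x (f x + f' x)%:E = \int[mu]_x (f x)%:E + \int[mu]_x (f' x)%:E)%E.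
Proof.
move=> mf mf' f0 f0'; under eq_integral do rewrite EFinD.
rewrite ge0_integralD//.
- by move=> z _; rewrite lee_fin.
- exact/measurable_EFinP.
- by move=> z _; rewrite lee_fin.
- exact/measurable_EFinP.
Qed.

Lemma int_Z (c : R) (f : V -> R) : measurable_fun [set: V] f -> (forall x, 0 <= f x) -> 0 <= c ->
  (\int[mu]_x (c * f x)%:E = c%:E * \int[mu]_x (f x)%:E)%E.
Proof.
move=> mf f0 c0; under eq_integral do rewrite EFinM.
rewrite ge0_integralZl//.
- exact/measurable_EFinP.
- by move=> z _; rewrite lee_fin.
Qed.

Lemma adde_lty (x y : \bar R) : (0 <= x -> 0 <= y -> x + y < +oo -> x < +oo /\ y < +oo)%E.
Proof.
by move=> x0 y0 xy; split; apply: le_lt_trans xy; [exact: leeDl|exact: leeDr].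
Qed.

Lemma adde_rearrange (A A' B B' D X X' Y Y' : \bar R) : (A + A' = X + X' -> B + B' + D = Y + Y' ->
  A + B + (A' + B') + D = X + Y + (X' + Y'))%E.
Proof. by move=> H1 H2; rewrite addeACA H1 -addeA H2 addeACA. Qed.

Definition Lp u : \bar R := (\int[mu]_x (`|u x| `^ p)%:E)%E.
Definition Loc g : \bar R := (\int[mu]_x (enorm (g x) `^ p)%:E)%E.
Lemma Lp_ge0 u : (0 <= Lp u)%E.
Proof. by apply: integral_ge0 => x _; rewrite lee_fin powR_ge0. Qed.

Lemma Loc_ge0 g : (0 <= Loc g)%E.
Proof. by apply: integral_ge0 => x _; rewrite lee_fin powR_ge0. Qed.

Lemma isgrad_measurable u g : isgrad u g -> measurable_fun [set: V] u.
Proof. by move=> [/LI_measurable]. Qed.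

Lemma isgrad_measurable_grad u g : isgrad u g -> measurable_fun [set: V] g.
Proof. by move=> [_ ug]; apply: measurable_fun_rV => i; have [/LI_measurable] := ug i. Qed.

Lemma measurable_enorm_pow g : measurable_fun [set: V] g ->
  measurable_fun [set: V] (fun x => enorm (g x) `^ p).
Proof.
move=> mg; apply: (measurableT_comp (measurable_powR _)).
exact: (measurableT_comp measurable_enorm mg).
Qed.

Lemma isgrad_weak_gradient u g : isgrad u g -> isgrad u (weak_gradient u).
Proof.
move=> ug; have /isgradE ug' := ug; apply/isgradE.
exact: (@xgetPex _ (cst 0) [set g | is_weak_gradient u g] (ex_intro _ g ug')).
Qed.

Lemma Lnorm_Lp u : ('N[mu]_p%:E [EFin \o u] `^ p)%E = Lp u.
Proof.
rewrite poweR_Lnorm ?gt_eqF//; by apply: eq_integral.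
Qed.

Lemma Lnorm_patch_Lp Omega u : measurable Omega -> measurable_fun [set: V] u ->
  {ae mu, forall x, ~ Omega x -> u x = 0} ->
  ('N[mu]_p%:E [(EFin \o u) \_ Omega] `^ p)%E = Lp u.
Proof.
move=> mO mu_ u0; rewrite poweR_Lnorm ?gt_eqF// epatch_indic; apply: ae_eq_integral => //.
- apply: (measurableT_comp (measurable_poweR _)); apply: measurableT_comp => //.
  by apply: emeasurable_funM; apply/measurable_EFinP.
- by apply/measurable_EFinP; exact: measurable_pow_norm.
- apply: filterS u0 => x E _ /=; rewrite indicE; have [Ox|Ox] := pselect (Omega x).
    by rewrite mem_set// mulr1.
  by rewrite memNset// mulr0 E.
Qed.

Lemma enorm0 : enorm (0 : V) = 0.
Proof. by rewrite -(scale0r (0 : V)) enormZ normr0 mul0r. Qed.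

(** Restricting the gradient to Omega loses nothing: outside, [u] vanishes a.e., hence so does its
    gradient by [isgrad_zero], with no condition on the boundary of Omega. *)
Lemma Lnorm_patch_grad Omega u g : measurable Omega -> isgrad u g ->
  {ae mu, forall x, ~ Omega x -> u x = 0} ->
  ('N[mu]_p%:E [(grad_norm u) \_ Omega] `^ p)%E = Loc g.
Proof.
move=> mO ug u0; have ug' := isgrad_weak_gradient ug.
have mg := isgrad_measurable_grad ug; have mg' := isgrad_measurable_grad ug'.
rewrite poweR_Lnorm ?gt_eqF// epatch_indic; apply: ae_eq_integral => //.
- apply: (measurableT_comp (measurable_poweR _)); apply: measurableT_comp => //.
  apply: emeasurable_funM; apply/measurable_EFinP => //.
  exact: (measurableT_comp measurable_enorm mg').
- by apply/measurable_EFinP; exact: measurable_enorm_pow.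
- have := isgrad_zero ug; have := isgrad_unique ug' ug.
  apply: filterS3 u0 => x E1 E2 E3 _ /=; rewrite indicE; have [Ox|Ox] := pselect (Omega x).
    by rewrite mem_set// mulr1 E2 ger0_norm ?enorm_ge0.
  by rewrite memNset// mulr0 E3 ?E1// enorm0 normr0.
Qed.

Lemma grad_norm_Loc u g : isgrad u g -> ('N[mu]_p%:E [grad_norm u] `^ p)%E = Loc g.
Proof.
move=> ug; have := @Lnorm_patch_grad setT u g measurableT ug (aeW _ (fun x H => False_ind _ (H Logic.I))).
by rewrite patch_setT.
Qed.

Lemma Lp_scale (c : R) u : measurable_fun [set: V] u ->
  Lp (fun x => c * u x) = ((`|c| `^ p)%:E * Lp u)%E.
Proof.
move=> mu_; rewrite /Lp -(int_Z (measurable_pow_norm p mu_) (fun x => powR_ge0 _ _) (powR_ge0 _ _)).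
by apply: eq_integral => x _; rewrite normrM powRM.
Qed.

Lemma Loc_scale (c : R) g : measurable_fun [set: V] g ->
  Loc (fun x => c *: g x) = ((`|c| `^ p)%:E * Loc g)%E.
Proof.
move=> mg; rewrite /Loc -(int_Z (measurable_enorm_pow mg) (fun x => powR_ge0 _ _) (powR_ge0 _ _)).
by apply: eq_integral => x _; rewrite enormZ powRM// enorm_ge0.
Qed.

Lemma Lp_pick_sum (b : V -> bool) u v : measurable [set x | b x] -> measurable_fun [set: V] u ->
  measurable_fun [set: V] v -> (Lp (pick b u v) + Lp (pick b v u) = Lp u + Lp v)%E.
Proof.
move=> mb mu_ mv; have m1 := measurable_pick mb mu_ mv; have m2 := measurable_pick mb mv mu_.
have P0 (k : V -> R) x : 0 <= `|k x| `^ p by exact: powR_ge0.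
transitivity (\int[mu]_x (`|pick b u v x| `^ p + `|pick b v u x| `^ p)%:E)%E.
  by apply/esym; exact: (int_D (measurable_pow_norm p m1) (measurable_pow_norm p m2) (P0 _) (P0 _)).
transitivity (\int[mu]_x (`|u x| `^ p + `|v x| `^ p)%:E)%E.
  by apply: eq_integral => x _; rewrite /pick; case: (b x) => //; rewrite addrC.
exact: (int_D (measurable_pow_norm p mu_) (measurable_pow_norm p mv) (P0 _) (P0 _)).
Qed.

Lemma Loc_pick_sum (b : V -> bool) g h : measurable_fun [set: V] g -> measurable_fun [set: V] h ->
  measurable_fun [set: V] (pick b g h) -> measurable_fun [set: V] (pick b h g) ->
  (Loc (pick b g h) + Loc (pick b h g) = Loc g + Loc h)%E.
Proof.
move=> mg mh m1 m2.
have P0 (k : V -> V) x : 0 <= enorm (k x) `^ p by exact: powR_ge0.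
transitivity (\int[mu]_x (enorm (pick b g h x) `^ p + enorm (pick b h g x) `^ p)%:E)%E.
  by apply/esym; exact: (int_D (measurable_enorm_pow m1) (measurable_enorm_pow m2) (P0 _) (P0 _)).
transitivity (\int[mu]_x (enorm (g x) `^ p + enorm (h x) `^ p)%:E)%E.
  by apply: eq_integral => x _; rewrite /pick; case: (b x) => //; rewrite addrC.
exact: (int_D (measurable_enorm_pow mg) (measurable_enorm_pow mh) (P0 _) (P0 _)).
Qed.

Lemma Lp_norm u : Lp (fun x => `|u x|) = Lp u.
Proof. by rewrite /Lp; under eq_integral do rewrite normr_id. Qed.

Lemma Loc_sg_le u g : measurable_fun [set: V] g ->
  measurable_fun [set: V] (fun x => Num.sg (u x) *: g x) ->
  (Loc (fun x => Num.sg (u x) *: g x)%R <= Loc g)%E.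
Proof.
move=> mg mg'; apply: ge0_le_integral => //.
- by move=> x _; rewrite lee_fin powR_ge0.
- by apply/measurable_EFinP; exact: measurable_enorm_pow.
- by apply/measurable_EFinP; exact: measurable_enorm_pow.
- move=> x _; rewrite lee_fin; apply: ge0_ler_powR; rewrite ?nnegrE ?enorm_ge0//; first exact: ltW.
  by rewrite enormZ ler_piMl ?enorm_ge0// normr_sg_le1.
Qed.

Lemma Lp_polar j a u g : isgrad u g -> Lp (polar j a u) = Lp u.
Proof.
move=> ug; rewrite /Lp -(@pick_integral _ _ (fun x => `|u x| `^ p) j a u g ug).
- by apply: eq_integral => x _; rewrite /polar /pick /=; case: ifP.
- by apply: measurable_pow_norm; exact: isgrad_measurable ug.
- by move=> x; exact: powR_ge0.
- by apply: aeW => x ->.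
Qed.

Lemma Loc_polar j a u g : isgrad u g -> Loc (polar_grad j a u g) = Loc g.
Proof.
move=> ug; rewrite /Loc -(@pick_integral _ _ (fun x => enorm (g x) `^ p) j a u g ug).
- by apply: eq_integral => x _; rewrite /polar_grad /pick /=; case: ifP => // _; rewrite enorm_rowrefl.
- by apply: measurable_enorm_pow; exact: isgrad_measurable_grad ug.
- by move=> x; exact: powR_ge0.
- apply: filterS (isgrad_diff_zero ug (isgrad_refl j a ug)) => x H /H ->.
  by rewrite enorm_rowrefl.
Qed.

Opaque Lp Loc DI.

Definition energy u g : \bar R := (Loc g + DI (gag s p u))%E.

Lemma energy_mul (c : R) u g :
  (c%:E * energy u g = c%:E * Loc g + c%:E * DI (gag s p u))%E.
Proof. exact: (ge0_muleDr _ (Loc_ge0 g) (DI_ge0 (gag_ge0 s p u))). Qed.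

Lemma energy_ge0 u g : (0 <= energy u g)%E.
Proof. by apply: adde_ge0; [exact: Loc_ge0|apply: DI_ge0 => z; exact: gag_ge0]. Qed.

(** The gradient is carried explicitly, since polarization and maxima produce it by a formula. As in
    [W1p0], the Gagliardo seminorm may be infinite. *)
Definition adm Omega u g : Prop := [/\ isgrad u g,
  {ae mu, forall x, ~ Omega x -> u x = 0}, (Lp u < +oo)%E & (Loc g < +oo)%E].

Lemma W1p0P Omega u : W1p0 p Omega u <-> exists g, adm Omega u g.
Proof.
have pn0 : p != 0 by rewrite gt_eqF.
split=> [[uL [g /isgradE ug] gp u0]|[g [ug u0 Lu Lg]]].
  exists g; split => //.
    rewrite -Lnorm_Lp; apply: poweR_lty; move: uL; rewrite inE/= => /andP[_].
    by rewrite inE.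
  by rewrite -(grad_norm_Loc ug); exact: poweR_lty.
split => //.
- rewrite inE/=; apply/andP; split; rewrite inE/=; first exact: isgrad_measurable ug.
  by apply: (lty_poweRy pn0); rewrite Lnorm_Lp.
- by exists g; apply/isgradE.
- by apply: (lty_poweRy pn0); rewrite (grad_norm_Loc ug).
Qed.

Lemma Lambda_ge0 Omega : (0 <= Lambda s p Omega)%E.
Proof.
by apply: le_ereal_inf_tmp => _ [u _ <-]; apply: adde_ge0; exact: poweR_ge0.
Qed.

Lemma Lambda_le1 Omega u g : measurable Omega -> adm Omega u g -> Lp u = 1%E ->
  (Lambda s p Omega <= energy u g)%E.
Proof.
move=> mO au Lu; have [ug u0 Lfin Locfin] := au; have mu_ := isgrad_measurable ug.
apply: ereal_inf_lbound; exists u.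
  split; first by apply/W1p0P; exists g.
  have := Lnorm_patch_Lp mO mu_ u0; rewrite Lu => E.
  have : (('N[mu]_p%:E[(EFin \o u) \_ Omega] `^ p) `^ p^-1 = 1)%E by rewrite E poweR1r.
  by rewrite -poweRrM divff ?gt_eqF// poweRe1// Lnorm_ge0.
by rewrite (Lnorm_patch_grad mO ug u0) (gagliardoE s p1 mu_).
Qed.

Lemma energy_scale (c : R) u g : measurable_fun [set: V] u -> measurable_fun [set: V] g ->
  energy (fun x => c * u x) (fun x => c *: g x) = ((`|c| `^ p)%:E * energy u g)%E.
Proof.
move=> mu_ mg; rewrite energy_mul /energy Loc_scale//.
congr (_ + _)%E; rewrite -(DI_Z (measurable_gag s p mu_) (gag_ge0 s p u) (powR_ge0 _ _)).
by congr DI; apply/funext => z; rewrite gag_scale.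
Qed.

Lemma adm_scale (c : R) Omega u g : adm Omega u g -> adm Omega (fun x => c * u x) (fun x => c *: g x).
Proof.
move=> [ug u0 Lu Lg]; split.
- exact: isgrad_scale.
- by apply: filterS u0 => x H /H ->; rewrite mulr0.
- rewrite (Lp_scale c (isgrad_measurable ug)); by apply: lte_mul_pinfty => //; rewrite lee_fin powR_ge0.
- rewrite (Loc_scale c (isgrad_measurable_grad ug)); by apply: lte_mul_pinfty => //; rewrite lee_fin powR_ge0.
Qed.

(** The homogeneous form of the infimum: rescale by c = Lp(u)^(-1/p). It also holds for u = 0 a.e.,
    which matters for minima of two functions. *)
Lemma Lambda_le Omega u g : measurable Omega -> adm Omega u g ->
  (Lambda s p Omega * Lp u <= energy u g)%E.
Proof.
move=> mO au; have [ug u0 Lu Lg] := au; have mu_ := isgrad_measurable ug.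
have mg := isgrad_measurable_grad ug; have L0 := Lp_ge0 u; have E0 := energy_ge0 u g.
have [Lz|Lnz] := eqVneq (Lp u) 0%E; first by rewrite Lz mule0.
have Lfin : Lp u \is a fin_num by rewrite ge0_fin_numE.
set r := fine (Lp u); have rE : Lp u = r%:E by rewrite fineK.
have r0 : 0 < r by rewrite -lte_fin -rE lt_neqAle eq_sym Lnz.
pose c := r `^ (- p^-1); have c0 : 0 < c by exact: powR_gt0.
have cp : `|c| `^ p = r^-1.
  by rewrite gtr0_norm// /c -powRrM mulNr mulVf ?gt_eqF// powR_inv1// ltW.
have := Lambda_le1 mO (adm_scale c au).
rewrite Lp_scale// cp rE -EFinM mulVf ?gt_eqF// => /(_ erefl).
rewrite energy_scale// cp => H.
rewrite -[leRHS](_ : (r%:E * (r^-1%:E * energy u g) = _)%E); last first.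
  by rewrite muleA -EFinM divff ?gt_eqF// mul1e.
by rewrite muleC; apply: lee_wpmul2l => //; rewrite lee_fin ltW.
Qed.

Lemma adm_abs Omega u g : adm Omega u g ->
  adm Omega (fun x => `|u x|) (fun x => Num.sg (u x) *: g x) /\
  (energy (fun x => `|u x|)%R (fun x => Num.sg (u x) *: g x)%R <= energy u g)%E.
Proof.
move=> [ug u0 Lu Lg]; have ug' := isgrad_abs ug.
have mg := isgrad_measurable_grad ug; have mg' := isgrad_measurable_grad ug'.
have mu_ := isgrad_measurable ug; have mu' := isgrad_measurable ug'.
have H := Loc_sg_le mg mg'.
split.
  split; [exact: ug'| |by rewrite Lp_norm|exact: le_lt_trans H Lg].
  by apply: filterS u0 => x H0 /H0 ->; rewrite normr0.
apply: leeD; first exact: H.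
apply: DI_le; [exact: measurable_gag|exact: measurable_gag|exact: gag_ge0|].
exact: (gag_abs_le s p1 u).
Qed.

Lemma Lambda_adherent Omega (e : R) : Lambda s p Omega \is a fin_num -> 0 < e ->
  exists2 u, W1p0 p Omega u /\ 'N[mu]_p%:E [(EFin \o u) \_ Omega]%E = 1%E &
    ('N[mu]_p%:E [(grad_norm u) \_ Omega] `^ p + gagliardo s p u `^ p < Lambda s p Omega + e%:E)%E.
Proof.
by move=> Lf e0; have [_ [u Hu <-] H] := lb_ereal_inf_adherent e0 Lf; exists u.
Qed.

(** Near-minimizers can be taken nonnegative: passing to |u| keeps the norm and does not raise the
    energy. *)
Lemma Lambda_min Omega (e : R) : measurable Omega -> (Lambda s p Omega < +oo)%E -> 0 < e ->
  exists u g, [/\ adm Omega u g, forall x, 0 <= u x, Lp u = 1%E &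
    (energy u g < Lambda s p Omega + e%:E)%E].
Proof.
move=> mO Lfin e0; have Lf : Lambda s p Omega \is a fin_num by rewrite ge0_fin_numE// Lambda_ge0.
have [u [/W1p0P[g au] N1] H] := Lambda_adherent Lf e0.
have [ug u0 Lu Lg] := au; have mu_ := isgrad_measurable ug.
have [au' Eu'] := adm_abs au.
exists (fun x => `|u x|), (fun x => Num.sg (u x) *: g x); split => //.
  have := Lnorm_patch_Lp mO mu_ u0; rewrite N1 poweR1r => ->.
  by rewrite Lp_norm.
apply: (le_lt_trans Eu').
by rewrite (Lnorm_patch_grad mO ug u0) (gagliardoE s p1 mu_) in H.
Qed.

(** At each point the maximum and minimum are the two functions in some order, so norms and gradient
    terms add up exactly; only the Gagliardo term loses, by [mgap]. *)
Lemma adm_maxmin Omega u g v h : adm Omega u g -> adm Omega v h ->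
  let b x := v x <= u x in
  [/\ adm Omega (pick b u v) (pick b g h), adm Omega (pick b v u) (pick b h g) &
   (energy (pick b u v) (pick b g h) + energy (pick b v u) (pick b h g) + DI (mgap s p u v) =
    energy u g + energy v h)%E].
Proof.
move=> [ug u0 Lu Lg] [vh v0 Lv Lh] b.
have mu_ := isgrad_measurable ug; have mv := isgrad_measurable vh.
have mg := isgrad_measurable_grad ug; have mh := isgrad_measurable_grad vh.
have mb := measurable_leb mu_ mv.
have M := isgrad_max ug vh; have m := isgrad_min ug vh.
have LL := Lp_pick_sum mb mu_ mv.
have LG := Loc_pick_sum mg mh (isgrad_measurable_grad M) (isgrad_measurable_grad m).
have [L1' L2'] := adde_lty (Lp_ge0 _) (Lp_ge0 _) (eq_ind_r (fun z => (z < +oo)%E) (lte_add_pinfty Lu Lv) LL).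
have [G1' G2'] := adde_lty (Loc_ge0 _) (Loc_ge0 _) (eq_ind_r (fun z => (z < +oo)%E) (lte_add_pinfty Lg Lh) LG).
split.
- split; [exact: M| |exact: L1'|exact: G1'].
  by apply: filterS2 u0 v0 => x H1 H2 Ox; rewrite /pick; case: ifP => _; [exact: H1|exact: H2].
- split; [exact: m| |exact: L2'|exact: G2'].
  by apply: filterS2 u0 v0 => x H1 H2 Ox; rewrite /pick; case: ifP => _; [exact: H2|exact: H1].
have D := DI_maxmin s p1 mu_ mv.
exact: (adde_rearrange LG D).
Qed.

(** The factor 4 comes from folding: every pair of points is counted with its four images, while the
    gap is kept on one of them only. *)
Lemma adm_polar Omega Omega' j a u g : adm Omega u g ->
  {ae mu, forall x, ~ Omega' x -> polar j a u x = 0} ->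
  [/\ adm Omega' (polar j a u) (polar_grad j a u g), Lp (polar j a u) = Lp u &
    (4%:E * energy (polar j a u) (polar_grad j a u g) + DI (hgap s p j a u) <= 4%:E * energy u g)%E].
Proof.
move=> [ug u0 Lu Lg] pu0; have Pg := isgrad_polar j a ug.
have mu_ := isgrad_measurable ug; have mg := isgrad_measurable_grad ug.
have mP := isgrad_measurable Pg.
have LpE := Lp_polar j a ug; have LocE := Loc_polar j a ug.
split; [split|exact: LpE|].
- exact: Pg.
- exact: pu0.
- by rewrite LpE.
- by rewrite LocE.
have D := DI_polar p1 s0 mu_ mP.
have E1 := energy_mul 4 (polar j a u) (polar_grad j a u g).
have E2 := energy_mul 4 u g.
rewrite LocE in E1.
by rewrite E1 E2 -addeA; apply: leeD.
Qed.

End admissible.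

(** * Finite Gagliardo energy of Lipschitz functions with compact support *)

Section finite_energy.
Context {R : realType} {n : nat}.
Local Notation V := 'rV[R]_n.
Local Notation VV := (V * V)%type.
Local Notation mu := (@lebesgue_rV R n).
Implicit Types (phi : V -> R) (i : 'I_n).

Lemma LI_cst (c : R) : LI (fun _ : V => c).
Proof.
move=> N; apply/integrableP; split; first by apply/measurable_EFinP; exact: measurable_cst.
rewrite (_ : (fun x => _) = cst `|c|%:E)// integral_cst; last exact: measurable_cube.
by rewrite lte_mul_pinfty// ?lee_fin//; exact: cube_lty.
Qed.

Lemma test_LI phi : test_function phi -> LI phi.
Proof.
move=> tphi; apply: LI_intg; have := test_intg (LI_cst 1) tphi.
by apply: eq_integrable => // x _ /=; rewrite mul1r.
Qed.

Lemma test_wderiv i phi : test_function phi -> wderiv i phi (partial i phi).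
Proof.
move=> tphi; have Iphi := test_LI tphi; apply: (@dq_cvg_wderivR _ _ _ _ _ false) => // psi tpsi.
have Ipsi := test_LI tpsi.
have [N [C C0 [p0 dp0 pC dpC]]] := test_bound tphi.
have md : measurable_fun [set: V] (partial i phi).
  by apply: continuous_measurable_rV; exact: test_partial_continuous.
have E (f g : V -> R) : \int[mu]_x (f x * g x) = \int[mu]_x (g x * f x).
  by apply: eq_Rintegral => x _; rewrite mulrC.
rewrite E; under eq_fun do rewrite (E _ psi).
apply: (@dominated_mulR _ _ psi _ _ C N.+1) => //.
- move=> k; apply: measurable_dq; exact: continuous_measurable_rV (test_continuous tphi).
- move=> k x; have hn := @hseq_neq0 R false k; have h1 := @hseq_le1 R false k.
  rewrite indicE; have [Nx|Nx] := pselect (cube N.+1%:R x).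
    by rewrite mem_set// mulr1 normrM normfV ler_pdivrMr ?normr_gt0//; exact: (test_lipschitz tphi (dpC i)).
  rewrite memNset// mulr0 /shf !p0 ?subrr ?mul0r ?normr0//.
    by move=> H; apply: Nx; apply: cube_sub H; rewrite ler_nat.
  move=> H; apply: Nx; rewrite -natr1 -[x](addKr (hseq false k *: unitv i)) -scaleNr.
  by apply: cube_shift => //; rewrite normrN.
- move=> x; have h0 := @hseq_cvg R false.
  have hd : (fun k => hseq false k) @ \oo --> (0 : R)^'.
    move=> A [e /= e0 HA]; have /cvgrPdist_lt/(_ e e0) := h0.
    by apply: filterS => k /= He; apply: HA => //; exact: hseq_neq0.
  have := @cvg_comp _ _ _ (fun k => hseq false k) (fun h : R => h^-1 * (phi (h *: unitv i + x) - phi x)) _ _ _ hd (@test_quotient_cvg _ _ phi i x tphi).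
  by apply: cvg_trans; apply: near_eq_cvg; apply: nearW => k /=; rewrite mulrC.
- have := partial_intg i Ipsi tphi; exact.
Qed.

Lemma test_isgrad phi : test_function phi -> isgrad phi (fun x => \row_i partial i phi x).
Proof.
move=> tphi; split; first exact: test_LI.
move=> i; rewrite (_ : (fun x => _) = partial i phi); last by apply/funext => x; rewrite mxE.
split; last exact: test_wderiv.
apply: LI_intg; have := partial_intg i (LI_cst 1) tphi.
by apply: eq_integrable => // x _ /=; rewrite mul1r.
Qed.

Lemma enorm_le_sum (x : V) : enorm x <= \sum_i `|x ord0 i|.
Proof.
have S0 : 0 <= \sum_i `|x ord0 i| by exact: sumr_ge0.
rewrite -ler_sqr ?nnegrE ?enorm_ge0// enorm_sqr expr2 mulr_suml; apply: ler_sum => i _.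
rewrite -[leLHS]real_normK ?num_real// expr2 ler_wpM2l//.
by rewrite (bigD1 i)//= lerDl sumr_ge0.
Qed.

Lemma enorm_cube (x : V) (r : R) : cube r x -> enorm x <= n%:R * r.
Proof.
move=> /cubeP xr; apply: (le_trans (enorm_le_sum x)).
apply: (@le_trans _ _ (\sum_(i < n) r)); first by apply: ler_sum => i _; exact: xr.
by rewrite sumr_const card_ord mulr_natl.
Qed.

(** Pass from y to x by changing one coordinate at a time, in the order of a list; each change is
    bounded by [test_lipschitz]. *)
Lemma test_lip phi (C : R) : test_function phi -> 0 <= C ->
  (forall i x, `|partial i phi x| <= C) -> forall x y : V, `|phi x - phi y| <= C * n%:R * enorm (x - y).
Proof.
move=> tphi C0 dC x y.
pose z (l : seq 'I_n) : V := \row_i if i \in l then x ord0 i else y ord0 i.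
have H (l : seq 'I_n) : uniq l -> `|phi (z l) - phi y| <= C * (\sum_(i <- l) `|x ord0 i - y ord0 i|).
  elim: l => [|i l IH] /=.
    rewrite (_ : z [::] = y); first by rewrite subrr normr0 big_nil mulr0.
    by apply: eq_row => i; rewrite mxE.
  move=> /andP[il /IH {}IH]; rewrite big_cons mulrDr.
  have -> : z (i :: l) = (x ord0 i - y ord0 i) *: unitv i + z l.
    apply: eq_row => k; rewrite unitvE !mxE inE; case: eqP => // ->.
    by rewrite (negbTE il) subrK.
  apply: (le_trans (ler_distD (phi (z l)) _ _)); apply: lerD => //.
  exact: (test_lipschitz tphi (dC i)).
have := H (index_enum 'I_n) (index_enum_uniq _); rewrite (_ : z _ = x); last first.
  by apply: eq_row => i; rewrite mxE mem_index_enum.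
move=> /le_trans; apply; rewrite -mulrA ler_wpM2l//.
apply: (@le_trans _ _ (\sum_(i < n) enorm (x - y))).
  by apply: ler_sum => i _; have := coord_le_enorm (x - y) i; rewrite !mxE.
by rewrite sumr_const card_ord mulr_natl.
Qed.

Lemma ind_ge0 (A : set V) x : 0 <= \1_A x :> R.
Proof. by rewrite indicE. Qed.

Lemma int_bounded_cube (f : V -> R) (C : R) (N : nat) : measurable_fun [set: V] f ->
  (forall x, 0 <= f x) -> (forall x, f x <= C * \1_(cube N%:R) x) -> 0 <= C ->
  (\int[mu]_x (f x)%:E < +oo)%E.
Proof.
move=> mf f0 fC C0; have mN := @measurable_cube R n N%:R.
apply: (@le_lt_trans _ _ (\int[mu]_x (C * \1_(cube N%:R) x)%:E)%E).
  apply: ge0_le_integral => //.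
  - by move=> x _; rewrite lee_fin.
  - exact/measurable_EFinP.
  - by apply/measurable_EFinP; apply: measurable_funM => //; exact: measurable_indic.
  - by move=> x _; rewrite lee_fin.
rewrite (int_Z (measurable_indic mN) (@ind_ge0 _) C0) integral_indic// setIT.
by apply: lte_mul_pinfty => //; exact: cube_lty.
Qed.

Lemma cube_measure (r : R) : 0 <= r -> mu (cube r) = ((2 * r) ^+ n)%:E.
Proof.
move=> r0; rewrite lebesgue_rV_box//; have E : lebesgue_measure (`[- r, r]%classic : set (measurableTypeR R)) = (2 * r)%:E.
  rewrite lebesgue_measure_itv/= lte_fin; case: ltP => [_|rr].
    by rewrite -EFinB; congr EFin; ring.
  by rewrite (_ : r = 0) ?mulr0//; lra.
under eq_bigr do rewrite E.
rewrite (_ : (2 * r) ^+ n = \prod_(i < n) (2 * r)); last by rewrite prodr_const card_ord.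
by elim/big_ind2 : _ => // x x' y y' -> ->.
Qed.

Lemma exp_powR (x q : R) k : 0 <= x -> (x ^+ k) `^ q = (x `^ q) ^+ k.
Proof. by move=> x0; rewrite -powR_mulrn// powRAC powR_mulrn// powR_ge0. Qed.

Lemma geo_le (t : R) M : 0 <= t -> t < 1 -> \sum_(k < M) t ^+ k <= (1 - t)^-1.
Proof.
move=> t0 t1; have h : 0 < 1 - t by rewrite subr_gt0.
rewrite -[leRHS]mul1r ler_pdivlMr// mulrC.
have -> : (1 - t) * (\sum_(k < M) t ^+ k) = 1 - t ^+ M by rewrite -(opprB t 1) mulNr -subrX1 opprB.
by rewrite lerBlDr lerDl exprn_ge0.
Qed.

Variables (s p L : R).
Hypotheses (p1 : 1 < p) (s0 : 0 < s) (s1 : s < 1) (L0 : 0 <= L).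
Let q := n%:R + s * p.
Let p0 : 0 < p. Proof. exact: lt_trans p1. Qed.
Let q0 : 0 < q. Proof. exact: kexp_gt0. Qed.

(** Bounds [gag s p phi] at points with difference w, for an L-Lipschitz [phi] with values in
    [0, 1]. It is integrable near 0 thanks to s < 1 and at infinity thanks to s > 0. *)
Definition lipker (w : V) : R := Num.min ((L * enorm w) `^ p) 1 * (enorm w `^ q)^-1.

Lemma lipker_ge0 w : 0 <= lipker w.
Proof. by rewrite mulr_ge0 ?invr_ge0 ?powR_ge0// le_min powR_ge0 ler01. Qed.

Lemma measurable_lipker : measurable_fun [set: V] lipker.
Proof.
have me := @measurable_enorm R n; apply: measurable_funM.
  apply: measurable_minr => //; apply: (measurableT_comp (measurable_powR _)).
  exact: measurable_funM.
rewrite (_ : (fun w => _) = (fun w => enorm w `^ (- q))); last by apply/funext => w; rewrite powRN.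
exact: (measurableT_comp (measurable_powR _) me).
Qed.

Let H := (2^-1 : R).
Let H0 : 0 < H. Proof. by rewrite invr_gt0. Qed.

Lemma lipker_near k w : cube (H ^+ k) w -> ~ cube (H ^+ k.+1) w ->
  lipker w <= (L * n%:R) `^ p * (H `^ q)^-1 * (H `^ p / H `^ q) ^+ k.
Proof.
move=> kw /cubeP; rewrite -existsNP => -[i /negP]; rewrite -ltNge => iw.
have e1 : H ^+ k.+1 <= enorm w by exact/ltW/(lt_le_trans iw (coord_le_enorm w i)).
have h0 : 0 < H ^+ k.+1 by rewrite exprn_gt0.
have e0 := lt_le_trans h0 e1.
have b1 : Num.min ((L * enorm w) `^ p) 1 <= (L * n%:R) `^ p * (H `^ p) ^+ k.
  apply: (@le_trans _ _ ((L * enorm w) `^ p)); first by rewrite ge_min lexx.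
  rewrite -exp_powR ?(ltW H0)// -powRM ?mulr_ge0// ?exprn_ge0 ?(ltW H0)//.
  apply: ge0_ler_powR; rewrite ?nnegrE ?mulr_ge0 ?enorm_ge0 ?exprn_ge0 ?(ltW H0)// ?(ltW p0)//.
  by rewrite -mulrA ler_wpM2l//; exact: enorm_cube.
have b2 : (enorm w `^ q)^-1 <= (H `^ q)^-1 * ((H `^ q)^-1) ^+ k.
  rewrite -exprS exprVn lef_pV2 ?posrE ?exprn_gt0 ?powR_gt0//.
  rewrite -exp_powR ?(ltW H0)//; apply: ge0_ler_powR; rewrite ?nnegrE ?(ltW q0) ?(ltW h0) ?enorm_ge0//.
apply: (le_trans (ler_pM _ _ b1 b2)); rewrite ?invr_ge0 ?powR_ge0// ?le_min ?powR_ge0 ?ler01//.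
by rewrite le_eqVlt exprMn; apply/orP; left; apply/eqP; ring.
Qed.

Lemma lipker_far k w : ~ cube (2 ^+ k) w -> lipker w <= (H `^ q) ^+ k.
Proof.
move=> /cubeP; rewrite -existsNP => -[i /negP]; rewrite -ltNge => iw.
have e1 : 2 ^+ k <= enorm w by exact/ltW/(lt_le_trans iw (coord_le_enorm w i)).
have h0 : 0 < 2 ^+ k :> R by rewrite exprn_gt0.
have e0 := lt_le_trans h0 e1.
have b1 : Num.min ((L * enorm w) `^ p) 1 <= 1 by rewrite ge_min lexx orbT.
have b2 : (enorm w `^ q)^-1 <= (H `^ q) ^+ k.
  have -> : (H `^ q) ^+ k = ((2 ^+ k) `^ q)^-1.
    by rewrite -exp_powR ?(ltW H0)// /H exprVn -[(2 ^+ k)^-1]powR_inv1 ?(ltW h0)// -powRrM mulN1r powRN.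
  rewrite lef_pV2 ?posrE ?powR_gt0//.
  by apply: ge0_ler_powR; rewrite ?nnegrE ?(ltW q0) ?(ltW h0) ?enorm_ge0.
rewrite -[leRHS]mul1r; apply: ler_pM => //; rewrite ?invr_ge0 ?powR_ge0//.
by rewrite le_min powR_ge0 ler01.
Qed.

(** [a k] bounds [lipker] on the k-th dyadic shell inside the unit cube and [b k] on the k-th one
    outside; [step] spreads them over whole cubes, whose measures are explicit. *)
Let a k : R := (L * n%:R) `^ p * (H `^ q)^-1 * (H `^ p / H `^ q) ^+ k.
Let b k : R := (H `^ q) ^+ k.
Let step k (w : V) : R := a k * \1_(cube (H ^+ k)) w + b k * \1_(cube (2 ^+ k.+1)) w.
Let major M (w : V) : R := \sum_(k < M) step k w.
Let cut M (w : V) : R := \1_(cube (2 ^+ M) `\` cube (H ^+ M)) w * lipker w.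

Let a0 k : 0 <= a k. Proof. by rewrite /a !mulr_ge0 ?exprn_ge0 ?divr_ge0 ?invr_ge0 ?powR_ge0. Qed.
Let b0 k : 0 <= b k. Proof. by rewrite /b exprn_ge0 ?powR_ge0. Qed.
Let step0 k w : 0 <= step k w. Proof. by rewrite /step addr_ge0// mulr_ge0. Qed.
Let major0 M w : 0 <= major M w. Proof. exact: sumr_ge0. Qed.

Let stepb k w : cube (2 ^+ k.+1) w -> b k <= step k w.
Proof.
move=> kw; rewrite /step (_ : \1_(cube (2 ^+ k.+1)) w = 1); last by rewrite indicE mem_set.
by rewrite mulr1 lerDr; apply: mulr_ge0; [exact: a0|exact: ind_ge0].
Qed.

Let stepa k w : cube (H ^+ k) w -> a k <= step k w.
Proof.
move=> kw; rewrite /step (_ : \1_(cube (H ^+ k)) w = 1); last by rewrite indicE mem_set.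
by rewrite mulr1 lerDl; apply: mulr_ge0; [exact: b0|exact: ind_ge0].
Qed.

(** Induction on M: a point of the larger truncation lies in the new outer shell, in the new inner
    shell, or in the previous truncation. *)
Let cut_le M w : cut M w <= major M w.
Proof.
rewrite /cut indicE; have [[Mw NMw]|Mw] := pselect ((cube (2 ^+ M) `\` cube (H ^+ M)) w); last first.
  by rewrite memNset// mul0r.
rewrite mem_set// mul1r; elim: M Mw NMw => [|M IH] Mw NMw.
  by exfalso; apply: NMw; rewrite expr0 in Mw *.
rewrite /major big_ord_recr/= -/(major M w).
have [Mw'|Mw'] := pselect (cube (2 ^+ M) w); last first.
  by apply: (le_trans (lipker_far Mw')); apply: (le_trans (stepb Mw)); rewrite lerDr.
have [Mw''|Mw''] := pselect (cube (H ^+ M) w).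
  by apply: (le_trans (lipker_near Mw'' NMw)); apply: (le_trans (stepa Mw'')); rewrite lerDr.
by apply: (le_trans (IH Mw' Mw'')); rewrite lerDl.
Qed.

Let mstep k : measurable_fun [set: V] (step k).
Proof. by apply: measurable_funD; apply: measurable_funM => //; apply: measurable_indic; exact: measurable_cube. Qed.

Let int_step k : (\int[mu]_w (step k w)%:E = (a k * (2 * H ^+ k) ^+ n + b k * (2 * 2 ^+ k.+1) ^+ n)%:E)%E.
Proof.
have mI r : measurable_fun [set: V] (\1_(cube r) : V -> R) by apply: measurable_indic; exact: measurable_cube.
have mZ c r : measurable_fun [set: V] (fun w => c * \1_(cube r) w : R) by exact: measurable_funM.
rewrite (int_D (mZ _ _) (mZ _ _)); [|by move=> w; rewrite mulr_ge0|by move=> w; rewrite mulr_ge0].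
rewrite (int_Z (mI _) (@ind_ge0 _) (a0 k)) (int_Z (mI _) (@ind_ge0 _) (b0 k)).
have cm r : 0 <= r -> (\int[mu]_x (\1_(cube r) x)%:E = ((2 * r) ^+ n)%:E)%E.
  move=> r0; rewrite integral_indic ?setIT//; last exact: measurable_cube.
  exact: cube_measure.
by rewrite !cm ?exprn_ge0 ?(ltW H0)// -!EFinM -EFinD.
Qed.

Let int_major M : (\int[mu]_w (major M w)%:E = (\sum_(k < M) (a k * (2 * H ^+ k) ^+ n + b k * (2 * 2 ^+ k.+1) ^+ n))%:E)%E.
Proof.
elim: M => [|M IH].
  by under eq_integral do rewrite /major big_ord0; rewrite big_ord0 integral0.
have mM : measurable_fun [set: V] (major M) by apply: measurable_sum => k; exact: mstep.
rewrite big_ord_recr/= EFinD -IH -int_step -(int_D mM (mstep M) (major0 M) (step0 M)).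
by apply: eq_integral => w _; rewrite /major big_ord_recr.
Qed.

(** The ratios of the two geometric series of integrals: t1 = 2^(-p(1-s)) near 0 and t2 = 2^(-sp) at
    infinity. *)
Let t1 : R := H `^ p / H `^ q * H ^+ n.
Let t2 : R := H `^ q * 2 ^+ n.

Let Hexp : H ^+ n = H `^ n%:R. Proof. by rewrite powR_mulrn// ltW. Qed.

Let Hlt1 (c : R) : 0 < c -> H `^ c < 1.
Proof.
move=> c0; rewrite [ltRHS](_ : 1 = 1 `^ c); last by rewrite powR1.
apply: (gt0_ltr_powR c0); rewrite ?nnegrE ?(ltW H0)//.
by rewrite /H invf_lt1// ltr1n.
Qed.

Let Hn0 : (H == 0) = false. Proof. by rewrite gt_eqF. Qed.

Let t1_lt1 : t1 < 1.
Proof.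
have -> : t1 = H `^ (p * (1 - s)).
  rewrite /t1 Hexp -powRN -powRD ?Hn0 ?implybT// -powRD ?Hn0 ?implybT//.
  by congr (_ `^ _); rewrite /q; ring.
by apply: Hlt1; rewrite mulr_gt0// subr_gt0.
Qed.

Let t2_lt1 : t2 < 1.
Proof.
have -> : t2 = H `^ (s * p).
  have E : (2 ^+ n : R) = H `^ (- n%:R) by rewrite powRN -Hexp /H exprVn invrK.
  by rewrite /t2 E -powRD ?Hn0 ?implybT//; congr (_ `^ _); rewrite /q; ring.
by apply: Hlt1; rewrite mulr_gt0.
Qed.

Lemma lipker_lty : (\int[mu]_w (lipker w)%:E < +oo)%E.
Proof.
pose C1 := (L * n%:R) `^ p * (H `^ q)^-1 * 2 ^+ n; pose C2 : R := 4 ^+ n.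
have C10 : 0 <= C1 by rewrite /C1 !mulr_ge0 ?invr_ge0 ?powR_ge0 ?exprn_ge0.
have C20 : 0 <= C2 by rewrite exprn_ge0.
pose B := C1 * (1 - t1)^-1 + C2 * (1 - t2)^-1.
have bound M : (\int[mu]_w (major M w)%:E <= B%:E)%E.
  rewrite int_major lee_fin big_split/=.
  have t10 : 0 <= t1 by rewrite /t1 mulr_ge0 ?divr_ge0 ?powR_ge0 ?exprn_ge0 ?(ltW H0).
  have t20 : 0 <= t2 by rewrite /t2 mulr_ge0 ?powR_ge0 ?exprn_ge0.
  apply: lerD.
    apply: (@le_trans _ _ (C1 * \sum_(k < M) t1 ^+ k)); last by apply: ler_wpM2l => //; exact: geo_le.
    rewrite mulr_sumr; apply: ler_sum => k _; rewrite le_eqVlt; apply/orP; left; apply/eqP.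
     rewrite /a /C1 /t1 !exprMn -!exprM (mulnC n k); ring.
  apply: (@le_trans _ _ (C2 * \sum_(k < M) t2 ^+ k)); last by apply: ler_wpM2l => //; exact: geo_le.
  rewrite mulr_sumr; apply: ler_sum => k _; rewrite le_eqVlt; apply/orP; left; apply/eqP.
   rewrite /b /C2 /t2 exprS mulrA (_ : 2 * 2 = 4 :> R); last by ring.
  by rewrite !exprMn -!exprM (mulnC n k); ring.
apply: (@le_lt_trans _ _ B%:E); last exact: ltry.
have mcut M : measurable_fun [set: V] (cut M).
  apply: measurable_funM; last exact: measurable_lipker.
  by apply: measurable_indic; apply: measurableD; exact: measurable_cube.
have cut0 M w : 0 <= cut M w by rewrite mulr_ge0 ?lipker_ge0.
apply: (fatou_le (m := mu) (f := cut)) => //.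
- exact: measurable_lipker.
- apply: aeW => w; apply: cvg_near_cst; have [->|w0] := eqVneq w 0.
    apply: nearW => M; rewrite /cut /lipker enorm0 powR0 ?gt_eqF// invr0 !mulr0//.
  have e0 : 0 < enorm w by rewrite lt_neqAle enorm_ge0 andbT eq_sym; apply: contra w0 => /eqP/enorm_eq0 ->.
  have h1 : (H ^+ M * n%:R) @[M --> \oo] --> (0 : R).
    rewrite -(mul0r n%:R); apply: cvgM; last exact: cvg_cst.
    by apply: cvg_expr; rewrite ger0_norm ?(ltW H0)// /H invf_lt1// ltr1n.
  have h2 : (H ^+ M * enorm w) @[M --> \oo] --> (0 : R).
    rewrite -(mul0r (enorm w)); apply: cvgM; last exact: cvg_cst.
    by apply: cvg_expr; rewrite ger0_norm ?(ltW H0)// /H invf_lt1// ltr1n.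
  have /cvgrPdist_lt/(_ _ e0) := h1; have /cvgrPdist_lt/(_ _ ltr01) := h2.
  apply: filterS2 => M; rewrite !sub0r !normrN => w1 w2.
  rewrite /cut indicE mem_set ?mul1r//; split.
    apply/cubeP => i; apply: (le_trans (coord_le_enorm w i)).
    move: w1; rewrite ger0_norm ?mulr_ge0 ?exprn_ge0 ?(ltW H0) ?enorm_ge0// /H exprVn.
    by rewrite ltr_pdivrMl ?exprn_gt0// mulr1 => /ltW.
  move=> /enorm_cube; apply/negP; rewrite -ltNge mulrC; apply: le_lt_trans w2; exact: ler_norm.
- move=> e e0; apply: nearW => M; apply: (le_trans _ (leeDl _ _)); last by rewrite lee_fin ltW.
  apply: le_trans (bound M); apply: ge0_le_integral => //.
  + by move=> w _; rewrite lee_fin.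
  + exact/measurable_EFinP.
  + by apply/measurable_EFinP; apply: measurable_sum => k; exact: mstep.
  + by move=> w _; rewrite lee_fin.
Qed.

Implicit Types N : nat.

Lemma ker_lipker (x y : V) : lipker (x - y) = Num.min ((L * enorm (x - y)) `^ p) 1 * ker s p (x, y).
Proof. by []. Qed.

(** The difference phi x - phi y vanishes unless one of the points lies in the support cube, hence
    the two symmetric terms. *)
Lemma gag_le_lipker phi N : (forall x, 0 <= phi x <= 1) ->
  (forall x y, `|phi x - phi y| <= L * enorm (x - y)) -> (forall x, ~ cube N%:R x -> phi x = 0) ->
  forall z, gag s p phi z <= \1_(cube N%:R) z.1 * lipker (z.1 - z.2) + \1_(cube N%:R) z.2 * lipker (z.2 - z.1).
Proof.
move=> phi01 lip supp [x y] /=; have l0 := lipker_ge0 (x - y).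
have -> : lipker (y - x) = lipker (x - y) by rewrite /lipker enorm_subC.
rewrite -mulrDl; have H1 : gag s p phi (x, y) <= lipker (x - y).
  rewrite ker_lipker /gag /= ler_wpM2r ?ker_ge0// le_min; apply/andP; split.
    by apply: ge0_ler_powR; rewrite ?nnegrE ?mulr_ge0 ?enorm_ge0 ?(ltW p0).
  have : `|phi x - phi y| <= 1.
    by have /andP[? ?] := phi01 x; have /andP[? ?] := phi01 y; rewrite ler_norml; apply/andP; split; lra.
  move=> h; apply: (@le_trans _ _ (1 `^ p)); last by rewrite powR1.
  by apply: ge0_ler_powR; rewrite ?nnegrE ?(ltW p0).
have [Nx|Nx] := pselect (cube N%:R x).
  apply: (le_trans H1); rewrite [\1__ x]indicE mem_set// mulrDl mul1r lerDl.
  by apply: mulr_ge0 => //; exact: ind_ge0.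
have [Ny|Ny] := pselect (cube N%:R y).
  apply: (le_trans H1); rewrite [\1__ y]indicE mem_set// mulrDl mul1r lerDr.
  by apply: mulr_ge0 => //; exact: ind_ge0.
rewrite /gag /= !supp// subrr normr0 powR0 ?gt_eqF// mul0r mulr_ge0// addr_ge0 ?ind_ge0//.
Qed.

Lemma DI_swap (F : VV -> R) : measurable_fun [set: VV] F -> (forall z, 0 <= F z) ->
  DI (fun z => F (z.2, z.1)) = DI F.
Proof.
move=> mF F0; have ms : measurable_fun [set: VV] (fun z : VV => (z.2, z.1)).
  by apply/measurable_fun_pairP; split; [exact: measurable_snd|exact: measurable_fst].
have mF' : measurable_fun [set: VV] (fun z => F (z.2, z.1)) by exact: (measurableT_comp mF ms).
rewrite !DI_iter//; apply/esym.
have mFe : measurable_fun [set: VV] (fun z => (F z)%:E) by exact/measurable_EFinP.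
have F0e z : (0 <= (F z)%:E)%E by rewrite lee_fin.
exact: (fubini_tonelli (m1 := mu) (m2 := mu) _ mFe F0e).
Qed.

Lemma DI_lipker N : (DI (fun z : VV => \1_(cube N%:R) z.1 * lipker (z.1 - z.2))%R < +oo)%E.
Proof.
have mN := @measurable_cube R n N%:R; have mI : measurable_fun [set: V] (\1_(cube N%:R) : V -> R) by exact: measurable_indic.
have ml := measurable_lipker.
have mF : measurable_fun [set: VV] (fun z : VV => \1_(cube N%:R) z.1 * lipker (z.1 - z.2)).
  apply: measurable_funM; first by apply: (measurableT_comp mI); exact: measurable_fst.
  exact: (measurableT_comp ml measurable_subVV).
rewrite DI_iter//; last by move=> z; rewrite mulr_ge0 ?ind_ge0 ?lipker_ge0.
set J := (\int[mu]_w (lipker w)%:E)%E.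
have J0 : (0 <= J)%E by apply: integral_ge0 => w _; rewrite lee_fin lipker_ge0.
have Jfin : J \is a fin_num by rewrite ge0_fin_numE// lipker_lty.
have inner x : (\int[mu]_y (\1_(cube N%:R) x * lipker (x - y))%:E = (fine J * \1_(cube N%:R) x)%:E)%E.
  have E y : lipker (x - y) = lipker (- x + y) by rewrite /lipker enorm_subC addrC.
  under eq_integral do rewrite /= E.
  have ms : measurable_fun [set: V] (fun y => lipker (- x + y)).
    by apply: (measurableT_comp ml); have [] := mpres_shift (- x).
  rewrite (int_Z ms (fun y => lipker_ge0 _) (ind_ge0 _ _)).
  have -> : (\int[mu]_y (lipker (- x + y))%:E = J)%E.
    have ml' : measurable_fun [set: V] (fun w => (lipker w)%:E) by exact/measurable_EFinP.
    by apply: (ge0_integral_mpres (mpres_shift (- x)) ml') => w; rewrite lee_fin lipker_ge0.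
  by rewrite -[J in LHS](fineK Jfin) -EFinM mulrC.
under eq_integral do rewrite /= inner.
have f0 : 0 <= fine J by exact: fine_ge0.
apply: (@int_bounded_cube _ (fine J) N) => //.
- exact: measurable_funM.
- by move=> x; rewrite mulr_ge0 ?ind_ge0.
Qed.

Lemma DI_gag_lty phi N : measurable_fun [set: V] phi -> (forall x, 0 <= phi x <= 1) ->
  (forall x y, `|phi x - phi y| <= L * enorm (x - y)) -> (forall x, ~ cube N%:R x -> phi x = 0) ->
  (DI (gag s p phi) < +oo)%E.
Proof.
move=> mphi phi01 lip supp; pose F (z : VV) := \1_(cube N%:R) z.1 * lipker (z.1 - z.2).
have F0 z : 0 <= F z by rewrite mulr_ge0 ?ind_ge0 ?lipker_ge0.
have mN := @measurable_cube R n N%:R; have mI : measurable_fun [set: V] (\1_(cube N%:R) : V -> R) by exact: measurable_indic.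
have mF : measurable_fun [set: VV] F.
  apply: measurable_funM; first by apply: (measurableT_comp mI); exact: measurable_fst.
  exact: (measurableT_comp measurable_lipker measurable_subVV).
have mF' : measurable_fun [set: VV] (fun z => F (z.2, z.1)).
  apply: (measurableT_comp mF); apply/measurable_fun_pairP.
  by split; [exact: measurable_snd|exact: measurable_fst].
apply: (@le_lt_trans _ _ (DI F + DI (fun z => F (z.2, z.1)))%E).
  rewrite -(DI_D mF mF' F0 (fun z => F0 _)); apply: DI_le.
  - exact: measurable_gag.
  - exact: (measurable_funD mF mF').
  - exact: gag_ge0.
  - exact: gag_le_lipker phi01 lip supp.
exact: (lte_add_pinfty (DI_lipker N) (eq_ind_r (fun z => (z < +oo)%E) (DI_lipker N) (DI_swap mF F0))).
Qed.

End finite_energy.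

(** * Bumps are admissible with finite energy *)

Section bump_energy.
Context {R : realType} {n : nat}.
Local Notation V := 'rV[R]_n.
Local Notation mu := (@lebesgue_rV R n).
Variables (s p : R).
Hypotheses (p1 : 1 < p) (s0 : 0 < s) (s1 : s < 1).

Let p0 : 0 < p. Proof. exact: lt_trans p1. Qed.

Lemma bump_adm k (a b : V) (Omega : set V) : obox a b `<=` Omega ->
  exists g, adm p Omega (bump k a b) g /\ (energy s p (bump k a b) g < +oo)%E.
Proof.
move=> abO; set phi := bump k a b; have tphi : test_function phi by exact: bump_test.
have [N [C C0 [z0 dz0 zC dzC]]] := test_bound tphi; have C0' := ltW C0.
have phig := test_isgrad tphi; exists (fun x => \row_i partial i phi x).
have phi01 x : 0 <= phi x <= 1 by rewrite bump_ge0 bump_le1.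
have mphi := isgrad_measurable phig; have mg := isgrad_measurable_grad phig.
have Lfin : (Lp p phi < +oo)%E.
  apply: (@int_bounded_cube _ _ _ 1 N) => //.
  - exact: measurable_pow_norm.
  - move=> x; rewrite mul1r indicE; have [Nx|Nx] := pselect (cube N%:R x).
      have /andP[h0 h1] := phi01 x; rewrite mem_set// (ger0_norm h0).
      apply: (@le_trans _ _ (1 `^ p)); last by rewrite powR1.
      by apply: ge0_ler_powR; rewrite ?nnegrE ?(ltW p0).
    by rewrite memNset// z0// normr0 powR0 ?gt_eqF.
have Gfin : (Loc p (fun x => \row_i partial i phi x) < +oo)%E.
  apply: (@int_bounded_cube _ _ _ ((n%:R * C) `^ p) N) => //; last exact: powR_ge0.
  - exact: measurable_enorm_pow.
  - by move=> x; exact: powR_ge0.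
  - move=> x; rewrite indicE; have [Nx|Nx] := pselect (cube N%:R x).
      rewrite mem_set// mulr1; apply: ge0_ler_powR; rewrite ?nnegrE ?(ltW p0) ?enorm_ge0 ?mulr_ge0//.
      by apply: enorm_cube; apply/cubeP => i; rewrite mxE.
    rewrite memNset// mulr0 (_ : \row_i partial i phi x = 0); first by rewrite enorm0 powR0 ?gt_eqF.
    by apply: eq_row => i; rewrite !mxE dz0.
split.
  split => //; apply: aeW => x Ox; apply: bump_out => abx; apply: Ox; exact: abO.
apply: lte_add_pinfty => //.
apply: (@DI_gag_lty _ _ s p (C * n%:R) p1 s0 s1 _ phi N) => //.
  by rewrite mulr_ge0.
exact: test_lip.
Qed.

Lemma obox_measure_gt0 (a b : V) : (forall i, a ord0 i < b ord0 i) -> (0 < mu (obox a b))%E.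
Proof.
move=> ab; rewrite lebesgue_rV_box//.
apply: (big_ind (fun x => 0 < x)%E) => // [x y|i _]; first exact: mule_gt0.
by rewrite lebesgue_measure_itv/= lte_fin ab -EFinB lte_fin subr_gt0.
Qed.

Lemma bump_Lp_gt0 k (a b : V) : (forall i, a ord0 i < b ord0 i) -> (0 < Lp p (bump k a b))%E.
Proof.
move=> ab; rewrite lt_neqAle Lp_ge0 andbT eq_sym; apply/negP => /eqP L0.
have mb := @measurable_bump R n k a b.
have mP : measurable_fun [set: V] (fun x => (`|bump k a b x| `^ p)%:E).
  by apply/measurable_EFinP; exact: measurable_pow_norm.
have : (\int[mu]_x `|(`|bump k a b x| `^ p)%:E| = 0)%E.
  by rewrite -[RHS]L0; apply: eq_integral => x _; rewrite gee0_abs// lee_fin powR_ge0.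
move=> /(ae_eq_integral_abs mu measurableT mP)[N [mN N0 HN]].
have : (mu (obox a b) <= mu N)%E.
  apply: le_measure; rewrite ?inE//; first exact: measurable_obox.
  move=> x abx; apply: HN => /= /(_ Logic.I)[] /eqP; rewrite powR_eq0 normr_eq0 => /andP[/eqP b0 _].
  by have := bump_gt0 k abx; rewrite b0 ltxx.
have := obox_measure_gt0 ab; rewrite (_ : mu N = 0%E)// => /lt_le_trans H /H.
by rewrite ltxx.
Qed.

End bump_energy.

(** * Compactness *)

Section subsequences.
Context {R : realType} {n : nat}.
Local Notation V := 'rV[R]_n.
Local Notation mu := (@lebesgue_rV R n).
Variable p : R.
Hypothesis p1 : 1 < p.

Let p0 : 0 < p. Proof. exact: lt_trans p1. Qed.

Lemma geometric_cvg (v : nat -> R) (A : R) : (forall k, `|v k.+1 - v k| <= A * 2^-1 ^+ k) -> cvgn v.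
Proof.
move=> H; have H1 : cvgn (series (telescope v)).
  apply: normed_cvg; apply: (@series_le_cvg _ _ (geometric A 2^-1)) => //.
  - by move=> k /=; exact: normr_ge0.
  - by move=> k; exact: le_trans (normr_ge0 _) (H k).
  - by apply: is_cvg_geometric_series; rewrite ger0_norm// invf_lt1// ltr1n.
rewrite (_ : v = (fun k => v 0%N + series (telescope v) k)); last by apply/funext => k; exact: eq_sum_telescope.
by apply: is_cvgD => //; exact: is_cvg_cst.
Qed.

Lemma half_series_le : (\sum_(k <oo) ((2^-1 : R) ^+ k)%:E <= 2%:E)%E.
Proof.
apply: lime_le; first by apply: is_cvg_nneseries => k _ _; rewrite lee_fin exprn_ge0.
apply: nearW => k; rewrite sumEFin lee_fin big_mkord; apply: (le_trans (geo_le _ _ _)) => //.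
  by rewrite invf_lt1// ltr1n.
by rewrite le_eqVlt; apply/orP; left; apply/eqP; field.
Qed.

(** Weight the p-th powers of the increments by 2^(pk): the integrals then sum to at most 2, so the
    weighted series S is finite a.e. and the k-th increment is at most S^(1/p) 2^(-k). *)
Lemma fast_cvg (v : nat -> V -> R) : (forall k, measurable_fun [set: V] (v k)) ->
  (forall k, Lp p (fun x => v k.+1 x - v k x)%R <= ((2^-1 * 2^-1 `^ p) ^+ k)%:E)%E ->
  exists2 l : V -> R, measurable_fun [set: V] l & {ae mu, forall x, v k x @[k --> \oo] --> l x}.
Proof.
move=> mv Hv; pose c k : R := (2 `^ p) ^+ k.
have c0 k : 0 < c k by rewrite exprn_gt0// powR_gt0.
pose t k x := c k * `|v k.+1 x - v k x| `^ p.
have t0 k x : 0 <= t k x by rewrite mulr_ge0 ?powR_ge0// ltW.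
have md k : measurable_fun [set: V] (fun x => `|v k.+1 x - v k x| `^ p).
  by apply: measurable_pow_norm; exact: measurable_funB.
have mt k : measurable_fun [set: V] (t k) by exact: measurable_funM.
have mtE k : measurable_fun [set: V] (fun x => (t k x)%:E) by exact/measurable_EFinP.
have t0E k x : (0 <= (t k x)%:E)%E by rewrite lee_fin.
pose S x := (\sum_(k <oo) (t k x)%:E)%E.
have S0 x : (0 <= S x)%E by exact: nneseries_ge0.
have mS : measurable_fun [set: V] S by apply: ge0_emeasurable_sum => // k x _ _; exact: t0E.
have IS : (\int[mu]_x S x <= 2%:E)%E.
  rewrite integral_nneseries//; apply: le_trans half_series_le; apply: lee_nneseries => k _ //.
    by move=> _; apply: integral_ge0 => x _; exact: t0E.
  rewrite (int_Z (md k) (fun x => powR_ge0 _ _) (ltW (c0 k))).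
  apply: (@le_trans _ _ ((c k)%:E * ((2^-1 * 2^-1 `^ p) ^+ k)%:E)%E).
    by apply: lee_wpmul2l; [rewrite lee_fin ltW|exact: Hv].
  rewrite -EFinM lee_fin /c -exprMn mulrCA -powRM// divff// powR1 mulr1//.
have fS : {ae mu, forall x, S x \is a fin_num}.
  have IS' : mu.-integrable [set: V] S.
    apply/integrableP; split => //; apply: (@le_lt_trans _ _ 2%:E); last exact: ltry.
    by under eq_integral do rewrite gee0_abs//.
  by have := integrable_ae measurableT IS'; apply: filterS => x; exact.
pose l x := fine (limn_esup (fun k => (v k x)%:E)).
exists l.
  apply: (measurableT_comp (f := fine)); first exact: fine_measurable.
  by apply: measurable_fun_limn_esup => k; exact/measurable_EFinP.
apply: filterS fS => x fx.
have B k : `|v k.+1 x - v k x| <= (fine (S x)) `^ p^-1 * 2^-1 ^+ k.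
  have tS : t k x <= fine (S x).
    rewrite -lee_fin fineK//; apply: (le_trans _ (@nneseries_lim_ge _ (fun k => (t k x)%:E) xpredT 0%N k.+1 _)) => //.
    by rewrite big_nat_recr//= leeDr// sume_ge0.
  have fS0 : 0 <= fine (S x) by exact: fine_ge0.
  have h0 : (0 : R) <= 2^-1 by rewrite invr_ge0.
  have -> : `|v k.+1 x - v k x| = (`|v k.+1 x - v k x| `^ p) `^ p^-1.
    by rewrite -powRrM divff ?gt_eqF// powRr1.
  have -> : (2^-1 : R) ^+ k = ((2^-1 ^+ k) `^ p) `^ p^-1.
    by rewrite -powRrM divff ?gt_eqF// powRr1// exprn_ge0.
  rewrite -powRM ?powR_ge0//; apply: ge0_ler_powR; rewrite ?nnegrE ?invr_ge0 ?(ltW p0) ?powR_ge0 ?mulr_ge0 ?powR_ge0//.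
  rewrite exp_powR// -ler_pdivrMr; last by rewrite exprn_gt0// powR_gt0.
  apply: le_trans tS; rewrite /t /c le_eqVlt; apply/orP; left; apply/eqP.
  rewrite mulrC -exprVn; congr (_ ^+ _ * _).
  apply: (mulfI (x := 2^-1 `^ p)); first by rewrite gt_eqF// powR_gt0.
  by rewrite divff ?gt_eqF ?powR_gt0// -powRM// mulVf// powR1.
have cv := geometric_cvg B.
have H : (v k x)%:E @[k --> \oo] --> (lim (v k x @[k --> \oo]))%:E by apply: cvg_EFin; [exact: nearW|exact: cv].
by rewrite /l (cvg_limn_einf_sup H).2 /=; exact: cv.
Qed.

End subsequences.

(** * Piecewise constant approximation on small cells *)

Section cells.
Context {R : realType} {n : nat}.
Local Notation V := 'rV[R]_n.
Local Notation VV := (V * V)%type.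
Local Notation mu := (@lebesgue_rV R n).
Variables (N m : nat).
Local Notation J := {ffun 'I_n -> 'I_m.+1}.

(** The cells cut [-(N+1), N+1[ into m+1 half-open intervals along each axis; the margin of 1 lets
    half-open cells cover the closed [cube N]. *)
Definition side : R := 2 * N.+1%:R / m.+1%:R.
Local Notation de := side.

Lemma side_gt0 : 0 < de. Proof. by rewrite divr_gt0// mulr_gt0. Qed.

Definition cell (j : J) : set V :=
  rbox (fun i => `[- N.+1%:R + de * (j i)%:R, - N.+1%:R + de * (j i).+1%:R[%classic).

(** The index of the cell of x. Outside all cells [inord] may return an arbitrary index, but then x
    is not in [cell (col x)], which is how [sum_cell] stays true everywhere. *)
Definition col (x : V) : J := [ffun i => inord (Num.truncn ((x ord0 i + N.+1%:R) / de))].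

Lemma measurable_cell j : measurable (cell j).
Proof. by apply: measurable_rbox => i. Qed.

Lemma cellP j x : cell j x <-> forall i, (j i)%:R <= (x ord0 i + N.+1%:R) / de < (j i).+1%:R.
Proof.
have d0 := side_gt0; split=> H i; have := H i; rewrite /= in_itv/= ler_pdivlMr// ltr_pdivrMr// => /andP[h1 h2];
  apply/andP; split; lra.
Qed.

Lemma cell_col j x : cell j x -> col x = j.
Proof.
move=> /cellP H; apply/ffunP => i; rewrite ffunE; have /andP[h1 h2] := H i.
have t0 : 0 <= (x ord0 i + N.+1%:R) / de by exact: le_trans h1.
suff -> : Num.truncn ((x ord0 i + N.+1%:R) / de) = j i by exact: inord_val.
by apply/eqP; rewrite eqn_leq -ltnS truncn_lt_nat// h2 truncn_ge_nat// h1.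
Qed.

Lemma col_cell x : cube N%:R x -> cell (col x) x.
Proof.
move=> /cubeP Nx; apply/cellP => i; have := Nx i; rewrite ler_norml => /andP[h1 h2]; have d0 := side_gt0.
have t0 : 0 <= (x ord0 i + N.+1%:R) / de by rewrite divr_ge0 ?(ltW d0)// -natr1; lra.
rewrite ffunE inordK; first exact: truncn_itv.
rewrite truncn_lt_nat// ltr_pdivrMr// /side mulrCA divff ?mulr1; last by rewrite pnatr_eq0.
by rewrite -natr1; lra.
Qed.

Lemma mu_cell j : mu (cell j) = (de ^+ n)%:E.
Proof.
have d0 := side_gt0; rewrite lebesgue_rV_box//.
have E i : lebesgue_measure (`[- N.+1%:R + de * (j i)%:R, - N.+1%:R + de * (j i).+1%:R[%classic : set (measurableTypeR R)) = de%:E.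
  rewrite lebesgue_measure_itv/= lte_fin -natr1 ifT; last by lra.
  by rewrite -EFinB; congr EFin; ring.
under eq_bigr do rewrite E.
rewrite (_ : de ^+ n = \prod_(i < n) de); last by rewrite prodr_const card_ord.
by elim/big_ind2 : _ => // x x' y y' -> ->.
Qed.

Lemma cell_enorm j x y : cell j x -> cell j y -> enorm (x - y) <= n%:R * de.
Proof.
have d0 := side_gt0; move=> jx jy; apply: enorm_cube; apply/cubeP => i; rewrite !mxE.
have := jx i; have := jy i; rewrite /= !in_itv/= -natr1 => /andP[a1 a2] /andP[b1 b2].
by rewrite ler_norml; apply/andP; split; lra.
Qed.

Lemma sum_cell (G : J -> R) x : \sum_j \1_(cell j) x * G j = \1_(cell (col x)) x * G (col x).
Proof.
rewrite (bigD1 (col x))//= big1 ?addr0// => j jx.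
rewrite indicE memNset ?mul0r// => jx'; move: jx; rewrite (cell_col jx') eqxx//.
Qed.

Lemma int_sum (I : Type) (l : seq I) (F : I -> V -> R) : (forall i, measurable_fun [set: V] (F i)) ->
  (forall i x, 0 <= F i x) ->
  (\int[mu]_x (\sum_(i <- l) F i x)%:E = \sum_(i <- l) \int[mu]_x (F i x)%:E)%E.
Proof.
move=> mF F0; elim: l => [|i l IH].
  by rewrite big_nil; under eq_integral do rewrite big_nil; rewrite integral0.
rewrite big_cons -IH -(int_D (mF i) (measurable_sum _ mF) (F0 i)).
  by apply: eq_integral => x _; rewrite big_cons.
by move=> x; apply: sumr_ge0.
Qed.

Lemma DI_sum (I : Type) (l : seq I) (F : I -> VV -> R) : (forall i, measurable_fun [set: VV] (F i)) ->
  (forall i x, 0 <= F i x) -> DI (fun z => \sum_(i <- l) F i z) = (\sum_(i <- l) DI (F i))%E.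
Proof.
move=> mF F0; elim: l => [|i l IH].
  rewrite big_nil (_ : (fun z => _) = (fun z => 0 * (fun=> 0) z)); last by apply/funext => z; rewrite big_nil mul0r.
  by rewrite DI_Z// ?mul0e//; exact: measurable_cst.
rewrite big_cons -IH -(DI_D (mF i) (measurable_sum _ mF) (F0 i)).
  by congr DI; apply/funext => x; rewrite big_cons.
by move=> x; apply: sumr_ge0.
Qed.

(** Some value is at most the mean, up to [e]: if [f] exceeded (a + e) / q on all of [Q], its
    integral would be at least a + e. *)
Lemma mean_value (f : V -> \bar R) (Q : set V) (q a e : R) : measurable_fun [set: V] f ->
  (forall x, 0 <= f x)%E -> measurable Q -> mu Q = q%:E -> 0 < q -> 0 < e ->
  (\int[mu]_x ((\1_Q x)%:E * f x) <= a%:E)%E -> exists2 x, Q x & (f x <= ((a + e) / q)%:E)%E.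
Proof.
move=> mf f0 mQ muQ q0 e0 H; apply: contrapT => /forall2NP H'.
have c0 : 0 <= a.
  by rewrite -lee_fin; apply: (le_trans _ H); apply: integral_ge0 => x _; rewrite mule_ge0// lee_fin ind_ge0.
have : (\int[mu]_x (((a + e) / q) * \1_Q x)%:E <= a%:E)%E.
  apply: (le_trans _ H); apply: ge0_le_integral => //.
  - by move=> x _; rewrite lee_fin mulr_ge0 ?ind_ge0// divr_ge0 ?(ltW q0)// addr_ge0// ltW.
  - by apply/measurable_EFinP; apply: measurable_funM => //; exact: measurable_indic.
  - by apply: emeasurable_funM => //; apply/measurable_EFinP; exact: measurable_indic.
  - move=> x _; rewrite indicE; have [Qx|Qx] := pselect (Q x); last by rewrite memNset// mulr0 mul0e.
    rewrite mem_set// mulr1 mul1e; have [//|] := H' x.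
    by move=> /negP; rewrite -ltNge => /ltW.
have mI : measurable_fun [set: V] (\1_Q : V -> R) by exact: measurable_indic.
rewrite (int_Z mI (@ind_ge0 _ _ Q)); last by rewrite divr_ge0 ?(ltW q0)// addr_ge0// ltW.
have -> : (\int[mu]_x (\1_Q x)%:E = q%:E)%E by rewrite integral_indic// setIT; exact: muQ.
rewrite -EFinM lee_fin divfK ?gt_eqF//; lra.
Qed.

Variables (s p : R).
Hypotheses (p1 : 1 < p) (s0 : 0 < s).
Let q := n%:R + s * p.
Let p0 : 0 < p. Proof. exact: lt_trans p1. Qed.
Let q0 : 0 < q. Proof. exact: kexp_gt0. Qed.
Implicit Types u : V -> R.

Definition cellerr u (c : J -> R) (x : V) : R := \sum_j \1_(cell j) x * `|u x - c j| `^ p.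

Let mI j : measurable_fun [set: V] (\1_(cell j) : V -> R).
Proof. by apply: measurable_indic; exact: measurable_cell. Qed.

Lemma measurable_cellerr_term u (c : J -> R) j : measurable_fun [set: V] u ->
  measurable_fun [set: V] (fun x => \1_(cell j) x * `|u x - c j| `^ p).
Proof.
move=> mu_; apply: measurable_funM => //; apply: measurable_pow_norm.
by apply: measurable_funB.
Qed.

Lemma measurable_cellerr u (c : J -> R) : measurable_fun [set: V] u -> measurable_fun [set: V] (cellerr u c).
Proof. by move=> mu_; apply: measurable_sum => j; exact: measurable_cellerr_term. Qed.

Lemma cellerr_ge0 u c x : 0 <= cellerr u c x.
Proof. by apply: sumr_ge0 => j _; rewrite mulr_ge0 ?ind_ge0 ?powR_ge0. Qed.

Let pair u (j : J) (z : VV) : R := \1_(cell j) z.1 * (\1_(cell j) z.2 * `|u z.1 - u z.2| `^ p).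

Let pair0 u j z : 0 <= pair u j z.
Proof. by rewrite !mulr_ge0 ?ind_ge0 ?powR_ge0. Qed.

Let mpair u j : measurable_fun [set: V] u -> measurable_fun [set: VV] (pair u j).
Proof.
move=> mu_; apply: measurable_funM; first exact: (measurable_fstf (mI j)).
apply: measurable_funM; first exact: (measurable_sndf (mI j)).
by apply: measurable_pow_norm; exact: measurable_dif.
Qed.

(** Two points of one cell are within n times its side, so (n de)^q times the kernel is at least 1
    off the diagonal. *)
Let pair_le u z : \sum_j pair u j z <= (n%:R * de) `^ q * gag s p u z.
Proof.
case: z => x y; rewrite /pair /= sum_cell.
have g0 := gag_ge0 s p u (x, y); have d0 := side_gt0.
have r0 : 0 <= (n%:R * de) `^ q * gag s p u (x, y) by rewrite mulr_ge0 ?powR_ge0.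
rewrite !indicE; have [cx|cx] := pselect (cell (col x) x); last by rewrite memNset// mul0r.
have [cy|cy] := pselect (cell (col x) y); last by rewrite (memNset cy) mul0r mulr0.
rewrite !mem_set// !mul1r; have [->|xy] := eqVneq x y.
  rewrite subrr normr0 powR0; first by apply: mulr_ge0; [exact: powR_ge0|exact: gag_ge0].
  by rewrite gt_eqF.
have e0 : 0 < enorm (x - y).
  by rewrite lt_neqAle enorm_ge0 andbT eq_sym; apply: contra xy => /eqP/enorm_eq0/eqP; rewrite subr_eq0.
rewrite /gag /ker/= mulrCA -[leLHS]mulr1 ler_wpM2l ?powR_ge0// ler_pdivlMr ?powR_gt0// mul1r.
apply: ge0_ler_powR; rewrite ?nnegrE ?enorm_ge0 ?mulr_ge0 ?(ltW d0) ?(ltW q0)//.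
exact: cell_enorm cx cy.
Qed.

(** A fractional Poincare inequality: the constant on a cell is the value of [u] at a point of that
    cell chosen by [mean_value]. The slack [e] is shared among the [k] cells. *)
Lemma approx_cells u (B e : R) : measurable_fun [set: V] u -> (DI (gag s p u) <= B%:E)%E -> 0 < e ->
  exists c : J -> R, (\int[mu]_x (cellerr u c x)%:E <= ((n%:R * de) `^ q / de ^+ n * B + e)%:E)%E.
Proof.
move=> mu_ uB e0; have d0 := side_gt0; have dn0 : 0 < de ^+ n by rewrite exprn_gt0.
pose A j := DI (pair u j).
have A0 j : (0 <= A j)%E by apply: DI_ge0.
have SA : (\sum_j A j <= ((n%:R * de) `^ q * B)%:E)%E.
  rewrite -(DI_sum _ (fun j => mpair j mu_) (pair0 u)).
  apply: (@le_trans _ _ (DI (fun z => (n%:R * de) `^ q * gag s p u z))).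
    apply: DI_le; [by apply: measurable_sum => j; exact: mpair| | |exact: pair_le].
      by apply: measurable_funM => //; exact: measurable_gag.
    by move=> z; exact: sumr_ge0.
  rewrite (DI_Z (measurable_gag s p mu_) (gag_ge0 s p u) (powR_ge0 _ _)) EFinM.
  by apply: lee_wpmul2l => //; rewrite lee_fin powR_ge0.
have Afin j : A j \is a fin_num.
  rewrite ge0_fin_numE//; apply: (@le_lt_trans _ _ (\sum_j A j)%E).
    by rewrite (bigD1 j)//= leeDl// sume_ge0.
  exact: le_lt_trans SA (ltry _).
pose k : R := #|J|%:R; have k0 : 0 < k by rewrite ltr0n; apply/card_gt0P; exists (col 0).
have H j : exists c, (\int[mu]_x (\1_(cell j) x * `|u x - c| `^ p)%:E <= ((fine (A j) + e * de ^+ n / k) / de ^+ n)%:E)%E.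
  have m2 y : measurable_fun [set: V] (fun x => \1_(cell j) x * `|u y - u x| `^ p).
    apply: measurable_funM => //; apply: measurable_pow_norm; exact: measurable_funB.
  pose f y := (\int[mu]_x (\1_(cell j) x * `|u y - u x| `^ p)%:E)%E.
  have mpE : measurable_fun [set: VV] (fun z : VV => (\1_(cell j) z.2 * `|u z.1 - u z.2| `^ p)%:E).
    apply/measurable_EFinP; apply: measurable_funM; first exact: (measurable_sndf (mI j)).
    by apply: measurable_pow_norm; exact: measurable_dif.
  have mf : measurable_fun [set: V] f.
    apply: (measurable_fun_fubini_tonelli_F (m2 := mu) _ mpE) => z.
    by rewrite lee_fin mulr_ge0 ?ind_ge0 ?powR_ge0.
  have f0 y : (0 <= f y)%E by apply: integral_ge0 => x _; rewrite lee_fin mulr_ge0 ?ind_ge0 ?powR_ge0.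
  have e0' : 0 < e * de ^+ n / k by rewrite divr_gt0// mulr_gt0.
  have Hint : (\int[mu]_x ((\1_(cell j) x)%:E * f x) <= (fine (A j))%:E)%E.
    rewrite fineK// /A (DI_iter (mpair j mu_) (pair0 u j)) le_eqVlt; apply/orP; left; apply/eqP.
    apply: eq_integral => x _; rewrite /pair/= (int_Z (m2 x))//.
  have [y jy fy] := mean_value mf f0 (measurable_cell j) (mu_cell j) dn0 e0' Hint.
  by exists (u y); apply: le_trans fy; rewrite /f; under eq_integral do rewrite distrC.
have [c Hc] := choice H; exists c.
rewrite /cellerr (int_sum _ (fun j => measurable_cellerr_term c j mu_)); last first.
  by move=> j x; rewrite mulr_ge0 ?ind_ge0 ?powR_ge0.
apply: (@le_trans _ _ (\sum_j ((fine (A j) + e * de ^+ n / k) / de ^+ n)%:E)%E).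
  by apply: lee_sum => j _; exact: Hc.
rewrite sumEFin lee_fin -mulr_suml big_split/= sumr_const -/k.
have -> : (e * de ^+ n / k) *+ #|J| = e * de ^+ n by rewrite -mulr_natr -/k divfK ?gt_eqF.
rewrite mulrDl mulfK ?gt_eqF// lerD2r mulrAC ler_wpM2r ?invr_ge0 ?(ltW dn0)//.
rewrite -lee_fin -sumEFin; apply: le_trans SA; rewrite le_eqVlt; apply/orP; left; apply/eqP.
by apply: eq_bigr => j _; rewrite fineK.
Qed.

End cells.

(** * Almost everywhere convergent subsequences *)

Section compactness.
Context {R : realType} {n : nat}.
Local Notation V := 'rV[R]_n.
Local Notation VV := (V * V)%type.
Local Notation mu := (@lebesgue_rV R n).

Definition unbounded_nat (I : set nat) : Prop := forall K, exists2 k, (K <= k)%N & I k.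

Lemma unbounded_pigeonhole (T : finType) (color : nat -> T) (I : set nat) :
  unbounded_nat I -> exists t, unbounded_nat (I `&` [set k | color k = t]).
Proof.
move=> uI; apply: contrapT => /forallNP H.
have {}H t : exists K, forall k, (K <= k)%N -> I k -> color k <> t.
  have /existsNP[K HK] := H t; exists K => k Kk Ik kt; apply: HK; exists k => //.
have [K HK] := choice H; have [k Kk Ik] := uI (\sum_t K t)%N.
apply: (HK (color k) k) => //; apply: leq_trans Kk.
by rewrite (bigD1 (color k))//= leq_addr.
Qed.

Variables (s p : R) (N : nat) (B : R) (u : nat -> V -> R).
Hypotheses (p1 : 1 < p) (s0 : 0 < s) (B0 : 0 <= B).
Hypothesis mu_ : forall k, measurable_fun [set: V] (u k).
Hypothesis Lu : forall k, Lp p (u k) = 1%E.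
Hypothesis Gu : forall k, (DI (gag s p (u k)) <= B%:E)%E.
Hypothesis u0 : forall k, {ae mu, forall x, ~ cube N%:R x -> u k x = 0}.

Let q := n%:R + s * p.
Let p0 : 0 < p. Proof. exact: lt_trans p1. Qed.
Let q0 : 0 < q. Proof. exact: kexp_gt0. Qed.
Let sp0 : 0 < s * p. Proof. exact: mulr_gt0. Qed.

(** The factor equals n^q de^(sp), which tends to 0 with the side because s p > 0. *)
Lemma small_side (e : R) : 0 < e -> exists m, (n%:R * side N m) `^ q / side N m ^+ n * B <= e.
Proof.
move=> e0; pose A : R := n%:R `^ q * B + 1.
have A0 : 0 < A by rewrite ltr_wpDl// mulr_ge0// powR_ge0.
pose D := (e / A) `^ (s * p)^-1; have D0 : 0 < D by rewrite powR_gt0// divr_gt0.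
exists (Num.truncn (2 * N.+1%:R / D)); set m := Num.truncn _.
have d0 := @side_gt0 R N m; set de := side N m in d0 *.
have dD : de <= D.
  rewrite /de /side ler_pdivrMr// -ler_pdivrMl// mulrC; exact/ltW/truncnS_gt.
have -> : (n%:R * de) `^ q / de ^+ n * B = n%:R `^ q * B * de `^ (s * p).
  rewrite powRM ?(ltW d0)// -powR_mulrn ?(ltW d0)//.
  have -> : de `^ q = de `^ n%:R * de `^ (s * p) by rewrite -powRD// gt_eqF ?implybT// (gt_eqF d0) implybT.
  have : de `^ n%:R != 0 by rewrite gt_eqF// powR_gt0.
  by move: (de `^ n%:R) (de `^ (s * p)) (n%:R `^ q) => X Y Z h; field.
have h1 : de `^ (s * p) <= e / A.
  apply: (@le_trans _ _ (D `^ (s * p))); first by apply: ge0_ler_powR; rewrite ?nnegrE ?(ltW d0) ?(ltW D0) ?(ltW sp0).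
  by rewrite /D -powRrM mulVf ?gt_eqF// powRr1// divr_ge0// ltW.
apply: (@le_trans _ _ (A * (e / A))); last by rewrite mulrCA divff ?gt_eqF// mulr1.
by apply: ler_pM => //; rewrite ?powR_ge0 ?mulr_ge0 ?powR_ge0// /A lerDl.
Qed.

Let M1 : R := (2 * N.+1%:R) ^+ n.
Let M10 : 0 < M1. Proof. by rewrite exprn_gt0// mulr_gt0. Qed.

Lemma cellerr_cube (m : nat) v (c : {ffun 'I_n -> 'I_m.+1} -> R) x : cube N%:R x ->
  cellerr N p v c x = `|v x - c (col N m x)| `^ p.
Proof.
move=> Nx; rewrite /cellerr (sum_cell N (fun j => `|v x - c j| `^ p)).
by rewrite indicE mem_set ?mul1r//; exact: col_cell.
Qed.

(** Each u_k is close to a function constant on cells, whose finitely many values are bounded since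
    the norm is 1. Rounding these values to a mesh [th] leaves finitely many possibilities, used as
    colours for the pigeonhole principle. *)
Lemma total_bounded (e : R) : 0 < e -> exists (T : finType) (color : nat -> T),
  forall a b, color a = color b -> (Lp p (fun x => u a x - u b x)%R <= e%:E)%E.
Proof.
(* Two cell errors of at most 2 e' each, multiplied by 4^p, make e / 2; the rounding error th^p over
   a cube of measure [M1] makes the other half. The factor 4^p comes from using [powD_le] twice. *)
move=> e0; have F0 : 0 < 4 `^ p :> R by rewrite powR_gt0.
pose e' := e / (8 * 4 `^ p); have e'0 : 0 < e' by rewrite divr_gt0// mulr_gt0.
have [m Hm] := small_side e'0; have d0 := @side_gt0 R N m.
pose J : finType := {ffun 'I_n -> 'I_m.+1}.
have H k : exists c : J -> R, (\int[mu]_x (cellerr N p (u k) c x)%:E <= (e' + e')%:E)%E.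
  have [c Hc] := approx_cells N m p1 s0 (mu_ k) (Gu k) e'0; exists c.
  by apply: (le_trans Hc); rewrite lee_fin lerD2r.
have [c Hc] := choice H.
have dn0 : 0 < side N m ^+ n :> R by rewrite exprn_gt0.
pose K := (2 `^ p * (e' + e' + 1) / side N m ^+ n) `^ p^-1.
have K0 : 0 <= K by exact: powR_ge0.
have mcell (j : J) : measurable_fun [set: V] (\1_(cell N j) : V -> R).
  by apply: measurable_indic; exact: measurable_cell.
have cK k j : `|c k j| <= K.
  have c0 : 0 <= `|c k j| `^ p by exact: powR_ge0.
  have E : ((`|c k j| `^ p * side N m ^+ n)%:E <= (2 `^ p * (e' + e' + 1))%:E)%E.
    have -> : ((`|c k j| `^ p * side N m ^+ n)%:E = \int[mu]_x (`|c k j| `^ p * \1_(cell N j) x)%:E)%E.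
      rewrite (int_Z (mcell j) (@ind_ge0 _ _ _) c0) integral_indic ?setIT//; last exact: measurable_cell.
      by rewrite EFinM; congr (_ * _)%E; apply: esym; exact: mu_cell.
    have m1 : measurable_fun [set: V] (cellerr N p (u k) (c k)) by exact: measurable_cellerr.
    have m2 := measurable_pow_norm p (mu_ k).
    have m12 := measurable_funD m1 m2.
    apply: (@le_trans _ _ (\int[mu]_x (2 `^ p * (cellerr N p (u k) (c k) x + `|u k x| `^ p))%:E)%E).
      apply: ge0_le_integral => //.
      - by apply/measurable_EFinP; exact: measurable_funM.
      - by apply/measurable_EFinP; exact: measurable_funM.
      - move=> x _; rewrite lee_fin indicE; have [jx|jx] := pselect (cell N j x); last first.
          rewrite memNset// mulr0 mulr_ge0 ?powR_ge0// addr_ge0 ?powR_ge0//; exact: cellerr_ge0.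
        rewrite mem_set// mulr1 -(normrN (c k j)).
        have -> : - c k j = (u k x - c k j) + (- u k x) by ring.
        apply: (le_trans (powD_le p1 _ _)); rewrite normrN ler_wpM2l ?powR_ge0// lerD2r.
        rewrite /cellerr (bigD1 j)//= indicE mem_set// mul1r lerDl; apply: sumr_ge0 => i _.
        by rewrite mulr_ge0 ?ind_ge0 ?powR_ge0.
    have H0 x : 0 <= cellerr N p (u k) (c k) x + `|u k x| `^ p by rewrite addr_ge0 ?powR_ge0//; exact: cellerr_ge0.
    rewrite (int_Z m12 H0 (powR_ge0 _ _)) EFinM; apply: lee_wpmul2l; first by rewrite lee_fin powR_ge0.
    rewrite (int_D m1 m2 (cellerr_ge0 _ _ _ _) (fun x => powR_ge0 _ _)) EFinD; apply: leeD; first exact: Hc.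
    by rewrite -(Lu k).
  have -> : `|c k j| = (`|c k j| `^ p) `^ p^-1 by rewrite -powRrM divff ?gt_eqF// powRr1.
  apply: ge0_ler_powR; rewrite ?nnegrE ?invr_ge0 ?(ltW p0)//.
    by rewrite divr_ge0 ?mulr_ge0 ?powR_ge0 ?(ltW dn0)//; lra.
  by rewrite ler_pdivlMr// -lee_fin.
pose th := (e / (2 * 4 `^ p * M1)) `^ p^-1.
have thp : th `^ p = e / (2 * 4 `^ p * M1).
  by rewrite /th -powRrM mulVf ?gt_eqF// powRr1// divr_ge0 ?mulr_ge0 ?powR_ge0 ?(ltW e0) ?(ltW M10).
have th0 : 0 < th by rewrite powR_gt0// divr_gt0// mulr_gt0// mulr_gt0.
pose M := Num.truncn (2 * K / th).
pose tr k j := Num.truncn ((c k j + K) / th).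
have t0 k j : 0 <= (c k j + K) / th.
  by rewrite divr_ge0 ?(ltW th0)//; have := cK k j; rewrite ler_norml => /andP[? ?]; lra.
have trM k j : (tr k j <= M)%N.
  rewrite truncn_le_nat; apply: le_lt_trans (truncnS_gt _).
  rewrite ler_pM2r ?invr_gt0//; have := cK k j; rewrite ler_norml => /andP[? ?]; lra.
exists {ffun J -> 'I_M.+1}, (fun k => [ffun j => inord (tr k j)]) => a b ab.
have cab j : `|c a j - c b j| <= th.
  have tab : tr a j = tr b j.
    have /(congr1 val) := congr1 (fun f : {ffun J -> 'I_M.+1} => f j) ab.
    by rewrite !ffunE /= !inordK// ltnS.
  have /andP[a1 a2] := truncn_itv (t0 a j); have /andP[b1 b2] := truncn_itv (t0 b j).
  rewrite -/(tr a j) tab in a1 a2; rewrite -/(tr b j) in b1 b2.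
  rewrite ler_pdivlMr// in a1; rewrite ltr_pdivrMr// in a2.
  rewrite ler_pdivlMr// in b1; rewrite ltr_pdivrMr// in b2.
  move: a2 b2; rewrite -natr1 mulrDl mul1r => a2 b2.
  by rewrite ler_norml; apply/andP; split; lra.
have ma : measurable_fun [set: V] (cellerr N p (u a) (c a)) by exact: measurable_cellerr.
have mb : measurable_fun [set: V] (cellerr N p (u b) (c b)) by exact: measurable_cellerr.
have mI : measurable_fun [set: V] (\1_(cube N.+1%:R) : V -> R) by apply: measurable_indic; exact: measurable_cube.
have mtI : measurable_fun [set: V] (fun x => th `^ p * \1_(cube N.+1%:R) x : R) by exact: measurable_funM.
have mab := measurable_funD ma mb; have mall := measurable_funD mab mtI.
have h0 x : 0 <= cellerr N p (u a) (c a) x + cellerr N p (u b) (c b) x by rewrite addr_ge0//; exact: cellerr_ge0.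
have h1 (x : V) : 0 <= th `^ p * \1_(cube N.+1%:R) x by rewrite mulr_ge0 ?powR_ge0 ?ind_ge0.
have h2 x : 0 <= cellerr N p (u a) (c a) x + cellerr N p (u b) (c b) x + th `^ p * \1_(cube N.+1%:R) x by rewrite addr_ge0.
apply: (@le_trans _ _ (\int[mu]_x (4 `^ p * (cellerr N p (u a) (c a) x + cellerr N p (u b) (c b) x + th `^ p * \1_(cube N.+1%:R) x))%:E)%E).
  apply: ae_ge0_le_integral => //.
  - by apply/measurable_EFinP; apply: measurable_pow_norm; exact: measurable_funB.
  - by move=> x _; rewrite lee_fin mulr_ge0 ?powR_ge0.
  - by apply/measurable_EFinP; exact: measurable_funM.
  apply: filterS2 (u0 a) (u0 b) => x ua ub _; rewrite lee_fin.
  have [Nx|Nx] := pselect (cube N%:R x); last first.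
    rewrite ua// ub// subrr normr0 powR0 ?gt_eqF//; apply: mulr_ge0; [exact: powR_ge0|exact: h2].
  rewrite !cellerr_cube// indicE mem_set ?mulr1; last by apply: cube_sub Nx; rewrite ler_nat.
  set j := col N m x.
  have -> : u a x - u b x = (u a x - c a j) + ((c a j - c b j) + (- (u b x - c b j))) by ring.
  apply: (le_trans (powD_le p1 _ _)).
  have H1 := powD_le p1 (c a j - c b j) (- (u b x - c b j)); rewrite normrN in H1.
  have H2 : `|c a j - c b j| `^ p <= th `^ p by apply: ge0_ler_powR; rewrite ?nnegrE ?(ltW p0) ?(ltW th0).
  have -> : 4 `^ p = 2 `^ p * 2 `^ p :> R by rewrite -powRM//; congr (_ `^ _); ring.
  have two : 1 <= 2 `^ p :> R.
    by rewrite -[leLHS](powRr0 2); apply: ler_powR; rewrite ?ler1n// ltW.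
  rewrite -mulrA ler_wpM2l ?powR_ge0//.
  have X0 : 0 <= `|u a x - c a j| `^ p by exact: powR_ge0.
  have Y0 : 0 <= `|u b x - c b j| `^ p by exact: powR_ge0.
  have : `|u a x - c a j| `^ p <= 2 `^ p * `|u a x - c a j| `^ p by rewrite ler_peMl.
  have : 2 `^ p * `|c a j - c b j| `^ p <= 2 `^ p * th `^ p by rewrite ler_wpM2l ?powR_ge0.
  by move: H1; rewrite !mulrDr; lra.
rewrite (int_Z mall h2 (powR_ge0 _ _)) (int_D mab mtI h0 h1) (int_D ma mb (cellerr_ge0 _ _ _ _) (cellerr_ge0 _ _ _ _)).
have -> : (\int[mu]_x (th `^ p * \1_(cube N.+1%:R) x)%:E = (th `^ p * M1)%:E)%E.
  rewrite (int_Z mI (@ind_ge0 _ _ _) (powR_ge0 _ _)) integral_indic ?setIT//; last exact: measurable_cube.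
  by rewrite EFinM; congr (_ * _)%E; exact: cube_measure.
apply: (@le_trans _ _ ((4 `^ p)%:E * ((e' + e') + (e' + e') + th `^ p * M1)%:E)%E).
  apply: lee_wpmul2l; first by rewrite lee_fin powR_ge0.
  by rewrite 2!EFinD; apply: leeD => //; apply: leeD; exact: Hc.
rewrite -EFinM lee_fin thp /e' le_eqVlt; apply/orP; left; apply/eqP.
by have h8 := lt0r_neq0 F0; have hM := lt0r_neq0 M10; field; rewrite ?h8 ?hM.
Qed.

(** Nested infinite index sets, one pigeonhole per level, and a diagonal choice with index at least
    k. The bound k <= f k replaces monotonicity of the extraction. *)
Lemma extract_cauchy (e : nat -> R) : (forall k, 0 < e k) -> exists f : nat -> nat,
  (forall k, k <= f k)%N /\
  forall k l, (k <= l)%N -> (Lp p (fun x => u (f l) x - u (f k) x)%R <= (e k)%:E)%E.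
Proof.
move=> e0; pose T := {I : set nat | unbounded_nat I}.
have H k (I : T) : {I' : T | sval I' `<=` sval I /\
    forall a b, sval I' a -> sval I' b -> (Lp p (fun x => u a x - u b x)%R <= (e k)%:E)%E}.
  apply: cid; case: I => I uI /=; have [F [color Hc]] := total_bounded (e0 k).
  have [t ut] := unbounded_pigeonhole color uI.
  exists (exist _ _ ut) => /=; split; first by move=> a [].
  by move=> a b [_ at_] [_ bt]; apply: Hc; rewrite /= in at_ bt; rewrite at_ bt.
have uT : unbounded_nat setT by move=> K; exists K.
pose S := fix S k : T := match k with 0 => sval (H 0%N (exist _ _ uT)) | k'.+1 => sval (H k'.+1 (S k')) end.
have Se k a b : sval (S k) a -> sval (S k) b -> (Lp p (fun x => u a x - u b x)%R <= (e k)%:E)%E.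
  by case: k => [|k] /=; case: (H _ _) => I' [_ HI'] /=; exact: HI'.
have Ssub k l : (k <= l)%N -> sval (S l) `<=` sval (S k).
  elim: l => [|l IH]; first by rewrite leqn0 => /eqP ->.
  rewrite leq_eqVlt => /predU1P[->//|]; rewrite ltnS => /IH kl.
  by apply: subset_trans kl; have [Hs _] := svalP (H l.+1 (S l)); exact: Hs.
have pick k : {a | (k <= a)%N /\ sval (S k) a}.
  by apply: cid; have [a ka Sa] := svalP (S k) k; exists a.
exists (fun k => sval (pick k)); split; first by move=> k; case: (pick k) => a [].
move=> k l kl; apply: Se; first by apply: (Ssub k l kl); case: (pick l) => a [].
by case: (pick k) => a [].
Qed.

Lemma compactness : exists (f : nat -> nat) (l : V -> R), [/\ (forall k, k <= f k)%N,
  measurable_fun [set: V] l, {ae mu, forall x, u (f k) x @[k --> \oo] --> l x} &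
  ~ {ae mu, forall x, l x = 0}].
Proof.
have H0 : 0 < 2^-1 * 2^-1 `^ p :> R by rewrite mulr_gt0// ?powR_gt0// invr_gt0.
have [f [fk Hf]] := extract_cauchy (fun k => exprn_gt0 k H0).
have [|l ml fl] := @fast_cvg R n p p1 (fun k => u (f k)) (fun k => mu_ _).
  by move=> k; exact: Hf.
exists f, l; split => // l0.
(* If l = 0, Fatou bounds the norm of one term by its distance to the later ones. Index 1 is used
   because the bound at index 0 is 1, which would not contradict the normalization. *)
have : (Lp p (u (f 1%N)) <= ((2^-1 * 2^-1 `^ p) ^+ 1)%:E)%E.
  apply: (fatou_le (m := mu) (f := fun k x => `|u (f k) x - u (f 1%N) x| `^ p)).
  - by move=> k; apply: measurable_pow_norm; exact: measurable_funB.
  - exact: measurable_pow_norm.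
  - by move=> k x; exact: powR_ge0.
  - apply: filterS2 fl l0 => x cx lx.
    have H : u (f k) x - u (f 1%N) x @[k --> \oo] --> l x - u (f 1%N) x by apply: cvgB => //; exact: cvg_cst.
    have := pow_norm_cvg p1 (u := fun k => u (f k) x - u (f 1%N) x) (l := l x - u (f 1%N) x) H.
    by rewrite lx sub0r normrN.
  - move=> e e0; exists 1%N => // k /= k1; apply: (@le_trans _ _ ((2^-1 * 2^-1 `^ p) ^+ 1)%:E).
      exact: Hf.
    by rewrite leeDl// lee_fin ltW.
rewrite Lu lee_fin expr1; apply/negP; rewrite -ltNge.
have : 2^-1 `^ p <= 1 :> R.
  apply: (@le_trans _ _ (1 `^ p)); last by rewrite powR1.
  by apply: ge0_ler_powR; rewrite ?nnegrE ?invr_ge0 ?(ltW p0)// invf_le1// ler1n.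
by lra.
Qed.

End compactness.

(** * Strict monotonicity *)

Section limit_functions.
Context {R : realType} {n : nat}.
Local Notation V := 'rV[R]_n.
Local Notation VV := (V * V)%type.
Local Notation mu := (@lebesgue_rV R n).

Lemma ae_prod (A B : set V) : measurable A -> measurable B ->
  {ae (mu \x mu)%E, forall z : VV, ~ (A z.1 /\ B z.2)} ->
  {ae mu, forall x, ~ A x} \/ {ae mu, forall x, ~ B x}.
Proof.
move=> mA mB H.
have N C : measurable C -> mu C = 0%E -> {ae mu, forall x, ~ C x}.
  move=> mC C0; exists C; split => //; first by move=> x /= /contrapT.
have mAB : measurable (A `*` B : set VV) by exact: measurableX.
have : (mu \x mu)%E (A `*` B) = 0%E.
  apply/(negligibleP _ mAB).
  by apply: negligibleS H => z /= [Az Bz]; exact.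
rewrite (product_measure1E mu mu mA mB) => /eqP; rewrite mule_eq0 => /orP[]/eqP h.
- by left; exact: N.
- by right; exact: N.
Qed.

(** The product of the sets where w > 0 and w < 0 inside [P] is null, so one of the two factors is
    null. *)
Lemma ae_same_sign (P : set V) (w : V -> R) : measurable P -> measurable_fun [set: V] w ->
  {ae (mu \x mu)%E, forall z : VV, P z.1 -> P z.2 -> 0 <= w z.1 * w z.2} ->
  {ae mu, forall x, P x -> 0 <= w x} \/ {ae mu, forall x, P x -> w x <= 0}.
Proof.
move=> mP mw H.
have mlt (f : V -> R) : measurable_fun [set: V] f -> measurable [set x | 0 < f x].
  move=> mf; have := mf measurableT `]0, +oo[%classic (measurable_itv _); rewrite setTI.
  by congr measurable; apply/seteqP; split => x /=; rewrite in_itv/= andbT.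
have mA : measurable (P `&` [set x | 0 < w x]) by apply: measurableI => //; exact: mlt.
have mB : measurable (P `&` [set x | 0 < - w x]).
  by apply: measurableI => //; apply: mlt; exact: measurable_funN.
case: (ae_prod mA mB).
- apply: filterS H => z Hz [[P1 w1] [P2 w2]]; rewrite /= in w1 w2.
  by have := Hz P1 P2; apply/negP; rewrite -ltNge nmulr_llt0 // -oppr_gt0.
- by move=> HA; right; apply: filterS HA => x Hx Px; rewrite leNgt; apply/negP => w0; exact: Hx.
- move=> HB; left; apply: filterS HB => x Hx Px; rewrite leNgt; apply/negP => w0; apply: Hx.
  by split => //=; rewrite oppr_gt0.
Qed.

Variables (s p : R).
Hypotheses (p1 : 1 < p) (s0 : 0 < s) (s1 : s < 1).
Let p0 : 0 < p. Proof. exact: lt_trans p1. Qed.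

Lemma Lambda_lty (Omega : set V) (a b : V) : measurable Omega ->
  (forall i, a ord0 i < b ord0 i) -> obox a b `<=` Omega -> (Lambda s p Omega < +oo)%E.
Proof.
move=> mO ab abO; have [g [ag Eg]] := bump_adm p1 s0 s1 0 abO.
have := Lambda_le s p1 mO ag; have L0 := @bump_Lp_gt0 R n p 0 a b ab.
case: (Lambda s p Omega) => [r| |] //; first by rewrite ltry.
by rewrite gt0_mulye// leye_eq => /eqP E; rewrite E ltxx in Eg.
Qed.

(* A nonnegative function with mgap l (e phi) = O(e^p) cannot vanish on the
   box carrying phi: pairing the box with the set where l >= c gives a lower
   bound of order e. *)
Lemma mgap_small_contra (l : V -> R) k (a b : V) (E : \bar R) : (forall i, a ord0 i < b ord0 i) ->
  measurable_fun [set: V] l -> {ae mu, forall x, 0 <= l x} -> ~ {ae mu, forall x, l x = 0} ->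
  {ae mu, forall x, obox a b x -> l x = 0} -> (E < +oo)%E ->
  ~ (forall e : R, 0 < e -> (DI (mgap s p l (fun x => e * bump k a b x)%R) <= (e `^ p)%:E * E)%E).
Proof.
move=> ab ml l0 ln0 lB Ey H; set phi := bump k a b in H.
have mphi : measurable_fun [set: V] phi by exact: measurable_bump.
have phi0 x : 0 <= phi x by exact: bump_ge0.
have phi1 x : phi x <= 1 by exact: bump_le1.
have [Er Er0 EE] : exists2 Er : R, 0 <= Er & (E <= Er%:E)%E.
  case: (E) Ey => [r _| |]//; last by exists 0; rewrite ?leNye.
  by exists (Num.max r 0); rewrite ?le_max ?lexx ?orbT// lee_fin le_max lexx.
(* Otherwise l < 1/(m+1) a.e. for every m, so the nonnegative [l] would vanish a.e. *)
have [c c0 Hc] : exists2 c, 0 < c & ~ {ae mu, forall x, ~ (c <= l x)}.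
  apply: contrapT => /forall2NP Hn; apply: ln0.
  have {}Hn (m : nat) : {ae mu, forall x, ~ (m.+1%:R^-1 <= l x)}.
    by have [//|/contrapT//] := Hn m.+1%:R^-1; rewrite invr_gt0 ltr0Sn.
  have := ae_foralln Hn; apply: filterS2 l0 => x lx Hx.
  apply/eqP; rewrite eq_le lx andbT leNgt; apply/negP => lx0.
  apply: (Hx (Num.truncn (l x)^-1)).
  by rewrite invf_ple ?posrE//; exact/ltW/truncnS_gt.
(* On [S] the bump exceeds [l], and on [Q] it is below: max and min sort the two points oppositely,
   which is where the gap is strict. *)
pose S : set V := [set x | 0 < phi x] `&` [set x | l x = 0].
pose Q : set V := [set x | c <= l x] `&` [set x | phi x = 0].
have mge (f : V -> R) (t : R) : measurable_fun [set: V] f -> measurable [set x | t <= f x].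
  move=> mf; have := mf measurableT `[t, +oo[%classic (measurable_itv _); rewrite setTI.
  by congr measurable; apply/seteqP; split => x /=; rewrite in_itv/= andbT.
have meq (f : V -> R) : measurable_fun [set: V] f -> measurable [set x | f x = 0].
  by move=> mf; have := mf measurableT [set 0] (measurable_set1 _); rewrite setTI.
have mS : measurable S.
  apply: measurableI; last exact: meq.
  have -> : [set x | 0 < phi x] = ~` [set x | phi x = 0].
    by apply/seteqP; split => x /=; rewrite lt0r phi0 andbT => /eqP.
  by apply: measurableC; exact: meq.
have mQ : measurable Q by apply: measurableI; [exact: mge|exact: meq].
pose F (z : VV) : R := (\1_S z.1 * phi z.1) * (c `^ (p - 1) * (ker s p z * \1_Q z.2)).
have F0 z : 0 <= F z by rewrite /F !mulr_ge0 ?ind_ge0 ?powR_ge0//; exact: ker_ge0.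
have mF : measurable_fun [set: VV] F.
  apply: measurable_funM.
    apply: (measurable_fstf (u := fun x => \1_S x * phi x)); apply: measurable_funM => //.
  apply: measurable_funM => //; apply: measurable_funM; first exact: measurable_ker.
  by apply: (measurable_sndf (u := fun x => \1_Q x)); exact: measurable_indic.
have Fle (e : R) : 0 < e -> e <= c -> forall z, e * F z <= mgap s p l (fun x => e * phi x) z.
  move=> e0 ec z; have M0 := mgap_ge0 s p1 l (fun x => e * phi x) z.
  rewrite /F; have [[/= Sp Sl]|nS] := pselect (S z.1); last first.
    by rewrite [\1_S _]indicE memNset// !mul0r mulr0.
  have [[/= Ql Qp]|nQ] := pselect (Q z.2); last first.
    by rewrite [\1_Q _]indicE memNset// !mulr0.
  rewrite !indicE !mem_set//; rewrite !mul1r mulr1 /mgap /quad Sl Qp mulr0 mul0r addr0.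
  have t0 : 0 <= e * phi z.1 by rewrite mulr_ge0// ltW.
  have tc : e * phi z.1 <= c by apply: le_trans ec; rewrite ler_piMr// ltW.
  have lz0 : 0 <= l z.2 by exact: le_trans (ltW c0) Ql.
  rewrite (max_idPr t0) (min_idPl t0) (max_idPl lz0) (min_idPr lz0).
  rewrite sub0r normrN !subr0 normr0 powR0 ?gt_eqF// addr0.
  have := pow_gap p1 t0 tc Ql => G.
  rewrite (distrC (e * _)) in G *.
  rewrite (_ : e * _ = ker s p z * (e * phi z.1 * c `^ (p - 1))); last by ring.
  by rewrite ler_wpM2l ?ker_ge0// (distrC (l z.2)).
(* The gap is at least e F, with [F] independent of e; dividing the bound of order e^p by e leaves
   e^(p-1), which tends to 0. *)
have DF (e : R) : 0 < e -> e <= c -> (DI F <= (e `^ (p - 1) * Er)%:E)%E.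
  move=> e0 ec; have h1 : (e%:E * DI F <= (e `^ p)%:E * Er%:E)%E.
    rewrite -(DI_Z mF F0 (ltW e0)); apply: (@le_trans _ _ ((e `^ p)%:E * E)%E); last first.
      by apply: lee_wpmul2l => //; exact: powR_ge0.
    apply: le_trans (H e e0); apply: DI_le => //.
    - exact: measurable_funM.
    - by apply: measurable_mgap => //; exact: measurable_funM.
    - by move=> z; rewrite mulr_ge0// ltW.
    - exact: Fle.
  have ep : e `^ p = e * e `^ (p - 1).
    by rewrite -[X in X * _](powRr1 (ltW e0)) -powRD ?(gt_eqF e0) ?implybT// addrC subrK.
  by move: h1; rewrite ep 2!EFinM -muleA lee_pmul2l ?lte_fin.
have DF0 : DI F = 0%E.
  apply/eqP; rewrite eq_le DI_ge0// andbT; apply/lee_addgt0Pr => e e0; rewrite add0e.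
  pose t := (e / (Er + 1)) `^ (p - 1)^-1.
  have Er1 : 0 < Er + 1 by rewrite ltr_wpDl.
  have t0 : 0 < t by rewrite powR_gt0// divr_gt0.
  apply: (le_trans (DF (Num.min c t) _ _)); rewrite ?lt_min ?c0 ?ge_min ?lexx// lee_fin.
  have pp : 0 < p - 1 by rewrite subr_gt0.
  have h : Num.min c t `^ (p - 1) <= e / (Er + 1).
    have -> : e / (Er + 1) = t `^ (p - 1) by rewrite /t -powRrM mulVf ?gt_eqF// powRr1// divr_ge0// ltW.
    by apply: ge0_ler_powR; rewrite ?nnegrE ?le_min ?ge_min ?lexx ?orbT ?(ltW c0) ?(ltW t0) ?(ltW pp).
  apply: (le_trans (ler_wpM2r _ h)) => //.
  by rewrite -mulrA ler_piMr ?(ltW e0)// mulrC ler_pdivrMr// mul1r lerDl.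
case: (ae_prod mS mQ).
- apply: filterS (DI_eq0 mF F0 DF0) => z Fz [Sz Qz].
  have : 0 < F z.
    rewrite /F !indicE !mem_set// mul1r mulr1 mulr_gt0//; first by case: Sz.
    rewrite mulr_gt0 ?powR_gt0// invr_gt0 powR_gt0// lt0r enorm_ge0 andbT.
    (* The points are distinct, [l] being 0 at one and at least c at the other, so the kernel is
       positive. *)
    apply/eqP => /enorm_eq0/eqP; rewrite subr_eq0 => /eqP zz.
    by move: Sz.2 Qz.1 => /= + /=; rewrite zz => -> ; rewrite leNgt c0.
  by rewrite Fz ltxx.
- move=> nS; have := obox_measure_gt0 ab; rewrite lt0e => /andP[/eqP + _]; apply.
  apply/(negligibleP _ (measurable_obox a b)).
  have : {ae mu, forall x, ~ obox a b x}.
    by apply: filterS2 nS lB => x nSx lx abx; apply: nSx; split; [exact: bump_gt0|exact: lx].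
  by apply: negligibleS => x abx; exact.
- move=> nQ; apply: Hc; apply: filterS2 nQ lB => x nQx lx cx; apply: nQx; split => //=.
  by apply: bump_out => /lx lx0; move: cx; rewrite lx0 leNgt c0.
Qed.

End limit_functions.

(** * Polarization strictly lowers the eigenvalue, under geometric hypotheses *)

Section polarization.
Context {R : realType} {n : nat}.
Local Notation V := 'rV[R]_n.
Local Notation VV := (V * V)%type.
Local Notation mu := (@lebesgue_rV R n).
Variables (s p : R).
Hypotheses (p1 : 1 < p) (s0 : 0 < s) (s1 : s < 1).
Let p0 : 0 < p. Proof. exact: lt_trans p1. Qed.

Variables (Omega Omega' : set V) (j : 'I_n) (a : R) (N : nat).
Local Notation sig := (refl j a).
Hypotheses (mO : measurable Omega) (mO' : measurable Omega') (ON : Omega `<=` cube N%:R).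
Hypothesis polar_in : forall x, ~ Omega' x -> x ord0 j < a -> ~ Omega x /\ ~ Omega (sig x).
Hypothesis polar_out : forall x, ~ Omega' x -> a <= x ord0 j -> ~ Omega x \/ ~ Omega (sig x).

(** Where the maximum is taken, both the point and its image must lie outside Omega; where the
    minimum of nonnegative values is taken, one of them suffices. *)
Lemma polar_support u : (forall x, 0 <= u x) -> {ae mu, forall x, ~ Omega x -> u x = 0} ->
  {ae mu, forall x, ~ Omega' x -> polar j a u x = 0}.
Proof.
move=> u0 uO; have uO' := ae_mpres (mpres_refl j a) uO.
apply: filterS2 uO uO' => x ux usx Ox; have [xa|xa] := ltP (x ord0 j) a.
  have [h1 h2] := polar_in Ox xa.
  by rewrite polar_max ?(ltW xa)// ux// usx// maxxx.
rewrite -(reflK j a x) polar_min; last by rewrite reflE eqxx; lra.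
rewrite reflK; apply/eqP; rewrite eq_le le_min !u0 andbT ge_min.
by have [h|h] := polar_out Ox xa; [rewrite (ux h) lexx orbT|rewrite (usx h) lexx].
Qed.

(* The two boxes on which the limit function may vanish: beyond the hyperplane and
   reflected out of Omega, or on the near side and reflected out of Omega. *)
Variables (aA bA aB bB : V).
Hypotheses (abA : forall i, aA ord0 i < bA ord0 i) (abB : forall i, aB ord0 i < bB ord0 i).
Hypotheses (AO : obox aA bA `<=` Omega) (BO : obox aB bB `<=` Omega).
Hypothesis A_out : forall x, obox aA bA x -> a < x ord0 j /\ ~ Omega (sig x).
Hypothesis B_in : forall x, obox aB bB x -> x ord0 j < a /\ ~ Omega (sig x).

(** A vanishing gap makes l - l o sigma of constant sign on the half-space. If it is nonnegative,
    [l] vanishes on box A, whose image has l = 0; if nonpositive, on box B. *)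
Lemma hgap_limit_vanish (l : V -> R) : measurable_fun [set: V] l -> {ae mu, forall x, 0 <= l x} ->
  {ae mu, forall x, ~ Omega x -> l x = 0} -> DI (hgap s p j a l) = 0%E ->
  {ae mu, forall x, obox aA bA x -> l x = 0} \/ {ae mu, forall x, obox aB bB x -> l x = 0}.
Proof.
move=> ml l0 lO Dl.
have mpr := mpres_refl j a.
have l0s := ae_mpres mpr l0; have lOs := ae_mpres mpr lO.
have mls : measurable_fun [set: V] (fun x => l (sig x)) by exact: (measurableT_comp ml mpr.1).
have mw : measurable_fun [set: V] (fun x => l x - l (sig x)) by exact: measurable_funB.
have [] := ae_same_sign (measurable_half j a) mw.
- have := DI_eq0 (measurable_hgap s p j a ml) (hgap_ge0 p1 s0 j a l) Dl.
  apply: filterS => -[x y] /= H0 xa ya; have [->|xy] := eqVneq x y; first exact: sqr_ge0.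
  exact: (hgap_eq0 p1 s0 xy xa ya H0).
- move=> H; left; have Hs := ae_mpres mpr H.
  apply: filterS2 (filterI Hs l0) lOs => x [h lx] ls Ax; have [xa nO] := A_out Ax.
  apply/eqP; rewrite eq_le lx andbT.
  have : (sig x) ord0 j < a by rewrite reflE eqxx; lra.
  by move=> /h; rewrite reflK (ls nO) sub0r oppr_ge0.
- move=> H; right; apply: filterS2 (filterI H l0) lOs => x [h lx] ls Bx; have [xa nO] := B_in Bx.
  by apply/eqP; rewrite eq_le lx andbT; have := h xa; rewrite (ls nO) subr0.
Qed.

Theorem Lambda_polar_lt : (Lambda s p Omega' < Lambda s p Omega)%E.
Proof.
rewrite ltNge; apply/negP => LL.
have Ly : (Lambda s p Omega < +oo)%E by exact: (Lambda_lty p1 s0 s1 mO abA AO).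
have [L L0 LE] : exists2 L : R, 0 <= L & Lambda s p Omega = L%:E.
  move: Ly (Lambda_ge0 s p Omega); case: (Lambda s p Omega) => // r _; rewrite lee_fin.
  by exists r.
rewrite LE in LL Ly.
have ek (k : nat) : 0 < k.+1%:R^-1 :> R by rewrite invr_gt0 ltr0Sn.
have /choice[ug Hug] (k : nat) : exists ug : (V -> R) * (V -> V), [/\ adm p Omega ug.1 ug.2,
    forall x, 0 <= ug.1 x, Lp p ug.1 = 1%E & (energy s p ug.1 ug.2 < (L + k.+1%:R^-1)%:E)%E].
  have [|u [g H]] := @Lambda_min R n s p p1 Omega k.+1%:R^-1 mO _ (ek k); first by rewrite LE.
  by exists (u, g); rewrite EFinD -LE.
pose u k := (ug k).1; pose g k := (ug k).2.
have ad k : adm p Omega (u k) (g k) by have [] := Hug k.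
have u0 k x : 0 <= u k x by have [_ h _ _] := Hug k; exact: h.
have Lu k : Lp p (u k) = 1%E by have [] := Hug k.
have Eu k : (energy s p (u k) (g k) < (L + k.+1%:R^-1)%:E)%E by have [] := Hug k.
have mu_ k : measurable_fun [set: V] (u k) by have [/isgrad_measurable] := ad k.
have uO k : {ae mu, forall x, ~ Omega x -> u k x = 0} by have [] := ad k.
(* The polarized function competes for Omega', whose eigenvalue is assumed to be at least L; so four
   energies within 1/(k+1) of L leave a gap of at most 4/(k+1). *)
have hgap_le4 k : (DI (hgap s p j a (u k)) <= (4 * k.+1%:R^-1)%:E)%E.
  have [adP LP EP] := adm_polar p1 s0 (ad k) (polar_support (u0 k) (uO k)).
  have := Lambda_le1 s p1 mO' adP; rewrite LP => /(_ (Lu k)) /(le_trans LL) LE'.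
  have D0 := DI_ge0 (hgap_ge0 p1 s0 j a (u k)).
  have {}EP : (4%:E * L%:E + DI (hgap s p j a (u k)) <= 4%:E * (L + k.+1%:R^-1)%:E)%E.
    apply: le_trans (lee_wpmul2l _ (ltW (Eu k))); last by rewrite lee_fin.
    by apply: le_trans EP; rewrite leeD2r// lee_wpmul2l// lee_fin.
  move: D0 EP; rewrite mulrC; move: (k.+1%:R^-1) => t; rewrite -!EFinM.
  by case: (DI _) => [r _| |] //; rewrite -EFinD !lee_fin; lra.
(* Both the maximum and the minimum compete for Omega; their norms add up to 1 + Lp(v) >= 1, so
   together they cost at least L, and the gap is at most the excess of u_k plus the energy of v. *)
have mgap_le k v h e : adm p Omega v h -> (0 <= Lp p v)%E -> (energy s p v h <= e)%E ->
    (DI (mgap s p (u k) v) <= k.+1%:R^-1%:E + e)%E.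
  move=> adv Lv Ev; have [ad1 ad2 EE] := adm_maxmin s p1 (ad k) adv.
  have mb := measurable_leb (mu_ k) (isgrad_measurable (let: And4 ig _ _ _ := adv in ig)).
  have mv : measurable_fun [set: V] v by have [/isgrad_measurable] := adv.
  have LL1 := Lp_pick_sum p mb (mu_ k) mv.
  have E1 := Lambda_le s p1 mO ad1; have E2 := Lambda_le s p1 mO ad2.
  have {E1 E2} E12 := leeD E1 E2.
  rewrite LE -ge0_muleDr ?Lp_ge0// LL1 Lu in E12.
  have D0 := DI_ge0 (mgap_ge0 s p1 (u k) v).
  have : (L%:E + DI (mgap s p (u k) v) <= (L + k.+1%:R^-1)%:E + e)%E.
    apply: (@le_trans _ _ (energy s p (u k) (g k) + energy s p v h)%E); last by apply: leeD => //; exact: ltW.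
    rewrite -EE leeD2r//; apply: le_trans E12.
    by rewrite -[leLHS]mule1 lee_wpmul2l ?lee_fin// leeDl.
  by rewrite EFinD -addeA leeD2lE.
have uN k : {ae mu, forall x, ~ cube N%:R x -> u k x = 0}.
  by apply: filterS (uO k) => x H nN; apply: H => /ON.
have B0 : 0 <= L + 1 by rewrite addr_ge0.
have Gu k : (DI (gag s p (u k)) <= (L + 1)%:E)%E.
  apply: (@le_trans _ _ (energy s p (u k) (g k))); first by rewrite /energy leeDr// Loc_ge0.
  apply: (le_trans (ltW (Eu k))); rewrite lee_fin lerD2l invf_le1 ?ltr0Sn//.
  by rewrite ler1n.
have [f [l [fk ml fl ln0]]] := compactness p1 s0 B0 mu_ Lu Gu uN.
have l0 : {ae mu, forall x, 0 <= l x}.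
  apply: filterS fl => x cx; have <- := cvg_lim (@Rhausdorff R) cx.
  by apply: limr_ge; [apply/cvg_ex; exists (l x)|apply: nearW => k; exact: u0].
have lO : {ae mu, forall x, ~ Omega x -> l x = 0}.
  have uOf : {ae mu, forall x, forall k, ~ Omega x -> u (f k) x = 0} by apply: ae_foralln => k; exact: uO.
  apply: filterS2 fl uOf => x cx H nO; rewrite -(cvg_lim (@Rhausdorff R) cx).
  by apply: (cvg_lim (@Rhausdorff R)); under eq_fun do rewrite H//; exact: cvg_cst.
have fls := ae_mpres (mpres_refl j a) fl.
have near_le (e : R) : 0 < e -> \forall k \near \oo, (f k).+1%:R^-1 <= e.
  move=> e0; exists (Num.truncn e^-1) => // k /= ke.
  rewrite invf_ple ?posrE ?ltr0Sn//; apply: (le_trans (ltW (truncnS_gt _))).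
  by rewrite ler_nat ltnS (leq_trans ke).
have Dl : DI (hgap s p j a l) = 0%E.
  apply/eqP; rewrite eq_le (DI_ge0 (hgap_ge0 p1 s0 j a l)) andbT.
  apply: (fatou_le (m := (mu \x mu)%E) (f := fun k => hgap s p j a (u (f k)))).
  - by move=> k; exact: measurable_hgap.
  - exact: measurable_hgap.
  - by move=> k z; exact: hgap_ge0.
  - apply: filterS2 (filterI (ae_fst fl) (ae_fst fls)) (filterI (ae_snd fl) (ae_snd fls)).
    move=> z [c1 c2] [c3 c4]; apply: cvgM; first exact: cvg_cst.
    by rewrite /gap; apply: quad_cvg.
  - move=> e e0; have e4 : 0 < e / 4 by rewrite divr_gt0.
    apply: filterS (near_le _ e4) => k ke.
    by rewrite add0e; apply: le_trans (hgap_le4 (f k)) _; rewrite lee_fin mulrC -ler_pdivlMr.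
(* Apply [mgap_le] to v = e phi, of energy e^p E(phi), and let k tend to infinity with e fixed. *)
have mgap_lim (aa bb : V) : (forall i, aa ord0 i < bb ord0 i) -> obox aa bb `<=` Omega ->
    ~ {ae mu, forall x, obox aa bb x -> l x = 0}.
  move=> ab abO lB; have [h [adb Eb]] := bump_adm p1 s0 s1 0 abO.
  have mb := @measurable_bump R n 0 aa bb.
  apply: (mgap_small_contra p1 (k := 0) ab ml l0 ln0 lB Eb) => e e0.
  have ade := adm_scale e adb.
  have mv : measurable_fun [set: V] (fun x => e * bump 0 aa bb x) by exact: measurable_funM.
  apply: (fatou_le (m := (mu \x mu)%E) (f := fun k => mgap s p (u (f k)) (fun x => e * bump 0 aa bb x))).
  - by move=> k; exact: measurable_mgap.
  - exact: measurable_mgap.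
  - by move=> k z; exact: mgap_ge0.
  - apply: filterS2 (ae_fst fl) (ae_snd fl) => z c1 c2.
    by rewrite /mgap; apply: quad_cvg => //; exact: cvg_cst.
  - move=> t t0; apply: filterS (near_le _ t0) => k kt.
    rewrite addeC; apply: le_trans (mgap_le (f k) _ _ ((e `^ p)%:E * energy s p (bump 0 aa bb) h)%E ade (Lp_ge0 _ _) _) _.
      rewrite energy_scale ?gtr0_norm//.
      by have [/isgrad_measurable_grad] := adb.
    by rewrite leeD2r// lee_fin.
by have [lA|lB] := hgap_limit_vanish ml l0 lO Dl; [exact: (mgap_lim _ _ abA AO)|exact: (mgap_lim _ _ abB BO)].
Qed.

End polarization.

(** * The geometry of the eccentric shells *)

Section eccentric_shells.
Context {R : realType} {n : nat}.
Local Notation V := 'rV[R]_n.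
Variables (s p r rho : R) (j : 'I_n).
Hypotheses (p1 : 1 < p) (s0 : 0 < s) (s1 : s < 1) (r0 : 0 < r) (hrho : r < rho).
Hypothesis j0 : j = 0%N :> nat.

Lemma continuous_dist_enorm (c : V) : continuous (fun x : V => enorm (x - c)).
Proof.
have -> : (fun x => enorm (x - c)) = fun x : V => Num.sqrt (\sum_i (x ord0 i - c ord0 i) ^+ 2).
  by apply/funext => x; congr Num.sqrt; apply: eq_bigr => i _; rewrite !mxE.
move=> x; apply: continuous_comp; last exact: sqrt_continuous.
have ac : continuous (fun z : R * R => z.1 + z.2) by exact: add_continuous.
have := @continuous_big R 'I_n +%R 0 xpredT ac V (index_enum 'I_n)
  (fun i y => (y ord0 i - c ord0 i) ^+ 2).
apply => i _ {}x.
apply: (@continuous_comp _ _ _ (fun y : V => y ord0 i - c ord0 i) (fun t : R => t ^+ 2)).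
  have cx := @coord_continuous R 1 n ord0 i x.
  exact: (cvgB cx (cvg_cst _)).
exact: exprn_continuous.
Qed.

Lemma open_box (U : set V) (b : V) : open U -> U b ->
  exists c d : V, (forall i, c ord0 i < d ord0 i) /\ obox c d `<=` U.
Proof.
move=> oU Ub; have /nbhs_ballP[e /= e0 beU] : nbhs b U by exact: open_nbhs_nbhs.
exists (\row_i (b ord0 i - e)), (\row_i (b ord0 i + e)); split=> [i|x bx].
  by rewrite !mxE; lra.
apply: beU; apply/rV_ballP => // i; have := bx i; rewrite /= in_itv/= !mxE => /andP[h1 h2].
by rewrite ltr_norml; apply/andP; split; lra.
Qed.

Let D (t : R) (x : V) : R := enorm (x - t *: e1).

Let D0 x : D 0 x = enorm (x - 0). Proof. by rewrite /D scale0r. Qed.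

Let D_continuous t : continuous (D t).
Proof. exact: continuous_dist_enorm. Qed.

Let e1j i : @e1 R n ord0 i = (i == j)%:R.
Proof. by rewrite mxE -val_eqE /= j0. Qed.

Let D_e1 t c : D t (c *: e1) = `|c - t|.
Proof.
rewrite /D -scalerBl enormZ -[RHS]mulr1; congr (_ * _).
rewrite -[RHS]sqrtr1; congr Num.sqrt; rewrite (bigD1 j)//= e1j eqxx expr1n.
by rewrite big1 ?addr0// => i ij; rewrite e1j (negbTE ij) expr0n.
Qed.

Let D_refl t a (x : V) : D t (refl j a x) = D (a *+ 2 - t) x.
Proof.
rewrite /D enorm_refl1; congr (enorm (x - _)); apply: eq_row => i.
have E c : (c *: @e1 R n) ord0 i = c * (i == j)%:R by rewrite mxE e1j.
by rewrite reflE !E; case: eqP => _; rewrite ?mulr0 ?mulr1.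
Qed.

(** A point on the lower side of the mirror is closer to a centre on that side than to its mirror
    image. *)
Let D_le t a (x : V) : x ord0 j <= a -> t <= a -> D t x <= D (a *+ 2 - t) x.
Proof.
by move=> xa ta; rewrite -D_refl; apply: enorm_refl_le; rewrite // mxE e1j eqxx mulr1.
Qed.

Let shell t : set V := eball 0 rho `\` eclosed_ball (t *: e1) r.

Let shellE t x : shell t x <-> D 0 x < rho /\ r < D t x.
Proof.
rewrite D0; split=> [[h1 /negP]|[h1 h2]]; first by rewrite -ltNge.
by split => //; apply/negP; rewrite -ltNge.
Qed.

Let open_D_lt t c : open [set x | D t x < c].
Proof. by have /continuousP/(_ _ (@open_lt R c)) := @D_continuous t. Qed.

Let open_D_gt t c : open [set x | c < D t x].
Proof. by have /continuousP/(_ _ (@open_gt R c)) := @D_continuous t. Qed.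

Let open_coord_lt c : open [set x : V | x ord0 j < c].
Proof. by have /continuousP/(_ _ (@open_lt R c)) := @coord_continuous R 1 n ord0 j. Qed.

Let open_coord_gt c : open [set x : V | c < x ord0 j].
Proof. by have /continuousP/(_ _ (@open_gt R c)) := @coord_continuous R 1 n ord0 j. Qed.

Let shell_open t : shell t = [set x | D 0 x < rho] `&` [set x | r < D t x].
Proof. by apply/seteqP; split=> x /shellE. Qed.

Let measurable_shell t : measurable (shell t).
Proof. by rewrite shell_open; apply: open_measurable_rV; exact: openI. Qed.

(** The mirror halfway between t1 and t2 exchanges the holes and sends the centre of the ball to (t1
    + t2) e1. Both inclusions required for polarization are then comparisons of distances to
    mirrored centres. *)
Lemma Lambda_shell_lt t1 t2 : 0 <= t1 -> t1 < t2 -> t2 < rho - r ->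
  (Lambda s p (shell t2) < Lambda s p (shell t1))%E.
Proof.
move=> t10 t12 t2r; pose a := (t1 + t2) / 2.
have Ea : a *+ 2 = t1 + t2 by rewrite /a; field.
have ta : t1 < a by rewrite /a; lra.
have at2 : a < t2 by rewrite /a; lra.
have E1 : a *+ 2 - t1 = t2 by rewrite Ea; ring.
have E0 : a *+ 2 - 0 = t1 + t2 by rewrite Ea; ring.
pose N := (Num.truncn rho).+1.
have shN : shell t1 `<=` cube N%:R.
  move=> x /shellE[x0 _]; apply/cubeP => i; apply: (le_trans (coord_le_enorm x i)).
  by rewrite -[x]subr0 -D0; apply: ltW; apply: lt_trans x0 (truncnS_gt _).
have nshell t x : ~ shell t x -> rho <= D 0 x \/ D t x <= r.
  move=> H; have [|h1] := leP rho (D 0 x); first by left.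
  by right; rewrite leNgt; apply/negP => h2; apply: H; apply/shellE.
have out0 t x : rho <= D 0 x -> ~ shell t x by move=> h /shellE[+ _]; rewrite ltNge h.
have outt t x : D t x <= r -> ~ shell t x by move=> h /shellE[_]; rewrite ltNge h.
have polar_in x : ~ shell t2 x -> x ord0 j < a -> ~ shell t1 x /\ ~ shell t1 (refl j a x).
  move=> /nshell[h|h] xa; split.
  - exact: out0.
  - apply: out0; rewrite D_refl; apply: (le_trans h); apply: D_le; first exact: ltW.
    by apply: ltW; exact: le_lt_trans ta.
  - by apply: outt; apply: le_trans h; rewrite -E1; apply: D_le; exact: ltW.
  - by apply: outt; rewrite D_refl E1.
have polar_out x : ~ shell t2 x -> a <= x ord0 j -> ~ shell t1 x \/ ~ shell t1 (refl j a x).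
  move=> /nshell[h|h] xa; first by left; exact: out0.
  by right; apply: outt; rewrite D_refl E1.
have coordE c : (c *: @e1 R n) ord0 j = c by rewrite mxE e1j eqxx mulr1.
have [e [e0 e12 er]] : exists e : R, [/\ 0 < e, e < t2 - t1 & e < r].
  exists (Num.min (t2 - t1) r / 2); have : 0 < Num.min (t2 - t1) r by rewrite lt_min subr_gt0 t12.
  set m := Num.min _ _ => m0; have m1 : m <= t2 - t1 by rewrite ge_min lexx.
  have m2 : m <= r by rewrite ge_min lexx orbT.
  by split; lra.
have [c [d [cd cdA]]] : exists c d : V, (forall i, c ord0 i < d ord0 i) /\ obox c d `<=`
    [set x | D 0 x < rho] `&` [set x | r < D t1 x] `&` ([set x : V | a < x ord0 j] `&` [set x | D t2 x < r]).
  (* Just inside the far end of the second hole on the axis: e < t2 - t1 keeps the point out of the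
     first hole, and e < r keeps it beyond the mirror. *)
  apply: (@open_box _ ((t2 + r - e) *: e1)); first by do ![exact: openI|apply: openI].
  rewrite /= !D_e1 coordE subr0; split; split.
  - by rewrite ger0_norm; lra.
  - by rewrite ger0_norm; lra.
  - lra.
  - by rewrite ger0_norm; lra.
have [f [f0 ft fr]] : exists f : R, [/\ 0 < f, f < t2 & f < rho - r].
  exists (Num.min t2 (rho - r) / 2); have : 0 < Num.min t2 (rho - r).
    by rewrite lt_min subr_gt0 hrho andbT (le_lt_trans t10).
  set m := Num.min _ _ => m0; have m1 : m <= t2 by rewrite ge_min lexx.
  have m2 : m <= rho - r by rewrite ge_min lexx orbT.
  by split; lra.
have [c' [d' [cd' cdB]]] : exists c d : V, (forall i, c ord0 i < d ord0 i) /\ obox c d `<=`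
    [set x | D 0 x < rho] `&` [set x | r < D t1 x] `&` ([set x : V | x ord0 j < a] `&` [set x | rho < D (t1 + t2) x]).
  (* Just inside the ball at its end opposite to the holes: f < t2 puts the reflected point outside
     the ball, and f < rho - r keeps the point out of the first hole. *)
  apply: (@open_box _ ((f - rho) *: e1)); first by do ![exact: openI|apply: openI].
  rewrite /= !D_e1 coordE subr0; split; split.
  - by rewrite ltr0_norm; lra.
  - by rewrite ltr0_norm; lra.
  - lra.
  - by rewrite ltr0_norm; lra.
apply: (Lambda_polar_lt p1 s0 s1 (measurable_shell t1) (measurable_shell t2) shN polar_in polar_out cd cd').
- by rewrite shell_open => x /cdA[].
- by rewrite shell_open => x /cdB[].
- move=> x /cdA[_ [/= xa xt]]; split => //; apply: outt; rewrite D_refl E1; exact: ltW.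
- move=> x /cdB[_ [/= xa xt]]; split => //; apply: out0; rewrite D_refl E0; exact: ltW.
Qed.

End eccentric_shells.

Theorem theorem3p3 (R : realType) (d : nat) (p s r rho : R)
  (hd : (2 <= d)%N) (hp : 1 < p) (hs0 : 0 < s) (hs1 : s < 1)
  (hr : 0 < r) (hrho : r < rho) :
  let shell (t : R) : set 'rV[R]_d :=
    eball 0 rho `\` eclosed_ball (t *: e1) r in
  (forall t1 t2 : R, 0 <= t1 -> t1 < t2 -> t2 < rho - r ->
     (Lambda s p (shell t2) < Lambda s p (shell t1))%E) /\
  let values : set (\bar R) :=
    [set Lambda s p (shell t) | t in [set t : R | 0 <= t /\ t < rho - r]] in
  let Lambda0 : \bar R :=
    Lambda s p (eball (0 : 'rV[R]_d) rho `\` eclosed_ball 0 r) in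
  values Lambda0 /\ ubound values Lambda0.
Proof.
move=> shell.
have [j j0] : exists j : 'I_d, j = 0%N :> nat by exists (Ordinal (ltnW hd)).
have lt t1 t2 : 0 <= t1 -> t1 < t2 -> t2 < rho - r ->
  (Lambda s p (shell t2) < Lambda s p (shell t1))%E by exact: (Lambda_shell_lt hp hs0 hs1 hr hrho j0).
have shell0 : shell 0 = eball 0 rho `\` eclosed_ball 0 r by rewrite /shell scale0r.
split=> //=; rewrite -shell0; split; first by exists 0 => //; rewrite subr_gt0 lexx.
move=> _ [t [t0 tr] <-]; have [->//|tn0] := eqVneq t 0.
by apply/ltW/lt => //; rewrite lt0r tn0.
Qed.
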